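(* Consider the nonlinearly periodically forced delay equation $\dot x(t)=F(t,x_t)$ with equilibrium $\overline{x}$ as in the context, with $k\ge 3$. Suppose that $\pm i\omega$ ($\omega>0$) are simple eigenvalues of $A$, that they are the only eigenvalues of $A$ on the imaginary axis, and that $\omega_T/\omega\notin\mathbb{Q}$, where $\omega_T=2\pi/T$. Let $q\in\mathbb{C}^n$ (column) and $p\in\mathbb{C}^{n\star}$ (row) satisfy $$\Delta(i\omega)q=0,\qquad p\Delta(i\omega)=0,\qquad p\Delta'(i\omega)q=1,$$ and let $\varphi(\theta)=e^{i\omega\theta}q$ for $\theta\in[-h,0]$. Parametrize the $3$-dimensional local center manifold of $\overline{x}$ near $\overline{x}$ so that solutions on it are $x_t=\mathcal{H}(t,\xi(t),\bar\xi(t))$ with $$\mathcal{H}(t,\xi,\bar\xi)=\overline{x}+\xi\varphi+\bar\xi\overline{\varphi}+\sum_{2\le j+k\le 3}\frac{1}{j!\,k!}H_{jk}(t)\xi^j\bar\xi^k+\mathcal{O}(|\xi|^4),\qquad \xi\in\mathbb{C},$$ where the $H_{jk}$ are $T$-periodic with $H_{jk}=\overline{H_{kj}}$, and such that $\xi$ satisfies the periodically forced critical normal form $\dot\xi=i\omega\xi+c\,\xi|\xi|^2+\mathcal{O}(|\xi|^4)$ with $c\in\mathbb{C}$ and $T$-periodic $\mathcal{O}$-terms. Then $$c=\frac{1}{2T}\int_0^Tp\,\big[C(t;\varphi,\varphi,\overline{\varphi})+B(t;\overline{\varphi},H_{20}(t))+2B(t;\varphi,H_{11}(t))\big]\,dt,$$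 where, for $t\in\mathbb{R}$ and $\theta\in[-h,0]$, $$H_{20}(t)(\theta)=e^{2i\omega\theta}\big(\boldsymbol{\Delta}(2i\omega)^{-1}[B(\cdot\,;\varphi,\varphi)]\big)(t+\theta),\qquad H_{11}(t)(\theta)=\big(\boldsymbol{\Delta}(0)^{-1}[B(\cdot\,;\varphi,\overline{\varphi})]\big)(t+\theta).$$
   Context: Let $0<h<\infty$, $X=C([-h,0],\mathbb{R}^n)$ with the supremum norm (complexified when needed), $x_t(\theta)=x(t+\theta)$, and let $F:\mathbb{R}\times X\to\mathbb{R}^n$ be $C^k$-smooth. Assume $\overline{x}$ is an equilibrium (constant solution) of $\dot x(t)=F(t,x_t)$, that $L:=D_2F(t,\overline{x})$ is independent of $t$, and that $G(t,\varphi)=F(t,\overline{x}+\varphi)-F(t,\overline{x})-L\varphi$ is $T$-periodic in $t$ ($T>0$). Write $L\varphi=\int_0^hd\zeta(\theta)\varphi(-\theta)$ with $\zeta:[0,h]\to\mathbb{R}^{n\times n}$ of normalized bounded variation. $A$ is the generator $\mathcal{D}(A)=\{\varphi\in X:\varphi'\in X,\ \varphi'(0)=L\varphi\}$, $A\varphi=\varphi'$; its spectrum consists of the zeros of $\det\Delta(z)$, where $\Delta(z)=zI-\int_0^he^{-z\theta}d\zeta(\theta)$, and $\Delta'$ is the derivative in $z$. $B(t;\cdot,\cdot):=D_2^2F(t,\overline{x})$ and $C(t;\cdot,\cdot,\cdot):=D_2^3F(t,\overline{x})$ are the (complex multilinearly extended) Fréchet derivatives in the second argument. $C_T(\mathbb{R},\mathbb{C}^n)$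 and $C_T^1(\mathbb{R},\mathbb{C}^n)$ are the spaces of $T$-periodic continuous, resp. continuously differentiable, functions, and $\boldsymbol{\Delta}(z):C_T^1(\mathbb{R},\mathbb{C}^n)\to C_T(\mathbb{R},\mathbb{C}^n)$ is the operator $(\boldsymbol{\Delta}(z)\boldsymbol{q})(t)=\dot{\boldsymbol{q}}(t)+z\boldsymbol{q}(t)-\int_0^hd\zeta(\theta)e^{-z\theta}\boldsymbol{q}(t-\theta)$; it is invertible for $z\notin\sigma(A)+i\omega_T\mathbb{Z}$, in particular for $z=2i\omega$ and $z=0$ in the claim. The local center manifold of $\overline{x}$ is the $T$-periodic, $C^k$-smooth, locally positively invariant manifold in $\mathbb{R}\times X$ containing $\mathbb{R}\times\{\overline{x}\}$ and tangent there to $\mathbb{R}\times X_0$, where $X_0$ is the (real) generalized eigenspace of $A$ for $\{\pm i\omega\}$; a parametrization and normal form as in the claim exist for it. The coefficients are determined by inserting $\mathcal{H}$ and the normal form into the equation (homological equation) and comparing equal powers of $\xi,\bar\xi$. (In the sum over $j+k$ the index $k$ is a summation index, not the smoothness.) *)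

(* Defs.v *)
From HB Require Import structures.
From mathcomp Require Import all_boot all_order all_algebra.
From mathcomp Require Import complex.
From mathcomp Require Import all_classical all_reals all_analysis.

Set Implicit Arguments.
Unset Strict Implicit.
Unset Printing Implicit Defensive.

Import Order.TTheory GRing.Theory Num.Theory.
Import numFieldNormedType.Exports.

Local Open Scope classical_set_scope.
Local Open Scope ring_scope.
Local Open Scope complex_scope.

(* An element of C([-h, 0], R^n) is encoded by its unique continuous extension
to R that is constant on ]-oo, -h] and on [0, +oo[. *)

Definition clamp (R : realType) (h theta : R) : R :=
  Num.max (- h) (Num.min theta 0).

Section History.
Context {R : realType} (h : R) (n : nat).

Definition history_pred : {pred R -> 'cV[R]_n} := fun f =>
  `[< continuous f /\ forall theta, f theta = f (clamp h theta) >].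

Record history := History {
  history_fun :> R -> 'cV[R]_n ;
  _ : history_fun \in history_pred }.

HB.instance Definition _ := [isSub for history_fun].
HB.instance Definition _ := [Choice of history by <:].

Lemma history_predP (f : R -> 'cV[R]_n) :
  reflect (continuous f /\ forall theta, f theta = f (clamp h theta))
    (f \in history_pred).
Proof. exact: asboolP. Qed.

Lemma history_submod_closed : submod_closed history_pred.
Proof.
split; first by apply/history_predP; split => // x; exact: cst_continuous.
move=> a f g /history_predP[cf ef] /history_predP[cg eg].
apply/history_predP; split=> [x|x].
  by apply: (@cvgD _ _ _ _ _ (a *: f) g); [apply: cvgZr; exact: cf|exact: cg].
by rewrite !fctE ef eg.
Qed.

HB.instance Definition _ :=
  GRing.isSubmodClosed.Build R (R -> 'cV[R]_n) history_pred
    history_submod_closed.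
HB.instance Definition _ := [SubChoice_isSubLmodule of history by <:].

Lemma historyP (f : history) :
  continuous f /\ forall theta, f theta = f (clamp h theta).
Proof. by apply/history_predP; case: f. Qed.

Lemma clamp_range (theta : R) : clamp h theta \in `[- h, Num.max (- h) 0].
Proof.
rewrite in_itv /= /clamp; apply/andP; split; first by rewrite le_max lexx.
by rewrite ge_max !le_max !ge_min !lexx !orbT.
Qed.

Lemma history_bounded (f : history) : has_ubound (range (fun t => `|f t|)).
Proof.
have [cf ef] := historyP f.
have : compact [set `|f t| | t in `[- h, Num.max (- h) 0]].
  apply: (@continuous_compact _ _ (fun t => `|f t|)); last exact: segment_compact.
  apply: continuous_subspaceT => x.
  by apply: (@continuous_comp _ _ _ f Num.norm); [exact: cf|exact: norm_continuous].
move=> /compact_bounded[M [_ Mb]]; exists (M + 1) => _ [t _ <-].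
rewrite ef (le_trans (ler_norm _))//; apply: (Mb (M + 1)).
  by rewrite ltrDl.
by exists (clamp h t) => //; exact: clamp_range.
Qed.

(* The supremum over R is the supremum over [-h, 0], by the encoding. *)
Definition sup_norm (f : history) : R := sup (range (fun t => `|f t|)).

Lemma sup_norm_ge (f : history) t : `|f t| <= sup_norm f.
Proof. by apply: ub_le_sup; [exact: history_bounded|exists t]. Qed.

Lemma sup_norm_le (f : history) (M : R) :
  (forall t, `|f t| <= M) -> sup_norm f <= M.
Proof.
move=> fM; apply: ge_sup; first by exists `|f 0|; exists 0.
by move=> _ [t _ <-].
Qed.

Lemma sup_normD f g : sup_norm (f + g) <= sup_norm f + sup_norm g.
Proof.
apply: sup_norm_le => t; rewrite (le_trans (ler_normD _ _))//.
by rewrite lerD// sup_norm_ge.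
Qed.

Lemma sup_normZ (a : R) f : sup_norm (a *: f) = `|a| * sup_norm f.
Proof.
have le b g : sup_norm (b *: g) <= `|b| * sup_norm g.
  apply: sup_norm_le => t; rewrite [leLHS](_ : _ = `|b *: g t|)//.
  by rewrite normrZ ler_wpM2l// sup_norm_ge.
apply/eqP; rewrite eq_le le/=; have [->|a0] := eqVneq a 0.
  by rewrite normr0 mul0r (le_trans (normr_ge0 _) (sup_norm_ge _ 0)).
have := le a^-1 (a *: f); rewrite scalerA mulVf// scale1r normfV.
by rewrite mulrC ler_pdivlMr ?normr_gt0// mulrC.
Qed.

Lemma sup_norm0_eq0 f : sup_norm f = 0 -> f = 0.
Proof.
move=> f0; apply/val_inj/funext => t /=.
by apply/eqP; rewrite -normr_le0 -f0 sup_norm_ge.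
Qed.

HB.instance Definition _ :=
  Lmodule_isNormed.Build R history sup_normD sup_normZ sup_norm0_eq0.

(* The element of X given by the restriction of f to [-h, 0] (0 if that
   restriction is not continuous). *)
Definition restr (f : R -> 'cV[R]_n) : history :=
  insubd (0 : history) (f \o clamp h).

Lemma restrE (f : R -> 'cV[R]_n) (theta : R) : 0 < h -> continuous f ->
  - h <= theta <= 0 -> restr f theta = f theta.
Proof.
have clE y : - h <= y <= 0 -> clamp h y = y.
  by move=> /andP[h1 h2]; rewrite /clamp min_l// max_r.
move=> h0 cf htheta; rewrite /restr insubdK /= ?clE//; apply/asboolP; split.
  move=> x; apply: (@continuous_comp _ _ _ (clamp h) f); last exact: cf.
  apply: continuous_max; first exact: cst_continuous.
  by apply: continuous_min => //; exact: cst_continuous.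
move=> x /=; congr f; rewrite [RHS]clE//.
by rewrite /clamp le_max lexx /= ge_max ge_min lexx orbT oppr_le0 ltW.
Qed.

Definition cst_history (v : 'cV[R]_n) : history := restr (fun=> v).

Definition segment (x : R -> 'cV[R]_n) (t : R) : history :=
  restr (fun theta => x (t + theta)).

End History.

(* f is C^k on the open set U: D x [:: v1; ...; vj] is the j-th Frechet
   derivative of f at x, seen as a bounded j-linear map, and limits are taken
   in the operator norm. *)
Definition Ck_on (R : realType) (E V : normedModType R) (k : nat)
    (U : set E) (f : E -> V) : Prop :=
  exists D : E -> seq E -> V,
  [/\ forall x, U x -> D x [::] = f x,
      forall x s1 s2 (a : R) u v, U x -> (size s1 + size s2 < k)%N ->
        D x (s1 ++ (a *: u + v) :: s2) =
        a *: D x (s1 ++ u :: s2) + D x (s1 ++ v :: s2),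
      forall x j, U x -> (j <= k)%N -> exists M : R, forall s, size s = j ->
        `|D x s| <= M * \prod_(v <- s) `|v|,
      forall x j (e : R), U x -> (j < k)%N -> 0 < e ->
        \forall d \near (0 : E), forall s, size s = j ->
          `|D (x + d) s - D x s - D x (d :: s)|
            <= e * `|d| * \prod_(v <- s) `|v|
    & forall x (e : R), U x -> 0 < e ->
        \forall y \near x, forall s, size s = k ->
          `|D y s - D x s| <= e * \prod_(v <- s) `|v| ].

Section SecondArgument.
Context {R : realType} {E V : normedModType R} (F : R * E -> V).

Definition d2F (t : R) (x u : E) : V := 'd (fun y : E => F (t, y)) x u.
(* For F of class C^2 (C^3), evaluation at the last arguments commutes with
   differentiation, so that these are the values of D_2^2 F and D_2^3 F. *)
Definition d2F2 (t : R) (x u v : E) : V := 'd (fun y : E => d2F t y v) x u.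
Definition d2F3 (t : R) (x u v w : E) : V :=
  'd (fun y : E => d2F2 t y v w) x u.

End SecondArgument.

(* Num.Theory shadows the projections of R[i]. *)
Local Notation Re := complex.Re.
Local Notation Im := complex.Im.

Section Complexification.
Context {R : realType}.

Definition cexp (z : R[i]) : R[i] :=
  (expR (Re z) * cos (Im z)) +i* (expR (Re z) * sin (Im z)).

Definition vec_Re {m n} (v : 'M[R[i]]_(m, n)) : 'M[R]_(m, n) :=
  map_mx (@Re R) v.
Definition vec_Im {m n} (v : 'M[R[i]]_(m, n)) : 'M[R]_(m, n) :=
  map_mx (@Im R) v.
Definition vec_C {m n} (a b : 'M[R]_(m, n)) : 'M[R[i]]_(m, n) :=
  \matrix_(i, j) (a i j +i* b i j).

Definition vcontinuous {n} (f : R -> 'cV[R[i]]_n) : Prop :=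
  continuous (vec_Re \o f) /\ continuous (vec_Im \o f).

Definition vderivable {n} (f : R -> 'cV[R[i]]_n) (t : R) : Prop :=
  derivable (vec_Re \o f) t 1 /\ derivable (vec_Im \o f) t 1.

Definition vderive {n} (f : R -> 'cV[R[i]]_n) (t : R) : 'cV[R[i]]_n :=
  vec_C ('D_1 (vec_Re \o f) t) ('D_1 (vec_Im \o f) t).

Definition cintegral (a b : R) (f : R -> R[i]) : R[i] :=
  (\int[lebesgue_measure]_(t in `[a, b]) Re (f t))
  +i* (\int[lebesgue_measure]_(t in `[a, b]) Im (f t)).

Definition CT {n} (T : R) : set (R -> 'cV[R[i]]_n) :=
  [set f | vcontinuous f /\ periodic f T].
Definition CT1 {n} (T : R) : set (R -> 'cV[R[i]]_n) :=
  [set f | (forall t, vderivable f t) /\ vcontinuous (vderive f) /\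
           periodic f T].

(* The complexification of X: (a, b) stands for a + i b. *)
Definition chistory (h : R) (n : nat) : Type :=
  (history h n * history h n)%type.

Section CHistory.
Context {h : R} {n : nat}.

Definition ceval (u : chistory h n) (theta : R) : 'cV[R[i]]_n :=
  vec_C (u.1 theta) (u.2 theta).
Definition of_real (a : history h n) : chistory h n := (a, 0).
Definition cconj (u : chistory h n) : chistory h n := (u.1, - u.2).
Definition hscale (z : R[i]) (u : chistory h n) : chistory h n :=
  (Re z *: u.1 - Im z *: u.2, Re z *: u.2 + Im z *: u.1).
Definition restrC (f : R -> 'cV[R[i]]_n) : chistory h n :=
  (restr h (vec_Re \o f), restr h (vec_Im \o f)).

(* The complex-linear extension of a real-linear map; iterating it on each
   argument gives the complex multilinear extensions. *)
Definition cext (f : history h n -> 'cV[R[i]]_n) (u : chistory h n) :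
  'cV[R[i]]_n := f u.1 + (0 +i* 1) *: f u.2.

Definition cext1 (f : history h n -> 'cV[R]_n) (u : chistory h n) :=
  cext (fun a => vec_C (f a) 0) u.
Definition cext2 (f : history h n -> history h n -> 'cV[R]_n)
    (u v : chistory h n) :=
  cext (fun a => cext1 (f a) v) u.
Definition cext3 (f : history h n -> history h n -> history h n -> 'cV[R]_n)
    (u v w : chistory h n) :=
  cext (fun a => cext2 (f a) v w) u.

End CHistory.
End Complexification.

Section Stieltjes.
Context {R : realType}.

(* s is the partition a < s_0 < ... < s_(size s - 1) = b, and tau its tags. *)
Definition stieltjes_sum (a : R) (s : seq R) (tau : nat -> R) (f g : R -> R) : R :=
  \sum_(0 <= i < size s)
    f (tau i) * (g (nth a (a :: s) i.+1) - g (nth a (a :: s) i)).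

Definition is_stieltjes (a b : R) (f g : R -> R) (I : R) : Prop :=
  forall e : R, 0 < e -> exists2 d : R, 0 < d &
    forall (s : seq R) (tau : nat -> R), itv_partition a b s ->
      (forall i, (i < size s)%N ->
        nth a (a :: s) i.+1 - nth a (a :: s) i < d /\
        nth a (a :: s) i <= tau i <= nth a (a :: s) i.+1) ->
      `|stieltjes_sum a s tau f g - I| < e.

(* \int_a^b f(theta) dg(theta) *)
Definition stieltjes (a b : R) (f g : R -> R) : R := get (is_stieltjes a b f g).

Definition cstieltjes (a b : R) (f : R -> R[i]) (g : R -> R) : R[i] :=
  stieltjes a b (fun t => Re (f t)) g +i* stieltjes a b (fun t => Im (f t)) g.

(* Normalized: zeta(0) = 0 and zeta is right-continuous on ]0, h[. *)
Definition NBV {n} (h : R) (zeta : R -> 'M[R]_n) : Prop :=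
  [/\ zeta 0 = 0,
      forall i j, bounded_variation 0 h (fun t => zeta t i j)
    & forall i j t, 0 < t < h ->
        (fun s => zeta s i j) @ t^'+ --> zeta t i j].

(* \int_0^h dzeta(theta) f(theta), for f : [0, h] -> R^n and C^n *)
Definition dzeta_int {n} (h : R) (zeta : R -> 'M[R]_n) (f : R -> 'cV[R]_n) :
    'cV[R]_n :=
  \col_i \sum_j stieltjes 0 h (fun t => f t j 0) (fun t => zeta t i j).
Definition dzeta_intC {n} (h : R) (zeta : R -> 'M[R]_n)
    (f : R -> 'cV[R[i]]_n) : 'cV[R[i]]_n :=
  \col_i \sum_j cstieltjes 0 h (fun t => f t j 0) (fun t => zeta t i j).

Definition Delta {n} (h : R) (zeta : R -> 'M[R]_n) (z : R[i]) : 'M[R[i]]_n :=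
  z%:M - \matrix_(i, j)
    cstieltjes 0 h (fun t => cexp (- z * t%:C)) (fun t => zeta t i j).

Definition Delta' {n} (h : R) (zeta : R -> 'M[R]_n) (z : R[i]) : 'M[R[i]]_n :=
  \matrix_(i, j) derive1 (fun w : R[i] => Delta h zeta w i j : R[i]^o) z.

Definition bDelta {n} (h : R) (zeta : R -> 'M[R]_n) (z : R[i])
    (q : R -> 'cV[R[i]]_n) (t : R) : 'cV[R[i]]_n :=
  vderive q t + z *: q t
  - dzeta_intC h zeta (fun s => cexp (- z * s%:C) *: q (t - s)).

(* q is the unique preimage of f under bDelta z : C_T^1 -> C_T. *)
Definition is_bDelta_inv {n} (h T : R) (zeta : R -> 'M[R]_n) (z : R[i])
    (f q : R -> 'cV[R[i]]_n) : Prop :=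
  [/\ CT T f, CT1 T q, bDelta h zeta z q = f &
      forall q', CT1 T q' -> bDelta h zeta z q' = f -> q' = q].

End Stieltjes.

Section Generator.
Context {R : realType} {h : R} {n : nat}.
Variable L : history h n -> 'cV[R]_n.

(* psi = phi' on [-h, 0] with psi continuous; one-sided derivatives at the end
   points then come for free, since phi and psi are continuous. *)
Definition history_deriv (phi psi : history h n) : Prop :=
  forall theta : R, - h < theta < 0 ->
    is_derive theta (1 : R) (phi : R -> 'cV[R]_n) (psi theta).

(* The graph of A: u is in D(A) and A u = v. *)
Definition gen_graph (u v : chistory h n) : Prop :=
  [/\ history_deriv u.1 v.1, history_deriv u.2 v.2 & ceval v 0 = cext1 L u].

Definition is_eigenvalue (l : R[i]) : Prop :=
  exists2 u, u != 0 & gen_graph u (hscale l u).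

(* The kernel of (A - l)^m. *)
Fixpoint gen_kernel (l : R[i]) (m : nat) (u : chistory h n) : Prop :=
  if m is m'.+1 then
    exists2 v, gen_graph u v & gen_kernel l m' (v - hscale l u)
  else u = 0.

Definition gen_eigenspace (l : R[i]) : set (chistory h n) :=
  [set u | exists m, gen_kernel l m u].

(* Algebraic multiplicity one. *)
Definition is_simple_eigenvalue (l : R[i]) : Prop :=
  is_eigenvalue l /\
  exists u, gen_eigenspace l = [set hscale z u | z in setT].

(* The real generalized eigenspace of {i omega, - i omega}. *)
Definition X0 (omega : R) : set (history h n) :=
  [set phi | exists u v, [/\ gen_eigenspace (0 +i* omega) u,
    gen_eigenspace (0 -i* omega) v & of_real phi = u + v]].

End Generator.

Section Manifold.
Context {R : realType} {E : normedModType R}.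

Definition is_Ck_submanifold (k d : nat) (W : set E) : Prop :=
  forall w, W w -> exists (V : set 'rV[R]_d) (U : set E)
    (f : 'rV[R]_d -> E) (g : E -> 'rV[R]_d),
  [/\ [/\ open V, open U, V 0, U w & f 0 = w],
      Ck_on k V f,
      f @` V = W `&` U,
      (forall v, V v -> injective ('d f v)) &
      (forall v, V v -> g (f v) = v) /\ {within W `&` U, continuous g}].

Definition tangent_space (W : set E) (w : E) : set E :=
  [set v | exists gamma : R -> E, [/\ gamma 0 = w,
    \forall s \near (0 : R), W (gamma s) & is_derive (0 : R) 1 gamma v]].

End Manifold.

Section DelayEquation.
Context {R : realType} {h : R} {n : nat}.
Variable F : R * history h n -> 'cV[R]_n.
Local Notation X := (history h n).

(* x solves x'(t) = F(t, x_t) on [s, s + tau[; the right derivative at s is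
   then F(s, x_s) by continuity. *)
Definition is_solution (s tau : R) (x : R -> 'cV[R]_n) : Prop :=
  {within `[s - h, s + tau[, continuous x} /\
  forall t : R, s < t < s + tau -> is_derive t (1 : R) x (F (t, segment h x t)).

Definition is_equilibrium (xb : 'cV[R]_n) : Prop :=
  forall s tau, 0 < tau -> is_solution s tau (fun=> xb).

Definition open_around (xb : 'cV[R]_n) (U : set (R * X)) : Prop :=
  open U /\ forall t, U (t, cst_history h xb).

Definition locally_positively_invariant (xb : 'cV[R]_n) (W : set (R * X)) :
    Prop :=
  exists2 U, open_around xb U &
    forall s tau x, 0 < tau -> is_solution s tau x -> W (s, segment h x s) ->
      (forall t, s <= t < s + tau -> U (t, segment h x t)) ->
      forall t, s <= t < s + tau -> W (t, segment h x t).

Definition is_local_center_manifold (k : nat) (T : R) (xb : 'cV[R]_n)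
    (L : X -> 'cV[R]_n) (omega : R) (W : set (R * X)) : Prop :=
  [/\ is_Ck_submanifold k 3 W,
      (forall t phi, W (t + T, phi) <-> W (t, phi)),
      locally_positively_invariant xb W,
      (forall t, W (t, cst_history h xb)) &
      forall t, tangent_space W (t, cst_history h xb) =
                [set v | X0 L omega v.2]].

(* (t, xi) |-> (t, H t xi) is a homeomorphism from R x {|xi| < delta} onto
   W `&` U; kappa is the xi-component of its inverse. *)
Definition is_parametrization (W U : set (R * X)) (delta : R)
    (H : R -> R[i] -> X) (kappa : R * X -> R[i]) : Prop :=
  [/\ forall t xi, Normc.normc xi < delta ->
        (W `&` U) (t, H t xi) /\ kappa (t, H t xi) = xi,
      forall w, (W `&` U) w ->
        Normc.normc (kappa w) < delta /\ H w.1 (kappa w) = w.2,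
      {within [set z : R * (R * R) | Normc.normc (z.2.1 +i* z.2.2) < delta],
        continuous (fun z : R * (R * R) => H z.1 (z.2.1 +i* z.2.2))},
      {within W `&` U, continuous (fun w => Re (kappa w))} &
      {within W `&` U, continuous (fun w => Im (kappa w))}].

(* H(t, xi, conj xi) = xb + xi phi + conj xi conj phi
     + \sum_(2 <= j + k <= 3) Hjk(t) xi^j (conj xi)^k / (j! k!) + O(|xi|^4),
   uniformly in t, as an identity in the complexification of X. *)
Definition has_expansion (xb : 'cV[R]_n) (phi : chistory h n)
    (Hjk : nat -> nat -> R -> chistory h n) (H : R -> R[i] -> X) : Prop :=
  exists M r : R, 0 < r /\ forall t xi, Normc.normc xi < r ->
    `| of_real (H t xi)
       - (of_real (cst_history h xb) + hscale xi phi
          + hscale xi^* (cconj phi)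
          + \sum_(j < 4) \sum_(k < 4 | (2 <= j + k <= 3)%N)
              hscale (xi ^+ j * xi^* ^+ k / (j`! * k`!)%:R) (Hjk j k t)) |
    <= M * Normc.normc xi ^+ 4.

(* On W `&` U the coordinate xi(t) = kappa(t, x_t) of every solution satisfies
   xi' = i omega xi + c xi |xi|^2 + rem(t, xi), with rem periodic in t and
   O(|xi|^4) uniformly in t. *)
Definition has_normal_form (T omega : R) (c : R[i]) (W U : set (R * X))
    (kappa : R * X -> R[i]) : Prop :=
  exists rem : R -> R[i] -> R[i],
  [/\ forall xi, periodic (rem ^~ xi) T,
      exists M r : R, 0 < r /\ forall t xi, Normc.normc xi < r ->
        Normc.normc (rem t xi) <= M * Normc.normc xi ^+ 4 &
      forall s tau x, 0 < tau -> is_solution s tau x ->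
        (forall t, s <= t < s + tau -> (W `&` U) (t, segment h x t)) ->
        forall t : R, s < t < s + tau ->
          let xi t := kappa (t, segment h x t) in
          let v := (0 +i* omega) * xi t
                   + c * xi t * (Normc.normc (xi t) ^+ 2)%:C
                   + rem t (xi t) in
          is_derive t (1 : R) (fun s => Re (xi s)) (Re v) /\
          is_derive t (1 : R) (fun s => Im (xi s)) (Im v)].

End DelayEquation.

(* Main.v *)
Require Import Defs.
From HB Require Import structures.
From mathcomp Require Import all_boot all_order all_algebra.
From mathcomp Require Import complex.
From mathcomp Require Import all_classical all_reals all_analysis.
From mathcomp Require Import ring lra.

Set Implicit Arguments.
Unset Strict Implicit.
Unset Printing Implicit Defensive.

Import Order.TTheory GRing.Theory Num.Theory.
Import numFieldNormedType.Exports.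

Local Open Scope classical_set_scope.
Local Open Scope ring_scope.
Local Open Scope complex_scope.

(** Fix a time t0 and a small amplitude zeta. The point of the center manifold
    above t0 with coordinate e^(i omega t0) (zeta + c t0 zeta |zeta|^2) starts
    a solution that stays on the manifold for a time independent of zeta. In
    the rotating frame z = e^(- i omega t) xi the normal form reads z' = c z
    |z|^2 + O(|z|^4), so z(t) = zeta + c t zeta |zeta|^2 + O(|zeta|^4)
    ([amplitude]). Inserting this in the expansion of the parametrization
    shows ([local_family]) that x_t - xbar agrees up to O(|zeta|^4) with a
    polynomial in zeta and its conjugate whose coefficients are histories
    Y_jk(t), among them Y_10 = e^(i omega t) phi, Y_20 = e^(2 i omega t) H_20
    / 2, Y_11 = H_11 and Y_21 = e^(i omega t) (H_21 / 2 + c t phi). The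
    coefficient c enters only through the secular term of Y_21.

    All these x are solutions of one delay equation, and that gives two
    families of relations. A history is a piece of a single function, hence
    Y_jk(t)(theta) = Y_jk(t + theta)(0) ([translation]). The values y_jk(t) =
    Y_jk(t)(0) satisfy y_jk' = L Y_jk + (the terms of order (j, k) of the
    second and third derivatives of F) ([coefficient_ode]). After division by
    the exponentials ([coefficient_equation]), H_20(.)(0) and H_11(.)(0) are
    periodic solutions of bDelta(2 i omega) y = B(phi, phi) and bDelta(0) y =
    B(phi, conj phi), while y = H_21(.)(0) satisfies bDelta(i omega) y = N_21
    - 2 c Delta'(i omega) q, where N_21 is the bracket in the formula for c;
    the term with Delta' is what the secular term leaves behind.

    The integral over a period of bDelta(z) y is Delta(z) applied to the
    integral of y ([mean_bDelta]). For z = i omega the row p annihilates it,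
    and p Delta'(i omega) q = 1 turns this solvability condition into the
    formula for c ([cintegral_coefficient]). The functions for z = 2 i omega
    and z = 0 are unique because the Fourier coefficients of a difference of
    two solutions lie in the kernels of Delta(z + i m omega_T) ([bDelta_inj]);
    a nonzero kernel vector would give an eigenvalue on the imaginary axis
    ([eigenvalue_of_Delta]), which then would be one of the two given ones,
    against the irrationality of omega_T / omega ([resonance]).

    Three points need care. The remainders are only estimated, so coefficients
    are compared by averaging over the eighth roots of unity, a finite form of
    Cauchy's integral ([avg_jet], [jet_zero]); the same averages show that the
    H_jk are continuous in time ([eta_cont]). The relations are first obtained
    forward in time, on intervals to the right of t0 whose length depends on
    t0, and hold for all times because a continuous function that is locally
    constant to the right is constant ([right_locally_constant]). Stieltjes
    integrals enter only through values of the bounded functional L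
    ([stieltjes_unit], [dzeta_intCE]), which makes Delta, Delta' and bDelta
    explicit. *)

Local Notation Re := complex.Re.
Local Notation Im := complex.Im.
Local Notation nc := Normc.normc.

(** * Complex valued functions of a real variable *)

Section Complex.
Context {R : realType}.
Implicit Types (z w : R[i]) (f g : R -> R[i]).

Lemma complexP z w : Re z = Re w -> Im z = Im w -> z = w.
Proof. by case: z w => [a b] [c d] /= -> ->. Qed.

Lemma nc_ge0 z : 0 <= nc z.
Proof. by case: z => a b /=; rewrite sqrtr_ge0. Qed.

Lemma ncD z w : nc (z + w) <= nc z + nc w.
Proof. exact: le_normcD. Qed.

Lemma ncM z w : nc (z * w) = nc z * nc w.
Proof. exact: Normc.normcM. Qed.

Lemma ncN z : nc (- z) = nc z.
Proof. exact: normcN. Qed.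

Lemma ncB z w : nc (z - w) <= nc z + nc w.
Proof. by rewrite (le_trans (ncD _ _))// ncN. Qed.

Lemma nc_distC z w : nc (z - w) = nc (w - z).
Proof. by rewrite -ncN opprB. Qed.

Lemma nc0 : nc (0 : R[i]) = 0. Proof. exact: Normc.normc0. Qed.
Lemma nc1 : nc (1 : R[i]) = 1. Proof. exact: Normc.normc1. Qed.

Lemma nc_real (x : R) : nc x%:C = `|x|.
Proof. by rewrite /= expr0n /= addr0 sqrtr_sqr. Qed.

Lemma ncX z n : nc (z ^+ n) = nc z ^+ n.
Proof. by elim: n => [|n IH]; rewrite ?expr0 ?nc1// !exprS ncM IH. Qed.

Lemma ncJ z : nc (conjc z) = nc z.
Proof. by case: z => a b /=; rewrite sqrrN. Qed.

Lemma nc_eq0 z : nc z = 0 -> z = 0.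
Proof. exact: Normc.eq0_normc. Qed.

Lemma nc_sqr z : nc z ^+ 2 = Re z ^+ 2 + Im z ^+ 2.
Proof. by case: z => a b /=; rewrite sqr_sqrtr// addr_ge0// sqr_ge0. Qed.

Lemma nc_Re z : `|Re z| <= nc z.
Proof.
rewrite -(ler_pXn2r (n := 2))// ?nnegrE ?nc_ge0// nc_sqr real_normK ?num_real//.
by rewrite lerDl sqr_ge0.
Qed.

Lemma nc_Im z : `|Im z| <= nc z.
Proof.
rewrite -(ler_pXn2r (n := 2))// ?nnegrE ?nc_ge0// nc_sqr real_normK ?num_real//.
by rewrite lerDr sqr_ge0.
Qed.

Lemma nc_le z : nc z <= `|Re z| + `|Im z|.
Proof.
rewrite {1}(complexE z) (le_trans (ncD _ _))// ncM !nc_real.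
have -> : nc ('i : R[i]) = 1 by rewrite /= expr0n expr1n add0r sqrtr1.
by rewrite mul1r.
Qed.

Lemma nc_sum (I : finType) (F : I -> R[i]) : nc (\sum_i F i) <= \sum_i nc (F i).
Proof.
elim/big_ind2: _ => [|x1 x2 y1 y2 h1 h2|i _]; rewrite ?nc0//.
by rewrite (le_trans (ncD _ _))// lerD.
Qed.

Lemma mul_conj z : z * conjc z = (nc z ^+ 2)%:C.
Proof.
rewrite nc_sqr; case: z => a b; apply: complexP => /=; ring.
Qed.

Lemma cReD z w : Re (z + w) = Re z + Re w. Proof. by case: z; case: w. Qed.
Lemma cImD z w : Im (z + w) = Im z + Im w. Proof. by case: z; case: w. Qed.
Lemma cReN z : Re (- z) = - Re z. Proof. by case: z. Qed.
Lemma cImN z : Im (- z) = - Im z. Proof. by case: z. Qed.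
Lemma cReM z w : Re (z * w) = Re z * Re w - Im z * Im w.
Proof. by case: z; case: w. Qed.
Lemma cImM z w : Im (z * w) = Re z * Im w + Im z * Re w.
Proof. by case: z => a b; case: w => c d /=; rewrite addrC [b * c]mulrC [_ + a * _]addrC mulrC. Qed.

Definition RIE := (cReD, cImD, cReN, cImN, cReM, cImM).

Lemma Re_sum (I : Type) (s : seq I) (P : pred I) (F : I -> R[i]) :
  Re (\sum_(i <- s | P i) F i) = \sum_(i <- s | P i) Re (F i).
Proof. by elim/big_rec2: _ => // i x y _ <-; rewrite cReD. Qed.
Lemma Im_sum (I : Type) (s : seq I) (P : pred I) (F : I -> R[i]) :
  Im (\sum_(i <- s | P i) F i) = \sum_(i <- s | P i) Im (F i).
Proof. by elim/big_rec2: _ => // i x y _ <-; rewrite cImD. Qed.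

Lemma cexp0 : cexp (0 : R[i]) = 1.
Proof. by rewrite /cexp /= expR0 cos0 sin0 !mul1r. Qed.

Lemma cexpD z w : cexp (z + w) = cexp z * cexp w.
Proof.
by case: z w => [a b] [c d]; apply: complexP => /=; rewrite expRD (cosD, sinD); ring.
Qed.

Lemma cexpN z : cexp (- z) * cexp z = 1.
Proof. by rewrite -cexpD addNr cexp0. Qed.

Lemma cexp_neq0 z : cexp z != 0.
Proof.
by apply/negP => /eqP h; have := cexpN z; rewrite h mulr0 => /eqP; rewrite eq_sym oner_eq0.
Qed.

Lemma nc_cexp z : nc (cexp z) = expR (Re z).
Proof.
by rewrite /cexp /= !exprMn -mulrDr cos2Dsin2 mulr1 sqrtr_sqr ger0_norm ?expR_ge0.
Qed.

(** Real and imaginary parts are differentiated separately, which is also the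
    form in which the normal form of the center manifold is given. *)
Definition Cder f (t : R) z : Prop :=
  is_derive t (1 : R) (fun s => Re (f s)) (Re z) /\
  is_derive t (1 : R) (fun s => Im (f s)) (Im z).

Definition Ccont f : Prop :=
  continuous (fun s => Re (f s)) /\ continuous (fun s => Im (f s)).

Lemma is_derive_eqfun (f g : R -> R) (t a b : R) :
  is_derive t 1 f a -> f =1 g -> a = b -> is_derive t 1 g b.
Proof. by move=> fd /funext <- <-. Qed.

Lemma Cder_eq f g t z w : Cder f t z -> f =1 g -> z = w -> Cder g t w.
Proof. by move=> fd /funext <- <-. Qed.

Lemma Cder_cst z t : Cder (fun=> z) t 0.
Proof. by split; exact: is_derive_cst. Qed.

Lemma CderD f g t a b : Cder f t a -> Cder g t b -> Cder (fun s => f s + g s) t (a + b).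
Proof.
move=> [f1 f2] [g1 g2]; split.
  by apply: (is_derive_eqfun (is_deriveD f1 g1)) => [s|]; rewrite ?cReD.
by apply: (is_derive_eqfun (is_deriveD f2 g2)) => [s|]; rewrite ?cImD.
Qed.

Lemma CderN f t a : Cder f t a -> Cder (fun s => - f s) t (- a).
Proof.
move=> [f1 f2]; split.
  by apply: (is_derive_eqfun (is_deriveN f1)) => [s|]; rewrite ?cReN.
by apply: (is_derive_eqfun (is_deriveN f2)) => [s|]; rewrite ?cImN.
Qed.

Lemma CderB f g t a b : Cder f t a -> Cder g t b -> Cder (fun s => f s - g s) t (a - b).
Proof. by move=> hf hg; apply: CderD => //; exact: CderN. Qed.

Lemma CderM f g t a b : Cder f t a -> Cder g t b ->
  Cder (fun s => f s * g s) t (a * g t + f t * b).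
Proof.
move=> [f1 f2] [g1 g2]; split.
  apply: (is_derive_eqfun (is_deriveB (is_deriveM f1 g1) (is_deriveM f2 g2))) => [s|].
    by rewrite cReM.
  by rewrite !RIE /GRing.scale /=; ring.
apply: (is_derive_eqfun (is_deriveD (is_deriveM f1 g2) (is_deriveM f2 g1))) => [s|].
  by rewrite cImM.
by rewrite !RIE /GRing.scale /=; ring.
Qed.

Lemma CderZ z f t a : Cder f t a -> Cder (fun s => z * f s) t (z * a).
Proof.
move=> h; apply: (Cder_eq (CderM (Cder_cst z t) h)) => //.
by rewrite mul0r add0r.
Qed.

Lemma Cder_sum (I : finType) (f : I -> R -> R[i]) t (a : I -> R[i]) :
  (forall i, Cder (f i) t (a i)) -> Cder (fun s => \sum_i f i s) t (\sum_i a i).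
Proof.
move=> h.
rewrite (_ : (fun s => \sum_i f i s) =
  fun s => (\big[(fun (g1 g2 : R -> R[i]) s => g1 s + g2 s)/fun=> 0]_i f i) s).
  elim/big_rec2: _ => [|i g b _ gb]; first exact: Cder_cst.
  by apply: (Cder_eq (CderD (h i) gb)).
by apply/funext => s; elim/big_rec2: _ => // i x y _ ->.
Qed.

Lemma Cder_id t : Cder (fun s => s%:C) t 1.
Proof. by split => /=; [exact: is_derive_id|exact: is_derive_cst]. Qed.

Lemma Cder_cexp z t : Cder (fun s => cexp (z * s%:C)) t (z * cexp (z * t%:C)).
Proof.
case: z => a b.
have lin (c : R) : is_derive t (1 : R) (fun s => c * s) c.
  apply: (is_derive_eqfun (is_deriveZ c (is_derive_id t 1))) => [s|].
    by [].
  by rewrite /GRing.scale /= mulr1.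
have e1 : is_derive t (1:R) (fun s => expR (a * s)) (expR (a * t) * a).
  by have := is_derive1_comp (is_derive_expR (a * t)) (lin a).
have e2 : is_derive t (1:R) (fun s => cos (b * s)) (- sin (b * t) * b).
  by have := is_derive1_comp (is_derive_cos (b * t)) (lin b).
have e3 : is_derive t (1:R) (fun s => sin (b * s)) (cos (b * t) * b).
  by have := is_derive1_comp (is_derive_sin (b * t)) (lin b).
split.
  apply: (is_derive_eqfun (is_deriveM e1 e2)) => [s|].
    by rewrite /cexp/= !mulr0 subr0 add0r.
  by rewrite /cexp /GRing.scale /= !mulr0 !subr0 !add0r; ring.
apply: (is_derive_eqfun (is_deriveM e1 e3)) => [s|].
  by rewrite /cexp/= !mulr0 subr0 add0r.
by rewrite /cexp /GRing.scale /= !mulr0 !subr0 !add0r; ring.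
Qed.

Lemma Cder_cont f t a : Cder f t a ->
  {for t, continuous (fun s => Re (f s))} /\ {for t, continuous (fun s => Im (f s))}.
Proof.
move=> [h1 h2].
by split; apply: differentiable_continuous; apply/derivable1_diffP.
Qed.

Lemma contD (f g : R -> R) : continuous f -> continuous g -> continuous (fun s => f s + g s).
Proof. by move=> cf cg x; apply: cvgD; [exact: cf|exact: cg]. Qed.

Lemma contN (f : R -> R) : continuous f -> continuous (fun s => - f s).
Proof. by move=> cf x; apply: cvgN; exact: cf. Qed.

Lemma contM (f g : R -> R) : continuous f -> continuous g -> continuous (fun s => f s * g s).
Proof. by move=> cf cg x; apply: cvgM; [exact: cf|exact: cg]. Qed.

Lemma CcontM f g : Ccont f -> Ccont g -> Ccont (fun s => f s * g s).
Proof.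
move=> [f1 f2] [g1 g2]; split.
  rewrite (_ : (fun s => _) = (fun s => Re (f s) * Re (g s) + - (Im (f s) * Im (g s)))).
    by apply: contD; [|apply: contN]; apply: contM.
  by apply/funext => u; rewrite cReM.
rewrite (_ : (fun s => _) = (fun s => Re (f s) * Im (g s) + Im (f s) * Re (g s))).
  by apply: contD; apply: contM.
by apply/funext => u; rewrite cImM.
Qed.

Lemma CcontD f g : Ccont f -> Ccont g -> Ccont (fun s => f s + g s).
Proof.
move=> [f1 f2] [g1 g2]; split.
  rewrite (_ : (fun s => _) = (fun s => Re (f s) + Re (g s))); first exact: contD.
  by apply/funext => u; rewrite cReD.
rewrite (_ : (fun s => _) = (fun s => Im (f s) + Im (g s))); first exact: contD.
by apply/funext => u; rewrite cImD.
Qed.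

Lemma Ccont_cst z : Ccont (fun=> z).
Proof. by split => x; exact: cst_continuous. Qed.

Lemma Ccont_sum (I : finType) (f : I -> R -> R[i]) :
  (forall i, Ccont (f i)) -> Ccont (fun s => \sum_i f i s).
Proof.
move=> h.
rewrite (_ : (fun s => \sum_i f i s) =
  fun s => (\big[(fun (g1 g2 : R -> R[i]) s => g1 s + g2 s)/fun=> 0]_i f i) s).
  elim/big_ind: _ => [|g b hg gb|//]; first exact: Ccont_cst.
  exact: CcontD.
by apply/funext => s; elim/big_rec2: _ => // i x y _ ->.
Qed.

Lemma Cder_Ccont f (a : R -> R[i]) : (forall t, Cder f t (a t)) -> Ccont f.
Proof. by move=> h; split => t; case: (Cder_cont (h t)). Qed.

Lemma Ccont_cexp z : Ccont (fun s => cexp (z * s%:C)).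
Proof. exact: (Cder_Ccont (Cder_cexp z)). Qed.

Lemma CcontP f : Ccont f <-> (forall t (e : R), 0 < e -> \forall s \near t, nc (f s - f t) < e).
Proof.
split=> [[f1 f2] t e e0|h].
  have e2 : 0 < e / 2 by rewrite divr_gt0.
  have /cvgrPdist_lt/(_ _ e2) h1 := f1 t.
  have /cvgrPdist_lt/(_ _ e2) h2 := f2 t.
  near=> s; rewrite (le_lt_trans (nc_le _))// (splitr e) !RIE ltrD// distrC.
    by near: s; exact: h1.
  by near: s; exact: h2.
split => t; apply/cvgrPdist_lt => e e0; have := h t e e0; apply: filterS => s hs.
  by rewrite distrC -cReN -cReD (le_lt_trans (nc_Re _)).
by rewrite distrC -cImN -cImD (le_lt_trans (nc_Im _)).
Unshelve. all: by end_near. Qed.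

Lemma mvt_ineq (f df : R -> R) (a b K : R) : a <= b ->
  (forall t, a < t < b -> is_derive t (1 : R) f (df t)) ->
  {within `[a, b], continuous f} ->
  (forall t, a < t < b -> `|df t| <= K) -> `|f b - f a| <= K * (b - a).
Proof.
move=> ab fd fc dfK; have := ab; rewrite le_eqVlt => /predU1P[->|ltab].
  by rewrite !subrr normr0 mulr0.
have fd' x : x \in `]a, b[ -> is_derive x (1 : R) f (df x).
  by rewrite in_itv /= => /fd.
have [c cab ->] := MVT ltab fd' fc.
rewrite normrM (ger0_norm (_ : 0 <= b - a)) ?subr_ge0// ler_wpM2r ?subr_ge0// dfK//.
Qed.

(** The factor 2 comes from estimating the real and the imaginary part one
    after the other. *)
Lemma Cmvt_ineq f (df : R -> R[i]) (a b K : R) : a <= b ->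
  (forall t, a < t < b -> Cder f t (df t)) ->
  {within `[a, b], continuous (fun t => Re (f t))} ->
  {within `[a, b], continuous (fun t => Im (f t))} ->
  (forall t, a < t < b -> nc (df t) <= K) -> nc (f b - f a) <= 2 * K * (b - a).
Proof.
move=> ab fd c1 c2 dfK; rewrite (le_trans (nc_le _))// !RIE mulrAC mulr_natl mulr2n mulrDl.
rewrite [X in _ <= X](_ : _ = K * (b - a) + K * (b - a)); last by ring.
apply: lerD.
  apply: (@mvt_ineq _ (fun t => Re (df t)) _ _ _ ab _ c1) => [t /fd[]//|t h].
  exact: (le_trans (nc_Re _) (dfK t h)).
apply: (@mvt_ineq _ (fun t => Im (df t)) _ _ _ ab _ c2) => [t /fd[]//|t h].
exact: (le_trans (nc_Im _) (dfK t h)).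
Qed.

(** The point a itself is excluded: to its left the integral vanishes, so the
    two-sided derivative there need not exist. *)
Lemma primitive (f : R -> R) (a : R) : continuous f ->
  let F x := \int[lebesgue_measure]_(t in `[a, x]) f t in
  forall x, a < x -> is_derive x (1 : R) F (f x).
Proof.
move=> cf F x ax.
have [||d1 d2] := @continuous_FTC1_closed R f a x (x + 1) _ _ ax (cf x).
- by rewrite ltrDl.
- apply: continuous_compact_integrable; first exact: segment_compact.
  exact: continuous_subspaceT.
by apply: DeriveDef; [exact: d1|rewrite -derive1E; exact: d2].
Qed.

Lemma RintegralE (f F : R -> R) (a b : R) : a < b -> continuous f ->
  (forall x, a <= x <= b -> is_derive x (1 : R) F (f x)) ->
  \int[lebesgue_measure]_(t in `[a, b]) f t = F b - F a.
Proof.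
move=> ab cf dF.
have cF x : a <= x <= b -> {for x, continuous F}.
  by move=> /dF h; apply: differentiable_continuous; apply/derivable1_diffP.
rewrite /Rintegral (@continuous_FTC2 _ f F)//.
- exact: continuous_subspaceT.
- split=> [x xab||].
  + move: xab; rewrite in_itv /= => /andP[x1 x2].
    by have /dF[] : a <= x <= b by rewrite !ltW.
  + by apply: cvg_at_right_filter; apply: cF; rewrite lexx ltW.
  + by apply: cvg_at_left_filter; apply: cF; rewrite lexx ltW.
- move=> x; rewrite in_itv /= => /andP[x1 x2].
  have h : a <= x <= b by rewrite !ltW.
  by have d := dF _ h; rewrite derive1E; exact: derive_val.
Qed.

(** The supremum of the times up to which f is constant belongs to that set by
    continuity, and cannot be smaller than b. This turns identities known only
    forward in time, on intervals of uncontrolled length, into global ones. *)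
Lemma right_locally_constant (f : R -> R) (a b : R) : a <= b -> continuous f ->
  (forall t, a <= t < b -> exists2 d : R, 0 < d &
     forall s, t <= s -> s < t + d -> s <= b -> f s = f t) ->
  f b = f a.
Proof.
move=> ab cf hf.
pose S := [set t | a <= t <= b /\ forall s, a <= s <= t -> f s = f a].
have Sa : S a.
  split; first by rewrite lexx.
  by move=> s /andP[h1 h2]; congr f; apply/eqP; rewrite eq_le h1 h2.
have hS : has_sup S by split; [exists a|exists b => t [/andP[]]].
pose m := sup S.
have am : a <= m by apply: sup_upper_bound.
have mb : m <= b by apply: ge_sup; [exists a|move=> t [/andP[]]].
have lt s : a <= s < m -> f s = f a.
  move=> /andP[as_ sm].
  have ms0 : 0 < m - s by rewrite subr_gt0.
  have [t [tab tS] st] := sup_adherent ms0 hS.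
  by apply: tS; rewrite as_ /= ltW//; move: st; rewrite opprB addrC subrK.
have fm : f m = f a.
  have [->//|ma] := eqVneq m a.
  have {}ma : a < m by rewrite lt_neqAle eq_sym ma.
  apply/eqP/negPn/negP => ne.
  have e0 : 0 < `|f m - f a| by rewrite normr_gt0 subr_eq0.
  have /cvgrPdist_lt/(_ _ e0)/nbhs_ballP[d d0 hd] := cf m.
  pose s := Num.max a (m - d / 2).
  have sm : s < m by rewrite gt_max ma /= ltrBlDr ltrDl divr_gt0.
  have := hd s; rewrite (lt s) ?ltxx ?le_max ?lexx//.
  suff h : ball m d s by move=> /(_ h).
  rewrite /ball /= ger0_norm ?subr_ge0 ?ltW//.
  have : m - d / 2 <= s by rewrite le_max lexx orbT.
  have : 0 < d by [].
  by lra.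
have [<-//|mneb] := eqVneq m b.
have mltb : m < b by rewrite lt_neqAle mneb.
have [|d d0 hd] := hf m; first by rewrite am.
pose s := Num.min b (m + d / 2).
have ms : m < s by rewrite lt_min mltb ltrDl divr_gt0.
have sd : s <= m + d / 2 by rewrite ge_min lexx orbT.
have sb : s <= b by rewrite ge_min lexx.
have : S s.
  split; first by rewrite sb (le_trans am) ?ltW.
  move=> u /andP[au us]; have [um|mu] := ltP u m; first by apply: lt; rewrite au.
  rewrite hd//; first by rewrite (le_lt_trans us) // (le_lt_trans sd)// ltrD2l ltr_pdivrMr// ltr_pMr// ltr1n.
  by rewrite (le_trans us).
move=> Ss; have := sup_upper_bound hS Ss; rewrite -/m => /le_lt_trans/(_ ms).
by rewrite ltxx.
Qed.

End Complex.

(** * Histories and the complex extensions of multilinear forms *)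

Section Histories.
Context {R : realType} {n : nat}.

Lemma cv_norm_ge (v : 'cV[R]_n) i : `|v i 0| <= `|v|.
Proof.
rewrite [leRHS]/Num.Def.normr/= mx_normrE.
exact: (le_bigmax _ (fun ij : 'I_n * 'I_1 => `|v ij.1 ij.2|) (i, 0)).
Qed.

Lemma cv_norm_le (v : 'cV[R]_n) (K : R) : 0 <= K -> (forall i, `|v i 0| <= K) -> `|v| <= K.
Proof.
move=> K0 h; rewrite [leLHS]/Num.Def.normr/= mx_normrE bigmax_le// => -[i j] _ /=.
by rewrite ord1.
Qed.

Lemma vcontP (T : topologicalType) (x : T -> 'cV[R]_n) (t : T) :
  {for t, continuous x} <-> forall i, {for t, continuous (fun s => x s i 0)}.
Proof.
split=> [c i|c].
  apply/cvgrPdist_le => e e0; move/cvgrPdist_le : c => /(_ _ e0); apply: filterS => s.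
  by apply: le_trans; have := cv_norm_ge (x t - x s) i; rewrite !mxE.
apply/cvgrPdist_le => e e0; near=> s; apply: cv_norm_le; first exact: ltW.
move=> i; rewrite !mxE; move: i; near: s; apply: filter_forall => i.
by have /cvgrPdist_le/(_ _ e0) := c i.
Unshelve. all: by end_near. Qed.

Lemma is_derive_vecP (x : R -> 'cV[R]_n) (t : R) (v : 'cV[R]_n) :
  is_derive t (1 : R) x v <-> forall i, is_derive t (1 : R) (fun s => x s i 0) (v i 0).
Proof.
split=> [[d1 d2] i|h].
  apply: DeriveDef; first by move/derivable_mxP : d1; exact.
  by rewrite -d2 derive_mx// mxE.
have d : derivable x t 1.
  by apply/derivable_mxP => i j; rewrite ord1; case: (h i).
apply: DeriveDef => //; rewrite derive_mx//; apply/matrixP => i j.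
by rewrite mxE ord1; case: (h i).
Qed.

Context {h : R} (h0 : 0 < h).
Local Notation X := (history h n).

Lemma clamp_itv theta : - h <= clamp h theta <= 0.
Proof.
rewrite /clamp le_max lexx /= ge_max ge_min lexx orbT andbT.
by rewrite oppr_le0 ltW.
Qed.

Lemma clamp_id theta : - h <= theta <= 0 -> clamp h theta = theta.
Proof. by move=> /andP[h1 h2]; rewrite /clamp min_l// max_r. Qed.

Lemma clamp_cont : continuous (clamp h).
Proof.
move=> x; rewrite -[clamp h]/((fun=> - h) \max ((id : R -> R) \min (fun=> 0))).
apply: continuous_max.
  exact: cst_continuous.
by apply: (@continuous_min _ _ id (fun=> 0)) => //; exact: cst_continuous.
Qed.

Lemma restr_clampE (f : R -> 'cV[R]_n) : continuous f ->
  forall theta, restr h f theta = f (clamp h theta).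
Proof.
move=> cf theta; rewrite /restr insubdK//; apply/asboolP; split.
  by move=> x; apply: continuous_comp; [exact: clamp_cont|exact: cf].
by move=> x /=; rewrite [in RHS]clamp_id// clamp_itv.
Qed.

Lemma hist_norm (u : X) (theta : R) : `|u theta| <= `|u|.
Proof. exact: sup_norm_ge. Qed.

Lemma hist_norm_le (u : X) (K : R) :
  (forall theta, - h <= theta <= 0 -> `|u theta| <= K) -> `|u| <= K.
Proof.
move=> hu; apply: (@sup_norm_le _ _ _ u) => t.
by have [_ ->] := historyP u; apply: hu; exact: clamp_itv.
Qed.

Lemma histP (u v : X) : (forall theta, - h <= theta <= 0 -> u theta = v theta) -> u = v.
Proof.
move=> uv; apply/val_inj/funext => t /=.
have [_ ->] := historyP u; have [_ ->] := historyP v; apply: uv; exact: clamp_itv.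
Qed.

Lemma hist_cont (u : X) : continuous u.
Proof. by have [] := historyP u. Qed.

Lemma histB (u v : X) theta : (u - v) theta = u theta - v theta.
Proof. by []. Qed.

Lemma histZ a (u : X) theta : (a *: u) theta = a *: u theta.
Proof. by []. Qed.

Lemma shift_cont (x : R -> 'cV[R]_n) t : continuous x -> continuous (fun s => x (t + s)).
Proof.
move=> cx s; apply: (@continuous_comp _ _ _ (fun s => t + s) x); last exact: cx.
by apply: cvgD; [exact: cvg_cst|exact: cvg_id].
Qed.

Lemma segmentE (x : R -> 'cV[R]_n) t theta : continuous x ->
  segment h x t theta = x (t + clamp h theta).
Proof. by move=> cx; exact: (restr_clampE (@shift_cont x t cx)). Qed.

Lemma cst_historyE (v : 'cV[R]_n) theta : cst_history h v theta = v.
Proof. by rewrite /cst_history restr_clampE// => x; exact: cst_continuous. Qed.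

(** Uniform continuity of x on the compact window of a history. *)
Lemma segment_unif (x : R -> 'cV[R]_n) t (e : R) : continuous x -> 0 < e ->
  \forall s \near t, forall theta, - h <= theta <= 0 -> `|x (s + theta) - x (t + theta)| < e.
Proof.
move=> cx e0.
have cpt : compact `[(- h), 0 : R] by exact: segment_compact.
have [+ _] := compact_near_coveringP `[(- h), 0 : R].
move=> /(_ cpt R (nbhs t) (fun s theta => `|x (s + theta) - x (t + theta)| < e) _) H.
have {H} : \forall s \near t, `[- h, 0] `<=` (fun theta : R => `|x (s + theta) - x (t + theta)| < e).
  apply: H => theta _.
  have e2 : 0 < e / 2 by rewrite divr_gt0.
  have /cvgrPdist_lt/(_ _ e2)/nbhs_ballP[d d0 hd] := cx (t + theta).
  exists (ball theta (d / 2), ball t (d / 2)) => /=.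
    by split; apply: nbhsx_ballx; rewrite divr_gt0.
  move=> [u s] /= [hu hs].
  have h1 : `|x (t + theta) - x (s + u)| < e / 2.
    apply: hd; rewrite /ball /= opprD addrACA (splitr d).
    by rewrite (le_lt_trans (ler_normD _ _))// ltrD.
  have h2 : `|x (t + theta) - x (t + u)| < e / 2.
    apply: hd; rewrite /ball /= opprD addrACA subrr add0r.
    by rewrite (lt_trans hu)// ltr_pdivrMr// ltr_pMr// ltr1n.
  rewrite -(subrKA (x (t + theta))) (splitr e) (le_lt_trans (ler_normD _ _))//.
  by rewrite ltrD// distrC.
by apply: filterS => s hs theta ht; apply: hs; rewrite /= in_itv.
Unshelve. all: by end_near. Qed.

Lemma segment_cont (x : R -> 'cV[R]_n) : continuous x -> continuous (segment h x : R -> X).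
Proof.
move=> cx t; apply/cvgrPdist_le => e e0; have := segment_unif t cx e0.
apply: filterS => s hs; apply: hist_norm_le => theta ht.
by rewrite histB !segmentE// distrC ltW// hs// clamp_id.
Qed.

Lemma is_derive_shift (f : R -> R) (a t v : R) :
  is_derive (a + t) (1 : R) f v -> is_derive t (1 : R) (fun s => f (a + s)) v.
Proof.
move=> fd.
have := @is_derive1_comp R f (fun s => a + s) t v 1 fd.
rewrite mulr1; apply.
apply: (is_derive_eqfun (is_deriveD (is_derive_cst a t (1 : R)) (is_derive_id t (1 : R)))) => //.
by rewrite add0r.
Qed.

(** By the mean value theorem the difference quotients at theta are values of
    the derivative near t + theta, and these converge uniformly in theta. *)
Lemma segment_der (x y : R -> 'cV[R]_n) t : (forall s, is_derive s (1 : R) x (y s)) ->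
  continuous y -> is_derive t (1 : R) (segment h x : R -> X) (segment h y t).
Proof.
move=> xy cy.
have cx : continuous x.
  by move=> s; apply: differentiable_continuous; apply/derivable1_diffP; case: (xy s).
suff cv : (d^-1 *: (segment h x (d *: 1 + t) - segment h x t)) @[d --> 0^'] --> segment h y t.
  by apply: DeriveDef; [apply/cvg_ex; exists (segment h y t)|exact: cvg_lim].
apply/cvgrPdist_le => e e0.
have /nbhs_ballP[d d0 hd] := segment_unif t cy e0.
near=> z; apply: hist_norm_le => theta ht; rewrite histB histZ histB !segmentE// clamp_id//.
have z0 : z != 0 by near: z; exact: nbhs_dnbhs_neq.
have zd : `|z| < d by near: z; exact: dnbhs0_lt.
apply: cv_norm_le; first exact: ltW.
move=> i; rewrite !mxE /GRing.scale /= mulr1.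
have [c [cz cE]] : exists c, `|c| <= `|z| /\ x (z + t + theta) i 0 - x (t + theta) i 0 = y (t + theta + c) i 0 * z.
  have dd s : is_derive s (1 : R) (fun s => x (t + theta + s) i 0) (y (t + theta + s) i 0).
    by apply: (@is_derive_shift (fun s => x s i 0)); have /is_derive_vecP := xy (t + theta + s); exact.
  have cc : continuous (fun s => x (t + theta + s) i 0).
    by move=> s; apply: differentiable_continuous; apply/derivable1_diffP; case: (dd s).
  have [zp|zn] := leP 0 z.
    have [|c] := MVT_segment zp (fun s _ => dd s); first exact: continuous_subspaceT.
    rewrite in_itv /= => /andP[c0 cz] E; exists c; split; first by rewrite !ger0_norm.
    by move: E; rewrite addr0 subr0 => <-; congr (x _ _ _ - _); ring.
  have [|c] := MVT_segment (ltW zn) (fun s _ => dd s); first exact: continuous_subspaceT.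
  rewrite in_itv /= => /andP[c0 cz] E; exists c; split; first by rewrite !ler0_norm ?lerN2// ltW.
  move: E; rewrite addr0 sub0r mulrN => /(congr1 -%R); rewrite opprB opprK => <-.
  by congr (x _ _ _ - _); ring.
rewrite cE mulrCA mulVf// mulr1.
have : ball t d (t + c).
  by rewrite /ball /= opprD addrA subrr sub0r normrN (le_lt_trans cz).
move=> /hd/(_ theta ht) hh.
rewrite (le_trans _ (ltW hh))// distrC.
by have := cv_norm_ge (y (t + c + theta) - y (t + theta)) i; rewrite !mxE addrAC.
Unshelve. all: by end_near. Qed.

Lemma linear_der (V W : normedModType R) (l : V -> W) (x : R -> V) t v :
  linear l -> continuous l -> is_derive t (1 : R) x v ->
  is_derive t (1 : R) (l \o x) (l v).
Proof.
move=> ll cl [d1 d2].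
have lB u w : l (u - w) = l u - l w.
  by rewrite addrC -scaleN1r ll scaleN1r addrC.
have lZ a u : l (a *: u) = a *: l u.
  have l0 : l 0 = 0 by rewrite -(subrr 0) lB subrr.
  by rewrite -[a *: u]addr0 ll l0 addr0.
suff cv : (d^-1 *: ((l \o x) (d *: 1 + t) - (l \o x) t)) @[d --> 0^'] --> l v.
  by apply: DeriveDef; [apply/cvg_ex; exists (l v)|exact: cvg_lim].
rewrite (_ : (fun d => _) = l \o (fun d => d^-1 *: (x (d *: 1 + t) - x t))).
  apply: (@cvg_comp _ _ _ _ l _ (nbhs v)); last exact: cl.
  by rewrite -d2; exact: d1.
by apply/funext => d /=; rewrite lZ lB.
Qed.

End Histories.

Section ComplexHistories.
Context {R : realType} {n : nat}.

Lemma vcontinuousP (y : R -> 'cV[R[i]]_n) :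
  vcontinuous y <-> forall i, Ccont (fun s => y s i 0).
Proof.
split=> [[c1 c2] i|c].
  split=> t.
    have /vcontP/(_ i) := c1 t.
    rewrite (_ : (fun s => _) = (fun s => Re (y s i 0)))//.
    by apply/funext => s; rewrite /= mxE.
  have /vcontP/(_ i) := c2 t.
  rewrite (_ : (fun s => _) = (fun s => Im (y s i 0)))//.
  by apply/funext => s; rewrite /= mxE.
split=> t; apply/vcontP => i; have [c1 c2] := c i.
  rewrite (_ : (fun s => _) = (fun s => Re (y s i 0))); first exact: c1.
  by apply/funext => s; rewrite /= mxE.
rewrite (_ : (fun s => _) = (fun s => Im (y s i 0))); first exact: c2.
by apply/funext => s; rewrite /= mxE.
Qed.

Lemma vderP (y : R -> 'cV[R[i]]_n) t (v : 'cV[R[i]]_n) :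
  (forall i, Cder (fun s => y s i 0) t (v i 0)) <-> vderivable y t /\ vderive y t = v.
Proof.
split=> [c|[[d1 d2] <-] i].
  have d1 : is_derive t (1 : R) (vec_Re \o y) (vec_Re v).
    apply/is_derive_vecP => i; have [c1 _] := c i.
    by apply: (is_derive_eqfun c1) => [s|]; rewrite /= mxE.
  have d2 : is_derive t (1 : R) (vec_Im \o y) (vec_Im v).
    apply/is_derive_vecP => i; have [_ c2] := c i.
    by apply: (is_derive_eqfun c2) => [s|]; rewrite /= mxE.
  split; first by split; [case: d1|case: d2].
  rewrite /vderive; case: d1 => _ ->; case: d2 => _ ->.
  by apply/matrixP => i j; rewrite !mxE; case: (v i j).
have e1 : is_derive t (1 : R) (vec_Re \o y) ('D_1 (vec_Re \o y) t) by exact: (DeriveDef d1 erefl).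
have e2 : is_derive t (1 : R) (vec_Im \o y) ('D_1 (vec_Im \o y) t) by exact: (DeriveDef d2 erefl).
move/is_derive_vecP : e1 => /(_ i) e1; move/is_derive_vecP : e2 => /(_ i) e2.
split; rewrite mxE /=.
  by apply: (is_derive_eqfun e1) => [s|//]; rewrite /= mxE.
by apply: (is_derive_eqfun e2) => [s|//]; rewrite /= mxE.
Qed.

Context {h : R} (h0 : 0 < h).
Local Notation X := (history h n).
Local Notation CX := (chistory h n).
Implicit Types (u v w : CX) (z : R[i]).

(** A complex history evaluated at one time and in one coordinate: identities
    and estimates between complex histories are reduced to complex numbers by
    [chistP] and [cnorm_le]. *)
Definition cev u theta i : R[i] := (u.1 theta i 0) +i* (u.2 theta i 0).

Lemma cevalE u theta i : ceval u theta i 0 = cev u theta i.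
Proof. exact: mxE. Qed.

Lemma chistP u v :
  (forall theta i, - h <= theta <= 0 -> cev u theta i = cev v theta i) -> u = v.
Proof.
case: u v => [u1 u2] [v1 v2] uv; congr pair; apply: (histP h0) => theta ht.
  by apply/matrixP => i j; rewrite ord1; have [] := uv theta i ht.
by apply/matrixP => i j; rewrite ord1; have [] := uv theta i ht.
Qed.

Lemma hev_D (a b : X) theta i : (a + b) theta i 0 = a theta i 0 + b theta i 0.
Proof. exact: (mxE _ _ i 0). Qed.

Lemma hev_N (a : X) theta i : (- a) theta i 0 = - (a theta i 0).
Proof. exact: (mxE _ _ i 0). Qed.

Lemma hev_Z r (a : X) theta i : (r *: a) theta i 0 = r * (a theta i 0).
Proof. exact: (mxE _ _ i 0). Qed.

Lemma hev_B (a b : X) theta i : (a - b) theta i 0 = a theta i 0 - b theta i 0.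
Proof. by rewrite hev_D hev_N. Qed.

Lemma cevD u v theta i : cev (u + v) theta i = cev u theta i + cev v theta i.
Proof. by apply: complexP; rewrite ?cReD ?cImD; exact: hev_D. Qed.

Lemma cevN u theta i : cev (- u) theta i = - cev u theta i.
Proof. by apply: complexP; rewrite ?cReN ?cImN; exact: hev_N. Qed.

Lemma cevB u v theta i : cev (u - v) theta i = cev u theta i - cev v theta i.
Proof. by rewrite cevD cevN. Qed.

Lemma cev0 theta i : cev (0 : CX) theta i = 0.
Proof. by apply: complexP; exact: (mxE _ _ i 0). Qed.

Lemma cev_hscale z u theta i : cev (hscale z u) theta i = z * cev u theta i.
Proof.
apply: complexP; rewrite ?cReM ?cImM.
  exact: (etrans (hev_B (Re z *: u.1) (Im z *: u.2) theta i)
    (f_equal2 (fun a b => a - b) (hev_Z _ _ _ _) (hev_Z _ _ _ _))).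
exact: (etrans (hev_D (Re z *: u.2) (Im z *: u.1) theta i)
  (f_equal2 (fun a b => a + b) (hev_Z _ _ _ _) (hev_Z _ _ _ _))).
Qed.

Lemma cev_sum (I : Type) (s : seq I) (P : pred I) (F : I -> CX) theta i :
  cev (\sum_(k <- s | P k) F k) theta i = \sum_(k <- s | P k) cev (F k) theta i.
Proof. by elim/big_rec2: _ => [|k x y _ <-]; rewrite ?cev0// cevD. Qed.

Lemma cev_conj u theta i : cev (cconj u) theta i = conjc (cev u theta i).
Proof. exact: (f_equal (Complex _) (hev_N _ _ _)). Qed.

Lemma cev_real (a : X) theta i : cev (of_real a) theta i = (a theta i 0)%:C.
Proof. exact: (f_equal (Complex _) (mxE _ _ i 0)). Qed.

Lemma hscaleA z1 z2 u : hscale z1 (hscale z2 u) = hscale (z1 * z2) u.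
Proof. by apply: chistP => theta i _; rewrite !cev_hscale mulrA. Qed.

Lemma hscale1 u : hscale 1 u = u.
Proof. by apply: chistP => theta i _; rewrite cev_hscale mul1r. Qed.

Lemma hscale0 u : hscale 0 u = 0.
Proof. by apply: chistP => theta i _; rewrite cev_hscale mul0r cev0. Qed.

Lemma cnormE u : `|u| = Num.max `|u.1| `|u.2|.
Proof. by []. Qed.

Lemma cnorm1 u : `|u.1| <= `|u|.
Proof. by rewrite cnormE le_max lexx. Qed.

Lemma cnorm2 u : `|u.2| <= `|u|.
Proof. by rewrite cnormE le_max lexx orbT. Qed.

Lemma nc_cev u theta i : nc (cev u theta i) <= 2 * `|u|.
Proof.
rewrite (le_trans (nc_le _))// mulr_natl mulr2n lerD//.
  exact: (le_trans (cv_norm_ge _ _) (le_trans (hist_norm _ _) (cnorm1 u))).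
exact: (le_trans (cv_norm_ge _ _) (le_trans (hist_norm _ _) (cnorm2 u))).
Qed.

(** The norm of a complex history is the larger one of the norms of its real
    and imaginary parts, so it is dominated by a bound on the moduli; the
    converse [nc_cev] loses a factor 2. *)
Lemma cnorm_le u (K : R) : 0 <= K ->
  (forall theta i, - h <= theta <= 0 -> nc (cev u theta i) <= K) -> `|u| <= K.
Proof.
move=> K0 hu; rewrite cnormE ge_max; apply/andP; split; apply: (hist_norm_le h0) => theta ht;
  apply: cv_norm_le => // i; apply: le_trans (hu theta i ht).
  exact: (nc_Re (cev u theta i)).
exact: (nc_Im (cev u theta i)).
Qed.

Lemma cnorm_hscale z u : `|hscale z u| <= 2 * nc z * `|u|.
Proof.
rewrite cnormE ge_max /hscale/= mulrAC mulr_natl mulr2n mulrDl.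
apply/andP; split.
  rewrite (le_trans (ler_normB _ _))// !normrZ ![_ * nc z]mulrC lerD// ler_pM//.
  - exact: nc_Re.
  - exact: cnorm1.
  - exact: nc_Im.
  - exact: cnorm2.
rewrite (le_trans (ler_normD _ _))// !normrZ ![_ * nc z]mulrC lerD// ler_pM//.
- exact: nc_Re.
- exact: cnorm2.
- exact: nc_Im.
- exact: cnorm1.
Qed.

Lemma cnorm_real (a : X) : `|of_real a| = `|a|.
Proof. by rewrite cnormE /= normr0 max_l. Qed.

Definition segC (y : R -> 'cV[R[i]]_n) (t : R) : CX := restrC (fun theta => y (t + theta)).

Lemma cev_restrC (y : R -> 'cV[R[i]]_n) theta i : vcontinuous y ->
  cev (restrC y) theta i = y (clamp h theta) i 0.
Proof.
move=> [c1 c2]; rewrite /cev /restrC -[X in X +i* _]/(restr h (vec_Re \o y) theta i 0).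
rewrite -[X in _ +i* X]/(restr h (vec_Im \o y) theta i 0) (restr_clampE h0 c1) (restr_clampE h0 c2).
rewrite -[X in X +i* _]/(vec_Re (y (clamp h theta)) i 0) [X in X +i* _]mxE.
rewrite -[X in _ +i* X]/(vec_Im (y (clamp h theta)) i 0) [X in _ +i* X]mxE.
by case: (y _ i 0).
Qed.

Lemma vcontinuous_shift (y : R -> 'cV[R[i]]_n) t : vcontinuous y ->
  vcontinuous (fun s => y (t + s)).
Proof. by move=> [c1 c2]; split => /=; [exact: (@shift_cont _ _ (vec_Re \o y) t c1)|exact: (@shift_cont _ _ (vec_Im \o y) t c2)]. Qed.

Lemma cev_segC (y : R -> 'cV[R[i]]_n) t theta i : vcontinuous y ->
  cev (segC y t) theta i = y (t + clamp h theta) i 0.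
Proof. by move=> cy; exact: (@cev_restrC (fun s => y (t + s)) _ _ (vcontinuous_shift t cy)). Qed.

(** The complex extensions of scalar real forms of degree 1, 2 and 3, which
    are the entries of [cext1], [cext2] and [cext3]. Each extension is
    obtained from the one below it in two steps, by [bCE] and [tCE]. *)
Section Linear.
Variable l : X -> R.
Hypothesis ll : forall a (u v : X), l (a *: u + v) = a * l u + l v.

Definition lC u : R[i] := l u.1 +i* l u.2.

Lemma lin0 : l 0 = 0.
Proof.
have := ll 1 0 0; rewrite !scale1r addr0 mul1r => /eqP.
by rewrite -{1}[l 0]addr0 (inj_eq (addrI _)) eq_sym => /eqP.
Qed.
Lemma linD (a b : X) : l (a + b) = l a + l b.
Proof. by have := ll 1 a b; rewrite scale1r mul1r. Qed.
Lemma linZ a (b : X) : l (a *: b) = a * l b.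
Proof. by have := ll a b 0; rewrite lin0 !addr0. Qed.
Lemma linN (b : X) : l (- b) = - l b.
Proof. by rewrite -scaleN1r linZ mulN1r. Qed.
Lemma linB (a b : X) : l (a - b) = l a - l b.
Proof. by rewrite linD linN. Qed.

Lemma lCD u v : lC (u + v) = lC u + lC v.
Proof. by apply: complexP; rewrite ?cReD ?cImD; exact: linD. Qed.

Lemma lCZ z u : lC (hscale z u) = z * lC u.
Proof.
rewrite /lC -[(hscale z u).1]/(Re z *: u.1 - Im z *: u.2).
rewrite -[(hscale z u).2]/(Re z *: u.2 + Im z *: u.1) linB linD !linZ.
by case: z => a b; apply: complexP => /=; ring.
Qed.

Lemma lC0 : lC 0 = 0.
Proof. by apply: complexP; exact: lin0. Qed.

Lemma lCB u v : lC (u - v) = lC u - lC v.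
Proof. by apply: complexP; rewrite ?RIE; exact: linB. Qed.

Lemma lC_sum (I : Type) (s : seq I) (P : pred I) (F : I -> CX) :
  lC (\sum_(i <- s | P i) F i) = \sum_(i <- s | P i) lC (F i).
Proof. by elim/big_rec2: _ => [|i x y _ <-]; rewrite ?lC0// lCD. Qed.

Lemma lC_real (a : X) : lC (of_real a) = (l a)%:C.
Proof. exact: (f_equal (Complex _) lin0). Qed.

Lemma nc_lC (M : R) u : (forall a, `|l a| <= M * `|a|) -> 0 <= M ->
  nc (lC u) <= 2 * M * `|u|.
Proof.
move=> hL M0; rewrite (le_trans (nc_le _))// -mulrA mulr_natl mulr2n lerD//.
  by rewrite (le_trans (hL _))// ler_wpM2l// cnorm1.
by rewrite (le_trans (hL _))// ler_wpM2l// cnorm2.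
Qed.

Lemma lC_der (y dy : R -> 'cV[R[i]]_n) t : continuous l ->
  (forall s j, Cder (fun s => y s j 0) s (dy s j 0)) -> vcontinuous dy ->
  Cder (fun s => lC (segC y s)) t (lC (segC dy t)).
Proof.
move=> cL yd [c1 c2].
have y1 s : is_derive s (1 : R) (vec_Re \o y) ((vec_Re \o dy) s).
  apply/is_derive_vecP => j; have [d _] := yd s j.
  by apply: (is_derive_eqfun d) => [r|]; rewrite /= mxE.
have y2 s : is_derive s (1 : R) (vec_Im \o y) ((vec_Im \o dy) s).
  apply/is_derive_vecP => j; have [_ d] := yd s j.
  by apply: (is_derive_eqfun d) => [r|]; rewrite /= mxE.
have ll' : linear (l : X -> R^o) by move=> a u v; rewrite ll.
split.
  exact: (@linear_der R X R^o l _ _ _ ll' cL (segment_der h0 t y1 c1)).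
exact: (@linear_der R X R^o l _ _ _ ll' cL (segment_der h0 t y2 c2)).
Qed.

End Linear.

Section Bilinear.
Variable b : X -> X -> R.
Hypothesis bl : forall a (u v w : X), b (a *: u + v) w = a * b u w + b v w.
Hypothesis bs : forall u v : X, b u v = b v u.

Definition bC u v : R[i] := (b u.1 v.1 - b u.2 v.2) +i* (b u.1 v.2 + b u.2 v.1).

Lemma bCC u v : bC u v = bC v u.
Proof.
rewrite /bC (bs v.1 u.1) (bs v.2 u.2) (bs v.1 u.2) (bs v.2 u.1).
by apply: complexP => //=; rewrite addrC.
Qed.

Lemma bCE u v : bC u v = lC (b^~ v.1) u + 'i * lC (b^~ v.2) u.
Proof. by apply: complexP => /=; ring. Qed.

Lemma bCDl u v w : bC (u + v) w = bC u w + bC v w.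
Proof. by rewrite !bCE !lCD; [ring|move=> *; exact: bl|move=> *; exact: bl]. Qed.

Lemma bCZl z u w : bC (hscale z u) w = z * bC u w.
Proof. by rewrite !bCE !lCZ; [ring|move=> *; exact: bl|move=> *; exact: bl]. Qed.

Lemma bCDr u v w : bC w (u + v) = bC w u + bC w v.
Proof. by rewrite ![bC w _]bCC bCDl. Qed.

Lemma bCZr z u w : bC w (hscale z u) = z * bC w u.
Proof. by rewrite ![bC w _]bCC bCZl. Qed.

Lemma nc_bC (M : R) u v : (forall a c, `|b a c| <= M * (`|a| * `|c|)) -> 0 <= M ->
  nc (bC u v) <= 4 * M * (`|u| * `|v|).
Proof.
move=> hB M0.
have H (a c : X) : `|a| <= `|u| -> `|c| <= `|v| -> `|b a c| <= M * (`|u| * `|v|).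
  by move=> ha hc; rewrite (le_trans (hB _ _))// ler_wpM2l// ler_pM.
have h1 := H _ _ (cnorm1 u) (cnorm1 v); have h2 := H _ _ (cnorm1 u) (cnorm2 v).
have h3 := H _ _ (cnorm2 u) (cnorm1 v); have h4 := H _ _ (cnorm2 u) (cnorm2 v).
rewrite (le_trans (nc_le _))//=.
have g1 := ler_normB (b u.1 v.1) (b u.2 v.2).
have g2 := ler_normD (b u.1 v.2) (b u.2 v.1).
by lra.
Qed.

Lemma bC_real (a c : X) : bC (of_real a) (of_real c) = (b a c)%:C.
Proof.
have b0 x : b 0 x = 0 := lin0 (fun a (u v : X) => bl a u v x).
by rewrite /bC /= b0 subr0 (bs a 0) !b0 addr0.
Qed.

End Bilinear.

Section Trilinear.
Variable c : X -> X -> X -> R.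
Hypothesis cl : forall a (u v w x : X), c (a *: u + v) w x = a * c u w x + c v w x.
Hypothesis cs12 : forall u v w : X, c u v w = c v u w.
Hypothesis cs23 : forall u v w : X, c u v w = c u w v.

Definition tC u v w : R[i] :=
  (c u.1 v.1 w.1 - c u.1 v.2 w.2 - c u.2 v.1 w.2 - c u.2 v.2 w.1) +i*
  (c u.1 v.1 w.2 + c u.1 v.2 w.1 + c u.2 v.1 w.1 - c u.2 v.2 w.2).

Lemma tC12 u v w : tC u v w = tC v u w.
Proof.
rewrite /tC (cs12 v.1 u.1) (cs12 v.1 u.1) (cs12 v.1 u.2) (cs12 v.1 u.2).
rewrite (cs12 v.2 u.1) (cs12 v.2 u.1) (cs12 v.2 u.2) (cs12 v.2 u.2).
by apply: complexP => /=; ring.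
Qed.

Lemma tC23 u v w : tC u v w = tC u w v.
Proof.
rewrite /tC !(cs23 _ w.1 v.1) !(cs23 _ w.2 v.2) !(cs23 _ w.1 v.2) !(cs23 _ w.2 v.1).
by apply: complexP => /=; ring.
Qed.

Lemma tCE u v w : tC u v w = bC (fun a b => c a b w.1) u v + 'i * bC (fun a b => c a b w.2) u v.
Proof. by apply: complexP => /=; ring. Qed.

Lemma tCD1 u v w x : tC (u + v) w x = tC u w x + tC v w x.
Proof. by rewrite !tCE !bCDl; [ring|move=> *; exact: cl|move=> *; exact: cl]. Qed.

Lemma tCZ1 z u w x : tC (hscale z u) w x = z * tC u w x.
Proof. by rewrite !tCE !bCZl; [ring|move=> *; exact: cl|move=> *; exact: cl]. Qed.

Lemma tCD2 u v w x : tC w (u + v) x = tC w u x + tC w v x.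
Proof. by rewrite ![tC w _ _]tC12 tCD1. Qed.

Lemma tCZ2 z u w x : tC w (hscale z u) x = z * tC w u x.
Proof. by rewrite ![tC w _ _]tC12 tCZ1. Qed.

Lemma tCD3 u v w x : tC w x (u + v) = tC w x u + tC w x v.
Proof. by rewrite ![tC w x _]tC23 tCD2. Qed.

Lemma tCZ3 z u w x : tC w x (hscale z u) = z * tC w x u.
Proof. by rewrite ![tC w x _]tC23 tCZ2. Qed.

Lemma nc_tC (M : R) u v w :
  (forall x y z : X, `|c x y z| <= M * (`|x| * (`|y| * `|z|))) -> 0 <= M ->
  nc (tC u v w) <= 8 * M * (`|u| * (`|v| * `|w|)).
Proof.
move=> hC M0.
have H (x y z : X) : `|x| <= `|u| -> `|y| <= `|v| -> `|z| <= `|w| ->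
    `|c x y z| <= M * (`|u| * (`|v| * `|w|)).
  move=> hx hy hz; rewrite (le_trans (hC _ _ _))//.
  by rewrite ler_wpM2l// ler_pM ?mulr_ge0// ler_pM.
have N4 (x y z t K : R) : `|x| <= K -> `|y| <= K -> `|z| <= K -> `|t| <= K ->
    `|x + y + z + t| <= 4 * K.
  move=> hx hy hz ht; have := ler_normD (x + y + z) t.
  have := ler_normD (x + y) z; have := ler_normD x y; lra.
have a1 := cnorm1 u; have a2 := cnorm2 u; have b1 := cnorm1 v; have b2 := cnorm2 v.
have c1 := cnorm1 w; have c2 := cnorm2 w.
rewrite (le_trans (nc_le _))//.
rewrite [leRHS](_ : _ = 4 * (M * (`|u| * (`|v| * `|w|))) + 4 * (M * (`|u| * (`|v| * `|w|)))); last by ring.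
by apply: lerD; apply: N4; rewrite ?normrN; apply: H.
Qed.

Lemma tC_real (x y z : X) : tC (of_real x) (of_real y) (of_real z) = (c x y z)%:C.
Proof.
have c0 (w v : X) : c 0 w v = 0 := lin0 (fun a (u v' : X) => cl a u v' w v).
have c1 (w v : X) : c w 0 v = 0 by rewrite cs12 c0.
have c2 (w v : X) : c w v 0 = 0 by rewrite cs23 c1.
by rewrite /tC /= !c0 !c1 !c2 !subr0 !addr0.
Qed.

End Trilinear.

Lemma cext1E (L : X -> 'cV[R]_n) u i : cext1 L u i 0 = lC (fun a => L a i 0) u.
Proof. by rewrite /cext1 /cext !mxE; apply: complexP => /=; ring. Qed.

Lemma cext2E (B : X -> X -> 'cV[R]_n) u v i : cext2 B u v i 0 = bC (fun a b => B a b i 0) u v.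
Proof. by rewrite /cext2 /cext [LHS]mxE [X in _ + X]mxE !cext1E; apply: complexP => /=; ring. Qed.

Lemma cext3E (C : X -> X -> X -> 'cV[R]_n) u v w i :
  cext3 C u v w i 0 = tC (fun a b c => C a b c i 0) u v w.
Proof. by rewrite /cext3 /cext [LHS]mxE [X in _ + X]mxE !cext2E; apply: complexP => /=; ring. Qed.

End ComplexHistories.

(** * Taylor expansion of maps of class C^3 *)

Section C3.
Context {R : realType} {E : normedModType R}.

Lemma near0P (P : E -> Prop) :
  (\forall d \near (0 : E), P d) <-> exists2 r : R, 0 < r & forall d, `|d| < r -> P d.
Proof.
split.
  move=> /nbhs_ballP[r r0 hr]; exists r => // d hd; apply: hr.
  by rewrite -ball_normE /ball_ /= sub0r normrN.
move=> [r r0 hr]; apply/nbhs_ballP; exists r => // d.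
by rewrite -ball_normE /ball_ /= sub0r normrN => /hr.
Qed.

Lemma nearP (P : E -> Prop) (x : E) :
  (\forall y \near x, P y) <-> exists2 r : R, 0 < r & forall y, `|y - x| < r -> P y.
Proof.
split.
  move=> /nbhs_ballP[r r0 hr]; exists r => // d hd; apply: hr.
  by rewrite -ball_normE /ball_ /= distrC.
move=> [r r0 hr]; apply/nbhs_ballP; exists r => // d.
by rewrite -ball_normE /ball_ /= distrC => /hr.
Qed.

(** The scalar version of [Ck_on] for k = 3 on the whole space: D x [:: v1;
    ..; vj] is the j-th derivative at x in the directions v1, .., vj, and the
    estimates are uniform in the directions. *)
Record C3 (D : E -> seq E -> R) : Prop := {
  C3_lin : forall x s1 s2 (a : R) u v, (size s1 + size s2 < 3)%N ->
    D x (s1 ++ (a *: u + v) :: s2) = a * D x (s1 ++ u :: s2) + D x (s1 ++ v :: s2) ;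
  C3_bnd : forall x j, (j <= 3)%N -> exists M : R, forall s, size s = j ->
    `|D x s| <= M * \prod_(v <- s) `|v| ;
  C3_der : forall x j (e : R), (j < 3)%N -> 0 < e ->
    \forall d \near (0 : E), forall s, size s = j ->
      `|D (x + d) s - D x s - D x (d :: s)| <= e * `|d| * \prod_(v <- s) `|v| ;
  C3_cont : forall x (e : R), 0 < e ->
    \forall y \near x, forall s, size s = 3%N ->
      `|D y s - D x s| <= e * \prod_(v <- s) `|v| }.

Variable D : E -> seq E -> R.
Hypothesis CD : C3 D.

Lemma prod_norm_ge0 (s : seq E) : 0 <= \prod_(v <- s) `|v|.
Proof. by apply: prodr_ge0. Qed.

Lemma C3_bnd_gt0 x j : (j <= 3)%N -> exists2 M : R, 0 < M & forall s, size s = j ->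
    `|D x s| <= M * \prod_(v <- s) `|v|.
Proof.
move=> /(C3_bnd CD x)[M hM]; exists (Num.max 1 M); first by rewrite lt_max ltr01.
move=> s /hM h; rewrite (le_trans h)// ler_wpM2r ?prod_norm_ge0//.
by rewrite le_max lexx orbT.
Qed.

Lemma D_lin_head x a u v s : (size s < 3)%N ->
  D x (a *: u + v :: s) = a * D x (u :: s) + D x (v :: s).
Proof. by move=> hs; apply: (C3_lin CD x (s1 := [::])). Qed.

Lemma D_head0 x s : (size s < 3)%N -> D x (0 :: s) = 0.
Proof.
move=> hs; have := D_lin_head x 1 0 0 hs; rewrite scaler0 addr0 mul1r => /eqP.
by rewrite -{1}[D x _]addr0 (inj_eq (addrI _)) eq_sym => /eqP.
Qed.

Lemma D_scale_head x a u s : (size s < 3)%N -> D x (a *: u :: s) = a * D x (u :: s).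
Proof. by move=> hs; have := D_lin_head x a u 0 hs; rewrite addr0 D_head0// addr0. Qed.

Lemma line_der x u s a : (size s < 3)%N ->
  is_derive a (1 : R) (fun b => D (x + b *: u) s) (D (x + a *: u) (u :: s)).
Proof.
move=> hs; set y := x + a *: u.
suff cv : (d^-1 *: (D (x + (d *: 1 + a) *: u) s - D (x + a *: u) s)) @[d --> 0^']
    --> D y (u :: s).
  by apply: DeriveDef; [apply/cvg_ex; exists (D y (u :: s))|exact: cvg_lim].
apply/cvgrPdist_le => e e0.
pose P := \prod_(v <- s) `|v|.
pose e' := e / (`|u| * P + 1).
have K0 : 0 < `|u| * P + 1 by rewrite ltr_wpDl// mulr_ge0// prod_norm_ge0.
have e'0 : 0 < e' by rewrite divr_gt0.
have /near0P[r r0 hr] := C3_der CD y hs e'0.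
have r'0 : 0 < r / (`|u| + 1) by rewrite divr_gt0// ltr_wpDl.
near=> d.
have d0 : d != 0 by near: d; exact: nbhs_dnbhs_neq.
have dr : `|d| < r / (`|u| + 1) by near: d; exact: dnbhs0_lt.
have := hr (d *: u) _ s erefl.
rewrite normrZ D_scale_head// => /(_ _) H.
have {}H : `|D (y + d *: u) s - D y s - d * D y (u :: s)| <= e' * (`|d| * `|u|) * P.
  apply: H; rewrite (@le_lt_trans _ _ (`|d| * (`|u| + 1)))//.
    by rewrite ler_wpM2l// lerDl.
  by rewrite -ltr_pdivlMr// ltr_wpDl.
have -> : x + (d *: 1 + a) *: u = y + d *: u.
  by rewrite -[d *: 1]/(d * 1) mulr1 scalerDl [d *: u + _]addrC addrA.
rewrite -[d^-1 *: _]/(d^-1 * _) -/y.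
rewrite -(ler_pM2l (_ : 0 < `|d|)) ?normr_gt0// -normrM mulrBr mulrA mulfV// mul1r distrC.
apply: (le_trans H); have e'E : e' * (`|u| * P + 1) = e by rewrite divfK ?gt_eqF.
have -> : e' * (`|d| * `|u|) * P = `|d| * (e' * (`|u| * P)) by ring.
by rewrite -e'E ler_wpM2l// ler_wpM2l ?(ltW e'0)// lerDl.
Unshelve. all: by end_near. Qed.

Lemma D_cont x j (e : R) : (j <= 3)%N -> 0 < e ->
  \forall y \near x, forall s, size s = j -> `|D y s - D x s| <= e * \prod_(v <- s) `|v|.
Proof.
rewrite leq_eqVlt => /predU1P[->|j3] e0; first exact: C3_cont.
have [M M0 hM] := @C3_bnd_gt0 x j.+1 j3.
have /near0P[r r0 hr] := C3_der CD x j3 (ltr01 : 0 < (1 : R)).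
apply/nearP; exists (Num.min r (e / (M + 1))).
  by rewrite lt_min r0 divr_gt0// ltr_wpDr// ltW.
move=> y; rewrite lt_min => /andP[yr ye] s sj.
have yE : x + (y - x) = y by rewrite addrC subrK.
have := hr _ yr s sj; rewrite yE mul1r => H.
have := hM (y - x :: s); rewrite /= sj big_cons => /(_ erefl) H2.
have P0 := prod_norm_ge0 s.
have M10 : 0 < M + 1 by rewrite ltr_wpDr// ltW.
have : (M + 1) * `|y - x| <= e by rewrite mulrC -ler_pdivlMr// ltW.
move=> /(ler_wpM2r P0); apply: le_trans.
rewrite -(subrK (D x (y - x :: s)) (_ - _)) (le_trans (ler_normD _ _))//.
by rewrite mulrDl mul1r mulrDl addrC lerD// -mulrA.
Qed.

Lemma D_bnd (x : E) j : (j <= 3)%N -> exists M : R, 0 < M /\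
  \forall y \near x, forall s, size s = j -> `|D y s| <= M * \prod_(v <- s) `|v|.
Proof.
move=> j3; have [M M0 hM] := C3_bnd_gt0 x j3.
exists (M + 1); split; first by rewrite ltr_wpDr// ltW.
have := D_cont x j3 (ltr01 : 0 < (1 : R)).
apply: filterS => y hy s sj; rewrite -(subrK (D x s) (D y s)).
rewrite (le_trans (ler_normD _ _))// addrC mulrDl lerD//; [exact: hM|exact: hy].
Qed.

(** The mean value theorem in the direction u turns the second difference into
    s times a difference of first derivatives in the direction u, to which
    differentiability applies. *)
Lemma second_difference x (u v : E) w (e : R) : (size w <= 1)%N -> 0 < e ->
  \forall s \near 0^'+,
   `|(D (x + s *: u + s *: v) w - D (x + s *: u) w - D (x + s *: v) w + D x w) -
      s ^+ 2 * D x (v :: u :: w)|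
     <= s ^+ 2 * (e * ((2 * `|u| + `|v|) * `|u| * \prod_(z <- w) `|z|)).
Proof.
move=> hw.
pose P := \prod_(z <- w) `|z|; rewrite -/P.
have P0 : 0 <= P := prod_norm_ge0 w.
move=> e0.
have w2 : (size (u :: w) < 3)%N by rewrite /= ltnS.
have w1 : (size w < 3)%N by rewrite ltnS (leq_trans hw).
have /near0P[r r0 hr] := C3_der CD x w2 e0.
near=> s.
have s0 : 0 < s by [].
have sr : s * (2 * (`|u| + `|v|) + 1) < r.
  rewrite -ltr_pdivlMr; last by rewrite ltr_wpDl// mulr_ge0// addr_ge0.
  near: s; apply: nbhs_right_lt; rewrite divr_gt0// ltr_wpDl// mulr_ge0// addr_ge0.
pose g a := D (x + s *: v + a *: u) w - D (x + a *: u) w.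
have gd a : is_derive a (1 : R) g (D (x + s *: v + a *: u) (u :: w) - D (x + a *: u) (u :: w)).
  by apply: is_deriveB; exact: line_der.
have [|a] := MVT s0 (fun a _ => gd a).
  apply: continuous_subspaceT => a; apply: differentiable_continuous.
  by apply/derivable1_diffP; case: (gd a).
rewrite in_itv /= subr0 => /andP[a0 as_] gE.
have -> : D (x + s *: u + s *: v) w - D (x + s *: u) w - D (x + s *: v) w + D x w = g s - g 0.
  by rewrite /g !scale0r !addr0 [x + s *: v + s *: u]addrAC; ring.
have n1 : `|s *: v + a *: u| <= s * (`|u| + `|v|).
  rewrite (le_trans (ler_normD _ _))// !normrZ !ger0_norm ?(ltW s0) ?(ltW a0)//.
  by rewrite mulrDr addrC lerD// ler_wpM2r// ltW.
have n2 : `|a *: u| <= s * `|u|.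
  by rewrite normrZ ger0_norm ?(ltW a0)// ler_wpM2r// ltW.
have sN : s * (`|u| + `|v|) < r.
  apply: le_lt_trans sr; rewrite ler_wpM2l ?(ltW s0)//.
  by have := normr_ge0 u; have := normr_ge0 v; lra.
have sN2 : s * `|u| < r.
  by apply: le_lt_trans sN; rewrite ler_wpM2l ?(ltW s0)// lerDl.
have h1 := hr _ (le_lt_trans n1 sN) (u :: w) erefl.
have h2 := hr _ (le_lt_trans n2 sN2) (u :: w) erefl.
rewrite D_lin_head// opprD in h1; rewrite !addrA in h1.
rewrite gE.
set A := D (x + s *: v + a *: u) (u :: w) in h1 *.
set B := D (x + a *: u) (u :: w) in h2 *.
rewrite big_cons -/P in h1 h2.
have -> : (A - B) * s - s ^+ 2 * D x (v :: u :: w) =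
  s * ((A - D x (u :: w) - s * D x (v :: u :: w) - D x (a *: u :: u :: w)) -
       (B - D x (u :: w) - D x (a *: u :: u :: w))) by ring.
rewrite normrM ger0_norm ?(ltW s0)// expr2 -mulrA ler_wpM2l ?(ltW s0)//.
rewrite (le_trans (ler_normB _ _))// (le_trans (lerD h1 h2))//.
have -> : e * `|s *: v + a *: u| * (`|u| * P) + e * `|a *: u| * (`|u| * P) =
  (`|s *: v + a *: u| + `|a *: u|) * (e * (`|u| * P)) by ring.
have -> : s * (e * ((2 * `|u| + `|v|) * `|u| * P)) =
  (s * (`|u| + `|v|) + s * `|u|) * (e * (`|u| * P)) by ring.
by rewrite ler_wpM2r ?lerD// !mulr_ge0// ltW.
Unshelve. all: by end_near. Qed.

(** Symmetry is not part of the definition of the derivatives. It holds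
    because the second difference is symmetric in u and v, while its quotient
    by s^2 tends to either side, depending on the order of the two increments. *)
Lemma D_sym12 x u v w : (size w <= 1)%N -> D x (u :: v :: w) = D x (v :: u :: w).
Proof.
move=> hw.
pose P := \prod_(z <- w) `|z|.
have P0 : 0 <= P := prod_norm_ge0 w.
apply/eqP; rewrite -subr_eq0 -normr_le0.
apply/ler_addgt0Pl => e e0; rewrite addr0.
pose K := (2 * `|u| + `|v|) * `|u| * P + (2 * `|v| + `|u|) * `|v| * P + 1.
have K0 : 0 < K by rewrite ltr_wpDl// addr_ge0// !mulr_ge0// addr_ge0// mulr_ge0.
have e'0 : 0 < e / K by rewrite divr_gt0.
near (0:R)^'+ => s.
have s0 : 0 < s by [].
have h1 : `|(D (x + s *: u + s *: v) w - D (x + s *: u) w - D (x + s *: v) w + D x w) -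
      s ^+ 2 * D x (v :: u :: w)| <= s ^+ 2 * (e / K * ((2 * `|u| + `|v|) * `|u| * P)).
  by near: s; exact: second_difference.
have h2 : `|(D (x + s *: v + s *: u) w - D (x + s *: v) w - D (x + s *: u) w + D x w) -
      s ^+ 2 * D x (u :: v :: w)| <= s ^+ 2 * (e / K * ((2 * `|v| + `|u|) * `|v| * P)).
  by near: s; exact: second_difference.
rewrite [x + s *: v + s *: u]addrAC in h2.
have s20 : 0 < s ^+ 2 by rewrite exprn_gt0.
rewrite -(ler_pM2l s20) -[s ^+ 2 in leLHS]ger0_norm ?(ltW s20)// -normrM.
rewrite [X in `|X|](_ : _ = ((D (x + s *: u + s *: v) w - D (x + s *: u) w - D (x + s *: v) w + D x w) -
      s ^+ 2 * D x (v :: u :: w)) - ((D (x + s *: u + s *: v) w - D (x + s *: v) w - D (x + s *: u) w + D x w) -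
      s ^+ 2 * D x (u :: v :: w))); last by ring.
rewrite (le_trans (ler_normB _ _))// (le_trans (lerD h1 h2))// -mulrDr ler_wpM2l ?(ltW s20)//.
have -> : e / K * ((2 * `|u| + `|v|) * `|u| * P) + e / K * ((2 * `|v| + `|u|) * `|v| * P) =
  e / K * (K - 1) by rewrite /K; ring.
by rewrite -[leRHS](@divfK _ K) ?gt_eqF// ler_wpM2l ?(ltW e'0)// gerBl.
Unshelve. all: by end_near. Qed.

Lemma D_sym23 x u v w : D x [:: u; v; w] = D x [:: u; w; v].
Proof.
have h1 := @line_der x u [:: v; w] 0 isT.
have h2 := @line_der x u [:: w; v] 0 isT.
have E1 : (fun b => D (x + b *: u) [:: v; w]) = (fun b => D (x + b *: u) [:: w; v]).
  by apply/funext => b; exact: D_sym12.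
rewrite E1 in h1; have := @derive_val _ _ _ _ _ _ _ h1.
by rewrite (@derive_val _ _ _ _ _ _ _ h2) !scale0r !addr0.
Qed.

(** Uniform in the base point x near x0. The third derivative is integrated
    three times along the segment from x to x + d. *)
Lemma D_taylor x0 (e : R) : 0 < e -> exists2 r : R, 0 < r &
  forall x d, `|x - x0| < r -> `|d| < r ->
  `|D (x + d) [::] - D x [::] - D x [:: d] - D x [:: d; d] / 2 - D x [:: d; d; d] / 6|
    <= e * `|d| ^+ 3.
Proof.
move=> e0; have e20 : 0 < e / 2 by rewrite divr_gt0.
have /nearP[r r0 hr] := C3_cont CD x0 e20.
exists (r / 2) => [|x d xr dr]; first by rewrite divr_gt0.
set K := e * `|d| ^+ 3.
have K0 : 0 <= K by rewrite mulr_ge0 ?(ltW e0)// exprn_ge0.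
have h3 a : 0 <= a <= 1 -> `|D (x + a *: d) [:: d; d; d] - D x [:: d; d; d]| <= K.
  move=> /andP[a0 a1].
  have p3 : \prod_(v <- [:: d; d; d]) `|v| = `|d| ^+ 3.
    by rewrite !big_cons big_nil mulr1 !exprS expr0 mulr1.
  have k1 : `|D (x + a *: d) [:: d; d; d] - D x0 [:: d; d; d]| <= e / 2 * `|d| ^+ 3.
    rewrite -p3; apply: hr => //; rewrite addrAC (le_lt_trans (ler_normD _ _))// (splitr r).
    rewrite ltrD// (le_lt_trans _ dr)// normrZ ger0_norm//.
    by rewrite ler_piMl.
  have k2 : `|D x [:: d; d; d] - D x0 [:: d; d; d]| <= e / 2 * `|d| ^+ 3.
    by rewrite -p3; apply: hr => //; rewrite (lt_trans xr)// ltr_pdivrMr// ltr_pMr// ltr1n.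
  rewrite -(subrKA (D x0 [:: d; d; d])) (le_trans (ler_normD _ _))//.
  by rewrite [X in _ + X]distrC /K (splitr e) mulrDl lerD.
have step (f df : R -> R) : (forall a, is_derive a (1 : R) f (df a)) -> f 0 = 0 ->
    (forall a, 0 <= a <= 1 -> `|df a| <= K) -> forall a, 0 <= a <= 1 -> `|f a| <= K.
  move=> fd f0 dfK a /andP[a0 a1].
  have := @mvt_ineq _ f df 0 a K a0 (fun t _ => fd t); rewrite f0 !subr0 => H.
  apply: (le_trans (H _ _)).
  - apply: continuous_subspaceT => b; apply: differentiable_continuous.
    by apply/derivable1_diffP; case: (fd b).
  - by move=> t /andP[t0 ta]; apply: dfK; rewrite (ltW t0) (le_trans (ltW ta)).
  - by rewrite ler_piMr.
have lin (c : R) (a : R) : is_derive a (1 : R) (fun b => c * b) c.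
  apply: (is_derive_eqfun (is_deriveZ c (is_derive_id a 1))) => [s|].
    by [].
  by rewrite /GRing.scale /= mulr1.
have sq (c : R) (a : R) : is_derive a (1 : R) (fun b => c / 2 * b ^+ 2) (c * a).
  apply: (is_derive_eqfun (is_deriveZ (c / 2) (is_deriveM (is_derive_id a 1) (is_derive_id a 1)))) => [s|].
    by rewrite -[LHS]/(c / 2 * (s * s)) expr2.
  by rewrite /GRing.scale /=; field.
have cu (c : R) (a : R) : is_derive a (1 : R) (fun b => c / 6 * b ^+ 3) (c / 2 * a ^+ 2).
  apply: (is_derive_eqfun (is_deriveZ (c / 6) (is_deriveM (is_derive_id a 1)
    (is_deriveM (is_derive_id a 1) (is_derive_id a 1))))) => [s|].
    by rewrite -[LHS]/(c / 6 * (s * (s * s))) !exprS expr0 mulr1.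
  by rewrite -[(id * id) a]/(a * a) /GRing.scale /=; field.
have cst (c : R) (a : R) : is_derive a (1 : R) (fun=> c) 0 by exact: is_derive_cst.
have dB (f g : R -> R) (a y z : R) : is_derive a (1 : R) f y -> is_derive a (1 : R) g z ->
    is_derive a (1 : R) (fun b => f b - g b) (y - z) by move=> hf hg; exact: is_deriveB.
have ld s a (hs : (size s < 3)%N) := @line_der x d s a hs.
pose d3 := D x [:: d; d; d]; pose d2 := D x [:: d; d]; pose d1 := D x [:: d].
have s2 := step (fun a => D (x + a *: d) [:: d; d] - d2 - d3 * a)
  (fun a => D (x + a *: d) [:: d; d; d] - 0 - d3).
have {}s2 : forall a, 0 <= a <= 1 -> `|D (x + a *: d) [:: d; d] - d2 - d3 * a| <= K.
  refine (s2 _ _ _) => [a||a ha].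
  - have e1 := dB _ _ a _ _ (ld [:: d; d] a isT) (cst d2 a).
    exact: (dB _ _ a _ _ e1 (lin d3 a)).
  - by rewrite scale0r addr0 subrr mulr0 subrr.
  - by rewrite subr0; exact: h3.
have s1 := step (fun a => D (x + a *: d) [:: d] - d1 - d2 * a - d3 / 2 * a ^+ 2)
  (fun a => D (x + a *: d) [:: d; d] - 0 - d2 - d3 * a).
have {}s1 : forall a, 0 <= a <= 1 -> `|D (x + a *: d) [:: d] - d1 - d2 * a - d3 / 2 * a ^+ 2| <= K.
  refine (s1 _ _ _) => [a||a ha].
  - have e1 := dB _ _ a _ _ (ld [:: d] a isT) (cst d1 a).
    have e2 := dB _ _ a _ _ e1 (lin d2 a).
    exact: (dB _ _ a _ _ e2 (sq d3 a)).
  - by rewrite scale0r addr0 subrr expr0n /= !mulr0 !subrr.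
  - by rewrite subr0; exact: s2.
have s0 := step (fun a => D (x + a *: d) [::] - D x [::] - d1 * a - d2 / 2 * a ^+ 2 - d3 / 6 * a ^+ 3)
  (fun a => D (x + a *: d) [:: d] - 0 - d1 - d2 * a - d3 / 2 * a ^+ 2).
have {}s0 : forall a, 0 <= a <= 1 -> `|D (x + a *: d) [::] - D x [::] - d1 * a - d2 / 2 * a ^+ 2 - d3 / 6 * a ^+ 3| <= K.
  refine (s0 _ _ _) => [a||a ha].
  - have e1 := dB _ _ a _ _ (ld [::] a isT) (cst (D x [::]) a).
    have e2 := dB _ _ a _ _ e1 (lin d1 a).
    have e3 := dB _ _ a _ _ e2 (sq d2 a).
    exact: (dB _ _ a _ _ e3 (cu d3 a)).
  - by rewrite scale0r addr0 subrr !expr0n /= !mulr0 !subrr.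
  - by rewrite subr0; exact: s1.
by have := s0 1; rewrite scale1r !expr1n !mulr1 ler01 lexx; apply.
Qed.

Lemma D_lipschitz x0 : exists r M : R, [/\ 0 < r, 0 < M &
  forall x y, `|x - x0| < r -> `|y - x0| < r -> `|D x [::] - D y [::]| <= M * `|x - y|].
Proof.
have [M [M0 /nearP[r r0 hr]]] := @D_bnd x0 1 isT.
exists r, M; split => // x y xr yr.
have line a : is_derive a (1 : R) (fun b => D (y + b *: (x - y)) [::]) (D (y + a *: (x - y)) [:: x - y]).
  exact: line_der.
have := @mvt_ineq _ _ _ 0 1 (M * `|x - y|) ler01 (fun t _ => line t).
rewrite scale1r scale0r addr0 [y + _]addrC subrK subr0 mulr1; apply.
  apply: continuous_subspaceT => b; apply: differentiable_continuous.
  by apply/derivable1_diffP; case: (line b).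
move=> t /andP[t0 t1].
have -> : M * `|x - y| = M * \prod_(v <- [:: x - y]) `|v| by rewrite big_cons big_nil mulr1.
apply: hr => //.
have -> : y + t *: (x - y) - x0 = (1 - t) *: (y - x0) + t *: (x - x0).
  rewrite scalerBl scale1r !scalerBr; rewrite !opprB.
  by rewrite -[RHS]addrA [t *: x0 - _ + _]addrC subrKA addrAC.
rewrite (le_lt_trans (ler_normD _ _))// !normrZ !ger0_norm ?subr_ge0 ?(ltW t0) ?(ltW t1)//.
rewrite [ltRHS](_ : _ = (1 - t) * r + t * r); last by ring.
by rewrite ltrD// ltr_pM2l// subr_gt0.
Qed.

End C3.

(** * The derivatives of a map of class C^k in its second argument *)

Section Derivatives.
Context {R : realType}.

(** A linear approximation with remainder o(|d|) is the differential;
    boundedness makes A continuous. *)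
Lemma diff_eq (V W : normedModType R) (f : V -> W) (A : V -> W) (x : V) (M : R) :
  linear A -> (forall d, `|A d| <= M * `|d|) ->
  (forall e : R, 0 < e -> \forall d \near (0 : V), `|f (x + d) - f x - A d| <= e * `|d|) ->
  differentiable f x /\ forall u, 'd f x u = A u.
Proof.
move=> lA bA fA.
pose LA := GRing.isLinear.Build R V W *:%R A lA.
pose A' : {linear V -> W} := HB.pack A LA.
have cA : continuous A'.
  apply: bounded_linear_continuous; apply/linear_boundedP.
  apply: filterS (nbhs_pinfty_ge (num_real M)) => r Mr y /=.
  by rewrite (le_trans (bA y))// ler_wpM2r.
have E : f \o shift x = cst (f x) + A' +o_ (0 : V) id.
  apply/eqaddoP => e e0; have := fA e e0; apply: filterS => d /=.
  move=> H; rewrite (_ : (f \o shift x - (cst (f x) + A)) d = f (x + d) - f x - A d)//.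
  by rewrite -[LHS]/(f (d + x) - (f x + A d)) opprD addrA [d + x]addrC.
have dE := diff_unique cA E.
split; last by move=> u; rewrite dE.
by apply/diff_locallyP; rewrite dE.
Qed.

Context {X : normedModType R} {n k : nat}.
Variable F : R * X -> 'cV[R]_n.
Hypothesis k3 : (3 <= k)%N.
Hypothesis Fk : Ck_on k setT F.

(** For k > 3 the continuity of the third derivative follows from its
    differentiability. *)
Lemma Ck_C3 : exists D : R * X -> seq (R * X) -> 'cV[R]_n,
  [/\ forall x, D x [::] = F x,
      forall i, C3 (fun x s => D x s i 0) &
      forall t x, [/\ forall u, d2F F t x u = D (t, x) [:: (0, u)],
        forall u v, d2F2 F t x u v = D (t, x) [:: (0, u); (0, v)] &
        forall u v w, d2F3 F t x u v w = D (t, x) [:: (0, u); (0, v); (0, w)]]].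
Proof.
have [D [D0 Dlin Dbnd Dder Dcont]] := Fk; exists D.
have lin s : (size s < 3)%N -> forall t x, linear (fun u : X => D (t, x) ((0, u) :: s)).
  move=> s3 t x a u v.
  rewrite (_ : (0, a *: u + v) = a *: (0, u) + (0, v) :> R * X); last first.
    by congr pair; rewrite -[RHS]/(a * 0 + 0) mulr0 addr0.
  by apply: (Dlin (t, x) [::] s) => //; rewrite (leq_trans _ k3).
have der s : (size s < 3)%N -> forall t x u,
    'd (fun y => D (t, y) s) x u = D (t, x) ((0, u) :: s).
  move=> s3 t x.
  have [M hM] := Dbnd (t, x) (size s).+1 I (leq_trans s3 k3).
  have nE (u : X) : `|(0, u) : R * X| = `|u|.
    by rewrite -[LHS]/(Num.max `|0 : R| `|u|) normr0 max_r.
  have P0 : 0 <= \prod_(v <- s) `|v| by apply: prodr_ge0.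
  apply: (@diff_eq _ _ _ _ x (M * \prod_(v <- s) `|v|) (lin s s3 t x) _ _).2 => [d|e e0].
    by rewrite (le_trans (hM ((0, d) :: s) erefl))// big_cons nE mulrAC mulrA.
  pose P := \prod_(v <- s) `|v| + 1.
  have Pgt0 : 0 < P by rewrite ltr_wpDl.
  have /near0P[r r0 hr] := Dder (t, x) (size s) (e / P) I (leq_trans s3 k3) (divr_gt0 e0 Pgt0).
  apply/near0P; exists r => // d dr.
  have := hr (0, d); rewrite nE => /(_ dr s erefl).
  rewrite (_ : (t, x) + (0, d) = (t, x + d)); last by rewrite -[LHS]/(t + 0, x + d) addr0.
  move=> /le_trans; apply; have eP : e / P * P = e by rewrite divfK ?gt_eqF.
  have -> : e * `|d| = e / P * `|d| * P by rewrite -[in LHS]eP; ring.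
  by rewrite ler_wpM2l ?lerDl// mulr_ge0// divr_ge0 ?ltW.
split => [x|i|t x]; first exact: D0.
  split => [x s1 s2 a u v s3|x j j3|x j e j3 e0|x e e0].
  - by rewrite Dlin ?(leq_trans s3)// !mxE.
  - have [M hM] := Dbnd x j I (leq_trans j3 k3); exists M => s sj.
    by rewrite (le_trans (cv_norm_ge _ _))// hM.
  - have := Dder x j e I (leq_trans j3 k3) e0; apply: filterS => d hd s sj.
    have := cv_norm_ge (D (x + d) s - D x s - D x (d :: s)) i.
    by rewrite !mxE => /le_trans; apply; exact: hd.
  - have cc : \forall y \near x, forall s, size s = 3%N ->
        `|D y s - D x s| <= e * \prod_(v <- s) `|v|.
      move: k3; rewrite leq_eqVlt => /predU1P[k3E|k3lt].
        by rewrite k3E; exact: Dcont.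
      have [M hM] := Dbnd x 4 I k3lt.
      have /near0P[r r0 hr] := Dder x 3%N 1 I k3lt ltr01.
      pose M1 := `|M| + 1.
      have M10 : 0 < M1 by rewrite ltr_wpDl.
      apply/nearP; exists (Num.min r (e / M1)); first by rewrite lt_min r0 divr_gt0.
      move=> y; rewrite lt_min => /andP[yr ye] s sj.
      have yE : x + (y - x) = y by rewrite addrC subrK.
      have := hr _ yr s sj; rewrite yE mul1r => H.
      have := hM (y - x :: s); rewrite /= sj big_cons => /(_ erefl) H2.
      have P0 : 0 <= \prod_(v <- s) `|v| by apply: prodr_ge0.
      have : M1 * `|y - x| <= e by rewrite mulrC -ler_pdivlMr// ltW.
      move=> /(ler_wpM2r P0); apply: le_trans.
      rewrite -(subrK (D x (y - x :: s)) (_ - _)) (le_trans (ler_normD _ _))//.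
      rewrite /M1 mulrDl mul1r mulrDl addrC lerD//.
      by rewrite (le_trans H2)// mulrA ler_wpM2r// ler_wpM2r// ler_norm.
    apply: filterS cc => y hy s sj; have := cv_norm_ge (D y s - D x s) i.
    by rewrite !mxE => /le_trans; apply; exact: hy.
have e1 y u : d2F F t y u = D (t, y) [:: (0, u)].
  rewrite /d2F (_ : (fun y => F (t, y)) = fun y => D (t, y) [::]); first exact: der.
  by apply/funext => z; rewrite D0.
have e2 y u v : d2F2 F t y u v = D (t, y) [:: (0, u); (0, v)].
  rewrite /d2F2 (_ : (fun y => d2F F t y v) = fun y => D (t, y) [:: (0, v)]); first exact: der.
  by apply/funext => z; rewrite e1.
split => // u v w.
rewrite /d2F3 (_ : (fun y => d2F2 F t y v w) = fun y => D (t, y) [:: (0, v); (0, w)]).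
  exact: der.
by apply/funext => z; rewrite e2.
Qed.

End Derivatives.

(** * Local existence of solutions *)

Section Existence.
Context {R : realType}.

Lemma geometric_small (K a : R) : (forall m, a <= K * 2^-1 ^+ m) -> a <= 0.
Proof.
move=> H; have half : `|2^-1 : R| < 1.
  by rewrite ger0_norm ?invr_ge0// invf_lt1 ?ltr1n.
have /cvgrPdist_lt cv := @cvg_geometric R K 2^-1 half.
apply/ler_addgt0Pl => e e0; rewrite addr0.
have [N _ hN] := cv e e0; have := hN N (leqnn N).
rewrite sub0r normrN /geometric /= => hh.
exact: (le_trans (H N) (le_trans (ler_norm _) (ltW hh))).
Qed.

Lemma geometric_cauchy (u : nat -> R) (C : R) :
  (forall m, `|u m.+1 - u m| <= C * 2^-1 ^+ m) ->
  exists l, forall m, `|u m - l| <= 2 * C * 2^-1 ^+ m.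
Proof.
move=> H.
have C0 : 0 <= C by have := H 0%N; rewrite expr0 mulr1; apply: le_trans.
have half : `|2^-1 : R| < 1.
  by rewrite ger0_norm ?invr_ge0// invf_lt1 ?ltr1n.
have p m : 0 <= (2^-1 : R) ^+ m by rewrite exprn_ge0// invr_ge0.
have step k m : `|u (m + k)%N - u m| <= 2 * C * 2^-1 ^+ m * (1 - 2^-1 ^+ k).
  elim: k => [|k IH]; first by rewrite addn0 !subrr normr0 mulr0.
  rewrite addnS -(subrKA (u (m + k)%N)) (le_trans (ler_normD _ _))//.
  rewrite (le_trans (lerD (H _) IH))// exprD exprS.
  by rewrite le_eqVlt; apply/orP; left; apply/eqP; field.
have step' k m : `|u (m + k)%N - u m| <= 2 * C * 2^-1 ^+ m.
  by rewrite (le_trans (step k m))// ler_piMr ?mulr_ge0// gerBl.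
have /cvgrPdist_lt cv := @cvg_geometric R (2 * C) 2^-1 half.
have cc : cauchy (u @ \oo).
  apply: cauchy_exP => e e0; have [N _ hN] := cv e e0.
  exists (u N); exists N => // n /= Nn.
  have := hN N (leqnn N); rewrite sub0r normrN /geometric /= => hh.
  rewrite -ball_normE /ball_ /= distrC -(subnKC Nn).
  exact: (le_lt_trans (step' _ _) (le_lt_trans (ler_norm _) hh)).
have /cauchy_cvgP/cvg_ex[/= l /cvgrPdist_lt ul] := cc.
exists l => m; apply/ler_addgt0Pl => e e0.
have [N _ hN] := ul e e0.
have := hN (m + N)%N (leq_addl _ _) => hh.
rewrite -(subrKA (u (m + N)%N)) (le_trans (ler_normD _ _))// addrC lerD//.
  by rewrite distrC ltW.
by rewrite distrC.
Qed.

Lemma graph_cont (E : normedModType R) (f : R -> E) (t : R) : {for t, continuous f} ->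
  {for t, continuous (fun u => (u, f u) : R * E)}.
Proof.
move=> cf; apply/cvgrPdist_lt => e e0; near=> u.
rewrite -[X in `|X|]/(t - u, f t - f u) -[`|_|]/(Num.max `|t - u| `|f t - f u|) gt_max.
apply/andP; split; near: u.
  by have /cvgrPdist_lt/(_ _ e0) := @cvg_id _ (nbhs t).
by move/cvgrPdist_lt : cf => /(_ _ e0).
Unshelve. all: by end_near. Qed.

Context {n : nat} {h : R} (h0 : 0 < h).
Local Notation X := (history h n).

Lemma vec_mvt (y dy : R -> 'cV[R]_n) (a b K : R) : a <= b -> 0 <= K ->
  (forall t, a <= t <= b -> is_derive t (1 : R) y (dy t)) ->
  (forall t, a < t < b -> `|dy t| <= K) -> `|y b - y a| <= K * (b - a).
Proof.
move=> ab K0 yd dK; apply: cv_norm_le => [|i]; first by rewrite mulr_ge0// subr_ge0.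
rewrite !mxE; apply: (@mvt_ineq _ (fun s => y s i 0) (fun s => dy s i 0)) => //.
- move=> t /andP[t1 t2]; have td : a <= t <= b by rewrite !ltW.
  by have /is_derive_vecP/(_ i) := yd t td.
- have cc t : t \in `[a, b] -> {for t, continuous (fun s => y s i 0)}.
    rewrite in_itv /= => /yd/is_derive_vecP/(_ i) d.
    by apply: differentiable_continuous; apply/derivable1_diffP; case: d.
  by apply: continuous_in_subspaceT => t; rewrite inE => /cc.
- by move=> t /dK; apply: le_trans; exact: cv_norm_ge.
Qed.

Definition vprim (a : R) (g : R -> 'cV[R]_n) (s : R) : 'cV[R]_n :=
  \col_i \int[lebesgue_measure]_(t in `[a, s]) g t i 0.

Lemma vprim_der (a : R) (g : R -> 'cV[R]_n) (s : R) : continuous g -> a < s -> is_derive s (1 : R) (vprim a g) (g s).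
Proof.
move=> cg as_; apply/is_derive_vecP => i.
have cgi : continuous (fun t => g t i 0) by move=> t; have /vcontP := cg t; exact.
apply: (is_derive_eqfun (primitive cgi as_)) => // t.
by rewrite /vprim mxE.
Qed.

Lemma segment_dist (x y : R -> 'cV[R]_n) t (K : R) : continuous x -> continuous y ->
  (forall s, `|x s - y s| <= K) -> `|segment h x t - segment h y t| <= K.
Proof.
move=> cx cy H; apply: (hist_norm_le h0) => theta _.
by rewrite histB !segmentE.
Qed.

Variable F : R * X -> 'cV[R]_n.
Hypothesis cF : continuous F.
Variable v0 : 'cV[R]_n.
Local Notation xb := (cst_history h v0).
Hypothesis F0 : forall t, F (t, xb) = 0.
Variables (t0 r M : R).
Hypotheses (r0 : 0 < r) (M0 : 0 < M).
Hypothesis Flip : forall t (u v : X), `|t - t0| < r -> `|u - xb| < r -> `|v - xb| < r ->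
  `|F (t, u) - F (t, v)| <= M * `|u - v|.

Let tau : R := Num.min (r / 2) (2 * M)^-1.

Let tau0 : 0 < tau.
Proof. by rewrite lt_min divr_gt0// invr_gt0 mulr_gt0. Qed.

Let tauM : M * tau <= 2^-1.
Proof.
have : tau <= (2 * M)^-1 by rewrite ge_min lexx orbT.
by move=> /(ler_wpM2l (ltW M0)) /le_trans; apply; rewrite invfM mulrCA mulfV ?gt_eqF// mulr1.
Qed.

Let taur : tau < r.
Proof.
have : tau <= r / 2 by rewrite ge_min lexx.
by move=> /le_lt_trans; apply; rewrite ltr_pdivrMr// ltr_pMr// ltr1n.
Qed.

Section Picard.
Variable psi : X.
Hypothesis psir : 2 * `|psi - xb| < r.
Let d := `|psi - xb|.

Let d0 : 0 <= d. Proof. exact: normr_ge0. Qed.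

Let g (x : R -> 'cV[R]_n) (u : R) := F (u, segment h x u).
(* Curves are frozen after t0 + tau, so that suprema over the whole line are
  controlled. *)
Let cl (t : R) := Num.max t0 (Num.min t (t0 + tau)).
(* The base point t0 - 1 makes P x differentiable at t0 itself. *)
Let P (x : R -> 'cV[R]_n) := vprim (t0 - 1) (g x).
Let T (x : R -> 'cV[R]_n) (t : R) := psi (Num.min (t - t0) 0) + (P x (cl t) - P x t0).

Let g_cont x : continuous x -> continuous (g x).
Proof.
move=> cx t; apply: (@continuous_comp _ _ _ (fun u => (u, segment h x u)) F); last exact: cF.
by apply: graph_cont; exact: (segment_cont h0 cx).
Qed.

Let cl_itv t : t0 <= cl t <= t0 + tau.
Proof.
by rewrite /cl le_max lexx /= ge_max ge_min lexx orbT andbT lerDl ltW.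
Qed.

Let P_der x s : continuous x -> t0 <= s -> is_derive s (1 : R) (P x) (g x s).
Proof.
move=> cx ts; apply: vprim_der; first exact: g_cont.
by rewrite (lt_le_trans _ ts)// gtrBl.
Qed.

Let psi0_cont : continuous (fun t => psi (Num.min (t - t0) 0)).
Proof.
move=> t; apply: (@continuous_comp _ _ _ (fun t => Num.min (t - t0) 0) psi); last exact: hist_cont.
rewrite -[fun t => Num.min _ _]/((fun t => t - t0) \min (fun=> 0)).
apply: continuous_min; last exact: cst_continuous.
by apply: cvgB; [exact: cvg_id|exact: cvg_cst].
Qed.

Let cl_cont : continuous cl.
Proof.
move=> t; rewrite -[cl]/((fun=> t0) \max ((id : R -> R) \min (fun=> t0 + tau))).
apply: continuous_max; first exact: cst_continuous.
by apply: continuous_min => //; exact: cst_continuous.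
Qed.

Let T_cont x : continuous x -> continuous (T x).
Proof.
move=> cx t; apply: cvgD; first exact: psi0_cont.
apply: cvgB; last exact: cvg_cst.
apply: (@continuous_comp _ _ _ cl (P x)); first exact: cl_cont.
apply: differentiable_continuous; apply/derivable1_diffP.
have /andP[c1 c2] := cl_itv t.
by have [] := P_der cx c1.
Qed.

Let near_b (x : R -> 'cV[R]_n) := forall t, `|x t - v0| <= 2 * d.

Let cst_segment t : segment h (fun=> v0) t = xb.
Proof.
have cv : continuous (fun _ : R => v0) by move=> ?; exact: cst_continuous.
by apply: (histP h0) => theta _; rewrite segmentE// cst_historyE.
Qed.

Let segment_b x t : continuous x -> near_b x -> `|segment h x t - xb| <= 2 * d.
Proof.
move=> cx bx; rewrite -(cst_segment t); apply: segment_dist => //.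
by move=> ?; exact: cst_continuous.
Qed.

Let in_r t : t0 <= t <= t0 + tau -> `|t - t0| < r.
Proof. by move=> /andP[t1 t2]; rewrite ger0_norm ?subr_ge0// ltrBlDl (le_lt_trans t2)// ltrD2l. Qed.

Let T_b x : continuous x -> near_b x -> near_b (T x).
Proof.
move=> cx bx t; rewrite /T addrAC mulr_natl mulr2n (le_trans (ler_normD _ _))// lerD//.
  have := hist_norm (psi - xb) (Num.min (t - t0) 0).
  by rewrite histB cst_historyE.
have /andP[c1 c2] := cl_itv t.
have := @vec_mvt (P x) (g x) t0 (cl t) (M * (2 * d)) c1 _ _ _.
move=> /(_ _ _ _) H; apply: (le_trans (H _ _ _)).
- by rewrite !mulr_ge0// ltW.
- by move=> s /andP[s1 s2]; exact: P_der.
- move=> s /andP[s1 s2]; rewrite -[g x s]subr0 -(F0 s) /g.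
  have sr : `|s - t0| < r by apply: in_r; rewrite (ltW s1) (le_trans (ltW s2)).
  have bb := segment_b s cx bx.
  rewrite (le_trans (Flip sr _ _))//; first by rewrite (le_lt_trans bb).
    by rewrite subrr normr0.
  by rewrite ler_wpM2l// ltW.
- apply: (@le_trans _ _ (M * (2 * d) * tau)).
    by rewrite ler_wpM2l ?lerBlDl// !mulr_ge0// ltW.
  rewrite (_ : M * (2 * d) * tau = (M * tau) * (2 * d)); last by ring.
  rewrite (le_trans (ler_wpM2r _ tauM)) ?mulr_ge0//.
  by rewrite mulrA mulVf// mul1r.
Qed.

Let T_lip x y K : continuous x -> continuous y -> near_b x -> near_b y ->
  (forall t, `|x t - y t| <= K) -> forall t, `|T x t - T y t| <= K / 2.
Proof.
move=> cx cy bx by_ H t.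
have K0 : 0 <= K by exact: le_trans (H 0).
have /andP[c1 c2] := cl_itv t.
rewrite (_ : T x t - T y t = (P x - P y) (cl t) - (P x - P y) t0); last first.
  rewrite -[RHS]/(P x (cl t) - P y (cl t) - (P x t0 - P y t0)) /T opprD addrACA subrr add0r.
  by rewrite !opprD !opprK addrACA.
apply: (le_trans (@vec_mvt (P x - P y) (fun s => g x s - g y s) t0 (cl t) (M * K) c1 _ _ _)).
- by rewrite mulr_ge0// ltW.
- by move=> s /andP[s1 s2]; apply: is_deriveB; exact: P_der.
- move=> s /andP[s1 s2]; rewrite /g.
  have sr : `|s - t0| < r by apply: in_r; rewrite (ltW s1) (le_trans (ltW s2)).
  rewrite (le_trans (Flip sr _ _))//.
    by rewrite (le_lt_trans (segment_b s cx bx)).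
    by rewrite (le_lt_trans (segment_b s cy by_)).
  by rewrite ler_wpM2l ?(ltW M0)// segment_dist.
- apply: (@le_trans _ _ (M * K * tau)).
    by rewrite ler_wpM2l ?lerBlDl// mulr_ge0// ltW.
  by rewrite mulrAC mulrC ler_wpM2l.
Qed.

Let xs (m : nat) : R -> 'cV[R]_n := iter m T (fun t => psi (Num.min (t - t0) 0)).

Let xs_ok m : continuous (xs m) /\ near_b (xs m).
Proof.
elim: m => [|m [c b]]; last by split; [exact: T_cont|exact: T_b].
split; first exact: psi0_cont.
move=> t; have := hist_norm (psi - xb) (Num.min (t - t0) 0).
rewrite histB (cst_historyE h0) => /le_trans; apply.
by rewrite -/d mulr_natl mulr2n lerDl.
Qed.

Let xs_step m t : `|xs m.+1 t - xs m t| <= 4 * d * 2^-1 ^+ m.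
Proof.
elim: m t => [|m IH] t.
  have [_ b1] := xs_ok 1; have [_ b0] := xs_ok 0.
  rewrite expr0 mulr1 -(subrKA v0) (le_trans (ler_normD _ _))//.
  rewrite [X in _ + X]distrC (le_trans (lerD (b1 t) (b0 t)))//.
  by rewrite -mulrDl ler_wpM2r//; lra.
have [c1 b1] := xs_ok m.+1; have [c0 b0] := xs_ok m.
by rewrite exprSr mulrA; apply: T_lip.
Qed.

Let xs_lim : exists x : R -> 'cV[R]_n, forall t m, `|xs m t - x t| <= 8 * d * 2^-1 ^+ m.
Proof.
have H t i : exists l, forall m, `|xs m t i 0 - l| <= 2 * (4 * d) * 2^-1 ^+ m.
  apply: (@geometric_cauchy (fun m => xs m t i 0)) => m.
  have := cv_norm_ge (xs m.+1 t - xs m t) i; rewrite !mxE => /le_trans; apply.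
  exact: xs_step.
pose l t i := sval (cid (H t i)).
have lP t i : forall m, `|xs m t i 0 - l t i| <= 2 * (4 * d) * 2^-1 ^+ m := svalP (cid (H t i)).
exists (fun t => \col_i l t i) => t m; apply: cv_norm_le => [|i].
  by rewrite !mulr_ge0// exprn_ge0// invr_ge0.
rewrite !mxE (le_trans (lP t i m))// ler_wpM2r ?exprn_ge0 ?invr_ge0//.
by rewrite mulrA ler_wpM2r//; lra.
Qed.

(** Picard iteration: the integral operator T maps curves that stay within 2
    |psi - xb| of the equilibrium into themselves, because F vanishes at the
    equilibrium and M tau <= 1/2, and halves distances. *)
Lemma picard : exists x : R -> 'cV[R]_n,
  [/\ continuous x, segment h x t0 = psi, is_solution F t0 tau x &
      forall t, `|segment h x t - xb| <= 2 * d].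
Proof.
have [x xP] := xs_lim.
have cx : continuous x.
  move=> t; apply/cvgrPdist_lt => e e0.
  have e3 : 0 < e / 4 by rewrite divr_gt0.
  have [m hm] : exists m, 8 * d * 2^-1 ^+ m < e / 4.
    apply: contrapT => no; have : e / 4 <= 0; last by rewrite leNgt e3.
    by apply: (@geometric_small (8 * d)) => m; rewrite leNgt; apply/negP => h1; apply: no; exists m.
  have [cm _] := xs_ok m.
  have /cvgrPdist_lt/(_ _ e3) := cm t; apply: filterS => s hs.
  rewrite -(subrKA (xs m t)) (le_lt_trans (ler_normD _ _))//.
  rewrite -(subrKA (xs m s) (xs m t)).
  have h1 := xP t m; have h2 := xP s m; rewrite distrC in h1.
  have h3 := ler_normD (xs m t - xs m s) (xs m s - x s).
  have h4 := le_lt_trans h1 hm; have h5 := le_lt_trans h2 hm.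
  by move: h3 h4 h5 hs; lra.
have bx : near_b x.
  move=> t; rewrite -subr_le0; apply: (@geometric_small (8 * d)) => m.
  have [_ bm] := xs_ok m; have h1 := xP t m; have h2 := bm t.
  have := ler_normD (x t - xs m t) (xs m t - v0); rewrite subrKA.
  by move: h1 h2; rewrite [`|x t - xs m t|]distrC; lra.
have Tx t : T x t = x t.
  apply/eqP; rewrite -subr_eq0 -normr_le0; apply: (@geometric_small (8 * d)) => m.
  have [cm bm] := xs_ok m.
  have h1 := T_lip cx cm bx bm (fun t => (_ : `|x t - xs m t| <= 8 * d * 2^-1 ^+ m)).
  have {}h1 : `|T x t - T (xs m) t| <= 8 * d * 2^-1 ^+ m / 2.
    by apply: h1 => s; rewrite distrC.
  have h2 := xP t m.+1; rewrite exprS in h2.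
  rewrite -(subrKA (T (xs m) t)) (le_trans (ler_normD _ _))//.
  have -> : T (xs m) t = xs m.+1 t by [].
  by move: h1 h2; rewrite -[T (xs m) t]/(xs m.+1 t); lra.
exists x; split => //.
- apply: (histP h0) => theta ht; rewrite segmentE// clamp_id// -Tx /T.
  have -> : cl (t0 + theta) = t0.
    rewrite /cl max_l// ge_min; apply/orP; left.
    by rewrite gerDl; case/andP: ht.
  rewrite subrr addr0 [t0 + theta]addrC addrK min_l//.
  by case/andP: ht.
- split; first exact: continuous_subspaceT.
  move=> t /andP[t1 t2].
  have d1 := P_der cx (ltW t1).
  have d2 : is_derive t (1 : R) (fun s => psi 0 + (P x s - P x t0)) (g x t).
    rewrite -[g x t]add0r -[g x t]subr0.
    by apply: is_deriveD; apply: is_deriveB.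
  apply: near_eq_is_derive d2; near=> s.
  have s1 : t0 < s by near: s; exact: lt_nbhsr.
  have s2 : s < t0 + tau by near: s; exact: lt_nbhsl.
  have e1 : Num.min (s - t0) 0 = 0 by apply: min_r; rewrite subr_ge0 ltW.
  have e2 : cl s = s by rewrite /cl min_l ?(ltW s2)// max_r// ltW.
  by move: (Tx s); rewrite /T e1 e2.
- by move=> t; exact: segment_b.
Unshelve. all: by end_near. Qed.

End Picard.

(** The time of existence is independent of the initial history, and the
    solution stays as close to the equilibrium as twice the initial distance.
    Both are used uniformly in the amplitude. *)
Lemma local_existence : exists2 tau, 0 < tau & forall psi : X, 2 * `|psi - xb| < r ->
  exists x : R -> 'cV[R]_n,
  [/\ continuous x, segment h x t0 = psi, is_solution F t0 tau x &
      forall t, `|segment h x t - xb| <= 2 * `|psi - xb|].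
Proof. by exists tau => // psi hpsi; exact: picard. Qed.

End Existence.

(** * Extraction of Taylor coefficients by averaging over roots of unity *)

Section Average.
Context {R : realType}.

Lemma conjM (z w : R[i]) : conjc (z * w) = conjc z * conjc w.
Proof. by case: z => a b; case: w => c d; apply: complexP => /=; ring. Qed.

Lemma conjX (z : R[i]) m : conjc (z ^+ m) = conjc z ^+ m.
Proof. by elim: m => [|m IH]; rewrite ?expr0 ?conjc1// !exprS conjM IH. Qed.

(** The exponents of a jet of order 3 satisfy |j - k| <= 3, so the eighth
    roots of unity separate them; this one has an explicit form. *)
Definition root8 : R[i] := (Num.sqrt 2)^-1 +i* (Num.sqrt 2)^-1.

Lemma root8_sqr : root8 ^+ 2 = 'i.
Proof.
have s2 : (Num.sqrt 2 : R)^-1 * (Num.sqrt 2)^-1 = 2^-1.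
  by rewrite -invfM -expr2 sqr_sqrtr.
rewrite expr2; apply: complexP; rewrite ?cReM ?cImM /= s2 ?subrr//.
by field.
Qed.

Lemma root8_4 : root8 ^+ 4 = -1.
Proof. by rewrite (exprM root8 2 2) root8_sqr; apply: complexP; rewrite expr2 ?cReM ?cImM /=; ring. Qed.

Lemma root8_8 : root8 ^+ 8 = 1.
Proof. by rewrite (exprM root8 4 2) root8_4 sqrrN expr1n. Qed.

Lemma nc_root8 : nc root8 = 1.
Proof.
have : nc root8 ^+ 8 = 1 by rewrite -ncX root8_8 nc1.
by move/eqP; rewrite pexpr_eq1 ?nc_ge0// => /eqP.
Qed.

Lemma root8J : conjc root8 = root8 ^+ 7.
Proof.
have E : root8 * conjc root8 = 1 by rewrite mul_conj nc_root8 expr1n.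
have E2 : root8 * root8 ^+ 7 = 1 by rewrite -exprS root8_8.
have w0 : root8 != 0.
  by apply/eqP => w0; move: E; rewrite w0 mul0r => /eqP; rewrite eq_sym oner_eq0.
by apply: (mulfI w0); rewrite E E2.
Qed.

Lemma root8_mod e : root8 ^+ e = root8 ^+ (e %% 8).
Proof. by rewrite {1}(divn_eq e 8) exprD mulnC exprM root8_8 expr1n mul1r. Qed.

Lemma root8_neq1 e : (e %% 8 != 0)%N -> root8 ^+ e != 1.
Proof.
move=> he; apply/eqP => E.
have H k : (e * k %% 8 = 4)%N -> False.
  move=> ek; have := congr1 (fun z => z ^+ k) E; rewrite -exprM expr1n root8_mod ek root8_4.
  by move=> /(congr1 (fun z : R[i] => Re z)) /=; lra.
have : (e %% 8 < 8)%N by rewrite ltn_mod.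
move: he; case D : (e %% 8)%N => [|[|[|[|[|[|[|[|//]]]]]]]] // _ _.
- by apply: (H 4%N); rewrite -modnMml D.
- by apply: (H 2%N); rewrite -modnMml D.
- by apply: (H 4%N); rewrite -modnMml D.
- by apply: (H 1%N); rewrite -modnMml D.
- by apply: (H 4%N); rewrite -modnMml D.
- by apply: (H 2%N); rewrite -modnMml D.
- by apply: (H 4%N); rewrite -modnMml D.
Qed.

Lemma root8_sum e : \sum_(l < 8) root8 ^+ (e * l) = if (e %% 8 == 0)%N then 8 else 0.
Proof.
case: ifP => he.
  rewrite (eq_bigr (fun=> 1)) ?sumr_const ?card_ord// => l _.
  by rewrite exprM root8_mod (eqP he) expr0 expr1n.
have w1 : root8 ^+ e - 1 != 0 by rewrite subr_eq0 root8_neq1// he.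
apply: (mulfI w1); rewrite mulr0 (eq_bigr (fun l : 'I_8 => (root8 ^+ e) ^+ l)).
  by rewrite -subrX1 -exprM mulnC exprM root8_8 expr1n subrr.
by move=> l _; rewrite exprM.
Qed.

Definition node (r : R) (l : 'I_8) : R[i] := r%:C * root8 ^+ l.

Lemma nc_node r l : 0 <= r -> nc (node r l) = r.
Proof. by move=> r0; rewrite ncM ncX nc_root8 expr1n mulr1 nc_real ger0_norm. Qed.

(** A finite form of Cauchy's integral over the circle of radius r when g is
    sampled at [node r]: the power root8^(7 m l) is the conjugate of root8^(m
    l), hence only the monomials with j - k = m modulo 8 survive. *)
Definition avg (m : nat) (g : 'I_8 -> R[i]) : R[i] :=
  8^-1 * \sum_(l < 8) root8 ^+ (7 * m * l) * g l.

Lemma avgD m f g : avg m (fun l => f l + g l) = avg m f + avg m g.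
Proof.
by rewrite -mulrDr -big_split /=; congr (8^-1 * _); apply: eq_bigr => l _; rewrite mulrDr.
Qed.

Lemma avgZ m a f : avg m (fun l => a * f l) = a * avg m f.
Proof.
rewrite /avg.
have -> : \sum_(l < 8) root8 ^+ (7 * m * l) * (a * f l) = a * \sum_(l < 8) root8 ^+ (7 * m * l) * f l.
  by rewrite mulr_sumr; apply: eq_bigr => l _; rewrite mulrCA.
by rewrite mulrCA.
Qed.

Lemma avgB m f g : avg m (fun l => f l - g l) = avg m f - avg m g.
Proof.
rewrite -[X in _ + X]mulN1r -avgZ -avgD; congr avg; apply/funext => l.
by rewrite mulN1r.
Qed.

Lemma eq_avg m f g : f =1 g -> avg m f = avg m g.
Proof. by move=> /funext ->. Qed.

Lemma nc_avg m f (K : R) : (forall l, nc (f l) <= K) -> nc (avg m f) <= K.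
Proof.
move=> fK; rewrite ncM.
have -> : nc (8^-1 : R[i]) = 8^-1.
  by rewrite (_ : 8^-1 = (8^-1 : R)%:C) ?nc_real ?ger0_norm ?invr_ge0// fmorphV rmorph_nat.
rewrite -ler_pdivlMl ?invr_gt0// invrK (le_trans (nc_sum _))//.
rewrite mulr_natl -[X in _ *+ X](card_ord 8) -sumr_const ler_sum// => l _.
by rewrite ncM ncX nc_root8 expr1n mul1r.
Qed.

Lemma avg_mono m r j k : avg m (fun l => node r l ^+ j * conjc (node r l) ^+ k) =
  if ((7 * m + (j + 7 * k)) %% 8 == 0)%N then (r ^+ (j + k))%:C else 0.
Proof.
rewrite /avg (eq_bigr (fun l : 'I_8 => (r ^+ (j + k))%:C * root8 ^+ ((7 * m + (j + 7 * k)) * l))).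
  rewrite -mulr_sumr root8_sum; case: ifP => _; last by rewrite !mulr0.
  by rewrite mulrCA mulVf ?mulr1// pnatr_eq0.
move=> l _.
have -> : conjc (node r l) = r%:C * root8 ^+ (7 * l).
  by rewrite /node conjM conjX root8J conjc_real -exprM.
rewrite /node !exprMn -!exprM mulrACA -exprD -exprD mulrCA -exprD rmorphXn.
by have -> : ((7 * m + (j + 7 * k)) * l = 7 * m * l + (l * j + 7 * l * k))%N
  by rewrite (mulnDl (7 * m)) (mulnDl j) (mulnC j) (mulnAC 7 k).
Qed.

(** The exponents (j, k) with 1 <= j + k <= 3. The two linear ones come first,
    so that drop 2 selects those of order 2 and 3. *)
Definition exps : seq (nat * nat) :=
  [:: (1, 0); (0, 1); (0, 2); (0, 3); (1, 1); (1, 2); (2, 0); (2, 1); (3, 0)]%N.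

Definition mono (p : nat * nat) (xi : R[i]) : R[i] := xi ^+ p.1 * conjc xi ^+ p.2.

Definition jet (a : nat -> nat -> R[i]) (xi : R[i]) : R[i] :=
  \sum_(p <- exps) a p.1 p.2 * mono p xi.

Lemma avg_sum (I : Type) (s : seq I) (P : pred I) m (F : I -> 'I_8 -> R[i]) :
  avg m (fun l => \sum_(i <- s | P i) F i l) = \sum_(i <- s | P i) avg m (F i).
Proof.
elim: s => [|i s IH].
  by rewrite big_nil /avg big1 ?mulr0// => l _; rewrite big_nil mulr0.
rewrite big_cons; case: ifP => Pi.
  by rewrite -IH -avgD; apply: eq_avg => l; rewrite big_cons Pi.
by rewrite -IH; apply: eq_avg => l; rewrite big_cons Pi.
Qed.

Lemma avg_jet m r a : avg m (fun l => jet a (node r l)) =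
  \sum_(p <- exps) a p.1 p.2 *
    (if ((7 * m + (p.1 + 7 * p.2)) %% 8 == 0)%N then (r ^+ (p.1 + p.2))%:C else 0).
Proof. by rewrite avg_sum; apply: eq_bigr => p _; rewrite avgZ avg_mono. Qed.

Lemma avg_jet0 r a : avg 0 (fun l => jet a (node r l)) = (r ^+ 2)%:C * a 1%N 1%N.
Proof. by rewrite avg_jet !big_cons big_nil /= ?(mulr0, add0r, addr0) mulrC. Qed.

Lemma avg_jet1 r a :
  avg 1 (fun l => jet a (node r l)) = r%:C * a 1%N 0%N + (r ^+ 3)%:C * a 2%N 1%N.
Proof.
rewrite avg_jet !big_cons big_nil /= ?(mulr0, add0r, addr0).
by rewrite [a 1%N 0%N * _]mulrC [a 2%N 1%N * _]mulrC.
Qed.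

Lemma avg_jet2 r a : avg 2 (fun l => jet a (node r l)) = (r ^+ 2)%:C * a 2%N 0%N.
Proof. by rewrite avg_jet !big_cons big_nil /= ?(mulr0, add0r, addr0) mulrC. Qed.

Lemma avg_jet3 r a : avg 3 (fun l => jet a (node r l)) = (r ^+ 3)%:C * a 3%N 0%N.
Proof. by rewrite avg_jet !big_cons big_nil /= ?(mulr0, add0r, addr0) mulrC. Qed.

End Average.

Section AverageHistories.
Context {R : realType} {n : nat} {h : R} (h0 : 0 < h).
Local Notation X := (history h n).
Local Notation CX := (chistory h n).

Definition avgX (m : nat) (u : 'I_8 -> CX) : CX :=
  \sum_(l < 8) hscale (8^-1 * root8 ^+ (7 * m * l)) (u l).

Lemma cev_avgX m u theta i : cev (avgX m u) theta i = avg m (fun l => cev (u l) theta i).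
Proof.
rewrite cev_sum /avg mulr_sumr; apply: eq_bigr => l _.
by rewrite cev_hscale mulrA.
Qed.

Lemma hscale_cont z : continuous (hscale z : CX -> CX).
Proof.
move=> u; apply/cvgrPdist_lt => e e0.
have K0 : 0 < 2 * nc z + 1 by rewrite ltr_wpDl// mulr_ge0// nc_ge0.
near=> v.
have -> : hscale z u - hscale z v = hscale z (u - v).
  by apply: (chistP h0) => theta i _; rewrite cevB !cev_hscale cevB mulrBr.
rewrite (le_lt_trans (cnorm_hscale _ _))//.
have uv : `|u - v| < e / (2 * nc z + 1).
  near: v; have /cvgrPdist_lt := @cvg_id _ (nbhs u); apply.
  by rewrite divr_gt0.
move: uv; rewrite ltr_pdivlMr// mulrC; apply: le_lt_trans.
by rewrite ler_wpM2r// lerDl.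
Unshelve. all: by end_near. Qed.

Lemma avgX_cont m (u : R -> 'I_8 -> CX) : (forall l, continuous (fun t => u t l)) ->
  continuous (fun t => avgX m (u t)).
Proof.
move=> cu; rewrite /avgX; elim: (index_enum _) => [|l s IH].
  rewrite (_ : (fun t => _) = fun=> 0); first by move=> t; exact: cst_continuous.
  by apply/funext => t; rewrite big_nil.
rewrite (_ : (fun t => _) = (fun t => hscale (8^-1 * root8 ^+ (7 * m * l)) (u t l) +
  \sum_(j <- s) hscale (8^-1 * root8 ^+ (7 * m * j)) (u t j))); last first.
  by apply/funext => t; rewrite big_cons.
move=> t; apply: cvgD; last exact: IH.
apply: (@continuous_comp _ _ _ (fun t => u t l) (hscale _)); first exact: cu.
exact: hscale_cont.
Qed.

Lemma cont_of_approx (Z : R -> CX) :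
  (forall e : R, 0 < e -> exists g : R -> CX, continuous g /\ forall t, `|Z t - g t| <= e) ->
  continuous Z.
Proof.
have aux (e a b c x y : R) : 0 < e -> a <= e / 4 -> b <= e / 4 -> x <= a + y -> y <= c + b ->
  c < e / 4 -> x < e by lra.
move=> H t; apply/cvgrPdist_lt => e e0.
have e4 : 0 < e / 4 by rewrite divr_gt0.
have [g [cg Zg]] := H _ e4.
have /cvgrPdist_lt/(_ _ e4) := cg t; apply: filterS => s hs.
have h1 := Zg t; have h2 := Zg s; rewrite distrC in h2.
have h3 := ler_normD (Z t - g t) (g t - Z s); rewrite subrKA in h3.
have h4 := ler_normD (g t - g s) (g s - Z s); rewrite subrKA in h4.
exact: (aux _ _ _ _ _ _ e0 h1 h2 h3 h4 hs).
Qed.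

End AverageHistories.

(** * The amplitude equation *)

Section Amplitude.
Context {R : realType}.
Implicit Types (z c : R[i]).

Lemma nc_lip z w : `|nc z - nc w| <= nc (z - w).
Proof.
have h1 := ncD (z - w) w; have h2 := ncD (w - z) z.
rewrite !subrK in h1 h2; rewrite [nc (w - z)]nc_distC in h2.
by rewrite ler_norml; apply/andP; split; lra.
Qed.

Lemma cRe_mulr z (s : R) : Re (z * s%:C) = Re z * s.
Proof. by case: z => a b /=; rewrite mulr0 subr0. Qed.

Lemma cIm_mulr z (s : R) : Im (z * s%:C) = Im z * s.
Proof. by case: z => a b /=; rewrite mulr0 add0r. Qed.

(** Since |z|' = O(|z|^3), the modulus of z stays of the order of |zeta| by a
    bootstrap argument, and then z stays O(|zeta|^3)-close to zeta. So z'
    differs from the constant c zeta |zeta|^2 by O(|zeta|^4) only. *)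
Lemma amplitude c (Kr t0 : R) : 0 <= Kr -> exists e0 r1 K : R, [/\ 0 < e0, 0 < r1, 0 <= K &
  forall zeta t (z dz : R -> R[i]), nc zeta < r1 -> t0 <= t <= t0 + 4^-1 ->
  {within `[t0, t], continuous (fun s => Re (z s))} ->
  {within `[t0, t], continuous (fun s => Im (z s))} ->
  (forall s, t0 < s < t -> Cder z s (dz s)) ->
  (forall s, t0 < s < t -> nc (dz s - c * z s * (nc (z s) ^+ 2)%:C) <= Kr * nc (z s) ^+ 4) ->
  (forall s, t0 <= s <= t -> nc (z s) < e0) ->
  z t0 = zeta + c * t0%:C * zeta * (nc zeta ^+ 2)%:C ->
  nc (z t - (zeta + c * t%:C * zeta * (nc zeta ^+ 2)%:C)) <= K * nc zeta ^+ 4].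
Proof.
move=> Kr0.
(* K1 bounds |z'| / |z|^3 where |z| <= 1, and C0 |zeta|^3 bounds the distance
  of z t0 from zeta. *)
pose K1 := nc c + Kr + 1.
have K1p : 0 < K1 by rewrite ltr_wpDl// addr_ge0// nc_ge0.
pose C0 := nc c * `|t0| + 1.
have C0p : 0 < C0 by rewrite ltr_wpDl// mulr_ge0// nc_ge0.
pose K2 := 32 * K1 + C0.
have K2p : 0 < K2 by rewrite addr_gt0// mulr_gt0.
pose K := (21 * nc c * K2 + 256 * Kr).
have K0 : 0 <= K.
  by apply: addr_ge0; apply: mulr_ge0; rewrite ?ler0n ?(ltW K2p) ?mulr_ge0 ?ler0n ?nc_ge0.
exists (Num.min 1 K1^-1), (Num.min 1 C0^-1), K; split => //.
- by rewrite lt_min ltr01 invr_gt0.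
- by rewrite lt_min ltr01 invr_gt0.
move=> zeta t z dz; rewrite lt_min => /andP[a1 aC] /andP[t0t tt] c1 c2 zd dzE ze zt0.
set a := nc zeta in a1 aC *; have a0 : 0 <= a by exact: nc_ge0.
have C0a : C0 * a ^+ 2 <= 1.
  have : C0 * a <= 1 by rewrite mulrC -ler_pdivlMr// mul1r ltW.
  by move=> h1; rewrite expr2 mulrA mulr_ile1// ?mulr_ge0// ltW.
have zt0a : nc (z t0 - zeta) <= C0 * a ^+ 3.
  have -> : z t0 - zeta = c * t0%:C * zeta * (a ^+ 2)%:C by rewrite zt0 addrAC subrr add0r.
  rewrite !ncM !nc_real -/a [`|a ^+ 2|]ger0_norm ?exprn_ge0//.
  have -> : nc c * `|t0| * a * a ^+ 2 = (nc c * `|t0|) * a ^+ 3 by ring.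
  by rewrite /C0 ler_wpM2r ?exprn_ge0// lerDl.
have zt0b : nc (z t0) <= 2 * a.
  have : C0 * a ^+ 3 <= a by rewrite exprSr mulrA ler_piMl.
  have := ncD (z t0 - zeta) zeta; rewrite subrK -/a; move: zt0a; lra.
have ze1 s : t0 <= s <= t -> nc (z s) <= 1.
  by move=> /ze; rewrite lt_min => /andP[/ltW].
have dz3 s : t0 < s < t -> nc (dz s) <= K1 * nc (z s) ^+ 3.
  move=> hs; have hs' : t0 <= s <= t by case/andP: hs => /ltW -> /ltW ->.
  have := ncD (dz s - c * z s * (nc (z s) ^+ 2)%:C) (c * z s * (nc (z s) ^+ 2)%:C).
  rewrite subrK !ncM nc_real ger0_norm ?exprn_ge0 ?nc_ge0//.
  move=> /le_trans; apply; rewrite /K1 !mulrDl mul1r.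
  have z3 : 0 <= nc (z s) ^+ 3 by rewrite exprn_ge0// nc_ge0.
  have h1 : Kr * nc (z s) ^+ 4 <= Kr * nc (z s) ^+ 3.
    by rewrite ler_wpM2l// exprS ler_piMl// ze1.
  have -> : nc c * nc (z s) * nc (z s) ^+ 2 = nc c * nc (z s) ^+ 3 by ring.
  have h2 := dzE s hs; move: h1 h2 z3; set A := nc _ ^+ 3; set B := nc c * A; set D := Kr * A; lra.
have dz1 s : t0 < s < t -> nc (dz s) <= nc (z s).
  move=> hs; have hs' : t0 <= s <= t by case/andP: hs => /ltW -> /ltW ->.
  apply: (le_trans (dz3 s hs)); rewrite exprS mulrCA ler_piMr ?nc_ge0//.
  have : K1 * nc (z s) <= 1.
    rewrite mulrC -ler_pdivlMr// mul1r; move: (ze s hs'); rewrite lt_min => /andP[_ /ltW//].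
  by move=> h1; rewrite expr2 mulrA mulr_ile1 ?mulr_ge0 ?nc_ge0 ?ze1// ltW.
have cnc : {within `[t0, t], continuous (fun s => nc (z s))}.
  move=> s; apply/cvgrPdist_lt => e e0.
  have e2 : 0 < e / 2 by rewrite divr_gt0.
  have /cvgrPdist_lt/(_ _ e2) h1 := c1 s; have /cvgrPdist_lt/(_ _ e2) h2 := c2 s.
  apply: filterS2 h1 h2 => u h1 h2.
  rewrite (le_lt_trans (nc_lip _ _))// (le_lt_trans (nc_le _))// !RIE (splitr e).
  by rewrite ltrD.
have sub s u : t0 <= s <= t -> u <= s -> t0 <= u -> `[u, s] `<=` `[t0, t].
  move=> /andP[_ st] us tu v; rewrite /= !in_itv /= => /andP[v1 v2].
  by rewrite (le_trans tu)//= (le_trans v2).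
have mvt s K' : t0 <= s <= t -> (forall u, t0 < u < s -> nc (dz u) <= K') ->
    nc (z s - z t0) <= 2 * K' * (s - t0).
  move=> hs; have /andP[hs1 hs2] := hs; apply: Cmvt_ineq => //.
  - by move=> u /andP[u1 u2]; apply: zd; rewrite u1 (lt_le_trans u2).
  - exact: (continuous_subspaceW (sub s t0 hs hs1 (lexx _)) c1).
  - exact: (continuous_subspaceW (sub s t0 hs hs1 (lexx _)) c2).
(* Bootstrap: over a time of length at most 1/4 the maximum of |z| exceeds |z
  t0| by at most half of itself. *)
have z4 s : t0 <= s <= t -> nc (z s) <= 4 * a.
  have [m mt zm] := EVT_max t0t cnc.
  have mt' : t0 <= m <= t by move: mt; rewrite in_itv.
  have K'0 : 0 <= nc (z m) by exact: nc_ge0.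
  have h1 : nc (z m - z t0) <= 2 * nc (z m) * (m - t0).
    apply: mvt => // u /andP[u1 u2]; have [m1 m2] := andP mt'.
    apply: (le_trans (dz1 u _)); first by rewrite u1 (lt_le_trans u2).
    by apply: zm; rewrite in_itv /= (ltW u1) (le_trans (ltW u2)).
  have h2 : 2 * nc (z m) * (m - t0) <= 2 * nc (z m) * 4^-1.
    by rewrite ler_wpM2l ?mulr_ge0// lerBlDl (le_trans _ tt)//; case/andP: mt'.
  have h3 := ncD (z m - z t0) (z t0); rewrite subrK in h3.
  move=> hs; have h4 : nc (z s) <= nc (z m) by apply: zm; rewrite in_itv.
  by move: h1 h2 h3 h4 zt0b; lra.
have zz s : t0 <= s <= t -> nc (z s - zeta) <= K2 * a ^+ 3.
  move=> hs; have /andP[hs1 hs2] := hs.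
  have h1 : nc (z s - z t0) <= 2 * (K1 * (4 * a) ^+ 3) * (s - t0).
    apply: mvt => // u /andP[u1 u2].
    apply: (le_trans (dz3 u _)); first by rewrite u1 (lt_le_trans u2).
    rewrite ler_wpM2l ?(ltW K1p)// lerXn2r// ?nnegrE ?nc_ge0 ?mulr_ge0//.
    by apply: z4; rewrite (ltW u1) (le_trans (ltW u2)).
  have a3 : 0 <= a ^+ 3 by rewrite exprn_ge0.
  have h2 : 2 * (K1 * (4 * a) ^+ 3) * (s - t0) <= 2 * (K1 * (4 * a) ^+ 3) * 4^-1.
    by rewrite ler_wpM2l ?mulr_ge0 ?exprn_ge0 ?mulr_ge0 ?(ltW K1p)// lerBlDl (le_trans hs2).
  have h3 := ncD (z s - z t0) (z t0 - zeta); rewrite subrKA in h3.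
  rewrite exprMn in h1 h2; rewrite /K2 mulrDl.
  have E : 2 * (K1 * (4 ^+ 3 * a ^+ 3)) * 4^-1 = 32 * K1 * a ^+ 3 by field.
  by move: h1 h2 h3 zt0a; rewrite E; lra.
(* The derivative of g is c (z |z|^2 - zeta |zeta|^2) + O(|zeta|^4). *)
pose g s := z s - c * zeta * (nc zeta ^+ 2)%:C * s%:C.
have gE : z t - (zeta + c * t%:C * zeta * (nc zeta ^+ 2)%:C) = g t - g t0.
  by rewrite /g zt0; ring.
rewrite gE -/a.
have a4 : 0 <= a ^+ 4 by rewrite exprn_ge0.
have Kt : K * a ^+ 4 * (2 * (t - t0)) <= K * a ^+ 4.
  by rewrite ler_piMr ?mulr_ge0//; move: tt; lra.
apply: le_trans Kt; rewrite mulrCA mulrA.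
have cre (f : R -> R) k : {within `[t0, t], continuous f} ->
    {within `[t0, t], continuous (fun s => f s - k * s)}.
  move=> cf; move=> s; apply: (@continuousB _ _ _ (f : subspace _ -> R^o) (fun u => k * u : R^o)).
    exact: cf.
  apply: continuous_subspaceT => u; exact: mulrl_continuous.
apply: (@Cmvt_ineq _ g (fun s => dz s - c * zeta * (nc zeta ^+ 2)%:C * 1)) => //.
- by move=> s hs; apply: CderB; [exact: zd|apply: CderZ; exact: Cder_id].
- rewrite (_ : (fun s => _) = fun s => Re (z s) - Re (c * zeta * (nc zeta ^+ 2)%:C) * s).
    exact: cre.
  by apply/funext => s; rewrite /g cReD cReN cRe_mulr.
- rewrite (_ : (fun s => _) = fun s => Im (z s) - Im (c * zeta * (nc zeta ^+ 2)%:C) * s).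
    exact: cre.
  by apply/funext => s; rewrite /g cImD cImN cIm_mulr.
move=> s hs; have hs' : t0 <= s <= t by case/andP: hs => /ltW -> /ltW ->.
rewrite mulr1.
have -> : dz s - c * zeta * (nc zeta ^+ 2)%:C =
  (dz s - c * z s * (nc (z s) ^+ 2)%:C) +
  c * ((z s - zeta) * (nc zeta ^+ 2)%:C +
       z s * (((nc (z s) - nc zeta) * (nc (z s) + nc zeta))%:C)).
  rewrite -subr_sqr rmorphB /= ; ring.
have -> : K * a ^+ 4 = 256 * Kr * a ^+ 4 + 21 * nc c * K2 * a ^+ 4.
  by rewrite /K mulrDl addrC.
apply: (le_trans (ncD _ _)); apply: lerD.
  rewrite (le_trans (dzE s hs))// (_ : 256 * Kr * a ^+ 4 = Kr * (4 * a) ^+ 4); last by ring.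
  by rewrite ler_wpM2l// lerXn2r// ?nnegrE ?nc_ge0 ?mulr_ge0// z4.
rewrite ncM (_ : 21 * nc c * K2 * a ^+ 4 = nc c * (21 * (K2 * a ^+ 4))); last by ring.
rewrite ler_wpM2l ?nc_ge0// (le_trans (ncD _ _))// !ncM !nc_real -/a.
have Z0 := zz s hs'; have Z1 := nc_lip (z s) zeta; have Z2 := z4 s hs'; rewrite -/a in Z1.
rewrite [`|a ^+ 2|]ger0_norm ?exprn_ge0// (normrM (nc (z s) - a)).
rewrite [`|nc (z s) + a|]ger0_norm ?addr_ge0 ?nc_ge0//.
have K2a : 0 <= K2 * a ^+ 3 by rewrite mulr_ge0 ?exprn_ge0 ?(ltW K2p).
have b1 : nc (z s - zeta) * a ^+ 2 <= K2 * a ^+ 3 * a ^+ 2.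
  by rewrite ler_wpM2r ?exprn_ge0.
have b2 : nc (z s) * (`|nc (z s) - a| * (nc (z s) + a)) <= 4 * a * (K2 * a ^+ 3 * (5 * a)).
  rewrite ler_pM ?nc_ge0 ?mulr_ge0 ?addr_ge0 ?nc_ge0//.
  rewrite ler_pM ?addr_ge0 ?nc_ge0//; first exact: (le_trans Z1).
  by move: Z2; lra.
have E : K2 * a ^+ 3 * a ^+ 2 + 4 * a * (K2 * a ^+ 3 * (5 * a)) = 21 * (K2 * a ^+ 4) * a by ring.
apply: (le_trans (lerD b1 b2)); rewrite E ler_piMr ?(ltW a1)//.
by rewrite !mulr_ge0// ltW.
Qed.

End Amplitude.

(** * Calculus of jets *)

Section Mono.
Context {R : realType}.
Implicit Types (z w : R[i]).

Lemma conjD z w : conjc (z + w) = conjc z + conjc w.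
Proof. by case: z => a b; case: w => c d; apply: complexP => /=; ring. Qed.

Lemma conjN z : conjc (- z) = - conjc z.
Proof. by case: z => a b; apply: complexP. Qed.

Lemma nc_mono p z : nc (mono p z) = nc z ^+ (p.1 + p.2).
Proof. by rewrite /mono ncM !ncX ncJ exprD. Qed.

Lemma pow_diff z w (A : R) m : nc z <= A -> nc w <= A ->
  nc (z ^+ m - w ^+ m) * A <= m%:R * A ^+ m * nc (z - w).
Proof.
move=> zA wA; have A0 : 0 <= A := le_trans (nc_ge0 _) zA.
elim: m => [|m IH]; first by rewrite !expr0 subrr nc0 !mul0r.
have -> : z ^+ m.+1 - w ^+ m.+1 = z * (z ^+ m - w ^+ m) + (z - w) * w ^+ m.
  by rewrite !exprS; ring.
apply: (le_trans (ler_wpM2r A0 (ncD _ _))); rewrite !ncM ncX mulrDl.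
have h1 : nc z * nc (z ^+ m - w ^+ m) * A <= A * (m%:R * A ^+ m * nc (z - w)).
  by rewrite -mulrA ler_pM ?nc_ge0 ?mulr_ge0 ?nc_ge0.
have h2 : nc (z - w) * nc w ^+ m * A <= nc (z - w) * A ^+ m * A.
  by rewrite ler_wpM2r// ler_wpM2l ?nc_ge0// lerXn2r// nnegrE ?nc_ge0.
apply: (le_trans (lerD h1 h2)); rewrite -[m.+1]addn1 natrD exprD expr1.
by rewrite le_eqVlt; apply/orP; left; apply/eqP; ring.
Qed.

Lemma mono_diff p z w (A : R) : nc z <= A -> nc w <= A ->
  nc (mono p z - mono p w) <= (p.1 + p.2)%:R * A ^+ (p.1 + p.2).-1 * nc (z - w).
Proof.
move=> zA wA; have A0 : 0 <= A := le_trans (nc_ge0 _) zA.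
have [AE|An] := eqVneq A 0.
  have z0 : z = 0 by apply: nc_eq0; apply/eqP; rewrite eq_le nc_ge0 -AE zA.
  have w0 : w = 0 by apply: nc_eq0; apply/eqP; rewrite eq_le nc_ge0 -AE wA.
  by rewrite z0 w0 !subrr nc0 mulr0.
have Ap : 0 < A by rewrite lt_neqAle eq_sym An.
rewrite -(ler_pM2r Ap).
case: p => j k; rewrite /mono /=.
have -> : z ^+ j * conjc z ^+ k - w ^+ j * conjc w ^+ k =
  z ^+ j * (conjc z ^+ k - conjc w ^+ k) + (z ^+ j - w ^+ j) * conjc w ^+ k by ring.
have [jk|jk] := eqVneq (j + k)%N 0%N.
  move: jk => /eqP; rewrite addn_eq0 => /andP[/eqP -> /eqP ->].
  by rewrite !expr0 !subrr mulr0 mul0r addr0 nc0 !mul0r.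
have E : A ^+ (j + k).-1 * A = A ^+ (j + k) by rewrite -exprSr prednK// lt0n.
have -> : (j + k)%:R * A ^+ (j + k).-1 * nc (z - w) * A = (j + k)%:R * A ^+ (j + k) * nc (z - w).
  by rewrite -E; ring.
apply: (le_trans (ler_wpM2r A0 (ncD _ _))); rewrite mulrDl !ncM !ncX ncJ.
have zc : nc (conjc z) <= A by rewrite ncJ.
have wc : nc (conjc w) <= A by rewrite ncJ.
have h1 := pow_diff k zc wc; have h2 := pow_diff j zA wA.
have {}h1 : nc z ^+ j * nc (conjc z ^+ k - conjc w ^+ k) * A <= A ^+ j * (k%:R * A ^+ k * nc (z - w)).
  rewrite -mulrA ler_pM ?exprn_ge0 ?nc_ge0 ?mulr_ge0 ?nc_ge0//.
    by rewrite lerXn2r// nnegrE ?nc_ge0.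
  by rewrite (le_trans h1)// -conjN -conjD ncJ.
have {}h2 : nc (z ^+ j - w ^+ j) * nc w ^+ k * A <= j%:R * A ^+ j * nc (z - w) * A ^+ k.
  rewrite mulrAC ler_pM ?mulr_ge0 ?exprn_ge0 ?nc_ge0//.
  by rewrite lerXn2r// nnegrE ?nc_ge0.
apply: (le_trans (lerD h1 h2)); rewrite natrD exprD.
by rewrite le_eqVlt; apply/orP; left; apply/eqP; ring.
Qed.

End Mono.

Section Jets.
Context {R : realType} {n : nat} {h : R} (h0 : 0 < h).
Local Notation X := (history h n).
Local Notation CX := (chistory h n).
Implicit Types (Y eta : nat -> nat -> CX) (zeta xi : R[i]).

Definition jetX Y xi : CX := \sum_(p <- exps) hscale (mono p xi) (Y p.1 p.2).

Lemma cev_jetX Y xi theta i :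
  cev (jetX Y xi) theta i = jet (fun j k => cev (Y j k) theta i) xi.
Proof. by rewrite cev_sum; apply: eq_bigr => p _; rewrite cev_hscale mulrC. Qed.

Lemma lC_jetX (l : X -> R) (ll : forall a (u v : X), l (a *: u + v) = a * l u + l v) Y xi :
  lC l (jetX Y xi) = jet (fun j k => lC l (Y j k)) xi.
Proof. by rewrite (lC_sum ll); apply: eq_bigr => p _; rewrite lCZ// mulrC. Qed.

Lemma cnorm_sum (I : eqType) (s : seq I) (F : I -> CX) (K : R) :
  (forall i, i \in s -> `|F i| <= K) -> `|\sum_(i <- s) F i| <= (size s)%:R * K.
Proof.
move=> FK; rewrite (le_trans (ler_norm_sum _ _ _))//.
rewrite mulr_natl -sum1_size -sumrMnr big_seq [leRHS]big_seq ler_sum// => i /FK.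
Qed.

(** The coefficients of the polynomial of order 3 in zeta obtained from the
    jet eta by the substitution xi = E (zeta + s zeta |zeta|^2), where |E| =
    1. *)
Definition shift_jet (E s : R[i]) eta (j k : nat) : CX :=
  hscale (mono (j, k) E) (eta j k) +
  match j, k with
  | 2, 1 => hscale (s * E) (eta 1%N 0%N)
  | 1, 2 => hscale (conjc (s * E)) (eta 0%N 1%N)
  | _, _ => 0
  end.

(** Up to O(|zeta|^4) the cubic correction of xi only acts on the linear terms
    of the jet. *)
Lemma substitution (K Kc Ke : R) : 0 <= K -> 0 <= Kc -> 0 <= Ke ->
  exists2 K', 0 <= K' & forall (E s : R[i]) eta zeta xi,
    nc E = 1 -> nc s <= Kc -> (forall p, p \in exps -> `|eta p.1 p.2| <= Ke) ->
    nc zeta <= 1 -> nc (xi - E * (zeta + s * zeta * (nc zeta ^+ 2)%:C)) <= K * nc zeta ^+ 4 ->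
    `|jetX eta xi - jetX (shift_jet E s eta) zeta| <= K' * nc zeta ^+ 4.
Proof.
move=> K0 Kc0 Ke0.
pose A := 1 + K + Kc; have A1 : 1 <= A by rewrite /A -addrA lerDl addr_ge0.
have A0 : 0 <= A := le_trans ler01 A1.
exists (4 * K * Ke + 7 * (2 * (3 * A ^+ 2 * (K + Kc)) * Ke)).
  by rewrite !(addr_ge0, mulr_ge0, exprn_ge0).
move=> E s eta zeta xi E1 sK eK z1; set D := xi - _ => DK.
set a := nc zeta in z1 DK *; have a0 : 0 <= a by exact: nc_ge0.
have -> : jetX eta xi - jetX (shift_jet E s eta) zeta =
    hscale D (eta 1%N 0%N) + hscale (conjc D) (eta 0%N 1%N) +
    \sum_(p <- drop 2 exps) hscale (mono p xi - mono p (E * zeta)) (eta p.1 p.2).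
  apply: (chistP h0) => theta i _.
  rewrite cevB /jetX !big_cons !big_nil !(cevD, cev_hscale, cev0) /shift_jet.
  have -> : D = xi - E * (zeta + s * zeta * (zeta * conjc zeta)) by rewrite mul_conj.
  rewrite /mono /= !(conjD, conjN, conjM) conjcK; ring.
have a41 : a ^+ 4 <= a ^+ 3 by rewrite exprS ler_piMl ?exprn_ge0.
have a3 : 0 <= a ^+ 3 by rewrite exprn_ge0.
have xE : nc (xi - E * zeta) <= (K + Kc) * a ^+ 3.
  have -> : xi - E * zeta = D + E * (s * zeta * (a ^+ 2)%:C) by rewrite /D -/a; ring.
  rewrite (le_trans (ncD _ _))// mulrDl lerD//.
    by rewrite (le_trans DK)// ler_wpM2l.
  rewrite !ncM E1 mul1r nc_real ger0_norm ?exprn_ge0// -mulrA -exprS.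
  by rewrite ler_wpM2r.
have xA : nc xi <= A * a.
  have := ncD (xi - E * zeta) (E * zeta); rewrite subrK ncM E1 mul1r -/a.
  have a31 : a ^+ 3 <= a by rewrite exprSr ler_piMl ?exprn_ile1.
  have : (K + Kc) * a ^+ 3 <= (K + Kc) * a by rewrite ler_wpM2l// addr_ge0.
  by move: xE; rewrite /A; lra.
have zA : nc (E * zeta) <= A * a by rewrite ncM E1 mul1r ler_peMl.
have m10 : (1, 0)%N \in exps by [].
have m01 : (0, 1)%N \in exps by [].
have e10 : `|eta 1%N 0%N| <= Ke := eK _ m10.
have e01 : `|eta 0%N 1%N| <= Ke := eK _ m01.
rewrite mulrDl (le_trans (ler_normD _ _))// lerD//.
  rewrite (le_trans (ler_normD _ _))//.
  have h1 : `|hscale D (eta 1%N 0%N)| <= 2 * (K * a ^+ 4) * Ke.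
    by rewrite (le_trans (cnorm_hscale _ _))// ler_pM ?mulr_ge0 ?nc_ge0// ler_wpM2l.
  have h2 : `|hscale (conjc D) (eta 0%N 1%N)| <= 2 * (K * a ^+ 4) * Ke.
    by rewrite (le_trans (cnorm_hscale _ _))// ncJ ler_pM ?mulr_ge0 ?nc_ge0// ler_wpM2l.
  by apply: (le_trans (lerD h1 h2)); rewrite le_eqVlt; apply/orP; left; apply/eqP; ring.
apply: (le_trans (@cnorm_sum _ _ _ (2 * (3 * A ^+ 2 * (K + Kc)) * Ke * a ^+ 4) _)); last first.
  by rewrite le_eqVlt; apply/orP; left; apply/eqP; rewrite /=; ring.
move=> p hp.
have pe : p \in exps by rewrite -(cat_take_drop 2 exps) mem_cat hp orbT.
have pn : (p.1 + p.2 = 2 \/ p.1 + p.2 = 3)%N.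
  by move: hp; rewrite !inE; do ?[case/orP]; do 7?[move=> /eqP ->]; by [left|right].
rewrite (le_trans (cnorm_hscale _ _))// -mulrA [leRHS](_ : _ = 2 * (3 * A ^+ 2 * (K + Kc) * a ^+ 4) * Ke); last by ring.
rewrite mulrA ler_pM ?mulr_ge0 ?nc_ge0// ?eK// ler_wpM2l//.
apply: (le_trans (mono_diff p xA zA)).
have T : (p.1 + p.2)%:R * (A * a) ^+ (p.1 + p.2).-1 <= 3 * A ^+ 2 * a.
  case: pn => -> /=.
    rewrite expr1 -!mulrA ler_pM ?mulr_ge0//; first by rewrite ler_nat.
    by rewrite ler_peMl ?mulr_ge0.
  rewrite exprMn -!mulrA ler_wpM2l// ler_wpM2l ?exprn_ge0// expr2.
  by rewrite ?ler_wpM2l// ler_piMl.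
apply: (le_trans (ler_pM _ (nc_ge0 _) T xE)); first by rewrite mulr_ge0 ?exprn_ge0 ?mulr_ge0.
by rewrite le_eqVlt; apply/orP; left; apply/eqP; ring.
Qed.

(** The coefficients, up to order 3, of the composition of l u + b u u / 2 + c
    u u u / 6 with the jet Y. *)
Definition taylor_jet (l : X -> R) (b : X -> X -> R) (c : X -> X -> X -> R) Y (j k : nat) : R[i] :=
  let b' := bC b in let c' := tC c in
  lC l (Y j k) +
  match j, k with
  | 2, 0 => b' (Y 1%N 0%N) (Y 1%N 0%N) / 2
  | 1, 1 => b' (Y 1%N 0%N) (Y 0%N 1%N)
  | 0, 2 => b' (Y 0%N 1%N) (Y 0%N 1%N) / 2
  | 3, 0 => b' (Y 1%N 0%N) (Y 2%N 0%N) + c' (Y 1%N 0%N) (Y 1%N 0%N) (Y 1%N 0%N) / 6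
  | 2, 1 => b' (Y 1%N 0%N) (Y 1%N 1%N) + b' (Y 0%N 1%N) (Y 2%N 0%N) + c' (Y 1%N 0%N) (Y 1%N 0%N) (Y 0%N 1%N) / 2
  | 1, 2 => b' (Y 0%N 1%N) (Y 1%N 1%N) + b' (Y 1%N 0%N) (Y 0%N 2%N) + c' (Y 1%N 0%N) (Y 0%N 1%N) (Y 0%N 1%N) / 2
  | 0, 3 => b' (Y 0%N 1%N) (Y 0%N 2%N) + c' (Y 0%N 1%N) (Y 0%N 1%N) (Y 0%N 1%N) / 6
  | _, _ => 0
  end.

(** The bound is uniform in the forms, which will depend on time. *)
Lemma composition (M K Ky : R) : 0 <= M -> 0 <= K -> 0 <= Ky ->
  exists2 K', 0 <= K' & forall (l : X -> R) (b : X -> X -> R) (c : X -> X -> X -> R),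
    (forall a (u v : X), l (a *: u + v) = a * l u + l v) ->
    (forall a (u v w : X), b (a *: u + v) w = a * b u w + b v w) ->
    (forall u v, b u v = b v u) ->
    (forall a (u v w x : X), c (a *: u + v) w x = a * c u w x + c v w x) ->
    (forall u v w, c u v w = c v u w) -> (forall u v w, c u v w = c u w v) ->
    (forall u, `|l u| <= M * `|u|) -> (forall u v, `|b u v| <= M * (`|u| * `|v|)) ->
    (forall u v w, `|c u v w| <= M * (`|u| * (`|v| * `|w|))) ->
    forall Y zeta (u : X), (forall p, p \in exps -> `|Y p.1 p.2| <= Ky) -> nc zeta <= 1 ->
    `|of_real u - jetX Y zeta| <= K * nc zeta ^+ 4 ->
    nc ((l u + b u u / 2 + c u u u / 6)%:C - jet (taylor_jet l b c Y) zeta) <= K' * nc zeta ^+ 4.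
Proof.
move=> M0 K0 Ky0.
have q4 : 2 * Ky + 2 * Ky <= 4 * Ky by lra.
have q6 : (2 + 2 + 2) * Ky <= 6 * Ky by lra.
have q8 : (2 + 2 + (2 + 2)) * Ky <= 8 * Ky by lra.
have q14 : 6 * Ky + (8 * Ky + K) <= 14 * Ky + K by lra.
have q18 : 4 * Ky + (14 * Ky + K) <= 18 * Ky + K by lra.
have q1 : 2 * Ky + 2 * Ky <= 18 * Ky + K by lra.
have q2 : 8 * Ky + K <= 18 * Ky + K by lra.
pose G := 18 * Ky + K; have G0 : 0 <= G by rewrite addr_ge0 ?mulr_ge0.
exists (2 * M * K + 8 * M * G ^+ 2 + 8 * M * G ^+ 3).
  by rewrite !(addr_ge0, mulr_ge0, exprn_ge0).
move=> l b c ll bl bs cl cs12 cs23 lM bM cM Y zeta u YK z1 uV.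
set a := nc zeta in z1 uV *; have a0 : 0 <= a by exact: nc_ge0.
set V := jetX Y zeta in uV.
(* The homogeneous parts of the jet; w collects what u has beyond order 2. *)
pose u1 : CX := hscale zeta (Y 1 0)%N + hscale (conjc zeta) (Y 0 1)%N.
pose u2 : CX := hscale (zeta ^+ 2) (Y 2 0)%N + hscale (zeta * conjc zeta) (Y 1 1)%N +
  hscale (conjc zeta ^+ 2) (Y 0 2)%N.
pose u3 : CX := hscale (zeta ^+ 3) (Y 3 0)%N + hscale (zeta ^+ 2 * conjc zeta) (Y 2 1)%N +
  (hscale (zeta * conjc zeta ^+ 2) (Y 1 2)%N + hscale (conjc zeta ^+ 3) (Y 0 3)%N).
have VE : V = u1 + u2 + u3.
  apply: (chistP h0) => theta i _.
  rewrite /V /jetX !big_cons !big_nil /u1 /u2 /u3 !(cevD, cev_hscale, cev0) /mono /=; ring.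
pose uC := of_real u; pose w := uC - u1 - u2; pose v := u2 + w.
have uE : uC = u1 + v by rewrite /v /w [u2 + _]addrC subrK addrC subrK.
have hs z (y : CX) m : nc z = a ^+ m -> `|y| <= Ky -> `|hscale z y| <= 2 * Ky * a ^+ m.
  move=> zE yK; rewrite (le_trans (cnorm_hscale _ _))// zE mulrAC ler_wpM2r ?exprn_ge0//.
  by rewrite ler_wpM2l.
have Yp j k : (j, k) \in exps -> `|Y j k| <= Ky by move=> /YK.
have tri (x y : CX) A B : `|x| <= A -> `|y| <= B -> `|x + y| <= A + B.
  by move=> hx hy; rewrite (le_trans (ler_normD _ _))// lerD.
have n1 : `|u1| <= G * a.
  have := tri _ _ _ _ (hs zeta _ 1%N _ (Yp 1 0 isT)%N) (hs (conjc zeta) _ 1%N _ (Yp 0 1 isT)%N).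
  rewrite ncJ expr1 => /(_ erefl erefl) /le_trans; apply.
  by rewrite -mulrDl; apply: ler_wpM2r; [exact: a0|exact: q1].
have n2 : `|u2| <= 6 * Ky * a ^+ 2.
  have := tri _ _ _ _ (tri _ _ _ _ (hs (zeta ^+ 2) _ 2%N _ (Yp 2 0 isT)%N)
    (hs (zeta * conjc zeta) _ 2%N _ (Yp 1 1 isT)%N)) (hs (conjc zeta ^+ 2) _ 2%N _ (Yp 0 2 isT)%N).
  rewrite ncM !ncX !ncJ -expr2 => /(_ erefl erefl erefl) /le_trans; apply.
  by rewrite -!mulrDl; apply: ler_wpM2r; [exact: exprn_ge0|exact: q6].
have n3 : `|u3| <= 8 * Ky * a ^+ 3.
  have := tri _ _ _ _ (tri _ _ _ _ (hs (zeta ^+ 3) _ 3%N _ (Yp 3 0 isT)%N)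
    (hs (zeta ^+ 2 * conjc zeta) _ 3%N _ (Yp 2 1 isT)%N))
    (tri _ _ _ _ (hs (zeta * conjc zeta ^+ 2) _ 3%N _ (Yp 1 2 isT)%N)
    (hs (conjc zeta ^+ 3) _ 3%N _ (Yp 0 3 isT)%N)).
  have g1 : nc (zeta ^+ 3) = a ^+ 3 by rewrite ncX.
  have g2 : nc (zeta ^+ 2 * conjc zeta) = a ^+ 3 by rewrite ncM ncX ncJ -exprSr.
  have g3 : nc (zeta * conjc zeta ^+ 2) = a ^+ 3 by rewrite ncM ncX ncJ -exprS.
  have g4 : nc (conjc zeta ^+ 3) = a ^+ 3 by rewrite ncX ncJ.
  move=> /(_ g1 g2 g3 g4) /le_trans; apply.
  by rewrite -!mulrDl; apply: ler_wpM2r; [exact: exprn_ge0|exact: q8].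
have a43 : a ^+ 4 <= a ^+ 3 by rewrite exprS ler_piMl ?exprn_ge0.
have a32 : a ^+ 3 <= a ^+ 2 by rewrite exprS ler_piMl ?exprn_ge0.
have a21 : a ^+ 2 <= a by rewrite expr2 ler_piMl.
have nw : `|w| <= (8 * Ky + K) * a ^+ 3.
  have ab (x y z t : CX) : t - x - y = z + (t - (x + y + z)).
    by rewrite addrCA opprD [z + _]addrCA subrr addr0 opprD addrA.
  have -> : w = u3 + (uC - V) by rewrite VE; exact: ab.
  by rewrite mulrDl; apply: tri => //; rewrite (le_trans uV)// ler_wpM2l.
have nwG : `|w| <= G * a ^+ 3.
  by apply: (le_trans nw); apply: ler_wpM2r; [exact: exprn_ge0|exact: q2].
have nv : `|v| <= G * a ^+ 2.
  apply: (le_trans (tri _ _ _ _ n2 nw)).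
  have : (8 * Ky + K) * a ^+ 3 <= (8 * Ky + K) * a ^+ 2 by rewrite ler_wpM2l// addr_ge0 ?mulr_ge0.
  have : 0 <= Ky * a ^+ 2 by rewrite mulr_ge0 ?exprn_ge0.
  rewrite /G !mulrDl; set p := Ky * a ^+ 2; set q := a ^+ 2.
  by rewrite -!mulrA -/p; lra.
have nu : `|uC| <= G * a.
  rewrite uE; have h1 : `|u1| <= 4 * Ky * a.
    have := tri _ _ _ _ (hs zeta _ 1%N _ (Yp 1 0 isT)%N) (hs (conjc zeta) _ 1%N _ (Yp 0 1 isT)%N).
    rewrite ncJ expr1 => /(_ erefl erefl) /le_trans; apply.
    by rewrite -mulrDl; apply: ler_wpM2r; [exact: a0|exact: q4].
  have h2 : `|v| <= (14 * Ky + K) * a.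
    apply: (le_trans (tri _ _ _ _ n2 nw)).
    have g1 : 6 * Ky * a ^+ 2 <= 6 * Ky * a by rewrite ler_wpM2l ?mulr_ge0.
    have g2 : (8 * Ky + K) * a ^+ 3 <= (8 * Ky + K) * a.
      by rewrite ler_wpM2l ?addr_ge0 ?mulr_ge0// (le_trans a32).
    by apply: (le_trans (lerD g1 g2)); rewrite -mulrDl; apply: ler_wpM2r; [exact: a0|exact: q14].
  by apply: (le_trans (tri _ _ _ _ h1 h2)); rewrite -mulrDl; apply: ler_wpM2r; [exact: a0|exact: q18].
have L1 : nc (lC l (uC - V)) <= 2 * M * K * a ^+ 4.
  apply: (le_trans (nc_lC (uC - V) lM M0)); rewrite -[leRHS]mulrA.
  by rewrite ler_wpM2l// mulr_ge0.
have jE : jet (taylor_jet l b c Y) zeta =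
    lC l V + bC b u1 u1 / 2 + bC b u1 u2 + tC c u1 u1 u1 / 6.
  rewrite /V (lC_jetX ll) /jet !big_cons !big_nil /u1 /u2 /taylor_jet /mono /=.
  rewrite !(bCDl bl, bCDr bl bs, bCZl bl, bCZr bl bs).
  rewrite !(tCD1 cl, tCD2 cl cs12, tCD3 cl cs12 cs23, tCZ1 cl, tCZ2 cl cs12, tCZ3 cl cs12 cs23).
  rewrite (bCC bs (Y 0 1)%N (Y 1 0)%N).
  rewrite (tC23 cs23 (Y 1 0)%N (Y 0 1)%N (Y 1 0)%N).
  rewrite (tC12 cs12 (Y 0 1)%N (Y 1 0)%N (Y 1 0)%N) (tC23 cs23 (Y 1 0)%N (Y 0 1)%N (Y 1 0)%N).
  rewrite (tC12 cs12 (Y 0 1)%N (Y 1 0)%N (Y 0 1)%N).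
  rewrite (tC23 cs23 (Y 0 1)%N (Y 0 1)%N (Y 1 0)%N) (tC12 cs12 (Y 0 1)%N (Y 1 0)%N (Y 0 1)%N).
  by field.
have cE : (l u + b u u / 2 + c u u u / 6)%:C = lC l uC + bC b uC uC / 2 + tC c uC uC uC / 6.
  rewrite /uC (lC_real ll) (bC_real bl bs) (tC_real cl cs12 cs23).
  by rewrite !rmorphD !rmorphM /= !fmorphV !rmorph_nat.
rewrite cE jE.
have vE : v = u2 + w by [].
clear jE cE VE n3 nw; clearbody v w u3 u2 u1 uC V.
have -> : lC l uC + bC b uC uC / 2 + tC c uC uC uC / 6 -
    (lC l V + bC b u1 u1 / 2 + bC b u1 u2 + tC c u1 u1 u1 / 6) =
    lC l (uC - V) + (bC b u1 w + bC b v v / 2) +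
    (tC c v uC uC + tC c u1 v uC + tC c u1 u1 v) / 6.
  rewrite (lCB ll).
  have -> : bC b uC uC = bC b u1 u1 + 2 * (bC b u1 u2 + bC b u1 w) + bC b v v.
    have e1 : bC b uC uC = bC b u1 uC + bC b v uC by rewrite {1}uE (bCDl bl).
    have e2 : bC b u1 uC = bC b u1 u1 + bC b u1 v by rewrite uE (bCDr bl bs).
    have e3 : bC b v uC = bC b u1 v + bC b v v by rewrite uE (bCDr bl bs) (bCC bs v u1).
    have e4 : bC b u1 v = bC b u1 u2 + bC b u1 w by rewrite vE (bCDr bl bs).
    by rewrite e1 e2 e3 e4; ring.
  have -> : tC c uC uC uC = tC c u1 u1 u1 + (tC c v uC uC + tC c u1 v uC + tC c u1 u1 v).
    have e1 : tC c uC uC uC = tC c u1 uC uC + tC c v uC uC by rewrite {1}uE (tCD1 cl).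
    have e2 : tC c u1 uC uC = tC c u1 u1 uC + tC c u1 v uC by rewrite {1}uE (tCD2 cl cs12).
    have e3 : tC c u1 u1 uC = tC c u1 u1 u1 + tC c u1 u1 v by rewrite {1}uE (tCD3 cl cs12 cs23).
    by rewrite e1 e2 e3; ring.
  by field.
have half : nc (2^-1 : R[i]) = 2^-1.
  by rewrite (_ : 2^-1 = (2^-1 : R)%:C) ?nc_real ?ger0_norm ?invr_ge0// fmorphV rmorph_nat.
have sixth : nc (6^-1 : R[i]) = 6^-1.
  by rewrite (_ : 6^-1 = (6^-1 : R)%:C) ?nc_real ?ger0_norm ?invr_ge0// fmorphV rmorph_nat.
have p4 : 0 <= a ^+ 4 by rewrite exprn_ge0.
have B1 : nc (bC b u1 w) <= 4 * M * G ^+ 2 * a ^+ 4.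
  apply: (le_trans (nc_bC u1 w bM M0)); rewrite -[leRHS]mulrA.
  apply: ler_wpM2l; first exact: (mulr_ge0 (ler0n _ _) M0).
  apply: (le_trans (ler_pM (normr_ge0 _) (normr_ge0 _) n1 nwG)).
  by rewrite le_eqVlt; apply/orP; left; apply/eqP; ring.
have B2 : nc (bC b v v / 2) <= 4 * M * G ^+ 2 * a ^+ 4.
  have h1 : nc (bC b v v) <= 4 * M * G ^+ 2 * a ^+ 4.
    apply: (le_trans (nc_bC v v bM M0)); rewrite -[leRHS]mulrA.
    apply: ler_wpM2l; first exact: (mulr_ge0 (ler0n _ _) M0).
    apply: (le_trans (ler_pM (normr_ge0 _) (normr_ge0 _) nv nv)).
    by rewrite le_eqVlt; apply/orP; left; apply/eqP; ring.
  by rewrite ncM half; have := nc_ge0 (bC b v v); move: h1; lra.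
have tb (x y z : CX) i j k : (i + (j + k) = 4)%N -> `|x| <= G * a ^+ i -> `|y| <= G * a ^+ j ->
    `|z| <= G * a ^+ k -> nc (tC c x y z) <= 8 * M * G ^+ 3 * a ^+ 4.
  move=> ijk hx hy hz; apply: (le_trans (nc_tC x y z cM M0)); rewrite -[leRHS]mulrA.
  apply: ler_wpM2l; first exact: (mulr_ge0 (ler0n _ _) M0).
  apply: (le_trans (ler_pM (normr_ge0 _) (mulr_ge0 (normr_ge0 _) (normr_ge0 _)) hx
    (ler_pM (normr_ge0 _) (normr_ge0 _) hy hz))).
  rewrite -ijk !exprD; by rewrite le_eqVlt; apply/orP; left; apply/eqP; ring.
have nu1 : `|uC| <= G * a ^+ 1 by rewrite expr1.
have n11 : `|u1| <= G * a ^+ 1 by rewrite expr1.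
have T1 := tb v uC uC 2%N 1%N 1%N erefl nv nu1 nu1.
have T2 := tb u1 v uC 1%N 2%N 1%N erefl n11 nv nu1.
have T3 := tb u1 u1 v 1%N 1%N 2%N erefl n11 n11 nv.
have -> : (2 * M * K + 8 * M * G ^+ 2 + 8 * M * G ^+ 3) * a ^+ 4 =
    2 * M * K * a ^+ 4 + (4 * M * G ^+ 2 * a ^+ 4 + 4 * M * G ^+ 2 * a ^+ 4) +
    (8 * M * G ^+ 3 * a ^+ 4 + 8 * M * G ^+ 3 * a ^+ 4 + 8 * M * G ^+ 3 * a ^+ 4) / 3.
  by field.
have T123 : nc ((tC c v uC uC + tC c u1 v uC + tC c u1 u1 v) / 6) <=
    (8 * M * G ^+ 3 * a ^+ 4 + 8 * M * G ^+ 3 * a ^+ 4 + 8 * M * G ^+ 3 * a ^+ 4) / 3.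
  rewrite ncM sixth.
  have hT : nc (tC c v uC uC + tC c u1 v uC + tC c u1 u1 v) <=
      8 * M * G ^+ 3 * a ^+ 4 + 8 * M * G ^+ 3 * a ^+ 4 + 8 * M * G ^+ 3 * a ^+ 4.
    apply: (le_trans (ncD _ _)); apply: lerD T3.
    by apply: (le_trans (ncD _ _)); exact: lerD.
  apply: ler_pM; [exact: nc_ge0|by rewrite invr_ge0|exact: hT|].
  by rewrite lef_pV2 ?posrE// ler_nat.
apply: (le_trans (ncD _ _)); apply: lerD T123.
apply: (le_trans (ncD _ _)); apply: lerD => //.
by apply: (le_trans (ncD _ _)); exact: lerD.
Qed.

End Jets.

(** * The jet of the center manifold along the equilibrium *)

Lemma sum_exps (V : zmodType) (F : nat -> nat -> V) :
  \sum_(j < 4) \sum_(k < 4 | (2 <= j + k <= 3)%N) F j k = \sum_(p <- drop 2 exps) F p.1 p.2.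
Proof.
rewrite /= !big_cons big_nil !big_ord_recr big_ord0 /=.
do 4!(rewrite big_mkcond !big_ord_recr big_ord0 /=).
by rewrite ?(add0r, addr0) !addrA.
Qed.

Section Expansion.
Context {R : realType} {n : nat} {h : R} (h0 : 0 < h).
Local Notation X := (history h n).
Local Notation CX := (chistory h n).
Variables (xb : 'cV[R]_n) (phi : CX) (Hjk : nat -> nat -> R -> CX) (H : R -> R[i] -> X).
Local Notation xbar := (cst_history h xb).

(** The coefficients of zeta^j conj(zeta)^k in the expansion of the
    parametrization, with phi and its conjugate as linear terms. *)
Definition eta (t : R) (j k : nat) : CX :=
  match j, k with
  | 1, 0 => phi
  | 0, 1 => cconj phi
  | _, _ => hscale ((j`! * k`!)%:R^-1) (Hjk j k t)
  end.

Hypothesis HE : has_expansion xb phi Hjk H.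

Lemma expansion_jet : exists M r : R, [/\ 0 <= M, 0 < r & forall t xi, nc xi < r ->
  `|of_real (H t xi - xbar) - jetX (eta t) xi| <= M * nc xi ^+ 4].
Proof.
have [M [r [r0 HM]]] := HE; exists (Num.max M 0), r; split => //; first by rewrite le_max lexx orbT.
move=> t xi xir; have := HM t xi xir.
set u := (X in `|X| <= _) => uM.
have -> : of_real (H t xi - xbar) - jetX (eta t) xi = u.
  apply: (chistP h0) => theta i _; rewrite /u !(cevB, cevD, cev_real, cev_hscale).
  rewrite (sum_exps (fun j k => hscale (xi ^+ j * conjc xi ^+ k / (j`! * k`!)%:R) (Hjk j k t))).
  rewrite cev_jetX cev_sum hev_B /jet !big_cons !big_nil /= !cev_hscale /mono /=.
  have NE : Num.conj xi = conjc xi by [].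
  rewrite ?NE rmorphB /= !expr0 !expr1 !mulr1 !mul1r cev_conj.
  move: (conjc xi) => xc.
  ring.
by apply: (le_trans uM); rewrite ler_wpM2r ?exprn_ge0 ?nc_ge0// le_max lexx.
Qed.

Lemma H_0 t : H t 0 = xbar.
Proof.
have [M [r [M0 r0 HM]]] := expansion_jet.
have := HM t 0; rewrite nc0 expr0n /= mulr0 => /(_ r0) Hn.
have : of_real (H t 0 - xbar) - jetX (eta t) 0 = 0.
  by apply/eqP; rewrite -normr_le0.
have -> : jetX (eta t) 0 = 0.
  have c0 : conjc (0 : R[i]) = 0 := conjc0 _.
  apply: (chistP h0) => theta i _; rewrite cev_jetX cev0 /jet !big_cons big_nil /mono c0 /=.
  by rewrite !expr0n /= ?(mulr0, mul0r, addr0).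
by rewrite subr0 => /(congr1 fst) /= /eqP; rewrite subr_eq0 => /eqP.
Qed.

Hypothesis HC : forall j l : nat, (2 <= j + l <= 3)%N -> forall t, Hjk j l t = cconj (Hjk l j t).

Lemma eta_conj t j k : (1 <= j + k <= 3)%N -> eta t j k = cconj (eta t k j).
Proof.
move=> jk; apply: (chistP h0) => theta i _; rewrite cev_conj.
have H2 a b : (2 <= a + b <= 3)%N -> cev (hscale (a`! * b`!)%:R^-1 (Hjk a b t)) theta i =
    conjc (cev (hscale (b`! * a`!)%:R^-1 (Hjk b a t)) theta i).
  by move=> ab; rewrite HC// !cev_hscale cev_conj conjM conjc_inv conjc_nat mulnC.
case: j k jk => [|[|[|[|j]]]] [|[|[|[|k]]]] jk; try discriminate jk; try exact: H2.
  exact: cev_conj.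
by change (cev phi theta i = conjc (cev (cconj phi) theta i)); rewrite cev_conj conjcK.
Qed.

Variable (delta : R).
Hypothesis delta0 : 0 < delta.
Hypothesis Hc : {within [set z : R * (R * R) | nc (z.2.1 +i* z.2.2) < delta],
        continuous (fun z : R * (R * R) => H z.1 (z.2.1 +i* z.2.2))}.

Lemma pair_cont (T : topologicalType) (f g : T -> X) : continuous f -> continuous g ->
  continuous (fun t => (f t, g t) : CX).
Proof.
move=> cf cg t; apply/cvgrPdist_lt => e e0; near=> s.
rewrite cnormE gt_max /=; apply/andP; split; near: s.
  by have /cvgrPdist_lt := cf t; apply.
by have /cvgrPdist_lt := cg t; apply.
Unshelve. all: by end_near. Qed.

Lemma H_cont xi : nc xi < delta -> continuous (fun t => H t xi).
Proof.
case: xi => a b xid t.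
have P := proj1 (subspace_continuousP _ _) Hc (t, (a, b)) xid.
have Q : (fun s : R => (s, (a, b))) @ t -->
   within [set z : R * (R * R) | nc (z.2.1 +i* z.2.2) < delta] (nbhs (t, (a, b))).
  move=> A /=; rewrite /within /= => hA.
  have : (fun s : R => (s, (a, b))) @ t --> (t, (a, b)).
    exact: (@graph_cont R (R * R)%type (fun=> (a, b)) t (@cst_continuous _ _ _ t)).
  by move=> /(_ _ hA); apply: (@filterS _ (nbhs t)) => s /=; apply.
exact: (cvg_comp _ _ Q P).
Qed.

Lemma avgX_jet2 r (Y : nat -> nat -> CX) : avgX 2 (fun l => jetX Y (node r l)) = hscale ((r ^+ 2)%:C) (Y 2%N 0%N).
Proof.
apply: (chistP h0) => theta i _; rewrite cev_avgX cev_hscale -(avg_jet2 r (fun j k => cev (Y j k) theta i)).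
by apply: eq_avg => l; rewrite cev_jetX.
Qed.

Lemma avgX_jet0 r (Y : nat -> nat -> CX) : avgX 0 (fun l => jetX Y (node r l)) = hscale ((r ^+ 2)%:C) (Y 1%N 1%N).
Proof.
apply: (chistP h0) => theta i _; rewrite cev_avgX cev_hscale -(avg_jet0 r (fun j k => cev (Y j k) theta i)).
by apply: eq_avg => l; rewrite cev_jetX.
Qed.

Lemma avgX_jet3 r (Y : nat -> nat -> CX) : avgX 3 (fun l => jetX Y (node r l)) = hscale ((r ^+ 3)%:C) (Y 3%N 0%N).
Proof.
apply: (chistP h0) => theta i _; rewrite cev_avgX cev_hscale -(avg_jet3 r (fun j k => cev (Y j k) theta i)).
by apply: eq_avg => l; rewrite cev_jetX.
Qed.

Lemma avgX_jet1 r (Y : nat -> nat -> CX) : avgX 1 (fun l => jetX Y (node r l)) =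
  hscale r%:C (Y 1%N 0%N) + hscale ((r ^+ 3)%:C) (Y 2%N 1%N).
Proof.
apply: (chistP h0) => theta i _; rewrite cev_avgX cevD !cev_hscale -(avg_jet1 r (fun j k => cev (Y j k) theta i)).
by apply: eq_avg => l; rewrite cev_jetX.
Qed.

Lemma avgXB m (u v : 'I_8 -> CX) : avgX m (fun l => u l - v l) = avgX m u - avgX m v.
Proof.
apply: (chistP h0) => theta i _; rewrite cevB !cev_avgX -avgB.
by apply: eq_avg => l; rewrite cevB.
Qed.

Lemma norm_avgX m (u : 'I_8 -> CX) (K : R) : 0 <= K -> (forall l, `|u l| <= K) ->
  `|avgX m u| <= 2 * K.
Proof.
move=> K0 uK; apply: cnorm_le => //; first by rewrite mulr_ge0.
move=> theta i _; rewrite cev_avgX; apply: nc_avg => l.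
by apply: (le_trans (nc_cev _ _ _)); rewrite ler_wpM2l.
Qed.

Lemma avgX_H_cont m r : 0 <= r -> r < delta ->
  continuous (fun t => avgX m (fun l => of_real (H t (node r l) - xbar))).
Proof.
move=> r0 rd; apply: (avgX_cont h0) => l; apply: pair_cont => t; last exact: cvg_cst.
apply: cvgB; last exact: cvg_cst.
by apply: H_cont; rewrite nc_node.
Qed.

(** The expansion shows that Z is recovered, up to O(r) uniformly in t, from
    the m-th average of the parametrization over the circle of radius r, which
    is continuous in t. Thus Z is a uniform limit of continuous curves. *)
Lemma coefficient_cont m s (Z : R -> CX) (w : R -> CX) : (s <= 3)%N ->
  (forall r t, avgX m (fun l => jetX (eta t) (node r l)) = hscale r%:C (w t) + hscale (r ^+ s)%:C (Z t)) ->
  continuous w -> continuous Z.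
Proof.
move=> s3 mE cw; apply: cont_of_approx => e e0.
have [M [r1 [M0 r10 HM]]] := expansion_jet.
pose r := Num.min (Num.min (r1 / 2) (delta / 2)) (Num.min 1 (e / (4 * M + 1))).
have M1 : 0 < 4 * M + 1 by rewrite ltr_wpDl// mulr_ge0.
have r0 : 0 < r by rewrite !lt_min !divr_gt0//= ltr01.
have rr1 : r < r1 by rewrite (le_lt_trans (_ : r <= r1 / 2))// ?ltr_pdivrMr ?ltr_pMr ?ltr1n// !ge_min lexx.
have rd : r < delta.
  by rewrite (le_lt_trans (_ : r <= delta / 2))// ?ltr_pdivrMr ?ltr_pMr ?ltr1n// !ge_min lexx orbT.
have re : r <= e / (4 * M + 1) by rewrite !ge_min lexx !orbT.
have r1l : r <= 1 by rewrite !ge_min lexx !orbT.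
pose g t := hscale ((r ^- s)%:C) (avgX m (fun l => of_real (H t (node r l) - xbar)) - hscale r%:C (w t)).
exists g; split.
  move=> t; apply: (@continuous_comp _ _ _ (fun t => avgX m (fun l => of_real (H t (node r l) - xbar)) - hscale r%:C (w t))); last exact: hscale_cont.
  apply: cvgB; first by apply: avgX_H_cont => //; exact: ltW.
  by apply: (@continuous_comp _ _ _ w); [exact: cw|exact: hscale_cont].
move=> t.
have rs0 : r ^+ s != 0 by rewrite expf_neq0// gt_eqF.
have -> : Z t - g t = hscale ((r ^- s)%:C)
   (- avgX m (fun l => of_real (H t (node r l) - xbar) - jetX (eta t) (node r l))).
  rewrite avgXB mE.
  apply: (chistP h0) => theta i _; rewrite /g !(cevB, cevN, cev_hscale, cevD).
  have e1 : (r ^- s)%:C * (r ^+ s)%:C = 1 by rewrite -rmorphM mulVf.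
  rewrite -[cev (Z t) theta i in LHS]mul1r -e1; ring.
apply: (le_trans (cnorm_hscale _ _)); rewrite nc_real normrN.
have h1 : `|avgX m (fun l => of_real (H t (node r l) - xbar) - jetX (eta t) (node r l))| <= 2 * (M * r ^+ 4).
  apply: norm_avgX; first by rewrite mulr_ge0// exprn_ge0// ltW.
  move=> l; have hl : nc (node r l) = r by rewrite nc_node// ltW.
  by have := HM t (node r l); rewrite hl; apply.
have rv : 0 <= r ^- s by rewrite invr_ge0 exprn_ge0// ltW.
rewrite (ger0_norm rv).
apply: (le_trans (ler_wpM2l _ h1)); first by rewrite mulr_ge0.
have -> : 2 * r ^- s * (2 * (M * r ^+ 4)) = 4 * M * r ^+ (4 - s).
  have {1}-> : (4 = s + (4 - s))%N by rewrite subnKC// ltnW.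
  rewrite exprD.
  have -> : 2 * r ^- s * (2 * (M * (r ^+ s * r ^+ (4 - s)))) = (r ^- s * r ^+ s) * (4 * M * r ^+ (4 - s)) by ring.
  by rewrite mulVf// mul1r.
have h2 : r ^+ (4 - s) <= r.
  by rewrite -[leRHS]expr1; apply: ler_wiXn2l; [exact: ltW|exact: r1l|rewrite subn_gt0].
apply: (@le_trans _ _ ((4 * M + 1) * r)).
  apply: ler_pM; [by rewrite mulr_ge0|by rewrite exprn_ge0// ltW|by rewrite lerDl|exact: h2].
by rewrite mulrC -ler_pdivlMr.
Qed.

Lemma cconj_cont : continuous (@cconj R h n).
Proof.
have c1 : continuous (fun u : CX => u.1) by move=> u; exact: cvg_fst.
have c2 : continuous (fun u : CX => - u.2) by move=> u; apply: cvgN; exact: cvg_snd.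
exact: pair_cont.
Qed.

(** Continuity of the coefficients is a consequence of the uniform remainder
    of the expansion and of the continuity of the parametrization. The average
    with m = 1 mixes the coefficients (1, 0) and (2, 1); the first one is
    constant. *)
Lemma eta_cont j k : (1 <= j + k <= 3)%N -> continuous (fun t => eta t j k).
Proof.
have c1 : continuous (fun t : R => 0 : CX) by move=> t; exact: cst_continuous.
have hs0 z : hscale z (0 : CX) = 0 by apply: (chistP h0) => theta i _; rewrite cev_hscale cev0 mulr0.
have c20 : continuous (fun t => eta t 2 0).
  apply: (@coefficient_cont 2 2 _ (fun=> 0)) => // r t; rewrite avgX_jet2.
  by rewrite hs0 add0r.
have c11 : continuous (fun t => eta t 1 1).
  apply: (@coefficient_cont 0 2 _ (fun=> 0)) => // r t; rewrite avgX_jet0.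
  by rewrite hs0 add0r.
have c30 : continuous (fun t => eta t 3 0).
  apply: (@coefficient_cont 3 3 _ (fun=> 0)) => // r t; rewrite avgX_jet3.
  by rewrite hs0 add0r.
have c10 : continuous (fun t => eta t 1 0) by move=> t; exact: cst_continuous.
have c21 : continuous (fun t => eta t 2 1).
  by apply: (@coefficient_cont 1 3 _ (fun=> phi)) => // r t; rewrite avgX_jet1.
have cc a b : (1 <= a + b <= 3)%N -> continuous (fun t => eta t b a) -> continuous (fun t => eta t a b).
  move=> ab cb; rewrite (_ : (fun t => _) = @cconj R h n \o (fun t => eta t b a)); last first.
    by apply/funext => t /=; rewrite -eta_conj.
  by move=> t; apply: continuous_comp; [exact: cb|exact: cconj_cont].
by case: j k => [|[|[|[|j]]]] [|[|[|[|k]]]] jk; try discriminate jk;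
  first [assumption|apply: (cc _ _ jk); assumption].
Qed.

Lemma eta_bounded t0 : exists2 K : R, 0 <= K & \forall t \near (t0 : R),
  forall p, p \in exps -> `|eta t p.1 p.2| <= K.
Proof.
have aux (a b : CX) : `|a - b| < 1 -> `|b| <= `|a| + 1.
  by move=> ab; have := ler_normB a (a - b); rewrite subKr => /le_trans; apply; rewrite lerD2l ltW.
have one p : p \in exps -> exists2 K : R, 0 <= K & \forall t \near (t0 : R), `|eta t p.1 p.2| <= K.
  move=> pe; exists (`|eta t0 p.1 p.2| + 1); first by rewrite addr_ge0.
  have p3 : (1 <= p.1 + p.2 <= 3)%N.
    by move: pe; rewrite !inE; do ?[case/orP]; do 9?[move=> /eqP ->].
  have ce : (fun t => eta t p.1 p.2) @ t0 --> eta t0 p.1 p.2 by exact: (eta_cont p3).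
  have /cvgrPdist_lt/(_ _ ltr01) := ce; apply: filterS => t ht.
  exact: aux ht.
elim: exps one => [|p s IH] one; first by exists 0 => //; near=> t => p; rewrite in_nil.
have hs p' : p' \in s -> p' \in p :: s by rewrite inE orbC => ->.
have [K1 K10 h1] := IH (fun p' hp => one p' (hs _ hp)).
have [K2 K20 h2] := one p (mem_head _ _).
exists (Num.max K1 K2); first by rewrite le_max K10.
near=> t => p'; rewrite inE => /orP[/eqP ->|ps]; rewrite le_max.
  by rewrite (near h2 t)// orbT.
by rewrite (near h1 t).
Unshelve. all: by end_near.
Qed.

End Expansion.

(** * Solutions on the center manifold *)

Section Bounds.
Context {R : realType} {n : nat} {h : R} (h0 : 0 < h).
Local Notation CX := (chistory h n).

Lemma nc_osc (w t : R) : nc (cexp ((0 +i* w) * t%:C)) = 1.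
Proof. by rewrite nc_cexp cReM /= mul0r mulr0 subr0 expR0. Qed.

Lemma jetX_bound (Y : nat -> nat -> CX) (K : R) xi : 0 <= K -> nc xi <= 1 ->
  (forall p, p \in exps -> `|Y p.1 p.2| <= K) -> `|jetX Y xi| <= 18 * K * nc xi.
Proof.
move=> K0 x1 YK; apply: (le_trans (@cnorm_sum _ _ _ _ _ _ (2 * nc xi * K) _)).
  move=> p pe; apply: (le_trans (cnorm_hscale _ _)).
  apply: ler_pM => //; last exact: YK.
    by rewrite mulr_ge0 ?nc_ge0.
  rewrite ler_wpM2l// nc_mono -[leRHS]expr1.
  apply: ler_wiXn2l => //; first exact: nc_ge0.
  by move: pe; rewrite !inE; do ?[case/orP]; do 9?[move=> /eqP ->].
by rewrite le_eqVlt; apply/orP; left; apply/eqP; rewrite /=; ring.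
Qed.

Lemma shift_jet_bound (E s : R[i]) (Y : nat -> nat -> CX) (K Kc : R) p :
  nc E = 1 -> nc s <= Kc -> 0 <= K -> (forall p, p \in exps -> `|Y p.1 p.2| <= K) ->
  p \in exps -> `|shift_jet E s Y p.1 p.2| <= 2 * K + 2 * Kc * K.
Proof.
move=> E1 sK K0 YK pe; apply: (le_trans (ler_normD _ _)); apply: lerD.
  apply: (le_trans (cnorm_hscale _ _)).
  have -> : nc (mono (p.1, p.2) E) = 1 by rewrite nc_mono E1 expr1n.
  by rewrite mulr1 ler_wpM2l// YK.
have Kc0 : 0 <= Kc := le_trans (nc_ge0 _) sK.
have B z (u : CX) : nc z = nc s -> `|u| <= K -> `|hscale z u| <= 2 * Kc * K.
  move=> zs uK; apply: (le_trans (cnorm_hscale _ _)); apply: ler_pM => //.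
    by rewrite mulr_ge0 ?nc_ge0.
  by rewrite ler_wpM2l// zs.
have Z : `|0 : CX| <= 2 * Kc * K by rewrite normr0 !mulr_ge0.
have s1 : nc (s * E) = nc s by rewrite ncM E1 mulr1.
have s2 : nc (conjc (s * E)) = nc s by rewrite ncJ.
case: p pe => [[|[|[|j]]] [|[|[|k]]]] _ //=.
  by apply: B => //; exact: (YK (0, 1)%N).
by apply: B => //; exact: (YK (1, 0)%N).
Qed.

End Bounds.

(** From each t0 on there are solutions, defined for a time independent of
    zeta, with jet Y up to O(|zeta|^4). This is the only information about the
    center manifold that enters the comparison of coefficients. *)
Definition has_solution_family {R : realType} {n : nat} {h : R}
    (F : R * history h n -> 'cV[R]_n) (xb : 'cV[R]_n) (Y : R -> nat -> nat -> chistory h n) : Prop :=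
  forall t0, exists tau K Ky r1 : R, [/\ 0 < tau, [/\ 0 <= K, 0 <= Ky & 0 < r1],
  (forall t, t0 <= t -> t < t0 + tau -> forall p, p \in exps -> `|Y t p.1 p.2| <= Ky) &
  forall zeta, nc zeta < r1 -> exists x, [/\ continuous x, is_solution F t0 tau x &
    forall t, t0 <= t -> t < t0 + tau ->
      `|of_real (segment h x t - cst_history h xb) - jetX (Y t) zeta| <= K * nc zeta ^+ 4]].

Section LocalFamily.
Context {R : realType} {n : nat} {h : R} (h0 : 0 < h).
Local Notation X := (history h n).
Local Notation CX := (chistory h n).
Variables (F : R * X -> 'cV[R]_n) (xb : 'cV[R]_n).
Local Notation xbar := (cst_history h xb).
Hypothesis cF : continuous F.
Hypothesis F0 : forall t, F (t, xbar) = 0.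
Hypothesis Flip : forall t0, exists r M : R, [/\ 0 < r, 0 < M &
  forall t (u v : X), `|t - t0| < r -> `|u - xbar| < r -> `|v - xbar| < r ->
  `|F (t, u) - F (t, v)| <= M * `|u - v|].
Variables (T omega : R) (W U : set (R * X)) (delta : R) (H : R -> R[i] -> X)
  (kappa : R * X -> R[i]) (Hjk : nat -> nat -> R -> CX) (c : R[i]) (phi : CX).
Hypothesis WI : locally_positively_invariant F xb W.
Hypothesis UO : open_around xb U.
Hypothesis delta0 : 0 < delta.
Hypothesis HP : is_parametrization W U delta H kappa.
Hypothesis HC : forall j l : nat, (2 <= j + l <= 3)%N -> forall t, Hjk j l t = cconj (Hjk l j t).
Hypothesis HE : has_expansion xb phi Hjk H.
Hypothesis HN : has_normal_form F T omega c W U kappa.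

Definition osc (t : R) : R[i] := cexp ((0 +i* omega) * t%:C).

(** In this jet xi(t) = e^(i omega t) (zeta + c t zeta |zeta|^2) is inserted
    in the expansion of the parametrization. *)
Definition sol_jet (t : R) : nat -> nat -> CX :=
  shift_jet (osc t) (c * t%:C) (eta phi Hjk t).

Lemma pair_dist (t t0 r : R) (u v : X) : `|t - t0| < r -> `|u - v| < r ->
  `|(t, u) - (t0, v) : R * X| < r.
Proof.
move=> h1 h2; have -> : (t, u) - (t0, v) = (t - t0, u - v) by [].
by rewrite prod_normE /= gt_max h1.
Qed.

(** The coordinate of a point of the manifold is small near the equilibrium,
    uniformly for t near t0. Hence the estimates for small xi apply to all
    solutions that start close enough to the equilibrium. *)
Lemma kappa_small t0 (e : R) : 0 < e -> exists2 r : R, 0 < r & forall t u,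
  `|t - t0| < r -> `|u - xbar| < r -> (W `&` U) (t, u) -> nc (kappa (t, u)) < e.
Proof.
move=> e0; have [P1 P2 P3 P4 P5] := HP.
have WU0 : (W `&` U) (t0, xbar).
  by have := (P1 t0 0); rewrite nc0 (H_0 h0 HE) => /(_ delta0)[].
have k0 : kappa (t0, xbar) = 0.
  by have := (P1 t0 0); rewrite nc0 (H_0 h0 HE) => /(_ delta0)[].
have e2 : 0 < e / 2 by rewrite divr_gt0.
have Q (f : R * X -> R) : {within W `&` U, continuous f} -> f (t0, xbar) = 0 ->
    \forall y \near (t0, xbar), (W `&` U) y -> `|f y| < e / 2.
  move=> /subspace_continuousP/(_ _ WU0)/cvgrPdist_lt/(_ _ e2) fc f0.
  have {}fc : \forall y \near (t0, xbar), (W `&` U) y -> `|f (t0, xbar) - f y| < e / 2 by exact: fc.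
  by apply: filterS fc => y fy Wy; have := fy Wy; rewrite f0 sub0r normrN.
have k0r : Re (kappa (t0, xbar)) = 0 by rewrite k0.
have k0i : Im (kappa (t0, xbar)) = 0 by rewrite k0.
have QQ : \forall y \near (t0, xbar), (W `&` U) y -> nc (kappa y) < e.
  apply: filterS2 (Q _ P4 k0r) (Q _ P5 k0i) => y h1 h2 Wy.
  apply: (le_lt_trans (nc_le _)); rewrite [ltRHS]splitr.
  by apply: ltrD; [exact: h1|exact: h2].
have [r r0 hr] := proj1 (nearP _ _) QQ.
exists r => // t u tr ur Wtu; apply: hr => //.
exact: pair_dist.
Qed.

Lemma open_small (V : set (R * X)) t0 : open V -> V (t0, xbar) -> exists2 r : R, 0 < r &
  forall t u, `|t - t0| < r -> `|u - xbar| < r -> V (t, u).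
Proof.
move=> Vo V0; have /nearP[r r0 hr] : \forall y \near (t0, xbar), V y by exact: open_nbhs_nbhs.
by exists r => // t u tr ur; apply: hr; exact: pair_dist.
Qed.

Lemma within_comp (f : R * X -> R) (A : set (R * X)) (B : set R) (w : R -> R * X) (s : R) :
  {within A, continuous f} -> (forall s, B s -> A (w s)) -> {for s, continuous w} -> B s ->
  f (w x) @[x --> within B (nbhs s)] --> f (w s).
Proof.
move=> /subspace_continuousP fc BA wc Bs.
have Q : w @ within B (nbhs s) --> within A (nbhs (w s)).
  move=> S hS; have wcs : w @ s --> w s by exact: wc.
  have hS' : \forall y \near w s, A y -> S y by exact: hS.
  have := wcs _ hS'; apply: (@filterS _ (nbhs s)) => x hx Bx.
  by apply: hx; exact: BA.
exact: (cvg_comp _ _ Q (fc _ (BA _ Bs))).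
Qed.

Lemma is_solution_shrink t0 (tau tau' : R) x : continuous x -> tau' <= tau ->
  is_solution F t0 tau x -> is_solution F t0 tau' x.
Proof.
move=> cx tt [_ dx]; split; first exact: continuous_subspaceT.
by move=> t /andP[h1 h2]; apply: dx; rewrite h1 (lt_le_trans h2)// lerD2l.
Qed.

(** Local invariance keeps the solution on the manifold as long as it is near
    the equilibrium, so its coordinate obeys the normal form and [amplitude]
    applies in the rotating frame; [substitution] then gives its jet. *)
Lemma local_family : has_solution_family F xb sol_jet.
Proof.
move=> t0.
have [P1 P2 P3 P4 P5] := HP.
have [rL [ML [rL0 ML0 FL]]] := Flip t0.
have [tau0 tau00 LE] := local_existence h0 cF F0 rL0 ML0 FL.
have [Uo Ut] := UO; have [V [Vo Vt] VI] := WI.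
have [rU rU0 hU] := open_small Uo (Ut t0).
have [rV rV0 hV] := open_small Vo (Vt t0).
have [rem [_ [M0 [rn [rn0 remM0]]] NF]] := HN.
pose Mr := Num.max M0 0.
have Mr0 : 0 <= Mr by rewrite le_max lexx orbT.
have remM t xi : nc xi < rn -> nc (rem t xi) <= Mr * nc xi ^+ 4.
  move=> /remM0 hr; apply: (le_trans (hr t)).
  by rewrite ler_wpM2r ?exprn_ge0 ?nc_ge0// le_max lexx.
have [e0 [ra [Ka [e00 ra0 Ka0 AMP]]]] := amplitude c t0 Mr0.
have [MH [rH [MH0 rH0 EXP]]] := expansion_jet h0 HE.
pose eps := Num.min e0 (Num.min rn rH).
have eps0 : 0 < eps by rewrite !lt_min e00 rn0 rH0.
have [rk rk0 hk] := kappa_small t0 eps0.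
have [Ke Ke0 /nearP[re re0 etaK]] := eta_bounded h0 HE HC delta0 P3 t0.
pose Kc := nc c * (`|t0| + 1).
have Kc0 : 0 <= Kc by rewrite mulr_ge0 ?nc_ge0// addr_ge0.
have [K1 K10 SUB] := @substitution R n h h0 _ _ _ Ka0 Kc0 Ke0.
pose tau := Num.min (Num.min tau0 (Num.min rU rV)) (Num.min (Num.min rk re) 4^-1).
have tau_gt0 : 0 < tau by rewrite !lt_min tau00 rU0 rV0 rk0 re0 invr_gt0 ltr0n.
have t_small t : t0 <= t -> t < t0 + tau -> [/\ `|t - t0| < rU, `|t - t0| < rV, `|t - t0| < rk,
    `|t - t0| < re & `|t - t0| < 4^-1].
  move=> h1 h2; have : `|t - t0| < tau by rewrite ger0_norm ?subr_ge0// ltrBlDl.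
  by rewrite !lt_min => /andP[/andP[_ /andP[-> ->]] /andP[/andP[-> ->] ->]].
have tau_le : tau <= tau0 by rewrite !ge_min lexx.
have ctK t : t0 <= t -> t < t0 + tau -> nc (c * t%:C) <= Kc.
  move=> h1 h2; have [_ _ _ _ h3] := t_small _ h1 h2.
  rewrite ncM nc_real ler_wpM2l ?nc_ge0//.
  have h4 := ler_normD (t - t0) t0; rewrite subrK in h4.
  apply: (le_trans h4); rewrite addrC lerD2l; apply: ltW; apply: (lt_le_trans h3).
  by rewrite invf_le1 ?ler1n ?ltr0n.
pose G := 18 * Ke + MH.
have G0 : 0 <= G by rewrite addr_ge0 ?mulr_ge0.
pose C0 := 1 + Kc.
have C00 : 0 <= C0 by rewrite addr_ge0.
pose rho := Num.min (Num.min rL (Num.min (Num.min rU rV) rk)) (Num.min (Num.min delta rH) 1).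
have rho0 : 0 < rho by rewrite !lt_min rL0 rU0 rV0 rk0 delta0 rH0 ltr01.
pose B := 2 * G * C0 + C0 + 1.
have B0 : 0 < B by rewrite ltr_wpDl// addr_ge0// !mulr_ge0.
pose A := 1 + Kc + Ka.
have A0 : 0 <= A by rewrite !addr_ge0.
exists tau, (MH * A ^+ 4 + K1), (2 * Ke + 2 * Kc * Ke), (Num.min (Num.min 1 ra) (rho / B)).
split => //.
- split; [by rewrite addr_ge0 ?mulr_ge0 ?exprn_ge0| |by rewrite !lt_min ltr01 ra0 divr_gt0].
  by rewrite -mulrA -mulrDr mulr_ge0// addr_ge0// mulr_ge0.
- move=> t h1 h2 p pe; apply: shift_jet_bound => //; first exact: nc_osc.
    exact: ctK.
  by move=> p' p'e; apply: etaK => //; have [] := t_small _ h1 h2.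
move=> zeta; rewrite !lt_min => /andP[/andP[z1 zra] zB].
have z0 := nc_ge0 zeta; rewrite ltr_pdivlMr// in zB.
set a := nc zeta in z1 zra zB z0 *.
have a31 : a ^+ 3 <= a by rewrite exprSr ler_piMl// exprn_ile1// ltW.
have a43 : a ^+ 4 <= a by rewrite exprSr ler_piMl// exprn_ile1// ltW.
(* The starting point is chosen so that z t0 is exactly the approximate
  solution at t0. *)
pose xi0 := osc t0 * (zeta + c * t0%:C * zeta * (a ^+ 2)%:C).
have cub s : nc s <= Kc -> nc (s * zeta * (a ^+ 2)%:C) <= Kc * a.
  move=> sK; rewrite !ncM nc_real ger0_norm ?exprn_ge0// -/a -mulrA -exprS.
  by apply: ler_pM => //; [exact: nc_ge0|exact: exprn_ge0].
have tt0 : t0 < t0 + tau by rewrite ltrDl.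
have xi0a : nc xi0 <= C0 * a.
  rewrite ncM nc_osc mul1r mulrDl mul1r; apply: (le_trans (ncD _ _)); rewrite lerD2l.
  by apply: cub; apply: ctK.
have aB : C0 * a < rho.
  apply: le_lt_trans zB; rewrite mulrC ler_wpM2l// /B addrAC lerDr.
  by rewrite addr_ge0// !mulr_ge0.
have xi0rho : nc xi0 < rho := le_lt_trans xi0a aB.
have [xi0d xi0H xi01] : [/\ nc xi0 < delta, nc xi0 < rH & nc xi0 < 1].
  by move: xi0rho; rewrite !lt_min => /andP[_ /andP[/andP[-> ->] ->]].
set psi := H t0 xi0.
have etaK0 : forall p, p \in exps -> `|eta phi Hjk t0 p.1 p.2| <= Ke.
  by apply: etaK; rewrite subrr normr0.
have psia : 2 * `|psi - xbar| < rho.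
  apply: le_lt_trans zB.
  have e1 : `|psi - xbar| <= G * nc xi0.
    rewrite -cnorm_real -(subrK (jetX (eta phi Hjk t0) xi0) (of_real _)).
    apply: (le_trans (ler_normD _ _)); rewrite addrC mulrDl; apply: lerD.
      by apply: jetX_bound => //; exact: ltW.
    apply: (le_trans (EXP _ _ xi0H)); rewrite ler_wpM2l// exprSr ler_piMl ?nc_ge0//.
    by rewrite exprn_ile1 ?nc_ge0// ltW.
  have e2 : G * nc xi0 <= G * (C0 * a) by rewrite ler_wpM2l.
  have e3 : 2 * `|psi - xbar| <= 2 * (G * (C0 * a)) by rewrite ler_wpM2l// (le_trans e1).
  apply: (le_trans e3).
  have -> : a * B = 2 * (G * (C0 * a)) + (C0 * a + a) by rewrite /B; ring.
  by rewrite lerDl addr_ge0// mulr_ge0.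
have [psiL psiU psiV psik] : [/\ 2 * `|psi - xbar| < rL, 2 * `|psi - xbar| < rU,
    2 * `|psi - xbar| < rV & 2 * `|psi - xbar| < rk].
  by move: psia; rewrite !lt_min => /andP[/andP[-> /andP[/andP[-> ->] ->]] _].
have [x [cx x0 solx xpsi]] := LE _ psiL.
have solt := is_solution_shrink cx tau_le solx.
exists x; split => //.
have [WUpsi kpsi] := P1 t0 xi0 xi0d.
have inU t : t0 <= t -> t < t0 + tau -> U (t, segment h x t).
  move=> h1 h2; have [g1 g2 g3 g4 g5] := t_small _ h1 h2.
  by apply: hU => //; apply: (le_lt_trans (xpsi t)).
have inW t : t0 <= t -> t < t0 + tau -> W (t, segment h x t).
  move=> h1 h2; apply: (VI t0 tau x) => //; last by rewrite h1 h2.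
    by rewrite x0; case: WUpsi.
  move=> s /andP[g1 g2]; have [_ g3 _ _ _] := t_small _ g1 g2.
  by apply: hV => //; apply: (le_lt_trans (xpsi s)).
pose xi t := kappa (t, segment h x t).
have xismall t : t0 <= t -> t < t0 + tau -> nc (xi t) < eps.
  move=> h1 h2; have [g1 g2 g3 g4 g5] := t_small _ h1 h2.
  apply: hk => //; first by apply: (le_lt_trans (xpsi t)).
  by split; [exact: inW|exact: inU].
have Hxi t : t0 <= t -> t < t0 + tau -> H t (xi t) = segment h x t.
  move=> h1 h2; have WUt : (W `&` U) (t, segment h x t) by split; [exact: inW|exact: inU].
  by have [] := P2 _ WUt.
pose dxi t := (0 +i* omega) * xi t + c * xi t * (nc (xi t) ^+ 2)%:C + rem t (xi t).
have xider t : t0 < t -> t < t0 + tau -> Cder xi t (dxi t).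
  move=> h1 h2; apply: (NF t0 tau x) => //; last by rewrite h1 h2.
  by move=> s /andP[g1 g2]; split; [exact: inW|exact: inU].
pose io := 0 +i* omega : R[i].
(* The rotating frame: the linear part of the normal form disappears. *)
pose z t := cexp (- io * t%:C) * xi t.
pose dz t := - io * cexp (- io * t%:C) * xi t + cexp (- io * t%:C) * dxi t.
have nE t : nc (cexp (- io * t%:C)) = 1.
  by rewrite (_ : - io = 0 +i* (- omega)) ?nc_osc//; apply: complexP => /=; rewrite ?oppr0.
have nz t : nc (z t) = nc (xi t) by rewrite ncM nE mul1r.
have oscN t : osc t * cexp (- io * t%:C) = 1.
  by rewrite mulNr mulrC cexpN.
have amp t : t0 <= t -> t < t0 + tau ->
    nc (z t - (zeta + c * t%:C * zeta * (a ^+ 2)%:C)) <= Ka * a ^+ 4.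
  move=> h1 h2.
  have sin s : s \in `[t0, t] -> t0 <= s /\ s < t0 + tau.
    by rewrite in_itv /= => /andP[g1 g2]; split => //; exact: le_lt_trans h2.
  have wcont s : {for s, continuous (fun u => (u, segment h x u) : R * X)}.
    by apply: graph_cont; exact: (segment_cont h0 cx).
  have WUin s : `[t0, t]%classic s -> (W `&` U) (s, segment h x s).
    by move=> /sin[g1 g2]; split; [exact: inW|exact: inU].
  have cz s : `[t0, t]%classic s ->
     Re (z u) @[u --> within `[t0, t] (nbhs s)] --> Re (z s) /\
     Im (z u) @[u --> within `[t0, t] (nbhs s)] --> Im (z s).
    move=> hs.
    have cr := within_comp P4 WUin (wcont s) hs.
    have ci := within_comp P5 WUin (wcont s) hs.
    have [er ei] := Ccont_cexp (- io).
    have er' : Re (cexp (- io * u%:C)) @[u --> within `[t0, t] (nbhs s)] --> Re (cexp (- io * s%:C)).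
      by apply: cvg_trans (er s); apply: cvg_app; exact: cvg_within.
    have ei' : Im (cexp (- io * u%:C)) @[u --> within `[t0, t] (nbhs s)] --> Im (cexp (- io * s%:C)).
      by apply: cvg_trans (ei s); apply: cvg_app; exact: cvg_within.
    split.
      rewrite [X in X @ _](_ : _ = (fun u => Re (cexp (- io * u%:C)) * Re (xi u) -
        Im (cexp (- io * u%:C)) * Im (xi u))); last by apply/funext => u; rewrite /z cReM.
      by rewrite /z cReM; apply: cvgB; apply: cvgM.
    rewrite [X in X @ _](_ : _ = (fun u => Re (cexp (- io * u%:C)) * Im (xi u) +
      Im (cexp (- io * u%:C)) * Re (xi u))); last by apply/funext => u; rewrite /z cImM.
    by rewrite /z cImM; apply: cvgD; apply: cvgM.
  apply: (AMP zeta t z dz) => //.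
  - have [_ _ _ _ h3] := t_small _ h1 h2.
    rewrite h1 /= -lerBlDl; apply: ltW; apply: le_lt_trans h3; exact: ler_norm.
  - by apply/subspace_continuousP => s hs; have [] := cz s hs.
  - by apply/subspace_continuousP => s hs; have [] := cz s hs.
  - move=> s /andP[g1 g2].
    by apply: CderM; [exact: Cder_cexp|apply: xider => //; exact: lt_trans h2].
  - move=> s /andP[g1 g2].
    have -> : dz s - c * z s * (nc (z s) ^+ 2)%:C = cexp (- io * s%:C) * rem s (xi s).
      rewrite nz /dz /dxi /z -/io; ring.
    rewrite ncM nE mul1r nz; apply: remM.
    have := xismall s (ltW g1) (lt_trans g2 h2).
    by rewrite !lt_min => /and3P[].
  - move=> s /andP[g1 g2]; rewrite nz.
    have := xismall s g1 (le_lt_trans g2 h2).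
    by rewrite !lt_min => /and3P[].
  - rewrite /z /xi x0 kpsi /xi0 mulrA [_ * osc t0]mulrC oscN mul1r.
    by rewrite -/a.
move=> t h1 h2.
have [g1 g2 g3 g4 g5] := t_small _ h1 h2.
have zt := amp t h1 h2.
have xiE : xi t = osc t * z t by rewrite /z mulrA oscN mul1r.
have xit : nc (xi t - osc t * (zeta + c * t%:C * zeta * (a ^+ 2)%:C)) <= Ka * a ^+ 4.
  by rewrite xiE -mulrBr ncM nc_osc mul1r.
have xitA : nc (xi t) <= A * a.
  rewrite -nz -(subrK (zeta + c * t%:C * zeta * (a ^+ 2)%:C) (z t)).
  apply: (le_trans (ncD _ _)); rewrite /A [leRHS]mulrDl addrC; apply: lerD.
    rewrite mulrDl mul1r; apply: (le_trans (ncD _ _)); rewrite lerD2l.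
    by apply: cub; apply: ctK.
  by apply: (le_trans zt); rewrite ler_wpM2l.
have sub := SUB (osc t) (c * t%:C) (eta phi Hjk t) zeta (xi t) (nc_osc _ _) (ctK _ h1 h2)
  (etaK _ g4) (ltW z1) xit.
rewrite -(subrK (jetX (eta phi Hjk t) (xi t)) (of_real _)) -addrA.
apply: (le_trans (ler_normD _ _)); rewrite mulrDl; apply: lerD; last exact: sub.
rewrite -Hxi//.
have xirH : nc (xi t) < rH by have := xismall t h1 h2; rewrite !lt_min => /and3P[].
apply: (le_trans (EXP t (xi t) xirH)); rewrite -mulrA ler_wpM2l// -exprMn.
by apply: lerXn2r; rewrite ?nnegrE ?nc_ge0// mulr_ge0.
Qed.

End LocalFamily.

(** * Comparison of coefficients along the family of solutions *)

Section Increments.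
Context {R : realType}.

(** The increments are those of a primitive of N, but only forward in time
    from each t0; y minus the primitive is locally constant to the right. *)
Lemma der_of_increments (y N : R -> R) : continuous y -> continuous N ->
  (forall t0, exists2 tau : R, 0 < tau & forall A b, A < t0 -> t0 <= b -> b < t0 + tau ->
    y b - y t0 = \int[lebesgue_measure]_(t in `[A, b]) N t -
                 \int[lebesgue_measure]_(t in `[A, t0]) N t) ->
  forall t, is_derive t (1 : R) y (N t).
Proof.
move=> cy cN H t; pose A := t - 2.
pose P x := \int[lebesgue_measure]_(t in `[A, x]) N t.
have PD x : A < x -> is_derive x (1 : R) P (N x) by exact: primitive.
have lA : A < t - 1 by rewrite /A; lra.
(* Times before t - 1 are cut off, since the primitive is only known to be
  differentiable after A. *)
pose m x := Num.max (t - 1) x.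
have Am x : A < m x by rewrite lt_max lA.
have cm : continuous m.
  move=> x; apply: (@continuous_max R R (fun=> t - 1) id x); [exact: cst_continuous|exact: cvg_id].
pose f x := y (m x) - P (m x).
have cf : continuous f.
  move=> x; apply: cvgB; first exact: (continuous_comp (cm x) (cy _)).
  apply: (continuous_comp (cm x)); apply: differentiable_continuous.
  by apply/derivable1_diffP; have [] := PD _ (Am x).
have mE x : t - 1 <= x -> m x = x by move=> hx; rewrite /m max_r.
have E b : t - 1 <= b -> f b = f (t - 1).
  move=> tb; apply: right_locally_constant => // s /andP[h1 h2].
  have [tau tau0 Hs] := H s; exists tau => // u su ut ub.
  rewrite /f !mE// ?(le_trans h1)//.
  have := Hs A u (lt_le_trans lA h1) su ut; rewrite -/(P u) -/(P s).
  by move=> e; rewrite -(subrK (y s) (y u)) e; ring.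
have At : A < t by rewrite /A; lra.
have D : is_derive t (1 : R) (fun x => P x + f (t - 1)) (N t + 0).
  by have D1 := PD _ At; exact: is_deriveD.
rewrite addr0 in D.
have N1 : \forall x \near t, t - 1 <= x.
  by apply/nearP; exists 1 => // x; rewrite ltr_norml => /andP[h1 _]; lra.
apply: near_eq_is_derive D; apply: filterS N1 => x tx.
by rewrite -(E x)// /f mE// addrC subrK.
Qed.

(** The base point A only has to lie to the left of the times considered; see
    [primitive]. *)
Definition cprim (f : R -> R[i]) (A x : R) : R[i] := cintegral A x f.

Lemma cprim_der f A x : Ccont f -> A < x -> Cder (cprim f A) x (f x).
Proof. by move=> [cr ci] Ax; split; exact: primitive. Qed.

Lemma Cder_of_increments (y N : R -> R[i]) : Ccont y -> Ccont N ->
  (forall t0, exists2 tau : R, 0 < tau & forall A b, A < t0 -> t0 <= b -> b < t0 + tau ->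
    y b - y t0 = cprim N A b - cprim N A t0) ->
  forall t, Cder y t (N t).
Proof.
move=> [cyr cyi] [cNr cNi] H t; split.
  apply: (der_of_increments cyr cNr) => t0; have [tau tau0 Ht] := H t0.
  exists tau => // A b h1 h2 h3; have /(congr1 (@complex.Re R)) := Ht A b h1 h2 h3.
  by rewrite !RIE.
apply: (der_of_increments cyi cNi) => t0; have [tau tau0 Ht] := H t0.
exists tau => // A b h1 h2 h3; have /(congr1 (@complex.Im R)) := Ht A b h1 h2 h3.
by rewrite !RIE.
Qed.

Lemma eq_of_small (z : R[i]) : (forall e : R, 0 < e -> nc z <= e) -> z = 0.
Proof.
move=> H; apply: nc_eq0; apply/eqP; rewrite eq_le nc_ge0 andbT.
by apply/ler_addgt0Pr => e e0; rewrite add0r H.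
Qed.

(** The average with m = 1 gives r a_10 + r^3 a_21 = o(r^3), hence first a_10
    = 0 and then a_21 = 0. *)
Lemma jet_zero (a : nat -> nat -> R[i]) :
  (forall e : R, 0 < e -> exists2 r : R, 0 < r & forall zeta, nc zeta < r ->
     nc (jet a zeta) <= e * nc zeta ^+ 3) ->
  [/\ a 2%N 0%N = 0, a 1%N 1%N = 0, a 1%N 0%N = 0 & a 2%N 1%N = 0].
Proof.
move=> H.
have HA m e : 0 < e -> exists2 r0 : R, 0 < r0 & forall r, 0 < r -> r < r0 ->
    nc (avg m (fun l => jet a (node r l))) <= e * r ^+ 3.
  move=> e0; have [r0 r00 Hr] := H _ e0; exists r0 => // r rp rr.
  apply: nc_avg => l; have nr : nc (node r l) = r by rewrite nc_node// ltW.
  by rewrite -{2}nr; apply: Hr; rewrite nr.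
have two z : (forall e : R, 0 < e -> exists2 r0 : R, 0 < r0 & forall r, 0 < r -> r < r0 ->
    nc ((r ^+ 2)%:C * z) <= e * r ^+ 3) -> z = 0.
  move=> hz; apply: eq_of_small => e e0; have [r0 r00 Hr] := hz e e0.
  pose r := Num.min (r0 / 2) 1.
  have rp : 0 < r by rewrite lt_min ltr01 divr_gt0.
  have rr : r < r0 by rewrite gt_min ltr_pdivrMr// ltr_pMr// ltr1n.
  have r1 : r <= 1 by rewrite ge_min lexx orbT.
  have r2 : 0 < r ^+ 2 by rewrite exprn_gt0.
  have := Hr r rp rr; rewrite ncM nc_real (ger0_norm (ltW r2)).
  have -> : e * r ^+ 3 = r ^+ 2 * (e * r) by ring.
  by rewrite ler_pM2l// => /le_trans; apply; rewrite ler_piMr// ltW.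
have a20 : a 2%N 0%N = 0.
  by apply: two => e e0; have [r0 r00 Hr] := HA 2%N _ e0; exists r0 => // r h1 h2; rewrite -avg_jet2 Hr.
have a11 : a 1%N 1%N = 0.
  by apply: two => e e0; have [r0 r00 Hr] := HA 0%N _ e0; exists r0 => // r h1 h2; rewrite -avg_jet0 Hr.
have a10 : a 1%N 0%N = 0.
  apply: eq_of_small => e e0; have [r0 r00 Hr] := HA 1%N _ ltr01.
  pose K := 1 + nc (a 2%N 1%N).
  have Kp : 0 < K by rewrite ltr_pwDl// nc_ge0.
  pose r := Num.min (Num.min (r0 / 2) 1) (e / K).
  have rp : 0 < r by rewrite !lt_min ltr01 !divr_gt0.
  have rr : r < r0 by rewrite !gt_min ltr_pdivrMr// ltr_pMr// ltr1n.
  have r1 : r <= 1 by rewrite !ge_min lexx orbT.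
  have re : r <= e / K by rewrite !ge_min lexx orbT.
  have := Hr r rp rr; rewrite avg_jet1 mul1r => hw.
  have h1 := ncB (r%:C * a 1%N 0%N + (r ^+ 3)%:C * a 2%N 1%N) ((r ^+ 3)%:C * a 2%N 1%N).
  have r3 : 0 <= r ^+ 3 by rewrite exprn_ge0// ltW.
  rewrite addrK !ncM !nc_real (ger0_norm (ltW rp)) (ger0_norm r3) in h1.
  have h2 : r * nc (a 1%N 0%N) <= r * (r ^+ 2 * K).
    apply: (le_trans h1); have -> : r * (r ^+ 2 * K) = r ^+ 3 + r ^+ 3 * nc (a 2%N 1%N) by rewrite /K; ring.
    by rewrite lerD2r.
  rewrite ler_pM2l// in h2; apply: (le_trans h2).
  rewrite -ler_pdivlMr//; apply: le_trans re.
  by rewrite expr2 ler_piMl// ltW.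
have a21 : a 2%N 1%N = 0.
  apply: eq_of_small => e e0; have [r0 r00 Hr] := HA 1%N _ e0.
  have rp : 0 < r0 / 2 by rewrite divr_gt0.
  have rr : r0 / 2 < r0 by rewrite ltr_pdivrMr// ltr_pMr// ltr1n.
  have := Hr _ rp rr; rewrite avg_jet1 a10 mulr0 add0r ncM nc_real ger0_norm; last by rewrite exprn_ge0// ltW.
  by rewrite mulrC ler_pM2r// exprn_gt0.
by [].
Qed.

Lemma jetB (a b : nat -> nat -> R[i]) z : jet a z - jet b z = jet (fun j k => a j k - b j k) z.
Proof. by rewrite /jet -sumrB; apply: eq_bigr => p _; rewrite mulrBl. Qed.

Lemma Cder_jet (a : R -> nat -> nat -> R[i]) (da : nat -> nat -> R[i]) t z :
  (forall p, p \in exps -> Cder (fun s => a s p.1 p.2) t (da p.1 p.2)) ->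
  Cder (fun s => jet (a s) z) t (jet da z).
Proof.
rewrite /jet; elim: exps => [|p s IH] H.
  by apply: (Cder_eq (Cder_cst 0 t)) => [u|]; rewrite big_nil.
apply: (Cder_eq (f := fun u => mono p z * a u p.1 p.2 + \sum_(q <- s) a u q.1 q.2 * mono q z)
   (z := mono p z * da p.1 p.2 + \sum_(q <- s) da q.1 q.2 * mono q z)) => [|u|].
- apply: CderD; first by apply: CderZ; apply: H; rewrite mem_head.
  by apply: IH => q qs; apply: H; rewrite inE qs orbT.
- by rewrite big_cons mulrC.
- by rewrite big_cons mulrC.
Qed.

End Increments.

Section Coefficients.
Context {R : realType} {n : nat} {h : R} (h0 : 0 < h).
Local Notation X := (history h n).
Local Notation CX := (chistory h n).
Variables (F : R * X -> 'cV[R]_n) (xb : 'cV[R]_n) (Y : R -> nat -> nat -> CX).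
Local Notation xbar := (cst_history h xb).
Hypothesis Yfam : has_solution_family F xb Y.
Hypothesis Yc : forall p, p \in exps -> continuous (fun t => Y t p.1 p.2).

Lemma cev_cont (u : R -> CX) (th : R -> R) i : continuous u -> continuous th ->
  Ccont (fun s => cev (u s) (th s) i).
Proof.
move=> cu cth; apply/CcontP => t e e0.
have e4 : 0 < e / 4 by rewrite divr_gt0.
have e2 : 0 < e / 2 by rewrite divr_gt0.
have c1 : Ccont (fun s => cev (u t) (th s) i).
  split => s /=.
    apply: (@continuous_comp _ _ _ th (fun y => (u t).1 y i 0)); first exact: cth.
    exact: (proj1 (vcontP _ _) (@hist_cont _ _ _ (u t).1 (th s)) i).
  apply: (@continuous_comp _ _ _ th (fun y => (u t).2 y i 0)); first exact: cth.
  exact: (proj1 (vcontP _ _) (@hist_cont _ _ _ (u t).2 (th s)) i).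
have h1 := proj1 (CcontP _) c1 t _ e2.
have /cvgrPdist_lt/(_ _ e4) h2 := cu t.
apply: filterS2 h1 h2 => s h1 h2.
have -> : cev (u s) (th s) i - cev (u t) (th t) i =
    (cev (u t) (th s) i - cev (u t) (th t) i) - cev (u t - u s) (th s) i.
  by rewrite cevB; ring.
apply: (le_lt_trans (ncB _ _)).
have h3 := nc_cev (u t - u s) (th s) i.
have aux (a b d : R) : a < e / 2 -> b <= 2 * d -> d < e / 4 -> a + b < e by lra.
exact: (aux _ _ _ h1 h3 h2).
Qed.

Lemma cev_dist (u v : CX) (K : R) theta i : `|u - v| <= K -> nc (cev u theta i - cev v theta i) <= 2 * K.
Proof. by move=> uv; rewrite -cevB; apply: (le_trans (nc_cev _ _ _)); rewrite ler_wpM2l. Qed.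

Lemma solution_value x t theta i : continuous x -> - h <= theta <= 0 ->
  cev (of_real (segment h x t - xbar)) theta i = (x (t + theta) i 0 - xb i 0)%:C.
Proof.
move=> cx th; rewrite cev_real hev_B (segmentE h0)// clamp_id//.
by rewrite (cst_historyE h0).
Qed.

(** The exponents whose coefficients are determined by [jet_zero]. *)
Definition low : seq (nat * nat) := [:: (1, 0); (1, 1); (2, 0); (2, 1)]%N.

Lemma jet_zero_low (a : nat -> nat -> R[i]) :
  (forall e : R, 0 < e -> exists2 r : R, 0 < r & forall zeta, nc zeta < r ->
     nc (jet a zeta) <= e * nc zeta ^+ 3) -> forall p, p \in low -> a p.1 p.2 = 0.
Proof.
move=> /jet_zero[h1 h2 h3 h4] p; rewrite !inE.
by do ?[case/orP]; move=> /eqP ->.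
Qed.

Lemma low_exps p : p \in low -> p \in exps.
Proof. by rewrite !inE; do ?[case/orP]; move=> /eqP ->. Qed.

(** The histories at s and t belong to the same function x, and the two
    evaluations refer to the same time s + theta = t + theta'. *)
Lemma translation_local t0 : exists2 tau : R, 0 < tau & forall s t theta theta' i p,
  t0 <= s -> s < t0 + tau -> t0 <= t -> t < t0 + tau ->
  - h <= theta <= 0 -> - h <= theta' <= 0 -> s + theta = t + theta' -> p \in low ->
  cev (Y s p.1 p.2) theta i = cev (Y t p.1 p.2) theta' i.
Proof.
have [tau [K [Ky [r1 [tau0 [K0 Ky0 r10] _ Hx]]]]] := Yfam t0.
exists tau => // s t theta theta' i p s1 s2 t1 t2 th th' E pl; apply/eqP; rewrite -subr_eq0; apply/eqP.
pose a j k := cev (Y s j k) theta i - cev (Y t j k) theta' i.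
rewrite -/(a p.1 p.2); apply: (jet_zero_low _ pl) => e e0.
pose K' := 4 * K + 1.
have K'0 : 0 < K' by rewrite ltr_wpDl// mulr_ge0.
exists (Num.min r1 (e / K')); first by rewrite lt_min r10 divr_gt0.
move=> zeta; rewrite lt_min => /andP[z1 z2].
have [x [cx _ xE]] := Hx zeta z1.
have z0 := nc_ge0 zeta.
have e1 := cev_dist theta i (xE s s1 s2); have e2 := cev_dist theta' i (xE t t1 t2).
rewrite !solution_value// !cev_jetX E in e1 e2.
rewrite /a -jetB.
move: e1 e2; move: (_%:C) (jet _ _) (jet _ _) => w j1 j2 e1 e2.
rewrite (_ : j2 - j1 = (w - j1) - (w - j2)); last by ring.
apply: (le_trans (ncB _ _)); apply: (le_trans (lerD e2 e1)).
have -> : 2 * (K * nc zeta ^+ 4) + 2 * (K * nc zeta ^+ 4) = 4 * K * nc zeta * nc zeta ^+ 3 by ring.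
rewrite ler_wpM2r ?exprn_ge0//.
move: z2; rewrite ltr_pdivlMr// => /ltW; apply: le_trans; rewrite mulrC ler_wpM2l//.
by rewrite lerDl.
Qed.

(** The value at the fixed time t + theta is followed along the histories that
    contain it. *)
Lemma translation t theta i p : - h <= theta <= 0 -> p \in low ->
  cev (Y t p.1 p.2) theta i = cev (Y (t + theta) p.1 p.2) 0 i.
Proof.
move=> /andP[th1 th2] pl.
(* The history at time t + theta + s, evaluated at the fixed time t + theta. *)
pose f s := cev (Y (t + theta + s) p.1 p.2) (- s) i.
have cY : continuous (fun s => Y (t + theta + s) p.1 p.2).
  move=> s; apply: (@continuous_comp _ _ _ (fun s => t + theta + s) (fun t => Y t p.1 p.2)).
    by apply: cvgD; [exact: cvg_cst|exact: cvg_id].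
  exact: (Yc (low_exps pl)).
have [cfr cfi] : Ccont f.
  by apply: cev_cont => // s; apply: cvgN; exact: cvg_id.
have s0 : 0 <= - theta by rewrite oppr_ge0.
have loc s : 0 <= s < - theta -> exists2 d : R, 0 < d & forall u, s <= u -> u < s + d -> u <= - theta ->
    f u = f s.
  move=> /andP[g1 g2]; have [tau tau0 Ht] := translation_local (t + theta + s).
  exists tau => // u su ut uth; by apply: Ht => //; try (apply/andP; split); lra.
have E : f (- theta) = f 0.
  apply: complexP.
    apply: (right_locally_constant s0 cfr) => s /loc[d d0 hd]; exists d => // u u1 u2 u3.
    by rewrite hd.
  apply: (right_locally_constant s0 cfi) => s /loc[d d0 hd]; exists d => // u u1 u2 u3.
  by rewrite hd.
by move: E; rewrite /f opprK oppr0 addr0 addrK.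
Qed.

End Coefficients.

Section ODE.
Context {R : realType} {n : nat} {h : R} (h0 : 0 < h).
Local Notation X := (history h n).
Local Notation CX := (chistory h n).
Variables (F : R * X -> 'cV[R]_n) (xb : 'cV[R]_n) (Y : R -> nat -> nat -> CX).
Local Notation xbar := (cst_history h xb).
Hypothesis Yfam : has_solution_family F xb Y.
Hypothesis Yc : forall p, p \in exps -> continuous (fun t => Y t p.1 p.2).

Variable i : 'I_n.
Variables (l : X -> R) (b : R -> X -> X -> R) (c : R -> X -> X -> X -> R).
Hypothesis ll : forall a (u v : X), l (a *: u + v) = a * l u + l v.
Hypothesis bl : forall t a (u v w : X), b t (a *: u + v) w = a * b t u w + b t v w.
Hypothesis bs : forall t u v, b t u v = b t v u.
Hypothesis cl : forall t a (u v w x : X), c t (a *: u + v) w x = a * c t u w x + c t v w x.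
Hypothesis cs12 : forall t u v w, c t u v w = c t v u w.
Hypothesis cs23 : forall t u v w, c t u v w = c t u w v.
Hypothesis bounds : forall t0, exists M r : R, [/\ 0 <= M, 0 < r &
  forall t, t0 <= t -> t < t0 + r -> [/\ forall u, `|l u| <= M * `|u|,
    forall u v, `|b t u v| <= M * (`|u| * `|v|) &
    forall u v w, `|c t u v w| <= M * (`|u| * (`|v| * `|w|))]].
Hypothesis lc : forall x : R -> X, continuous x -> continuous (fun t => l (x t)).
Hypothesis bc : forall x y : R -> X, continuous x -> continuous y ->
  continuous (fun t => b t (x t) (y t)).
Hypothesis cc : forall x y z : R -> X, continuous x -> continuous y -> continuous z ->
  continuous (fun t => c t (x t) (y t) (z t)).
Hypothesis taylor : forall a1 b1 e : R, a1 <= b1 -> 0 < e -> exists2 r : R, 0 < r & forall t d,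
  a1 <= t <= b1 -> `|d| < r ->
  `|F (t, xbar + d) i 0 - (l d + b t d d / 2 + c t d d d / 6)| <= e * `|d| ^+ 3.

Lemma zero_itv : - h <= (0 : R) <= 0.
Proof. by rewrite lexx oppr_le0 (ltW h0). Qed.

Lemma fst_cont (u : R -> CX) : continuous u -> continuous (fun t => (u t).1).
Proof. by move=> cu t; apply: (@continuous_comp _ _ _ u fst); [exact: cu|exact: cvg_fst]. Qed.

Lemma snd_cont (u : R -> CX) : continuous u -> continuous (fun t => (u t).2).
Proof. by move=> cu t; apply: (@continuous_comp _ _ _ u snd); [exact: cu|exact: cvg_snd]. Qed.

Lemma lC_cont (u : R -> CX) : continuous u -> Ccont (fun t => lC l (u t)).
Proof. by move=> cu; split => /=; apply: lc; [exact: fst_cont|exact: snd_cont]. Qed.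

Lemma bC_cont (u v : R -> CX) : continuous u -> continuous v -> Ccont (fun t => bC (b t) (u t) (v t)).
Proof.
move=> cu cv; have u1 := fst_cont cu; have u2 := snd_cont cu.
have v1 := fst_cont cv; have v2 := snd_cont cv.
split => /=; first by apply: contD; [exact: bc|apply: contN; exact: bc].
by apply: contD; exact: bc.
Qed.

Lemma tC_cont (u v w : R -> CX) : continuous u -> continuous v -> continuous w ->
  Ccont (fun t => tC (c t) (u t) (v t) (w t)).
Proof.
move=> cu cv cw; have u1 := fst_cont cu; have u2 := snd_cont cu.
have v1 := fst_cont cv; have v2 := snd_cont cv.
have w1 := fst_cont cw; have w2 := snd_cont cw.
split => /=.
  by do 3?[apply: contD]; try apply: contN; exact: cc.
by do 3?[apply: contD]; try apply: contN; exact: cc.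
Qed.

Lemma taylor_jet_cont p : p \in exps ->
  Ccont (fun t => taylor_jet l (b t) (c t) (Y t) p.1 p.2).
Proof.
move=> pe; rewrite /taylor_jet.
apply: CcontD; first by apply: lC_cont; exact: Yc.
have Y10 : continuous (fun t => Y t 1%N 0%N) by exact: (@Yc (1, 0)%N).
have Y01 : continuous (fun t => Y t 0%N 1%N) by exact: (@Yc (0, 1)%N).
have Y20 : continuous (fun t => Y t 2%N 0%N) by exact: (@Yc (2, 0)%N).
have Y02 : continuous (fun t => Y t 0%N 2%N) by exact: (@Yc (0, 2)%N).
have Y11 : continuous (fun t => Y t 1%N 1%N) by exact: (@Yc (1, 1)%N).
case: p pe => [[|[|[|[|j]]]] [|[|[|[|k]]]]] /= pe; try discriminate pe; try exact: Ccont_cst.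
- by apply: CcontM (Ccont_cst _); exact: bC_cont.
- by apply: CcontD; [exact: bC_cont|apply: CcontM (Ccont_cst _); exact: tC_cont].
- exact: bC_cont.
- apply: CcontD; last by apply: CcontM (Ccont_cst _); exact: tC_cont.
  by apply: CcontD; exact: bC_cont.
- by apply: CcontM (Ccont_cst _); exact: bC_cont.
- apply: CcontD; last by apply: CcontM (Ccont_cst _); exact: tC_cont.
  by apply: CcontD; exact: bC_cont.
- by apply: CcontD; [exact: bC_cont|apply: CcontM (Ccont_cst _); exact: tC_cont].
Qed.

(** Along the solution with amplitude zeta the equation says that d/dt jet (y
    t) zeta equals jet (taylor_jet (Y t)) zeta up to o(|zeta|^3). Only the
    increments can be compared, since the jet describes x and not its
    derivative. *)
Lemma increments_local t0 : exists2 tau : R, 0 < tau & forall A b1 p, A < t0 -> t0 <= b1 -> b1 < t0 + tau ->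
  p \in low -> cev (Y b1 p.1 p.2) 0 i - cev (Y t0 p.1 p.2) 0 i =
    cprim (fun t => taylor_jet l (b t) (c t) (Y t) p.1 p.2) A b1 -
    cprim (fun t => taylor_jet l (b t) (c t) (Y t) p.1 p.2) A t0.
Proof.
have three (r' a1 a2 a3 B : R) : 0 <= r' -> 0 <= a1 -> 0 <= a2 -> 0 <= a3 ->
    r' * (a1 + a2 + a3 + 1) < B -> [/\ r' * a1 < B, r' * a2 < B & r' * a3 < B].
  by move=> h1 h2 h3 h4 hB; split; apply: le_lt_trans hB; rewrite ler_wpM2l//; lra.
have [tau1 [K [Ky [r1 [tau10 [K0 Ky0 r10] YK Hx]]]]] := Yfam t0.
have [M [rM [M0 rM0 HM]]] := bounds t0.
have [K' K'0 COMP] := @composition R n h h0 _ _ _ M0 K0 Ky0.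
exists (Num.min tau1 rM); first by rewrite lt_min tau10.
move=> A b1 p At0 tb; rewrite -ltrBlDl lt_min !ltrBlDl => /andP[b1tau b1M] pl.
pose N t j k := taylor_jet l (b t) (c t) (Y t) j k.
pose Q t j k := cprim (fun t => N t j k) A t.
pose y t j k := cev (Y t j k) 0 i.
apply/eqP; rewrite -subr_eq0; apply/eqP.
pose a j k := y b1 j k - y t0 j k - (Q b1 j k - Q t0 j k).
rewrite -/(a p.1 p.2); apply: (jet_zero_low _ pl) => e e0.
have QD t zeta : A < t -> Cder (fun s => jet (Q s) zeta) t (jet (N t) zeta).
  by move=> At; apply: Cder_jet => q qe; apply: cprim_der => //; exact: taylor_jet_cont.
pose G := 18 * Ky + K.
have G0 : 0 <= G by rewrite addr_ge0 ?mulr_ge0.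
pose D := 4 * (b1 - t0) + 1.
have b10 : 0 <= b1 - t0 by rewrite subr_ge0.
have D0 : 0 < D by rewrite ltr_wpDl// mulr_ge0.
pose e1 := e / (2 * D).
have e10 : 0 < e1 by rewrite divr_gt0// mulr_gt0.
pose e2 := e1 / (G ^+ 3 + 1).
have G3 : 0 < G ^+ 3 + 1 by rewrite ltr_wpDl// exprn_ge0.
have e20 : 0 < e2 by rewrite divr_gt0.
have [rt rt0 Ht] := taylor tb e20.
exists (Num.min (Num.min 1 r1) (Num.min rt 1 / (G + K' / e1 + 8 * K / e + 1))).
  rewrite !lt_min ltr01 r10 divr_gt0// ?lt_min ?rt0 ?ltr01//.
  by rewrite ltr_wpDl// !addr_ge0 ?divr_ge0 ?mulr_ge0// ltW.
move=> zeta; rewrite !lt_min => /andP[/andP[z1 zr1]].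
rewrite ltr_pdivlMr; last by rewrite ltr_wpDl// !addr_ge0 ?divr_ge0 ?mulr_ge0// ltW.
have z0 := nc_ge0 zeta; set r := nc zeta in z0 z1 zr1 *.
rewrite lt_min => /andP[zz1 zz2].
have v1 : 0 <= K' / e1 by rewrite divr_ge0// ltW.
have v2 : 0 <= 8 * K / e by rewrite divr_ge0 ?mulr_ge0// ltW.
have [zG _ _] := three _ _ _ _ _ z0 G0 v1 v2 zz1.
have [_ zK' zK] := three _ _ _ _ _ z0 G0 v1 v2 zz2.
rewrite mulrC in zG.
have {}zK' : K' * r <= e1.
  by move/ltW: zK'; rewrite mulrA ler_pdivrMr// mul1r mulrC.
have {}zK : 8 * K * r <= e.
  by move/ltW: zK; rewrite mulrA ler_pdivrMr// mul1r mulrC.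
have {zz1 zz2} r3 : 0 <= r ^+ 3 by rewrite exprn_ge0.
have [x [cx [_ dx] xE]] := Hx zeta zr1.
have r43 : r ^+ 4 = r * r ^+ 3 by rewrite exprS.
have r4l : r ^+ 4 <= r.
  by rewrite exprSr ler_piMl// exprn_ile1// ltW.
pose f t := F (t, segment h x t) i 0.
(* The derivative of w is o(|zeta|^3), so x and the jet of primitives have the
  same increments up to that order. *)
pose w t := (x t i 0)%:C - jet (Q t) zeta.
have wder t : t0 < t < b1 -> Cder w t ((f t)%:C - jet (N t) zeta).
  move=> /andP[g1 g2]; apply: CderB; last by apply: QD; exact: lt_trans g1.
  have dxt : is_derive t (1 : R) x (F (t, segment h x t)).
    by apply: dx; rewrite g1 (lt_trans g2).
  split => /=; last exact: is_derive_cst.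
  exact: (proj1 (is_derive_vecP _ _ _) dxt i).
have wbnd t : t0 < t < b1 -> nc ((f t)%:C - jet (N t) zeta) <= 2 * e1 * r ^+ 3.
  move=> /andP[/ltW g1 /ltW g2]; pose u : X := segment h x t - xbar.
  have gt1 : t < t0 + tau1 := le_lt_trans g2 b1tau.
  have [hl hb hc] := HM t g1 (le_lt_trans g2 b1M).
  have uE := xE t g1 gt1.
  have uG : `|u| <= G * r.
    rewrite -cnorm_real -(subrK (jetX (Y t) zeta) (of_real u)).
    apply: (le_trans (ler_normD _ _)); rewrite addrC mulrDl; apply: lerD.
      by apply: jetX_bound; [exact: Ky0|exact: ltW|exact: YK].
    by apply: (le_trans uE); rewrite ler_wpM2l.
  have h1 := COMP l (b t) (c t) ll (bl t) (bs t) (cl t) (cs12 t) (cs23 t) hl hb hc (Y t) zeta u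
    (YK t g1 gt1) (ltW z1) uE.
  have h2 : `|f t - (l u + b t u u / 2 + c t u u u / 6)| <= e2 * `|u| ^+ 3.
    have -> : f t = F (t, xbar + u) i 0 by rewrite /f /u addrC subrK.
    by apply: Ht; [rewrite g1 g2|exact: le_lt_trans zG].
  have -> : (f t)%:C - jet (N t) zeta = (f t - (l u + b t u u / 2 + c t u u u / 6))%:C +
      ((l u + b t u u / 2 + c t u u u / 6)%:C - jet (N t) zeta).
    by rewrite rmorphB /=; ring.
  apply: (le_trans (ncD _ _)); rewrite nc_real.
  have -> : 2 * e1 * r ^+ 3 = e1 * r ^+ 3 + e1 * r ^+ 3 by ring.
  apply: lerD.
    apply: (le_trans h2); apply: (@le_trans _ _ (e2 * (G * r) ^+ 3)).
      by rewrite ler_wpM2l ?(ltW e20)//; apply: lerXn2r; rewrite ?nnegrE ?mulr_ge0.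
    rewrite exprMn mulrA ler_wpM2r// /e2 mulrAC ler_pdivrMr// ler_wpM2l ?(ltW e10)//.
    by rewrite lerDl.
  by apply: (le_trans h1); rewrite -/r r43 mulrA ler_wpM2r.
have wcont t : A < t -> {for t, continuous (fun s => Re (w s))} /\ {for t, continuous (fun s => Im (w s))}.
  move=> At; have [c1 c2] := Cder_cont (QD t zeta At).
  have c3 : {for t, continuous (fun s => x s i 0)} by exact: (proj1 (vcontP _ _) (cx t) i).
  rewrite (_ : (fun s => Re (w s)) = (fun s => x s i 0 - Re (jet (Q s) zeta))); last first.
    by apply/funext => s; rewrite /w !RIE.
  rewrite (_ : (fun s => Im (w s)) = (fun s => 0 - Im (jet (Q s) zeta))); last first.
    by apply/funext => s; rewrite /w !RIE.
  by split; apply: cvgB => //; exact: cvg_cst.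
have wmv : nc (w b1 - w t0) <= 2 * (2 * e1 * r ^+ 3) * (b1 - t0).
  apply: (Cmvt_ineq tb wder) => //.
    apply: continuous_in_subspaceT => s; rewrite inE /= in_itv /= => /andP[g1 _].
    by have [] := wcont s (lt_le_trans At0 g1).
  apply: continuous_in_subspaceT => s; rewrite inE /= in_itv /= => /andP[g1 _].
  by have [] := wcont s (lt_le_trans At0 g1).
have yx t : t0 <= t -> t < t0 + tau1 -> nc ((x t i 0 - xb i 0)%:C - jet (y t) zeta) <= 2 * (K * r ^+ 4).
  move=> g1 g2; have := cev_dist 0 i (xE t g1 g2).
  by rewrite (solution_value h0 xb t i cx zero_itv) cev_jetX addr0.
have y1 := yx b1 tb b1tau.
have y0 : nc ((x t0 i 0 - xb i 0)%:C - jet (y t0) zeta) <= 2 * (K * r ^+ 4).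
  by apply: yx => //; rewrite ltrDl.
have -> : jet a zeta = (w b1 - w t0) - ((x b1 i 0 - xb i 0)%:C - jet (y b1) zeta) +
   ((x t0 i 0 - xb i 0)%:C - jet (y t0) zeta).
  by rewrite /a -!jetB /w !rmorphB /=; ring.
apply: (le_trans (ncD _ _)).
apply: (@le_trans _ _ ((2 * (2 * e1 * r ^+ 3) * (b1 - t0) + 2 * (K * r ^+ 4)) + 2 * (K * r ^+ 4))).
  by apply: lerD y0; apply: (le_trans (ncB _ _)); exact: lerD.
have -> : 2 * (2 * e1 * r ^+ 3) * (b1 - t0) + 2 * (K * r ^+ 4) + 2 * (K * r ^+ 4) =
   (e1 * (4 * (b1 - t0)) + 4 * K * r) * r ^+ 3 by rewrite r43; ring.
rewrite ler_wpM2r// [leRHS]splitr; apply: lerD; last first.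
  by move: zK; lra.
apply: (@le_trans _ _ (e1 * D)); first by rewrite ler_wpM2l ?(ltW e10)// lerDl.
by rewrite /e1 invfM mulrA mulfVK// gt_eqF.
Qed.

(** The homological equation: comparison of the coefficients of order (j, k)
    in the delay equation. *)
Lemma coefficient_ode t p : p \in low ->
  Cder (fun t => cev (Y t p.1 p.2) 0 i) t (taylor_jet l (b t) (c t) (Y t) p.1 p.2).
Proof.
move=> pl; apply: (Cder_of_increments (N := fun t => taylor_jet l (b t) (c t) (Y t) p.1 p.2)).
- by apply: (cev_cont (th := fun=> 0)); [exact: (Yc (low_exps pl))|move=> s; exact: cst_continuous].
- exact: taylor_jet_cont (low_exps pl).
- move=> t0; have [tau tau0 Ht] := increments_local t0; exists tau => // A b1 h1 h2 h3.
  exact: Ht.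
Qed.

End ODE.

(** * The derivatives of a functional along the equilibrium *)

Section Forms.
Context {R : realType} {X : normedModType R}.
Variables (D : R * X -> seq (R * X) -> R) (xbar : X).
Hypothesis CD : C3 D.

Definition form1 (t : R) (u : X) := D (t, xbar) [:: (0, u)].
Definition form2 (t : R) (u v : X) := D (t, xbar) [:: (0, u); (0, v)].
Definition form3 (t : R) (u v w : X) := D (t, xbar) [:: (0, u); (0, v); (0, w)].

Lemma space_direction (a : R) (u v : X) : (0, a *: u + v) = a *: (0, u) + (0, v) :> R * X.
Proof. by congr pair; rewrite -[RHS]/(a * 0 + 0) mulr0 addr0. Qed.

Lemma norm_space (u : X) : `|(0, u) : R * X| = `|u|.
Proof. by rewrite prod_normE /= normr0 max_r. Qed.

Lemma norm_time (t s : R) : `|(t, xbar) - (s, xbar) : R * X| = `|t - s|.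
Proof.
have -> : (t, xbar) - (s, xbar) = (t - s, xbar - xbar) by [].
by rewrite prod_normE /= subrr normr0 max_l.
Qed.

Lemma form1_lin t a u v : form1 t (a *: u + v) = a * form1 t u + form1 t v.
Proof. by rewrite /form1 space_direction (D_lin_head CD). Qed.

Lemma form2_lin t a u v w : form2 t (a *: u + v) w = a * form2 t u w + form2 t v w.
Proof. by rewrite /form2 space_direction (D_lin_head CD). Qed.

Lemma form3_lin t a u v w x : form3 t (a *: u + v) w x = a * form3 t u w x + form3 t v w x.
Proof. by rewrite /form3 space_direction (D_lin_head CD). Qed.

Lemma form2_sym t u v : form2 t u v = form2 t v u.
Proof. by rewrite /form2 (D_sym12 CD). Qed.

Lemma form3_sym12 t u v w : form3 t u v w = form3 t v u w.
Proof. by rewrite /form3 (D_sym12 CD). Qed.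

Lemma form3_sym23 t u v w : form3 t u v w = form3 t u w v.
Proof. by rewrite /form3 (D_sym23 CD). Qed.

Lemma form_bounds t0 : exists M r : R, [/\ 0 < M, 0 < r & forall t, `|t - t0| < r ->
  [/\ forall u, `|form1 t u| <= M * `|u|,
    forall u v, `|form2 t u v| <= M * (`|u| * `|v|) &
    forall u v w, `|form3 t u v w| <= M * (`|u| * (`|v| * `|w|))]].
Proof.
have [M1 [M10 /nearP[r1 r10 h1]]] := D_bnd CD (t0, xbar) (isT : (1 <= 3)%N).
have [M2 [M20 /nearP[r2 r20 h2]]] := D_bnd CD (t0, xbar) (isT : (2 <= 3)%N).
have [M3 [M30 /nearP[r3 r30 h3]]] := D_bnd CD (t0, xbar) (isT : (3 <= 3)%N).
exists (M1 + M2 + M3), (Num.min r1 (Num.min r2 r3)).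
split; [by rewrite !addr_gt0|by rewrite !lt_min r10 r20|].
move=> t; rewrite !lt_min => /and3P[t1 t2 t3].
have aux (a p : R) : 0 <= p -> `|a| <= M1 * p -> `|a| <= (M1 + M2 + M3) * p.
  by move=> p0 h; apply: (le_trans h); rewrite ler_wpM2r// -addrA lerDl addr_ge0// ltW.
have aux2 (a p : R) : 0 <= p -> `|a| <= M2 * p -> `|a| <= (M1 + M2 + M3) * p.
  by move=> p0 h; apply: (le_trans h); rewrite ler_wpM2r// -addrA addrCA lerDl addr_ge0// ltW.
have aux3 (a p : R) : 0 <= p -> `|a| <= M3 * p -> `|a| <= (M1 + M2 + M3) * p.
  by move=> p0 h; apply: (le_trans h); rewrite ler_wpM2r// lerDr addr_ge0// ltW.
split.
- move=> u; apply: aux => //; have := h1 (t, xbar); rewrite norm_time => /(_ t1 [:: (0, u)] erefl).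
  by rewrite big_cons big_nil mulr1 norm_space.
- move=> u v; apply: aux2; first by rewrite mulr_ge0.
  have := h2 (t, xbar); rewrite norm_time => /(_ t2 [:: (0, u); (0, v)] erefl).
  by rewrite !big_cons big_nil mulr1 !norm_space.
- move=> u v w; apply: aux3; first by rewrite !mulr_ge0.
  have := h3 (t, xbar); rewrite norm_time => /(_ t3 [:: (0, u); (0, v); (0, w)] erefl).
  by rewrite !big_cons big_nil mulr1 !norm_space.
Qed.

Lemma form2_near t (e : R) : 0 < e -> \forall s \near t,
  forall u v, `|form2 s u v - form2 t u v| <= e * (`|u| * `|v|).
Proof.
move=> e0; have /nearP[r r0 hr] := D_cont CD (t, xbar) (isT : (2 <= 3)%N) e0.
apply/nearP; exists r => // s st u v.
have := hr (s, xbar); rewrite norm_time => /(_ st [:: (0, u); (0, v)] erefl).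
by rewrite !big_cons big_nil mulr1 !norm_space.
Qed.

Lemma form3_near t (e : R) : 0 < e -> \forall s \near t,
  forall u v w, `|form3 s u v w - form3 t u v w| <= e * (`|u| * (`|v| * `|w|)).
Proof.
move=> e0; have /nearP[r r0 hr] := D_cont CD (t, xbar) (isT : (3 <= 3)%N) e0.
apply/nearP; exists r => // s st u v w.
have := hr (s, xbar); rewrite norm_time => /(_ st [:: (0, u); (0, v); (0, w)] erefl).
by rewrite !big_cons big_nil mulr1 !norm_space.
Qed.

Lemma norm_cont (x : R -> X) t : continuous x -> (`|x s| @[s --> t] --> `|x t|).
Proof. by move=> cx; apply: cvg_norm; exact: cx. Qed.

Lemma dist_cont (x : R -> X) t : continuous x -> (`|x s - x t| @[s --> t] --> (0 : R)).
Proof.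
move=> cx; rewrite -(normr0 X) -(subrr (x t)); apply: cvg_norm.
by apply: cvgB; [exact: cx|exact: cvg_cst].
Qed.

Lemma form2_cont (x y : R -> X) : continuous x -> continuous y ->
  continuous (fun t => form2 t (x t) (y t)).
Proof.
move=> cx cy t; apply/cvgrPdist_lt => e e0.
have [M [r [M0 r0 hM]]] := form_bounds t.
have [_ bM _] := hM t ltac:(by rewrite subrr normr0).
pose e' := e / (`|x t| * `|y t| + 1).
have d0 : 0 < `|x t| * `|y t| + 1 by rewrite ltr_wpDl// mulr_ge0.
have e'0 : 0 < e' by rewrite divr_gt0.
pose g s := e' * (`|x s| * `|y s|) + M * (`|x s - x t| * `|y s|) + M * (`|x t| * `|y s - y t|).
have cg : g @ t --> e' * (`|x t| * `|y t|) + M * (0 * `|y t|) + M * (`|x t| * 0).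
  apply: cvgD; first apply: cvgD.
  - by apply: cvgMr; apply: cvgM; exact: norm_cont.
  - by apply: cvgMr; apply: cvgM; [exact: dist_cont|exact: norm_cont].
  - by apply: cvgMr; apply: cvgMr; exact: dist_cont.
have ge : \forall s \near t, g s < e.
  apply: (cvgr_lt _ cg); rewrite mul0r !mulr0 !addr0 /e' mulrAC ltr_pdivrMr//.
  by rewrite ltr_pM2l// ltrDl.
apply: filterS2 (form2_near t e'0) ge => s hs; apply: le_lt_trans.
rewrite distrC.
have -> : form2 s (x s) (y s) - form2 t (x t) (y t) =
   (form2 s (x s) (y s) - form2 t (x s) (y s)) + form2 t (x s - x t) (y s) + form2 t (x t) (y s - y t).
  have e1 : form2 t (x s - x t) (y s) = form2 t (x s) (y s) - form2 t (x t) (y s).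
    by have := form2_lin t (-1) (x t) (x s) (y s); rewrite scaleN1r addrC mulN1r => ->; rewrite addrC.
  have e2 : form2 t (x t) (y s - y t) = form2 t (x t) (y s) - form2 t (x t) (y t).
    rewrite !(form2_sym t (x t)).
    by have := form2_lin t (-1) (y t) (y s) (x t); rewrite scaleN1r addrC mulN1r => ->; rewrite addrC.
  by rewrite e1 e2; ring.
apply: (le_trans (ler_normD _ _)); apply: lerD; last exact: bM.
apply: (le_trans (ler_normD _ _)); apply: lerD; last exact: bM.
exact: hs.
Qed.

Lemma form3_cont (x y z : R -> X) : continuous x -> continuous y -> continuous z ->
  continuous (fun t => form3 t (x t) (y t) (z t)).
Proof.
move=> cx cy cz t; apply/cvgrPdist_lt => e e0.
have [M [r [M0 r0 hM]]] := form_bounds t.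
have [_ _ cM] := hM t ltac:(by rewrite subrr normr0).
pose e' := e / (`|x t| * (`|y t| * `|z t|) + 1).
have d0 : 0 < `|x t| * (`|y t| * `|z t|) + 1 by rewrite ltr_wpDl// !mulr_ge0.
have e'0 : 0 < e' by rewrite divr_gt0.
pose g s := e' * (`|x s| * (`|y s| * `|z s|)) + M * (`|x s - x t| * (`|y s| * `|z s|)) +
  M * (`|x t| * (`|y s - y t| * `|z s|)) + M * (`|x t| * (`|y t| * `|z s - z t|)).
have cg : g @ t --> e' * (`|x t| * (`|y t| * `|z t|)) + M * (0 * (`|y t| * `|z t|)) +
    M * (`|x t| * (0 * `|z t|)) + M * (`|x t| * (`|y t| * 0)).
  apply: cvgD; first apply: cvgD; first apply: cvgD.
  - by apply: cvgMr; apply: cvgM; [exact: norm_cont|apply: cvgM; exact: norm_cont].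
  - by apply: cvgMr; apply: cvgM; [exact: dist_cont|apply: cvgM; exact: norm_cont].
  - by apply: cvgMr; apply: cvgMr; apply: cvgM; [exact: dist_cont|exact: norm_cont].
  - by apply: cvgMr; apply: cvgMr; apply: cvgMr; exact: dist_cont.
have ge : \forall s \near t, g s < e.
  apply: (cvgr_lt _ cg); rewrite !mul0r !mulr0 !addr0 /e' mulrAC ltr_pdivrMr//.
  by rewrite ltr_pM2l// ltrDl.
apply: filterS2 (form3_near t e'0) ge => s hs; apply: le_lt_trans.
rewrite distrC.
have lin1 u v p q : form3 t (u - v) p q = form3 t u p q - form3 t v p q.
  by have := form3_lin t (-1) v u p q; rewrite scaleN1r addrC mulN1r => ->; rewrite addrC.
have lin2 u v p q : form3 t p (u - v) q = form3 t p u q - form3 t p v q.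
  by rewrite form3_sym12 lin1 !(form3_sym12 t p).
have lin3 u v p q : form3 t p q (u - v) = form3 t p q u - form3 t p q v.
  by rewrite form3_sym23 lin2 !(form3_sym23 t p q).
have -> : form3 s (x s) (y s) (z s) - form3 t (x t) (y t) (z t) =
   (form3 s (x s) (y s) (z s) - form3 t (x s) (y s) (z s)) + form3 t (x s - x t) (y s) (z s) +
   form3 t (x t) (y s - y t) (z s) + form3 t (x t) (y t) (z s - z t).
  by rewrite lin1 lin2 lin3; ring.
apply: (le_trans (ler_normD _ _)); apply: lerD; last exact: cM.
apply: (le_trans (ler_normD _ _)); apply: lerD; last exact: cM.
apply: (le_trans (ler_normD _ _)); apply: lerD; last exact: cM.
exact: hs.
Qed.

(** By compactness the radii of [D_taylor] at the base points of the interval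
    have a positive lower bound. *)
Lemma taylor_uniform (a b e : R) : (forall t, D (t, xbar) [::] = 0) -> 0 < e ->
  exists2 r : R, 0 < r & forall t d, a <= t <= b -> `|d| < r ->
  `|D (t, xbar + d) [::] - (form1 t d + form2 t d d / 2 + form3 t d d d / 6)| <= e * `|d| ^+ 3.
Proof.
move=> D0 e0.
pose P (r t : R) := forall d, `|d| < r ->
  `|D (t, xbar + d) [::] - (form1 t d + form2 t d d / 2 + form3 t d d d / 6)| <= e * `|d| ^+ 3.
have H : \forall r \near (0 : R)^'+, `[a, b] `<=` P r.
  apply: (proj1 (compact_near_coveringP _) (@segment_compact R a b)) => t _.
  have [r0 r00 Hr] := D_taylor CD (t, xbar) e0.
  have N1 : \forall s \near t, `|s - t| < r0 by apply/nearP; exists r0.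
  have N2 : \forall r \near (0 : R)^'+, r < r0 by exact: nbhs_right_lt.
  exists ([set s | `|s - t| < r0], [set r | r < r0]) => //= -[s r] /= [h1 h2] d dr.
  have dr0 : `|d| < r0 := lt_trans dr h2.
  have := Hr (s, xbar) (0, d); rewrite norm_time norm_space => /(_ h1 dr0).
  have -> : (s, xbar) + (0, d) = (s, xbar + d) by rewrite -[LHS]/(s + 0, xbar + d) addr0.
  rewrite D0 subr0 -/(form1 s d) -/(form2 s d d) -/(form3 s d d d).
  by rewrite !opprD !addrA.
near (0 : R)^'+ => r; exists r; first by near: r; exact: nbhs_right_gt.
move=> t d tab; have Hr : `[a, b] `<=` P r by near: r.
by apply: Hr; rewrite /= in_itv.
Unshelve. all: by end_near. Qed.

End Forms.

Section Vector.
Context {R : realType} {n : nat}.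

(** Used to pass from estimates on each coordinate to one estimate on vectors. *)
Lemma fin_choice (I : finType) (P : I -> R -> R -> Prop) :
  (forall i r M r' M', P i r M -> r' <= r -> M <= M' -> P i r' M') ->
  (forall i, exists r M, [/\ 0 < r, 0 < M & P i r M]) ->
  exists r M, [/\ 0 < r, 0 < M & forall i, P i r M].
Proof.
move=> mono H.
have : forall s : seq I, exists r M, [/\ 0 < r, 0 < M & forall i, i \in s -> P i r M].
  elim=> [|i s [r [M [r0 M0 Hs]]]]; first by exists 1, 1; split.
  have [r' [M' [r'0 M'0 Hi]]] := H i.
  exists (Num.min r r'), (Num.max M M'); split; first by rewrite lt_min r0.
    by rewrite lt_max M0.
  move=> j; rewrite inE => /orP[/eqP ->|js].
    by apply: mono Hi _ _; rewrite ?ge_min ?le_max lexx orbT.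
  by apply: mono (Hs j js) _ _; rewrite ?ge_min ?le_max lexx.
move=> /(_ (enum I))[r [M [r0 M0 Hs]]]; exists r, M; split => // i.
by apply: Hs; rewrite mem_enum.
Qed.

Context {E : normedModType R}.
Variable (F : E -> 'cV[R]_n) (D : E -> seq E -> 'cV[R]_n).
Hypothesis DF : forall x, D x [::] = F x.
Hypothesis CD : forall i, C3 (fun x s => D x s i 0).

Lemma C3_vector_cont : continuous F.
Proof.
move=> x; apply/vcontP => i; apply/cvgrPdist_lt => e e0.
have e2 : 0 < e / 2 by rewrite divr_gt0.
have := D_cont (CD i) x (isT : (0 <= 3)%N) e2; apply: filterS => y /(_ [::] erefl).
rewrite big_nil mulr1 !DF distrC => /le_lt_trans; apply.
by rewrite ltr_pdivrMr// ltr_pMr// ltr1n.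
Qed.

Lemma C3_vector_lipschitz x0 : exists r M : R, [/\ 0 < r, 0 < M & forall x y,
  `|x - x0| < r -> `|y - x0| < r -> `|F x - F y| <= M * `|x - y|].
Proof.
pose P i r M := forall x y, `|x - x0| < r -> `|y - x0| < r -> `|F x i 0 - F y i 0| <= M * `|x - y|.
have [] := @fin_choice 'I_n P.
- move=> i r M r' M' h1 rr MM x y xr yr; apply: (@le_trans _ _ (M * `|x - y|)).
    by apply: h1; [exact: lt_le_trans rr|exact: lt_le_trans rr].
  by rewrite ler_wpM2r.
- move=> i; have [r [M [r0 M0 h1]]] := D_lipschitz (CD i) x0; exists r, M; split => // x y xr yr.
  by have := h1 x y xr yr; rewrite !DF.
move=> r [M [r0 M0 h1]]; exists r, M; split => // x y xr yr.
apply: cv_norm_le; first by rewrite mulr_ge0// ltW.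
by move=> i; rewrite !mxE; exact: h1.
Qed.

End Vector.

(** * Stieltjes integrals and the characteristic matrix *)

Section StieltjesL.
Context {R : realType}.

Lemma partition_range (a b : R) (s : seq R) i : itv_partition a b s -> (i <= size s)%N ->
  a <= nth a (a :: s) i <= b.
Proof.
move=> [ps /eqP ls] si.
have st : sorted <=%R (a :: s) by apply: (sub_path _ ps) => x y; exact: ltW.
have mono := sorted_leq_nth (@le_trans _ _) (@lexx _ _) a st.
have E : nth a (a :: s) (size s) = b by rewrite -ls (last_nth a).
apply/andP; split; first by apply: (mono 0%N i); rewrite ?inE//= ltnS.
by rewrite -[leRHS]E; apply: mono; rewrite ?inE //= ?ltnS.
Qed.

Lemma is_stieltjes_ext (a b : R) (f f' g : R -> R) (I : R) :
  (forall t, a <= t <= b -> f t = f' t) -> is_stieltjes a b f g I -> is_stieltjes a b f' g I.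
Proof.
move=> ff H e e0; have [d d0 Hd] := H e e0; exists d => // s tau ps Ht.
rewrite (_ : stieltjes_sum a s tau f' g = stieltjes_sum a s tau f g); first exact: Hd.
apply: eq_big_nat => i /andP[_ si]; congr (_ * _); apply/esym; apply: ff.
have [_ /andP[h1 h2]] := Ht i si.
have /andP[h3 _] := partition_range ps (ltnW si).
have /andP[_ h4] := partition_range ps si.
by rewrite (le_trans h3 h1) (le_trans h2 h4).
Qed.

Lemma stieltjes_ext (a b : R) (f f' g : R -> R) : (forall t, a <= t <= b -> f t = f' t) ->
  stieltjes a b f g = stieltjes a b f' g.
Proof.
move=> ff; rewrite /stieltjes; congr get; apply/seteqP; split => I.
  exact: is_stieltjes_ext.
by apply: is_stieltjes_ext => t ht; rewrite ff.
Qed.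

Lemma fine_partition (b d : R) : 0 < b -> 0 < d -> exists s : seq R, itv_partition 0 b s /\
  forall i, (i < size s)%N -> nth 0 (0 :: s) i.+1 - nth 0 (0 :: s) i < d.
Proof.
move=> b0 d0.
pose N := (Num.truncn (b / d)).+1.
have NR : 0 < N%:R :> R by rewrite ltr0n.
have bd : b / N%:R < d.
  have := truncnS_gt (b / d); rewrite -/N ltr_pdivrMr// => h.
  by rewrite ltr_pdivrMr// mulrC.
pose s := mkseq (fun i => b * i.+1%:R / N%:R) N.
have sN : size s = N by rewrite size_mkseq.
have E i : (i <= N)%N -> nth 0 (0 :: s) i = b * i%:R / N%:R.
  by case: i => [|i] iN /=; [rewrite mulr0 mul0r|rewrite nth_mkseq].
exists s; split.
  split.
    apply/(pathP 0) => i; rewrite sN => iN.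
    change (nth 0 (0 :: s) i < nth 0 (0 :: s) i.+1); rewrite (E i (ltnW iN)) (E i.+1 iN).
    by rewrite ltr_pM2r ?invr_gt0// ltr_pM2l// ltr_nat.
  by rewrite (last_nth 0) sN E// mulfK// gt_eqF.
move=> i; rewrite sN => iN; rewrite (E i (ltnW iN)) (E i.+1 iN).
rewrite -mulrBl -mulrBr -natrB// subSnn mulr1; exact: bd.
Qed.

(** The Stieltjes integral is the value of a choice function among the limits
    of the sums. There are arbitrarily fine partitions, so 0 is the only
    limit. *)
Lemma stieltjes0 (b : R) (g : R -> R) : 0 < b -> stieltjes 0 b (fun=> 0) g = 0.
Proof.
move=> b0.
have Z s tau : stieltjes_sum 0 s tau (fun=> 0) g = 0 :> R.
  by rewrite /stieltjes_sum big1// => i _; rewrite mul0r.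
have H0 : is_stieltjes 0 b (fun=> 0) g 0.
  by move=> e e0; exists 1 => // s tau _ _; rewrite Z subrr normr0.
have : is_stieltjes 0 b (fun=> 0) g (stieltjes 0 b (fun=> 0) g) by exact: (getPex (ex_intro _ 0 H0)).
set I := stieltjes _ _ _ _ => HI; apply/eqP; rewrite -normr_le0; apply/ler_addgt0Pr => e e0.
rewrite add0r; have [d d0 Hd] := HI e e0.
have [s [ps ms]] := fine_partition b0 d0.
have := Hd s (fun i => nth 0 (0 :: s) i) ps; rewrite Z sub0r normrN => Hs.
apply: ltW; apply: Hs => i si; split; first exact: ms.
rewrite lexx /=; apply: ltW; case: ps => /(pathP 0) h _; exact: h.
Qed.

Context {n : nat} {h : R} (h0 : 0 < h).
Local Notation X := (history h n).
Local Notation CX := (chistory h n).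
Variables (L : X -> 'cV[R]_n) (zeta : R -> 'M[R]_n).
Hypothesis Lz : forall psi, L psi = dzeta_int h zeta (fun theta => psi (- theta)).
Hypothesis Ll : forall i a (u v : X), L (a *: u + v) i 0 = a * L u i 0 + L v i 0.

Definition component i : X -> R := fun u => L u i 0.

Lemma L_restr (y : R -> 'cV[R]_n) i : continuous y ->
  L (restr h y) i 0 = \sum_j stieltjes 0 h (fun s => y (- s) j 0) (fun t => zeta t i j).
Proof.
move=> cy; rewrite Lz mxE; apply: eq_bigr => j _; apply: stieltjes_ext => t /andP[t1 t2].
by rewrite restrE// oppr_le0 t1 lerN2 t2.
Qed.

(** The scalar integral is L applied to a multiple of a unit vector: the other
    columns contribute integrals of 0. *)
Lemma stieltjes_unit (f : R -> R) i k : continuous f ->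
  stieltjes 0 h f (fun t => zeta t i k) = component i (restr h (fun th => \col_j (f (- th) *+ (j == k)))).
Proof.
move=> cf; rewrite /component L_restr; last first.
  move=> t; apply/vcontP => j; rewrite (_ : (fun s => _) = (fun s => f (- s) *+ (j == k))); last first.
    by apply/funext => s; rewrite mxE.
  case: (j == k) => /=; last exact: cst_continuous.
  by apply: (@continuous_comp _ _ _ -%R f); [apply: cvgN; exact: cvg_id|exact: cf].
rewrite (bigD1 k)//= big1 ?addr0.
  by apply: stieltjes_ext => t _; rewrite mxE eqxx opprK.
move=> j jk; rewrite -[RHS](stieltjes0 (fun t => zeta t i j) h0).
by apply: stieltjes_ext => t _; rewrite mxE (negbTE jk).
Qed.

Lemma dzeta_intCE (y : R -> 'cV[R[i]]_n) i : vcontinuous y ->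
  dzeta_intC h zeta (fun s => y (- s)) i 0 = lC (component i) (restrC y).
Proof.
move=> [cr ci]; rewrite mxE /lC /component /restrC /= !L_restr//.
apply: complexP; rewrite ?Re_sum ?Im_sum /=; apply: eq_bigr => j _ /=.
  by apply: stieltjes_ext => t _; rewrite !mxE.
by apply: stieltjes_ext => t _; rewrite !mxE.
Qed.

(** The exponential history theta -> e^(z theta) v. It is an eigenfunction
    when Delta(z) v = 0. *)
Definition expv (z : R[i]) (v : 'cV[R[i]]_n) : CX := restrC (fun th : R => cexp (z * th%:C) *: v).

Lemma expv_vcont z (v : 'cV[R[i]]_n) : vcontinuous (fun th : R => cexp (z * th%:C) *: v).
Proof.
apply/vcontinuousP => i.
have [c1 c2] : Ccont (fun s => cexp (z * s%:C) * v i 0) by apply: CcontM; [exact: Ccont_cexp|exact: Ccont_cst].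
split => s; [move: (c1 s)|move: (c2 s)].
  by rewrite (_ : (fun s => Re _) = (fun s => Re ((cexp (z * s%:C) *: v) i 0)))//; apply/funext => u; rewrite mxE.
by rewrite (_ : (fun s => Im _) = (fun s => Im ((cexp (z * s%:C) *: v) i 0)))//; apply/funext => u; rewrite mxE.
Qed.

Lemma cev_expv z v th i : cev (expv z v) th i = cexp (z * (clamp h th)%:C) * v i 0.
Proof. by rewrite (cev_restrC h0)//; [rewrite mxE|exact: expv_vcont]. Qed.

Lemma cstieltjes_exp z i k :
  cstieltjes 0 h (fun t => cexp (- z * t%:C)) (fun t => zeta t i k) =
  lC (component i) (expv z (\col_j (j == k)%:R)).
Proof.
have [c1 c2] := Ccont_cexp (- z).
rewrite /cstieltjes !stieltjes_unit// /lC /expv /restrC /=; congr (component i (restr h _) +i* component i (restr h _)).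
  apply/funext => th; apply/colP => j; rewrite !mxE rmorphN mulrNN.
  by case: (j == k); rewrite ?mulr1 ?mulr0.
apply/funext => th; apply/colP => j; rewrite !mxE rmorphN mulrNN.
by case: (j == k); rewrite ?mulr1 ?mulr0.
Qed.

Lemma Delta_mulE z (v : 'cV[R[i]]_n) i : (Delta h zeta z *m v) i 0 = z * v i 0 - lC (component i) (expv z v).
Proof.
have -> : expv z v = \sum_k hscale (v k 0) (expv z (\col_j (j == k)%:R)).
  apply: (chistP h0) => th j _; rewrite cev_sum cev_expv (bigD1 j)//= big1 ?addr0.
    by rewrite cev_hscale cev_expv mxE eqxx mulr1 mulrC.
  by move=> k kj; rewrite cev_hscale cev_expv mxE eq_sym (negbTE kj) !mulr0.
rewrite mulmxBl mxE mul_scalar_mx !mxE; congr (_ - _).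
rewrite (lC_sum (Ll i)); apply: eq_bigr => k _.
by rewrite (lCZ (Ll i)) mxE cstieltjes_exp mulrC.
Qed.

(** The factor e^(- z t) is split off, so that the delayed term is L applied
    to a segment of the function e^(z s) y(s), whose derivative in t is again
    a segment. *)
Lemma bDeltaE z (y : R -> 'cV[R[i]]_n) t i : vcontinuous y ->
  bDelta h zeta z y t i 0 = vderive y t i 0 + z * y t i 0 -
    cexp (- z * t%:C) * lC (component i) (segC (fun s => cexp (z * s%:C) *: y s) t).
Proof.
move=> cy; rewrite /bDelta.
have cw : vcontinuous (fun th : R => cexp (z * th%:C) *: y (t + th)).
  apply/vcontinuousP => j.
  rewrite (_ : (fun s => _) = (fun s => cexp (z * s%:C) * y (t + s) j 0)); last first.
    by apply/funext => s; rewrite mxE.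
  apply: CcontM; first exact: Ccont_cexp.
  by move: (vcontinuous_shift t cy) => /vcontinuousP.
have cy' : vcontinuous (fun s : R => cexp (z * s%:C) *: y s).
  apply/vcontinuousP => j.
  rewrite (_ : (fun s => _) = (fun s => cexp (z * s%:C) * y s j 0)); last first.
    by apply/funext => s; rewrite mxE.
  by apply: CcontM; [exact: Ccont_cexp|move: cy => /vcontinuousP].
rewrite [LHS]mxE [X in X + _]mxE [X in _ + X]mxE [(z *: y t) i 0]mxE; congr (_ + _ - _).
rewrite (_ : (fun s => cexp (- z * s%:C) *: y (t - s)) =
   (fun s => (fun th : R => cexp (z * th%:C) *: y (t + th)) (- s))); last first.
  by apply/funext => s /=; rewrite rmorphN mulrN mulNr.
rewrite (dzeta_intCE i cw) -(lCZ (Ll i)); congr lC.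
apply: (chistP h0) => th j _.
rewrite cev_hscale (cev_restrC h0)// (cev_segC h0)// !mxE mulrA -cexpD rmorphD /= mulrDr mulNr addKr.
by [].
Qed.

(** The eigenfunction is [expv z v]: its derivative is z times itself, and
    Delta(z) v = 0 is the boundary condition at 0. *)
Lemma eigenvalue_of_Delta z (v : 'cV[R[i]]_n) : v != 0 -> Delta h zeta z *m v = 0 -> is_eigenvalue L z.
Proof.
move=> v0 Dv; exists (expv z v).
  apply/eqP => E; move/eqP: v0; apply; apply/colP => j.
  have := cev_expv z v 0 j; rewrite E cev0 clamp_id ?lexx ?oppr_le0 ?ltW//.
  by rewrite mulr0 cexp0 mul1r mxE => <-.
have cl (th : R) : - h < th < 0 -> \forall s \near th, clamp h s = s.
  move=> /andP[h1 h2]; near=> s; apply: clamp_id; apply/andP; split; apply: ltW; near: s.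
    exact: lt_nbhsr.
  exact: lt_nbhsl.
have D (th : R) j : Cder (fun s => cexp (z * s%:C) * v j 0) th (z * (cexp (z * th%:C) * v j 0)).
  rewrite mulrA -[z * _ * _]addr0 -(mulr0 (cexp (z * th%:C))).
  by apply: CderM; [exact: Cder_cexp|exact: Cder_cst].
split.
- move=> th hth; apply/is_derive_vecP => j.
  have [D1 _] := D th j.
  have -> : (hscale z (expv z v)).1 th j 0 = Re (z * (cexp (z * th%:C) * v j 0)).
    rewrite -[LHS]/(Re (cev (hscale z (expv z v)) th j)) cev_hscale cev_expv clamp_id//.
    by case/andP: hth => /ltW -> /ltW ->.
  apply: near_eq_is_derive D1; apply: filterS (cl th hth) => s hs.
  by rewrite -[RHS]/(Re (cev (expv z v) s j)) cev_expv hs.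
- move=> th hth; apply/is_derive_vecP => j.
  have [_ D1] := D th j.
  have -> : (hscale z (expv z v)).2 th j 0 = Im (z * (cexp (z * th%:C) * v j 0)).
    rewrite -[LHS]/(Im (cev (hscale z (expv z v)) th j)) cev_hscale cev_expv clamp_id//.
    by case/andP: hth => /ltW -> /ltW ->.
  apply: near_eq_is_derive D1; apply: filterS (cl th hth) => s hs.
  by rewrite -[RHS]/(Im (cev (expv z v) s j)) cev_expv hs.
- apply/colP => j; rewrite cevalE cext1E cev_hscale cev_expv clamp_id ?lexx ?oppr_le0 ?ltW//.
  rewrite mulr0 cexp0 mul1r; apply/eqP; rewrite -subr_eq0 -(Delta_mulE z v j) Dv mxE//.
Unshelve. all: by end_near. Qed.

End StieltjesL.

(** * Mean values over a period *)

Section Primitives.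
Context {R : realType}.

Lemma derivative0_const (f : R -> R) (a b : R) : a <= b ->
  (forall t, a <= t <= b -> is_derive t (1 : R) f 0) -> f b = f a.
Proof.
move=> ab D; apply/eqP; rewrite -subr_eq0 -normr_le0 -[leRHS](mul0r (b - a)).
apply: (mvt_ineq (df := fun=> 0)) => //.
- by move=> t /andP[h1 h2]; apply: D; rewrite !ltW.
- apply: continuous_in_subspaceT => t; rewrite inE /= in_itv /= => /D[Dt _].
  by apply: differentiable_continuous; apply/derivable1_diffP.
- by move=> t _; rewrite normr0.
Qed.

(** Two primitives on half lines are glued at 0, the one on the left being
    reflected. *)
Lemma global_primitive (f : R -> R) : continuous f -> exists F : R -> R, forall x, is_derive x (1 : R) F (f x).
Proof.
move=> cf.
pose P x := \int[lebesgue_measure]_(t in `[(-1 : R), x]) f t.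
pose P2 x := \int[lebesgue_measure]_(t in `[(-1 : R), x]) f (- t).
have cf2 : continuous (fun t => f (- t)).
  by move=> t; apply: (@continuous_comp _ _ _ -%R f); [apply: cvgN; exact: cvg_id|exact: cf].
have DP (x : R) : -1 < x -> is_derive x (1 : R) P (f x) by exact: primitive.
pose Q x := - P2 (- x).
have DQ (x : R) : x < 1 -> is_derive x (1 : R) Q (f x).
  move=> x1; have D2 : is_derive (- x) (1 : R) P2 (f x).
    rewrite -{2}(opprK x); apply: (primitive cf2); by rewrite ltrN2.
  have DN : is_derive x (1 : R) (fun t : R => - t) (- 1) by apply: is_deriveN.
  have DC := is_derive1_comp D2 DN.
  have DQ := is_deriveN DC.
  by apply: (is_derive_eqfun DQ) => //; rewrite mulrN1 opprK.
pose D x := P x - Q x.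
have DD x : -1 < x -> x < 1 -> D x = D 0.
  move=> h1 h2.
  have DD0 (y : R) : -1 < y -> y < 1 -> is_derive y (1 : R) D 0.
    move=> g1 g2; rewrite -(subrr (f y)); have D1 := DP _ g1; have D2 := DQ _ g2.
    exact: is_deriveB.
  have [x0|x0] := leP 0 x.
    apply: derivative0_const => // t /andP[g1 g2]; apply: DD0; lra.
  by apply/esym; apply: derivative0_const => //; [exact: ltW|move=> t /andP[g1 g2]; apply: DD0; lra].
exists (fun x => if x < 0 then Q x + D 0 else P x) => x.
have [x0|x0] := ltP x 0.
  have D1 : is_derive x (1 : R) (fun t => Q t + D 0) (f x).
    have D2 := DQ x (lt_trans x0 ltr01); rewrite -[f x]addr0; exact: is_deriveD.
  apply: near_eq_is_derive D1; have := lt_nbhsl x0; apply: filterS => t t0; by rewrite t0.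
have x1 : -1 < x by rewrite (lt_le_trans _ x0)// ltrN10.
apply: near_eq_is_derive (DP x x1); have := lt_nbhsr x1; apply: filterS => t t1.
case: ltP => // t0; rewrite -(DD t)//; last by rewrite (lt_trans t0).
by rewrite /D addrC subrK.
Qed.

Lemma Cglobal_primitive (f : R -> R[i]) : Ccont f -> exists F : R -> R[i], forall t, Cder F t (f t).
Proof.
move=> [/global_primitive[F1 D1] /global_primitive[F2 D2]].
by exists (fun t => F1 t +i* F2 t) => t; split; [exact: D1|exact: D2].
Qed.

Lemma Cder0_const (f : R -> R[i]) a b : (forall t, Cder f t 0) -> f a = f b.
Proof.
move=> D; have cst (g : R -> R) : (forall t, is_derive t (1 : R) g 0) -> g a = g b.
  move=> Dg; have [ab|ba] := leP a b; first by apply/esym; apply: derivative0_const.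
  by apply: derivative0_const => //; exact: ltW.
apply: complexP.
  by apply: (cst (fun s => Re (f s))) => t; have [] := D t.
by apply: (cst (fun s => Im (f s))) => t; have [] := D t.
Qed.

Lemma cintegralE (f F : R -> R[i]) a b : a < b -> Ccont f -> (forall t, Cder F t (f t)) ->
  cintegral a b f = F b - F a.
Proof.
move=> ab [c1 c2] D; apply: complexP; rewrite !RIE /=.
  by apply: (RintegralE ab c1 (F := fun t => Re (F t))) => x _; have [] := D x.
by apply: (RintegralE ab c2 (F := fun t => Im (F t))) => x _; have [] := D x.
Qed.

Lemma cintegral_lin (f g : R -> R[i]) z w a b : a < b -> Ccont f -> Ccont g ->
  cintegral a b (fun t => z * f t + w * g t) = z * cintegral a b f + w * cintegral a b g.
Proof.
move=> ab cf cg; have [F DF] := Cglobal_primitive cf; have [G DG] := Cglobal_primitive cg.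
rewrite (cintegralE ab cf DF) (cintegralE ab cg DG).
rewrite (@cintegralE _ (fun t => z * F t + w * G t))//; first by ring.
  by apply: CcontD; apply: CcontM => //; exact: Ccont_cst.
by move=> t; apply: CderD; exact: CderZ.
Qed.

Lemma cintegralZ (f : R -> R[i]) z a b : a < b -> Ccont f ->
  cintegral a b (fun t => z * f t) = z * cintegral a b f.
Proof.
move=> ab cf; have := cintegral_lin z 0 ab cf cf; rewrite mul0r addr0 => <-.
by congr cintegral; apply/funext => t; rewrite mul0r addr0.
Qed.

Lemma periodic_shift (f F : R -> R[i]) (T : R) : periodic f T -> (forall t, Cder F t (f t)) ->
  forall t, F (t + T) - F t = F T - F 0.
Proof.
move=> pf D t; have DS s : Cder (fun s => F (s + T) - F s) s 0.
  rewrite -(subrr (f s)); apply: CderB; last exact: D.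
  have pf' : f (T + s) = f s by rewrite addrC pf.
  have [d1 d2] := D (T + s); rewrite pf' in d1 d2.
  split; [move: (is_derive_shift d1)|move: (is_derive_shift d2)] => d.
    by apply: (is_derive_eqfun d) => // u; rewrite addrC.
  by apply: (is_derive_eqfun d) => // u; rewrite addrC.
by have := Cder0_const t 0 DS; rewrite add0r.
Qed.

End Primitives.

Section Mean.
Context {R : realType} {n : nat} {h : R} (h0 : 0 < h).
Local Notation X := (history h n).
Local Notation CX := (chistory h n).
Variables (L : X -> 'cV[R]_n) (zeta : R -> 'M[R]_n).
Hypothesis Lz : forall psi, L psi = dzeta_int h zeta (fun theta => psi (- theta)).
Hypothesis Ll : forall i a (u v : X), L (a *: u + v) i 0 = a * L u i 0 + L v i 0.
Hypothesis Lc : forall i, continuous (component L i).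
Variable (T : R).
Hypothesis T0 : 0 < T.

Lemma vscale_cont (e : R -> R[i]) (y : R -> 'cV[R[i]]_n) : Ccont e -> vcontinuous y ->
  vcontinuous (fun s => e s *: y s).
Proof.
move=> ce /vcontinuousP cy; apply/vcontinuousP => j.
rewrite (_ : (fun s => _) = (fun s => e s * y s j 0)); last by apply/funext => s; rewrite mxE.
exact: CcontM.
Qed.

Lemma lC_seg_cont (y : R -> 'cV[R[i]]_n) i : vcontinuous y -> Ccont (fun t => lC (component L i) (segC (h := h) y t)).
Proof.
move=> [c1 c2]; split => t /=.
  apply: (@continuous_comp _ _ _ (segment h (vec_Re \o y)) (component L i)); [exact: (segment_cont h0)|exact: Lc].
apply: (@continuous_comp _ _ _ (segment h (vec_Im \o y)) (component L i)); [exact: (segment_cont h0)|exact: Lc].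
Qed.

Lemma bDelta_cont z (y : R -> 'cV[R[i]]_n) i : vcontinuous y -> vcontinuous (vderive y) ->
  Ccont (fun t => bDelta h zeta z y t i 0).
Proof.
move=> cy cdy.
rewrite (_ : (fun t => _) = (fun t => vderive y t i 0 + z * y t i 0 + (-1) *
    (cexp (- z * t%:C) * lC (component L i) (segC (fun s => cexp (z * s%:C) *: y s) t)))); last first.
  by apply/funext => t; rewrite (bDeltaE h0 Lz Ll)// mulN1r.
apply: CcontD; first apply: CcontD.
- by move: cdy => /vcontinuousP.
- by apply: CcontM; [exact: Ccont_cst|move: cy => /vcontinuousP].
- apply: CcontM; first exact: Ccont_cst.
  apply: CcontM; first exact: Ccont_cexp.
  by apply: lC_seg_cont; apply: vscale_cont => //; exact: Ccont_cexp.
Qed.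

Lemma CT1_der (y : R -> 'cV[R[i]]_n) : CT1 T y -> [/\ vcontinuous y, vcontinuous (vderive y),
  periodic y T & forall t j, Cder (fun s => y s j 0) t (vderive y t j 0)].
Proof.
move=> [dy [cdy py]]; have D t j : Cder (fun s => y s j 0) t (vderive y t j 0).
  by apply: (proj2 (vderP y t (vderive y t))); split => //; exact: dy.
split; [|exact: cdy|exact: py|exact: D].
by apply/vcontinuousP => j; exact: (Cder_Ccont (fun t => D t j)).
Qed.

(** With a primitive G of y the delayed term has the primitive S(t) = e^(- z
    t) L((e^(z .) G)_t). Over a period the derivative y' contributes nothing,
    and G increases by the mean m at each argument, so S increases by L
    applied to [expv z m]. *)
Lemma mean_bDelta z (y : R -> 'cV[R[i]]_n) i : CT1 T y ->
  cintegral 0 T (fun t => bDelta h zeta z y t i 0) =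
  (Delta h zeta z *m \col_j cintegral 0 T (fun t => y t j 0)) i 0.
Proof.
move=> /CT1_der[cy cdy py D].
have cyj j : Ccont (fun t => y t j 0) by move: cy => /vcontinuousP.
have /choice[G DG] : forall j, exists F, forall t, Cder F t (y t j 0).
  by move=> j; exact: Cglobal_primitive.
pose Gv t : 'cV[R[i]]_n := \col_j G j t.
have GE j t : Gv t j 0 = G j t by rewrite mxE.
have cG : vcontinuous Gv.
  apply/vcontinuousP => j; rewrite (_ : (fun s => _) = G j); last by apply/funext => s; rewrite mxE.
  exact: Cder_Ccont (DG j).
have meanE j : cintegral 0 T (fun t => y t j 0) = G j T - G j 0.
  by apply: cintegralE.
set m := (\col_j _ in RHS).
have {meanE} mE j : m j 0 = G j T - G j 0 by rewrite mxE meanE.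
clearbody m.
have pG j t : G j (t + T) - G j t = G j T - G j 0.
  by apply: (periodic_shift (f := fun t => y t j 0)) => // s; rewrite /= py.
pose ez (s : R) := cexp (z * s%:C).
have cez : Ccont ez by exact: Ccont_cexp.
pose Y s := ez s *: Gv s.
pose dY s := ez s *: (z *: Gv s + y s).
have cY : vcontinuous Y by exact: vscale_cont.
have czG : vcontinuous (fun s => z *: Gv s + y s).
  apply/vcontinuousP => j; rewrite (_ : (fun s => _) = (fun s => z * Gv s j 0 + y s j 0)); last first.
    by apply/funext => s; rewrite !mxE.
  apply: CcontD => //; apply: CcontM; first exact: Ccont_cst.
  by move: cG => /vcontinuousP.
have cdY : vcontinuous dY by exact: vscale_cont.
have cey : vcontinuous (fun s => ez s *: y s) by exact: vscale_cont.
have DY s j : Cder (fun s => Y s j 0) s (dY s j 0).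
  apply: (@Cder_eq _ (fun s => ez s * G j s) _ _ (z * ez s * G j s + ez s * y s j 0)).
  - by apply: CderM; [exact: Cder_cexp|exact: DG].
  - by move=> u; rewrite /Y mxE GE.
  - by rewrite /dY !mxE; ring.
pose S t := cexp (- z * t%:C) * lC (component L i) (segC (h := h) Y t).
pose S' t := cexp (- z * t%:C) * lC (component L i) (segC (h := h) (fun s => ez s *: y s) t).
have DS t : Cder S t (S' t).
  have -> : S' t = - z * cexp (- z * t%:C) * lC (component L i) (segC (h := h) Y t) +
     cexp (- z * t%:C) * lC (component L i) (segC (h := h) dY t).
    have -> : segC (h := h) dY t = hscale z (segC Y t) + segC (fun s => ez s *: y s) t.
      apply: (chistP h0) => th j _; rewrite cevD cev_hscale !(cev_segC h0)// /Y /dY !mxE; ring.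
    by rewrite (lCD (Ll i)) (lCZ (Ll i)) /S'; ring.
  apply: CderM; first exact: Cder_cexp.
  by apply: (lC_der h0 (Ll i)) => //; exact: Lc.
have DB t : Cder (fun t => y t i 0 + z * G i t - S t) t (bDelta h zeta z y t i 0).
  rewrite (bDeltaE h0 Lz Ll)//; apply: CderB; last exact: DS.
  by apply: CderD; [exact: D|apply: CderZ; exact: DG].
rewrite (cintegralE T0 _ DB); last exact: bDelta_cont.
rewrite (Delta_mulE h0 Lz Ll) mE.
have -> : y T i 0 = y 0 i 0 by rewrite -[T]add0r py.
have fin (a1 b1 c1 d1 e1 : R[i]) : a1 + z * b1 - c1 - (a1 + z * d1 - e1) = z * (b1 - d1) - (c1 - e1).
  by clear; ring.
have -> : lC (component L i) (expv z m) = S T - S 0.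
  rewrite /S -!(lCZ (Ll i)) -(lCB (Ll i)); congr lC.
  apply: (chistP h0) => th j _.
  have YE s : Y s j 0 = ez s * G j s by rewrite /Y mxE GE.
  have E1 : cev (expv (h := h) z m) th j =
      cexp (z * (clamp h th)%:C) * (G j T - G j 0) by rewrite (cev_expv h0) mE.
  have E2 s : cev (segC (h := h) Y s) th j = ez (s + clamp h th) * G j (s + clamp h th).
    by rewrite (cev_segC h0 _ _ _ cY) YE.
  have e0 : cexp (- z * (0 : R)%:C) = 1 by rewrite rmorph0 mulr0 cexp0.
  rewrite E1.
  have e1 := E2 T; have e2 := E2 0; rewrite add0r in e2.
  move: e1 e2; move: (segC Y T) (segC Y 0) => u v e1 e2.
  rewrite cevB 2!cev_hscale e0 e1 e2 mul1r.
  have eT : cexp (- z * T%:C) * ez (T + clamp h th) = ez (clamp h th).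
    by rewrite -cexpD; congr cexp; rewrite rmorphD /=; ring.
  have pGc : G j (T + clamp h th) - G j (clamp h th) = G j T - G j 0.
    by rewrite [T + _]addrC pG.
  rewrite mulrA eT -pGc /ez.
  by clear; ring.
exact: fin.
Qed.

End Mean.

(** * Uniqueness of periodic solutions *)

Section Fourier.
Context {R : realType} (T : R) (T0 : 0 < T).
Let w : R := 2 * pi / T.

Lemma w_gt0 : 0 < w.
Proof. by rewrite divr_gt0// mulr_gt0// pi_gt0. Qed.

Lemma cos_le (x y : R) : 0 <= x -> x <= y -> y <= pi -> cos y <= cos x.
Proof.
move=> x0; rewrite le_eqVlt => /orP[/eqP ->//|xy] ypi.
have xi : x \in `[0, pi] by rewrite in_itv /= x0 (le_trans (ltW xy)).
have yi : y \in `[0, pi] by rewrite in_itv /= (le_trans x0 (ltW xy)).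
by apply: ltW; rewrite ltr_cos.
Qed.

Lemma increase_ge (Q dQ : R -> R) (a b K : R) : a <= b -> (forall t, is_derive t (1 : R) Q (dQ t)) ->
  (forall t, a < t < b -> K <= dQ t) -> K * (b - a) <= Q b - Q a.
Proof.
move=> ab D HK; move: ab; rewrite le_eqVlt => /orP[/eqP ->|ab]; first by rewrite !subrr mulr0.
have [|x xab ->] := MVT ab (fun x _ => D x).
  apply: continuous_subspaceT => t; apply: differentiable_continuous; apply/derivable1_diffP.
  by have [] := D t.
apply: ler_wpM2r; first by rewrite subr_ge0 ltW.
by apply: HK; move: xab; rewrite in_itv.
Qed.

Definition rint (f : R -> R) : R := \int[lebesgue_measure]_(t in `[0, T]) f t.

Lemma rint_lin (f g : R -> R) a b : continuous f -> continuous g ->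
  rint (fun t => a * f t + b * g t) = a * rint f + b * rint g.
Proof.
move=> cf cg; have [F DF] := global_primitive cf; have [G DG] := global_primitive cg.
rewrite /rint (RintegralE T0 cf (fun x _ => DF x)) (RintegralE T0 cg (fun x _ => DG x)).
rewrite (@RintegralE _ _ (fun t => a * F t + b * G t) _ _ T0); first by ring.
by apply: contD; apply: contM => //; exact: cst_continuous.
Qed.

Lemma cos_lin_cont (a b : R) : continuous (fun t : R => cos (a * t + b)).
Proof.
move=> t; apply: (@continuous_comp _ _ _ (fun t => a * t + b) cos); last exact: continuous_cos.
by apply: cvgD; [apply: cvgMr; exact: cvg_id|exact: cvg_cst].
Qed.

Variable r : R -> R.
Hypothesis rc : continuous r.
Hypothesis rp : periodic r T.
Hypothesis r_orth : forall (m : nat) (a : R), rint (fun t => cos (m%:R * w * t + a) * r t) = 0.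

(** Kernels orthogonal to r, together with all their products with cosines, so
    that the class is stable under the multiplication in [trigM]. *)
Definition trig (K : R -> R) : Prop := continuous K /\
  forall (m : nat) (a : R), rint (fun t => K t * (cos (m%:R * w * t + a) * r t)) = 0.

Lemma trig1 : trig (fun=> 1).
Proof.
split=> [t|m a]; first exact: cst_continuous.
by rewrite -[RHS](r_orth m a); congr rint; apply/funext => t; rewrite mul1r.
Qed.

Lemma trigM K (b t0 : R) : trig K -> trig (fun t => K t * (b + cos (w * (t - t0)))).
Proof.
move=> [cK HK].
have cc (m : nat) (a : R) : continuous (fun t => K t * (cos (m%:R * w * t + a) * r t)).
  by apply: contM => //; apply: contM => //; exact: cos_lin_cont.
split.
  apply: contM => //; apply: contD; first exact: cst_continuous.
  rewrite (_ : (fun s => _) = (fun s => cos (w * s + (- (w * t0))))); first exact: cos_lin_cont.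
  by apply/funext => s; rewrite mulrBr.
move=> m a.
have prod x y : cos x * cos y = 2^-1 * cos (x + y) + 2^-1 * cos (x - y) :> R.
  by rewrite cosD cosB; field.
have E1 (m' : nat) (a' : R) : (forall t, cos (m%:R * w * t + a - w * (t - t0)) = cos (m'%:R * w * t + a')) ->
  rint (fun t => K t * (b + cos (w * (t - t0))) * (cos (m%:R * w * t + a) * r t)) = 0.
  move=> Hm.
  rewrite (_ : (fun t => _) = (fun t => b * (K t * (cos (m%:R * w * t + a) * r t)) +
    1 * (2^-1 * (K t * (cos (m.+1%:R * w * t + (a - w * t0)) * r t)) + 2^-1 * (K t * (cos (m'%:R * w * t + a') * r t))))).
    rewrite rint_lin//; last by apply: contD; apply: contM => //; exact: cst_continuous.
    by rewrite (rint_lin _ _ (cc _ _) (cc _ _)) !HK; ring.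
  apply/funext => t; rewrite -Hm.
  have -> : m.+1%:R * w * t + (a - w * t0) = m%:R * w * t + a + w * (t - t0).
    by rewrite -natr1; ring.
  rewrite -[K t * (b + _) * _]/(K t * (b + cos (w * (t - t0))) * (cos (m%:R * w * t + a) * r t)).
  pose A := m%:R * w * t + a; pose B := w * (t - t0).
  have := prod A B; rewrite -/A -/B.
  move: (cos (A + B)) (cos (A - B)) (cos A) (cos B) => c1 c2 c3 c4 E.
  have -> : K t * (b + c4) * (c3 * r t) = b * (K t * (c3 * r t)) + K t * r t * (c3 * c4) by ring.
  by rewrite E; ring.
case: m cc E1 => [|m] cc E1.
  apply: (E1 1%N (- w * t0 - a)) => t; rewrite -cosN; congr cos; ring.
by apply: (E1 m (a + w * t0)) => t; congr cos; rewrite -[m.+1%:R]natr1; ring.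
Qed.

Lemma trig_kernel (N : nat) (b t0 : R) : trig (fun t => (b + cos (w * (t - t0))) ^+ N).
Proof.
elim: N => [|N IH]; first by rewrite (_ : (fun t => _) = fun=> 1); [exact: trig1|apply/funext => t; rewrite expr0].
rewrite (_ : (fun t => _) = (fun t => (b + cos (w * (t - t0))) ^+ N * (b + cos (w * (t - t0))))).
  exact: trigM.
by apply/funext => t; rewrite exprSr.
Qed.

(** If r were positive near t0, its integrals against the powers of P = 1 -
    cos (w d) + cos (w (t - t0)) would grow exponentially: P exceeds 1 on a
    fixed neighbourhood of t0 and is at most 1 in absolute value at distance d
    or more from t0 within a period. But these powers are trigonometric
    polynomials. *)
Lemma fourier_le0 t0 : r t0 <= 0.
Proof.
apply/negP => /negP; rewrite -ltNge => rt0.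
pose eta0 := r t0 / 2.
have eta00 : 0 < eta0 by rewrite divr_gt0.
have [d0 d00 Hd0] : exists2 d0 : R, 0 < d0 & forall t, `|t - t0| < d0 -> eta0 <= r t.
  have rct : r @ t0 --> r t0 by exact: rc.
  have /cvgrPdist_lt/(_ _ eta00)/nearP[d0 d00 Hd] := rct; exists d0 => // t /Hd.
  by rewrite ltr_norml /eta0 => /andP[_ h1]; lra.
pose d := Num.min d0 (T / 2) / 2.
have dd : 0 < Num.min d0 (T / 2) by rewrite lt_min d00 divr_gt0.
have dp : 0 < d by rewrite divr_gt0.
have dd0 : d < d0 by rewrite ltr_pdivrMr// (le_lt_trans (_ : _ <= d0))// ?ge_min ?lexx// ltr_pMr// ltr1n.
have dT : d < T / 2.
  by rewrite ltr_pdivrMr// (le_lt_trans (_ : _ <= T / 2))// ?ge_min ?lexx ?orbT// ltr_pMr ?divr_gt0// ltr1n.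
have wpos := w_gt0.
have wT : w * (T / 2) = pi by rewrite /w; field; rewrite gt_eqF.
have wd : w * d <= pi by rewrite -wT ler_pM2l// ltW.
pose cd := cos (w * d).
pose kap := cos (w * (d / 2)) - cd.
have d2 : d / 2 < d by rewrite ltr_pdivrMr// ltr_pMr// ltr1n.
have kap0 : 0 < kap.
  have i1 : w * d \in `[0, pi] by rewrite in_itv /= wd andbT mulr_ge0// ltW.
  have i2 : w * (d / 2) \in `[0, pi].
    rewrite in_itv /= (le_trans _ wd) ?andbT; last by rewrite ler_pM2l// ltW.
    by rewrite mulr_ge0 ?(ltW wpos)// divr_ge0// ltW.
  by rewrite subr_gt0 ltr_cos// ltr_pM2l.
pose P t := 1 - cd + cos (w * (t - t0)).
have cosE t : cos (w * (t - t0)) = cos (w * `|t - t0|).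
  by rewrite -cos_norm normrM (ger0_norm (ltW wpos)).
have P1 t : `|t - t0| <= d -> 1 <= P t.
  move=> td; rewrite /P cosE -addrA lerDl addrC subr_ge0; apply: cos_le => //.
    by rewrite mulr_ge0// ltW.
  by rewrite ler_pM2l.
have Pk t : `|t - t0| <= d / 2 -> 1 + kap <= P t.
  move=> td; rewrite /P cosE /kap addrCA addrC lerD2l; apply: cos_le.
  - by rewrite mulr_ge0// ltW.
  - by rewrite ler_pM2l.
  - by rewrite (le_trans _ wd)// ler_pM2l// ltW.
have Psmall t : d <= `|t - t0| -> `|t - t0| <= T / 2 -> `|P t| <= 1.
  move=> td tT; rewrite ler_norml; apply/andP; split.
    rewrite /P; have := cos_geN1 (w * (t - t0)); have := cos_le1 (w * d); rewrite -/cd; lra.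
  rewrite /P cosE; have : cos (w * `|t - t0|) <= cd.
    apply: cos_le; [by rewrite mulr_ge0// ltW|by rewrite ler_pM2l|by rewrite -wT ler_pM2l].
  by lra.
pose a := t0 - T / 2; pose b := t0 + T / 2.
have ab : a <= b by rewrite /a /b; lra.
have [M M0 rM] : exists2 M : R, 0 <= M & forall t, a <= t <= b -> `|r t| <= M.
  have cr : {within `[a, b], continuous (fun t => `|r t|)}.
    by apply: continuous_subspaceT => t; apply: cvg_norm; exact: rc.
  have [c _ hc] := EVT_max ab cr; by exists `|r c|.
have key (N : nat) : eta0 * (1 + kap) ^+ N * d <= 2 * M * T.
  have [cP HP] := trig_kernel N (1 - cd) t0.
  have cPr : continuous (fun t => P t ^+ N * r t) by exact: contM.
  have [Q DQ] := global_primitive cPr.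
  have QT : Q T - Q 0 = 0.
    rewrite -(RintegralE T0 cPr (fun x _ => DQ x)) -[RHS](HP 0%N 0).
    by congr rint; apply/funext => t; rewrite !mul0r add0r cos0 mul1r.
  have Qab : Q b = Q a.
    have pP : periodic (fun t => (P t ^+ N * r t)%:C) T.
      move=> t /=; rewrite rp; have -> : P (t + T) = P t; last by [].
      rewrite /P; have -> : w * (t + T - t0) = w * (t - t0) + pi *+ 2.
        by rewrite /w mulr2n; field; rewrite gt_eqF.
      by rewrite cosD2pi.
    have DC t : Cder (fun t => (Q t)%:C) t (P t ^+ N * r t)%:C.
      by split => /=; [exact: DQ|exact: is_derive_cst].
    have := periodic_shift pP DC a; rewrite /a addrAC (_ : t0 + T - T / 2 = b); last by rewrite /b; lra.
    rewrite -!rmorphB /= QT => /(congr1 (@complex.Re R)) /= E.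
    by apply/eqP; rewrite -subr_eq0 E.
  (* Away from t0 the integrand is bounded independently of N; near t0 it is
    nonnegative, and large within d / 2. *)
  have low t : a <= t <= b -> d <= `|t - t0| -> - M <= P t ^+ N * r t.
    move=> tab td.
    have tT : `|t - t0| <= T / 2.
      by move: tab; rewrite /a /b ler_norml => /andP[g1 g2]; apply/andP; split; lra.
    have : `|P t ^+ N * r t| <= M.
      rewrite normrM normrX -[leRHS]mul1r ler_pM ?exprn_ge0//; last exact: rM.
      by rewrite exprn_ile1// Psmall.
    by rewrite ler_norml => /andP[].
  have mid t : `|t - t0| <= d -> 0 <= P t ^+ N * r t.
    move=> td; rewrite mulr_ge0//.
      by rewrite exprn_ge0// (le_trans ler01)// P1.
    by rewrite (le_trans (ltW eta00))// Hd0// (le_lt_trans td).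
  have high t : `|t - t0| <= d / 2 -> eta0 * (1 + kap) ^+ N <= P t ^+ N * r t.
    move=> td; have k1 : 0 <= 1 + kap by apply: addr_ge0 => //; exact: ltW.
    rewrite mulrC; apply: ler_pM; [exact: exprn_ge0|exact: ltW| |].
      apply: lerXn2r; [by rewrite nnegrE|rewrite nnegrE; exact: (le_trans k1 (Pk _ td))|exact: Pk].
    by apply: Hd0; rewrite (le_lt_trans td)// (lt_trans d2).
  have I1 : - M * (t0 - d - a) <= Q (t0 - d) - Q a.
    apply: (increase_ge _ DQ); first by rewrite /a; lra.
    move=> t /andP[g1 g2]; apply: low; first by rewrite (ltW g1) /b; lra.
    by rewrite ler0_norm; lra.
  have I2 : 0 * (t0 - d / 2 - (t0 - d)) <= Q (t0 - d / 2) - Q (t0 - d).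
    apply: (increase_ge _ DQ); first lra.
    by move=> t /andP[g1 g2]; apply: mid; rewrite ler_norml; apply/andP; split; lra.
  have I3 : eta0 * (1 + kap) ^+ N * (t0 + d / 2 - (t0 - d / 2)) <= Q (t0 + d / 2) - Q (t0 - d / 2).
    apply: (increase_ge _ DQ); first lra.
    by move=> t /andP[g1 g2]; apply: high; rewrite ler_norml; apply/andP; split; lra.
  have I4 : 0 * (t0 + d - (t0 + d / 2)) <= Q (t0 + d) - Q (t0 + d / 2).
    apply: (increase_ge _ DQ); first lra.
    by move=> t /andP[g1 g2]; apply: mid; rewrite ler_norml; apply/andP; split; lra.
  have I5 : - M * (b - (t0 + d)) <= Q b - Q (t0 + d).
    apply: (increase_ge _ DQ); first by rewrite /b; lra.
    move=> t /andP[g1 g2]; apply: low; first by rewrite (ltW g2) /a andbT; lra.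
    by rewrite ger0_norm; lra.
  have MT1 : M * (t0 - d - a) <= M * T by rewrite ler_wpM2l// /a; lra.
  have MT2 : M * (b - (t0 + d)) <= M * T by rewrite ler_wpM2l// /b; lra.
  have dE : t0 + d / 2 - (t0 - d / 2) = d by lra.
  rewrite dE in I3; rewrite mulNr in I1; rewrite mulNr in I5; rewrite !mul0r in I2 I4.
  by clear - I1 I2 I3 I4 I5 MT1 MT2 Qab; lra.
have ed : 0 < eta0 * d * kap by rewrite !mulr_gt0.
pose N := (Num.truncn (2 * M * T / (eta0 * d * kap))).+1.
have hN : 2 * M * T < N%:R * (eta0 * d * kap).
  by rewrite -ltr_pdivrMr//; exact: truncnS_gt.
have bern (m : nat) : 1 + m%:R * kap <= (1 + kap) ^+ m.
  elim: m => [|m IH]; first by rewrite mul0r addr0 expr0.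
  rewrite exprSr -natr1 (le_trans (_ : _ <= (1 + m%:R * kap) * (1 + kap)))//; last first.
    by rewrite ler_wpM2r// addr_ge0// ltW.
  have : 0 <= m%:R * kap * kap by rewrite !mulr_ge0// ltW.
  by lra.
have := key N; apply/negP; rewrite -ltNge; apply: (lt_le_trans hN).
have -> : eta0 * (1 + kap) ^+ N * d = (eta0 * d) * (1 + kap) ^+ N by ring.
have -> : N%:R * (eta0 * d * kap) = (eta0 * d) * (N%:R * kap) by ring.
rewrite ler_pM2l ?mulr_gt0//; apply: le_trans (bern N); by rewrite lerDr.
Qed.

End Fourier.

Section FourierC.
Context {R : realType} (T : R) (T0 : 0 < T).
Let w : R := 2 * pi / T.

Lemma cexp_period (m : int) : cexp ((0 +i* (m%:~R * w)) * T%:C) = 1.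
Proof.
have wT : w * T = pi *+ 2 by rewrite /w mulrVK ?unitf_gt0// mulr2n; ring.
have H (k : nat) : cexp ((0 +i* (k%:R * w)) * T%:C) = 1.
  elim: k => [|k IH]; first by rewrite mul0r (_ : 0 +i* 0 = 0 :> R[i])// mul0r cexp0.
  have -> : (0 +i* (k.+1%:R * w)) * T%:C = (0 +i* (k%:R * w)) * T%:C + 0 +i* (pi *+ 2).
    apply: complexP; rewrite !RIE /=; first by ring.
    by rewrite -wT -natr1; ring.
  rewrite cexpD IH mul1r; apply: complexP => /=; rewrite expR0 mul1r.
    by rewrite cos2pi.
  by rewrite sin2pi.
case: m => k; first exact: H.
have -> : (0 +i* ((Negz k)%:~R * w)) * T%:C = - ((0 +i* (k.+1%:R * w)) * T%:C).
  by apply: complexP; rewrite !RIE /= NegzE mulrNz /=; ring.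
by have := cexpN ((0 +i* (k.+1%:R * w)) * T%:C); rewrite H mulr1.
Qed.

Lemma fourier_Re (f : R -> R[i]) : Ccont f -> periodic f T ->
  (forall m : int, cintegral 0 T (fun t => cexp ((0 +i* (m%:~R * w)) * t%:C) * f t) = 0) ->
  forall t, Re (f t) <= 0.
Proof.
move=> cf pf H; apply: (fourier_le0 T0).
- by case: cf.
- by move=> t; rewrite pf.
move=> m a.
have E : cintegral 0 T (fun t => (cos (m%:R * w * t + a))%:C * f t) = 0.
  pose e (j : int) t := cexp ((0 +i* (j%:~R * w)) * t%:C) * f t.
  have ce j : Ccont (e j) by apply: CcontM => //; exact: Ccont_cexp.
  rewrite (_ : (fun t => _) = (fun t => (2^-1 * cexp (0 +i* a)) * e m t +
     (2^-1 * cexp (0 +i* (- a))) * e (- m%:Z) t)).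
    by rewrite (cintegral_lin _ _ T0 (ce _) (ce _)) /e !H !mulr0 addr0.
  apply/funext => t; rewrite /e.
  have -> : (cos (m%:R * w * t + a))%:C = 2^-1 * (cexp (0 +i* a) * cexp ((0 +i* ((m%:Z)%:~R * w)) * t%:C)) +
    2^-1 * (cexp (0 +i* (- a)) * cexp ((0 +i* ((- m%:Z)%:~R * w)) * t%:C)).
    rewrite -!cexpD -mulrDr.
    have -> : 0 +i* a + (0 +i* ((m%:Z)%:~R * w)) * t%:C = 0 +i* (m%:R * w * t + a).
      by apply: complexP; rewrite !RIE /=; ring.
    have -> : 0 +i* (- a) + (0 +i* ((- m%:Z)%:~R * w)) * t%:C = 0 +i* (- (m%:R * w * t + a)).
      by apply: complexP; rewrite !RIE /= mulrNz; ring.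
    have h2 : (2^-1 : R[i]) = (2^-1)%:C by rewrite fmorphV rmorph_nat.
    rewrite h2 /cexp /= cosN sinN expR0; apply: complexP; rewrite !RIE /=; last by ring.
    by field.
  ring.
have F1 : (fun t => Re ((cos (m%:R * w * t + a))%:C * f t)) =
    (fun t => cos (m%:R * w * t + a) * Re (f t)).
  by apply/funext => t; rewrite cReM /= mul0r subr0.
by move: E => /(congr1 (@complex.Re R)) /=; rewrite F1.
Qed.

(** By [fourier_Re] the real part of z f is at most 0 for every z; take z = 1,
    -1, i and -i. *)
Lemma fourier_zero (f : R -> R[i]) : Ccont f -> periodic f T ->
  (forall m : int, cintegral 0 T (fun t => cexp ((0 +i* (m%:~R * w)) * t%:C) * f t) = 0) ->
  forall t, f t = 0.
Proof.
move=> cf pf H t.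
have K z : Re (z * f t) <= 0.
  apply: (fourier_Re (f := fun t => z * f t)).
  - by apply: CcontM => //; exact: Ccont_cst.
  - by move=> s; rewrite pf.
  move=> m; rewrite (_ : (fun t => _) = (fun t => z * (cexp ((0 +i* (m%:~R * w)) * t%:C) * f t))).
    rewrite cintegralZ ?H ?mulr0//.
    by apply: CcontM => //; exact: Ccont_cexp.
  by apply/funext => s; rewrite mulrCA.
have := K 1; have := K (-1); have := K 'i; have := K (- 'i).
rewrite !cReM /= => h1 h2 h3 h4.
by apply: complexP => /=; apply/eqP; rewrite eq_le; apply/andP; split; lra.
Qed.

End FourierC.

Section Uniqueness.
Context {R : realType} {n : nat} {h : R} (h0 : 0 < h).
Local Notation X := (history h n).
Local Notation CX := (chistory h n).
Variables (L : X -> 'cV[R]_n) (zeta : R -> 'M[R]_n).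
Hypothesis Lz : forall psi, L psi = dzeta_int h zeta (fun theta => psi (- theta)).
Hypothesis Ll : forall i a (u v : X), L (a *: u + v) i 0 = a * L u i 0 + L v i 0.
Hypothesis Lc : forall i, continuous (component L i).
Variable (T : R).
Hypothesis T0 : 0 < T.
Let w : R := 2 * pi / T.

Lemma CT1_intro (y dy : R -> 'cV[R[i]]_n) : (forall t j, Cder (fun s => y s j 0) t (dy t j 0)) ->
  vcontinuous dy -> periodic y T -> CT1 T y /\ vderive y = dy.
Proof.
move=> D cdy py.
have H t : vderivable y t /\ vderive y t = dy t by apply/vderP => j; exact: D.
have E : vderive y = dy by apply/funext => t; have [] := H t.
split; [|exact: E]; split; first by move=> t; have [] := H t.
by split; [rewrite E|exact: py].
Qed.

(** The curves e^((z + nu) s) y'(s) and e^(z s) y(s) coincide, so L is applied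
    to the same segments. *)
Lemma bDelta_shift z nu (y : R -> 'cV[R[i]]_n) : CT1 T y -> cexp (nu * T%:C) = 1 ->
  let y' t := cexp (- nu * t%:C) *: y t in
  CT1 T y' /\ forall t i, bDelta h zeta (z + nu) y' t i 0 = cexp (- nu * t%:C) * bDelta h zeta z y t i 0.
Proof.
move=> Cy nuT y'; have [cy cdy py D] := CT1_der Cy.
have eT : cexp (- nu * T%:C) = 1.
  by have := cexpN (nu * T%:C); rewrite nuT mulr1 mulNr.
pose dy t := cexp (- nu * t%:C) *: (vderive y t - nu *: y t).
have cdy' : vcontinuous dy.
  apply: vscale_cont; first exact: Ccont_cexp.
  apply/vcontinuousP => j; rewrite (_ : (fun s => _) = (fun s => vderive y s j 0 + (- nu) * y s j 0)).
    apply: CcontD; first by move: cdy => /vcontinuousP.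
    by apply: CcontM; [exact: Ccont_cst|move: cy => /vcontinuousP].
  by apply/funext => s; rewrite !mxE mulNr.
have [C' E] : CT1 T y' /\ vderive y' = dy.
  apply: CT1_intro => //.
    move=> t j; apply: (@Cder_eq _ (fun s => cexp (- nu * s%:C) * y s j 0) _ _
      (- nu * cexp (- nu * t%:C) * y t j 0 + cexp (- nu * t%:C) * vderive y t j 0)).
    - by apply: CderM; [exact: Cder_cexp|exact: D].
    - by move=> s; rewrite mxE.
    - by rewrite /dy !mxE; ring.
  by move=> t; rewrite /y' py rmorphD /= mulrDr cexpD eT mulr1.
split => // t i; have [cy' _ _ _] := CT1_der C'.
rewrite !(bDeltaE h0 Lz Ll)// E.
have -> : (fun s : R => cexp ((z + nu) * s%:C) *: y' s) = (fun s : R => cexp (z * s%:C) *: y s).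
  apply/funext => s; rewrite /y' scalerA -cexpD; congr (cexp _ *: _); ring.
have -> : cexp (- (z + nu) * t%:C) = cexp (- nu * t%:C) * cexp (- z * t%:C).
  by rewrite -cexpD; congr cexp; ring.
have -> : dy t i 0 = cexp (- nu * t%:C) * (vderive y t i 0 - nu * y t i 0) by rewrite !mxE.
have -> : y' t i 0 = cexp (- nu * t%:C) * y t i 0 by rewrite mxE.
ring.
Qed.

(** The Fourier coefficients of y1 - y2 are mean values of shifted functions,
    and by [mean_bDelta] they lie in the kernels of Delta(z + i m w). *)
Lemma bDelta_inj z (y1 y2 : R -> 'cV[R[i]]_n) :
  (forall (m : int) (v : 'cV[R[i]]_n), Delta h zeta (z + (0 +i* (m%:~R * w))) *m v = 0 -> v = 0) ->
  CT1 T y1 -> CT1 T y2 -> bDelta h zeta z y1 = bDelta h zeta z y2 -> y1 = y2.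
Proof.
move=> inj C1 C2 E.
have [c1 _ p1 _] := CT1_der C1; have [c2 _ p2 _] := CT1_der C2.
have d1 j : Ccont (fun t => y1 t j 0) by move: c1 => /vcontinuousP.
have d2 j : Ccont (fun t => y2 t j 0) by move: c2 => /vcontinuousP.
apply/funext => t; apply/colP => j; apply/eqP; rewrite -subr_eq0; apply/eqP.
have cd : Ccont (fun t => y1 t j 0 - y2 t j 0).
  rewrite (_ : (fun t => _) = (fun t => y1 t j 0 + (-1) * y2 t j 0)).
    by apply: CcontD => //; apply: CcontM => //; exact: Ccont_cst.
  by apply/funext => s; rewrite mulN1r.
apply: (fourier_zero T0 cd); first by move=> s; rewrite p1 p2.
move=> m; pose nu : R[i] := 0 +i* ((- m)%:~R * w).
have [S1 B1] := bDelta_shift z C1 (cexp_period T0 (- m)).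
have [S2 B2] := bDelta_shift z C2 (cexp_period T0 (- m)).
rewrite -/nu in S1 B1 S2 B2.
have nuE : - nu = 0 +i* (m%:~R * w).
  by apply: complexP; rewrite /nu /= ?oppr0// mulrNz; ring.
pose v1 := \col_k cintegral 0 T (fun t => (cexp (- nu * t%:C) *: y1 t) k 0).
pose v2 := \col_k cintegral 0 T (fun t => (cexp (- nu * t%:C) *: y2 t) k 0).
have v12 : v1 - v2 = 0.
  apply: (inj (- m)); apply/colP => i; rewrite mulmxBr [LHS]mxE [X in _ + X]mxE [RHS]mxE.
  have M1 := mean_bDelta h0 Lz Ll Lc T0 (z + nu) i S1.
  have M2 := mean_bDelta h0 Lz Ll Lc T0 (z + nu) i S2.
  apply/eqP; rewrite subr_eq0; apply/eqP.
  apply: (etrans (esym M1)); apply: etrans M2; apply: (f_equal (cintegral 0 T)); apply/funext => s.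
  by apply: (etrans (B1 s i)); apply: etrans (esym (B2 s i)); rewrite E.
have := congr1 (fun M : 'cV[R[i]]_n => M j 0) v12; rewrite [X in _ = X -> _]mxE [X in X = _ -> _]mxE.
rewrite [X in _ + X = _ -> _]mxE [v1 j 0]mxE [v2 j 0]mxE => <-.
have e1 : Ccont (fun t => cexp (- nu * t%:C) * y1 t j 0) by apply: CcontM => //; exact: Ccont_cexp.
have e2 : Ccont (fun t => cexp (- nu * t%:C) * y2 t j 0) by apply: CcontM => //; exact: Ccont_cexp.
have := cintegral_lin 1 (-1) T0 e1 e2; rewrite mul1r mulN1r.
rewrite (_ : (fun t => (cexp (- nu * t%:C) *: y1 t) j 0) = (fun t => cexp (- nu * t%:C) * y1 t j 0)); last first.
  by apply/funext => s; rewrite mxE.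
rewrite (_ : (fun t => (cexp (- nu * t%:C) *: y2 t) j 0) = (fun t => cexp (- nu * t%:C) * y2 t j 0)); last first.
  by apply/funext => s; rewrite mxE.
move=> <-; congr cintegral; apply/funext => s; rewrite nuE; ring.
Qed.

End Uniqueness.

(** * The derivative of the characteristic matrix *)

Section DeltaPrime.
Context {R : realType} {n : nat} {h : R} (h0 : 0 < h).
Local Notation X := (history h n).
Local Notation CX := (chistory h n).
Variables (L : X -> 'cV[R]_n) (zeta : R -> 'M[R]_n).
Hypothesis Lz : forall psi, L psi = dzeta_int h zeta (fun theta => psi (- theta)).
Hypothesis Ll : forall i a (u v : X), L (a *: u + v) i 0 = a * L u i 0 + L v i 0.
Hypothesis Lb : forall i, exists2 M : R, 0 <= M & forall u, `|L u i 0| <= M * `|u|.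

Lemma nc_cexp_le z (t : R) : `|t| <= h -> nc (cexp (z * t%:C)) <= expR (nc z * h).
Proof.
move=> th; have E : Re (z * t%:C) = Re z * t by rewrite cReM /= mulr0 subr0.
rewrite nc_cexp ler_expR E; apply: (le_trans (ler_norm _)); rewrite normrM.
by apply: ler_pM => //; exact: nc_Re.
Qed.

(** The mean value inequality, applied first to e^(z s) - 1 and then to e^(z
    s) - 1 - z s, between t and 0. *)
Lemma exp_remainder z (t : R) : - h <= t -> t <= 0 ->
  nc (cexp (z * t%:C) - 1 - z * t%:C) <= 4 * h ^+ 2 * expR (nc z * h) * nc z ^+ 2.
Proof.
move=> t1 t2; set K := expR (nc z * h).
have K0 : 0 <= K by exact: expR_ge0.
have z0 := nc_ge0 z.
have Di (f : R -> R[i]) (s : R) df : Cder f s df ->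
   {for s, continuous (fun s => Re (f s))} /\ {for s, continuous (fun s => Im (f s))}.
  exact: Cder_cont.
have mv (f df : R -> R[i]) (s k : R) : s <= 0 -> (forall s, Cder f s (df s)) ->
    (forall u, s < u < 0 -> nc (df u) <= k) -> nc (f 0 - f s) <= 2 * k * (0 - s).
  move=> s0 D; apply: (Cmvt_ineq s0 (fun u _ => D u)).
    by apply: continuous_subspaceT => u; have [] := Di _ _ _ (D u).
  by apply: continuous_subspaceT => u; have [] := Di _ _ _ (D u).
have D1 (s : R) : Cder (fun s => cexp (z * s%:C)) s (z * cexp (z * s%:C)) by exact: Cder_cexp.
have first (s : R) : - h <= s -> s <= 0 -> nc (cexp (z * s%:C) - 1) <= 2 * (nc z * K) * h.
  move=> s1 s2; have := mv _ _ s (nc z * K) s2 D1.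
  rewrite rmorph0 mulr0 cexp0 nc_distC sub0r => H; apply: (le_trans (H _)).
    move=> u /andP[u1 u2]; rewrite ncM ler_wpM2l// nc_cexp_le// ltr0_norm//; lra.
  by rewrite ler_wpM2l ?mulr_ge0//; lra.
pose g s := cexp (z * s%:C) - 1 - z * s%:C.
have D2 (s : R) : Cder g s (z * (cexp (z * s%:C) - 1)).
  rewrite mulrBr; apply: CderB; last by have := CderZ z (Cder_id s).
  by have := CderB (D1 s) (Cder_cst 1 s); rewrite subr0.
have := mv g _ t (nc z * (2 * (nc z * K) * h)) t2 D2.
have -> : g 0 = 0 by rewrite /g rmorph0 mulr0 cexp0 !subrr.
rewrite nc_distC subr0 sub0r => H; apply: (le_trans (H _)).
  move=> u /andP[u1 u2]; rewrite ncM ler_wpM2l//; apply: first; lra.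
have -> : 4 * h ^+ 2 * K * nc z ^+ 2 = 2 * (nc z * (2 * (nc z * K) * h)) * h by ring.
by rewrite ler_wpM2l ?mulr_ge0 ?(ltW h0)//; lra.
Qed.

(** The derivative of [expv z v] with respect to z. *)
Definition expv' (z : R[i]) (v : 'cV[R[i]]_n) : CX :=
  restrC (fun th : R => (th%:C * cexp (z * th%:C)) *: v).

Lemma cev_expv' z v th i : cev (expv' z v) th i =
  (clamp h th)%:C * cexp (z * (clamp h th)%:C) * v i 0.
Proof.
rewrite (cev_restrC h0) ?mxE//; apply: vscale_cont.
  apply: CcontM; last exact: Ccont_cexp.
  exact: (Cder_Ccont (fun t => Cder_id t)).
by split => t; exact: cst_continuous.
Qed.

Lemma expv_remainder z v : exists2 C : R, 0 <= C & forall w, nc w <= 1 ->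
  `|expv z v + hscale w (expv' z v) - expv (h := h) (w + z) v| <= C * nc w ^+ 2.
Proof.
pose V := \sum_i nc (v i 0).
have V0 : 0 <= V by apply: sumr_ge0 => i _; exact: nc_ge0.
pose C := expR (nc z * h) * (4 * h ^+ 2 * expR h) * V.
have C0 : 0 <= C.
  apply: mulr_ge0 => //; apply: mulr_ge0; first exact: expR_ge0.
  apply: mulr_ge0; last exact: expR_ge0.
  by apply: mulr_ge0 => //; apply: exprn_ge0; exact: ltW.
exists C => // w w1; apply: (cnorm_le h0); first by rewrite mulr_ge0 ?exprn_ge0 ?nc_ge0.
move=> th i _; rewrite cevB cevD cev_hscale.
move: (cev_expv h0 z v th i) (cev_expv' z v th i) (cev_expv h0 (w + z) v th i).
generalize (cev (expv (h := h) z v) th i) (cev (expv' z v) th i)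
  (cev (expv (h := h) (w + z) v) th i) => x1 x2 x3 -> -> ->.
set s := clamp h th.
have [s1 s2] : - h <= s /\ s <= 0 by have /andP[] := clamp_itv h0 th.
have -> : cexp (z * s%:C) * v i 0 + w * (s%:C * cexp (z * s%:C) * v i 0) - cexp ((w + z) * s%:C) * v i 0 =
   - (cexp (z * s%:C) * (cexp (w * s%:C) - 1 - w * s%:C) * v i 0).
  by rewrite mulrDl cexpD; ring.
rewrite ncN !ncM.
have h1 : nc (cexp (z * s%:C)) <= expR (nc z * h) by apply: nc_cexp_le; rewrite ler0_norm//; lra.
have h2 := exp_remainder w s1 s2.
have h3 : nc (v i 0) <= V.
  by rewrite /V (bigD1 i)//= lerDl sumr_ge0// => j _; exact: nc_ge0.
have h4 : expR (nc w * h) <= expR h by rewrite ler_expR ler_piMl// ltW.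
have h5 : nc (cexp (w * s%:C) - 1 - w * s%:C) <= 4 * h ^+ 2 * expR h * nc w ^+ 2.
  apply: (le_trans h2); rewrite ler_wpM2r ?exprn_ge0 ?nc_ge0// ler_wpM2l//.
  by rewrite mulr_ge0 ?exprn_ge0// ltW.
have -> : C * nc w ^+ 2 = expR (nc z * h) * (4 * h ^+ 2 * expR h * nc w ^+ 2) * V by rewrite /C; ring.
by apply: ler_pM; rewrite ?mulr_ge0 ?nc_ge0//; apply: ler_pM; rewrite ?nc_ge0.
Qed.

(** A quadratic remainder identifies the complex derivative. *)
Lemma cderive1E (f : R[i] -> R[i]^o) (z l : R[i]) :
  (exists2 K : R, 0 <= K & forall w : R[i], nc w <= 1 ->
     nc (w * l - (f (w + z) - f z)) <= K * nc w ^+ 2) -> derive1 f z = l.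
Proof.
move=> [K K0 H]; apply: cvg_lim => //; apply/cvgrPdist_le => e e0.
have [e1 e2] : 0 < Re e /\ Im e = 0.
  by move: e0; rewrite ltcE /= => /andP[/eqP -> ->].
have K1 : 0 < K + 1 by rewrite ltr_wpDl.
have d0 : 0 < Num.min 1 (Re e / (K + 1)) by rewrite lt_min ltr01 divr_gt0.
apply/nbhs_normP; exists (Num.min 1 (Re e / (K + 1)))%:C; first by rewrite /= ltcR.
move=> w /=; rewrite sub0r normrN => wd w0.
have {}wd : nc w < Num.min 1 (Re e / (K + 1)) by move: wd; rewrite -ltcR.
move: wd; rewrite lt_min => /andP[w1 w2].
have nw : 0 < nc w by rewrite lt_neqAle nc_ge0 andbT eq_sym; apply: contra w0 => /eqP/nc_eq0 ->.
have -> : l - w^-1 *: (f (w + z) - f z) = w^-1 * (w * l - (f (w + z) - f z)).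
  by rewrite mulrBr mulKf.
suff S : nc (w^-1 * (w * l - (f (w + z) - f z))) <= Re e.
  have -> : e = (Re e)%:C by apply: complexP.
  by rewrite lecR.
have nV : nc (w^-1) = (nc w)^-1.
  have nw0 : nc w != 0 by rewrite gt_eqF.
  by apply: (mulfI nw0); rewrite divff// -ncM divff// nc1.
rewrite ncM nV ler_pdivrMl//; apply: (le_trans (H w (ltW w1))).
have : K * nc w <= Re e.
  apply: le_trans (_ : (K + 1) * nc w <= _); first by rewrite ler_wpM2r ?nc_ge0// lerDl.
  by rewrite mulrC -ler_pdivlMr// ltW.
by rewrite expr2 mulrA [nc w * Re e]mulrC ler_pM2r.
Qed.

(** Delta is an affine function of the exponential histories, and those have a
    quadratic remainder in z uniformly in theta. *)
Lemma Delta'_entry z i j : Delta' h zeta z i j =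
  (i == j)%:R - lC (component L i) (expv' z (\col_k (k == j)%:R)).
Proof.
rewrite mxE; apply: cderive1E; set e : 'cV[R[i]]_n := (X in expv' z X).
have DE w : Delta h zeta w i j = w * (i == j)%:R - lC (component L i) (expv w e).
  by rewrite !mxE (cstieltjes_exp h0 Lz) mulr_natr.
have [C C0 HC] := expv_remainder z e.
have [M M0 HM] := Lb i.
exists (2 * M * C); first by rewrite !mulr_ge0.
move=> w w1; rewrite !DE.
have -> : w * ((i == j)%:R - lC (component L i) (expv' z e)) -
    ((w + z) * (i == j)%:R - lC (component L i) (expv (w + z) e) - (z * (i == j)%:R - lC (component L i) (expv z e))) =
    - lC (component L i) (expv z e + hscale w (expv' z e) - expv (w + z) e).
  have E : lC (component L i) (expv z e + hscale w (expv' z e) - expv (w + z) e) =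
      lC (component L i) (expv z e) + w * lC (component L i) (expv' z e) - lC (component L i) (expv (w + z) e).
    move: (expv z e) (expv' z e) (expv (w + z) e) => a b d.
    by rewrite (lCB (Ll i)) (lCD (Ll i)) (lCZ (Ll i)).
  have fin (dd a b d : R[i]) : w * (dd - b) - ((w + z) * dd - d - (z * dd - a)) = - (a + w * b - d).
    by clear; ring.
  by rewrite E; exact: fin.
rewrite ncN; apply: (le_trans (nc_lC _ HM M0)); rewrite -[leRHS]mulrA.
by rewrite ler_wpM2l ?mulr_ge0// HC.
Qed.

Lemma Delta'_mulE z (v : 'cV[R[i]]_n) i :
  (Delta' h zeta z *m v) i 0 = v i 0 - lC (component L i) (expv' z v).
Proof.
have -> : expv' z v = \sum_k hscale (v k 0) (expv' z (\col_j (j == k)%:R)).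
  apply: (chistP h0) => th j _; rewrite cev_sum cev_expv' (bigD1 j)//= big1 ?addr0.
    by rewrite cev_hscale cev_expv' mxE eqxx mulr1 mulrC.
  by move=> k kj; rewrite cev_hscale cev_expv' mxE eq_sym (negbTE kj) !mulr0.
rewrite mxE (lC_sum (Ll i)).
under eq_bigr => k _ do rewrite Delta'_entry mulrBl.
rewrite sumrB; congr (_ - _).
  rewrite (bigD1 i)//= eqxx mul1r big1 ?addr0// => k ki.
  by rewrite eq_sym (negbTE ki) mul0r.
by apply: eq_bigr => k _; rewrite (lCZ (Ll i)) mulrC.
Qed.

End DeltaPrime.

(** * Periodic equations for the coefficients *)

(** One argument for the three coefficients: Y(t) = s e^(mu t) Hh(t) + a t
    e^(mu t) expv mu v with (mu, s, a) = (2 i omega, 1/2, 0) for H_20, (0, 1,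
    0) for H_11 and (i omega, 1/2, c) for H_21. The hypothesis on v says that
    Delta(mu) v = 0 unless a = 0. *)
Section CoefficientEquation.
Context {R : realType} {n : nat} {h : R} (h0 : 0 < h).
Local Notation X := (history h n).
Local Notation CX := (chistory h n).
Variables (L : X -> 'cV[R]_n) (zeta : R -> 'M[R]_n).
Hypothesis Lz : forall psi, L psi = dzeta_int h zeta (fun theta => psi (- theta)).
Hypothesis Ll : forall i a (u v : X), L (a *: u + v) i 0 = a * L u i 0 + L v i 0.
Hypothesis Lc : forall i, continuous (component L i).
Variable (T : R).
Variables (mu s a : R[i]) (v : 'cV[R[i]]_n) (Hh Y : R -> CX) (N : R -> 'I_n -> R[i]).
Hypothesis s0 : s != 0.
Hypothesis YE : forall t, Y t = hscale (s * cexp (mu * t%:C)) (Hh t) +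
  hscale (a * t%:C * cexp (mu * t%:C)) (expv mu v).
Hypothesis lv : forall i, a * lC (component L i) (expv mu v) = a * (mu * v i 0).
Hypothesis tr : forall t th i, - h <= th <= 0 -> cev (Y t) th i = cev (Y (t + th)) 0 i.
Hypothesis ode : forall t i, Cder (fun t => cev (Y t) 0 i) t
  (lC (component L i) (Y t) + s * cexp (mu * t%:C) * N t i).
Hypothesis Hc : continuous Hh.
Hypothesis Nc : forall i, Ccont (fun t => N t i).
Hypothesis Hp : periodic Hh T.

Let y (t : R) : 'cV[R[i]]_n := ceval (Hh t) 0.

Lemma cev_Y t th i : - h <= th <= 0 -> cev (Y t) th i =
  cexp (mu * t%:C) * (s * cev (Hh t) th i + a * t%:C * (cexp (mu * th%:C) * v i 0)).
Proof.
move=> hth; rewrite YE cevD !cev_hscale (cev_expv h0) clamp_id//.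
by clear; ring.
Qed.

Lemma coefficient_translation t th i : - h <= th <= 0 ->
  cev (Hh t) th i = cexp (mu * th%:C) * (y (t + th) i 0 + a / s * th%:C * v i 0).
Proof.
move=> hth; have := tr t i hth; rewrite !cev_Y ?(zero_itv h0)//.
have e1 : cexp (mu * (t + th)%:C) = cexp (mu * t%:C) * cexp (mu * th%:C).
  by rewrite rmorphD /= mulrDr cexpD.
have e2 : cexp (mu * (0 : R)%:C) = 1 by rewrite rmorph0 mulr0 cexp0.
have e3 : (t + th)%:C = t%:C + th%:C :> R[i] by rewrite rmorphD.
rewrite e1 e2 e3 mul1r -[X in _ = X -> _]mulrA => /(mulfI (cexp_neq0 _)).
rewrite /y cevalE.
move: (cev (Hh t) th i) (cev (Hh (t + th)) 0 i) (cexp (mu * th%:C)) (v i 0) => k1 k2 e vi E.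
apply: (mulfI s0).
have -> : s * k1 = (s * k1 + a * t%:C * (e * vi)) - a * t%:C * (e * vi) by rewrite addrK.
rewrite E; move: (t%:C) (th%:C) => t' th'; by field.
Qed.

Lemma coefficient_der t i : Cder (fun t => y t i 0) t
  (lC (component L i) (Hh t) - mu * y t i 0 + N t i - a / s * v i 0).
Proof.
(* The function y, recovered from Y: this is what the differential equation
  for Y determines. *)
pose Z t := s^-1 * (cexp (- mu * t%:C) * cev (Y t) 0 i) - a / s * v i 0 * t%:C.
have eN t' : cexp (- mu * t'%:C) * cexp (mu * t'%:C) = 1 by rewrite mulNr cexpN.
have Yy t' : cev (Y t') 0 i = cexp (mu * t'%:C) * (s * y t' i 0 + a * t'%:C * v i 0).
  by rewrite cev_Y ?(zero_itv h0)// rmorph0 mulr0 cexp0 mul1r /y cevalE.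
apply: (@Cder_eq _ Z _ _ (s^-1 * (- mu * cexp (- mu * t%:C) * cev (Y t) 0 i +
  cexp (- mu * t%:C) * (lC (component L i) (Y t) + s * cexp (mu * t%:C) * N t i)) - a / s * v i 0 * 1)).
- apply: CderB; last by have := CderZ (a / s * v i 0) (Cder_id t).
  by apply: CderZ; apply: CderM; [exact: Cder_cexp|exact: ode].
- move=> t'; rewrite /Z Yy mulrA eN mul1r; move: (y t' i 0) (v i 0) => k vi; by field.
- rewrite Yy YE (lCD (l := component L i) (Ll i)) 2!(lCZ (l := component L i) (Ll i)).
  have := lv i; have := eN t.
  move: (t%:C) (cexp (- mu * t%:C)) (cexp (mu * t%:C)) (y t i 0) (v i 0) (lC (component L i) (Hh t))
    (lC (component L i) (expv mu v)) (N t i) => t' e' e k vi l1 l2 Nt.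
  move=> ee lvE.
  have -> : s^-1 * (- mu * e' * (e * (s * k + a * t' * vi)) +
      e' * (s * e * l1 + a * t' * e * l2 + s * e * Nt)) - a / s * vi * 1 =
    (e' * e) * (s^-1 * (- mu * (s * k + a * t' * vi) + s * l1 + t' * (a * l2) + s * Nt)) - a / s * vi by ring.
  rewrite ee lvE; by field.
Qed.

Lemma y_cont : vcontinuous y.
Proof.
apply/vcontinuousP => i; rewrite (_ : (fun t => _) = (fun t => cev (Hh t) 0 i)).
  by apply: (cev_cont (th := fun=> 0)) => // t; exact: cst_continuous.
by apply/funext => t; rewrite /y cevalE.
Qed.

(** In the delayed term [coefficient_translation] produces, besides the
    segment of y, the history (a / s) expv' mu v; together with the derivative
    of the secular term this gives the multiple - a / s of Delta'(mu) v. *)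
Lemma coefficient_equation : CT1 T y /\ forall t i, bDelta h zeta mu y t i 0 =
  N t i - a / s * (v i 0 - lC (component L i) (expv' mu v)).
Proof.
have cy := y_cont.
pose dy t : 'cV[R[i]]_n := \col_i (lC (component L i) (Hh t) - mu * y t i 0 + N t i - a / s * v i 0).
have clC i : Ccont (fun t => lC (component L i) (Hh t)).
  split => t /=.
    apply: (@continuous_comp _ _ _ (fun t => (Hh t).1) (component L i)); last exact: Lc.
    by apply: (@continuous_comp _ _ _ Hh fst); [exact: Hc|exact: cvg_fst].
  apply: (@continuous_comp _ _ _ (fun t => (Hh t).2) (component L i)); last exact: Lc.
  by apply: (@continuous_comp _ _ _ Hh snd); [exact: Hc|exact: cvg_snd].
have cdy : vcontinuous dy.
  apply/vcontinuousP => i; rewrite (_ : (fun t => _) = (fun t => lC (component L i) (Hh t) +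
      (- mu) * y t i 0 + N t i + (- (a / s * v i 0)))); last first.
    by apply/funext => t; rewrite mxE mulNr.
  apply: CcontD; last exact: Ccont_cst.
  apply: CcontD => //; apply: CcontD => //; apply: CcontM; first exact: Ccont_cst.
  by move: cy => /vcontinuousP.
have [C1 vE] : CT1 T y /\ vderive y = dy.
  apply: CT1_intro => //; last by move=> t; rewrite /y Hp.
  by move=> t j; apply: (Cder_eq (coefficient_der t j)) => //; rewrite [RHS]mxE.
split => // t i; rewrite (bDeltaE h0 Lz Ll)// vE [dy t i 0]mxE.
have cw : vcontinuous (fun u : R => cexp (mu * u%:C) *: y u).
  by apply: vscale_cont => //; exact: Ccont_cexp.
have -> : cexp (- mu * t%:C) * lC (component L i) (segC (h := h) (fun u => cexp (mu * u%:C) *: y u) t) =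
   lC (component L i) (Hh t) - a / s * lC (component L i) (expv' mu v).
  rewrite -!(lCZ (l := component L i) (Ll i)) -(lCB (l := component L i) (Ll i)); congr lC.
  apply: (chistP h0) => th j hth.
  rewrite cevB !cev_hscale (cev_segC h0 _ _ _ cw) (cev_expv' h0) clamp_id// coefficient_translation//.
  have yE : (cexp (mu * (t + th)%:C) *: y (t + th)) j 0 = cexp (mu * (t + th)%:C) * y (t + th) j 0.
    by rewrite [LHS]mxE.
  rewrite yE mulrA -cexpD.
  have -> : - mu * t%:C + mu * (t + th)%:C = mu * th%:C by rewrite rmorphD /=; ring.
  move: (th%:C) (cexp (mu * th%:C)) (y (t + th) j 0) (v j 0) => t' e k vj; by clear; ring.
move: (lC (component L i) (Hh t)) (lC (component L i) (expv' mu v)) (y t i 0) (v i 0) (N t i) => l1 l2 k vi Nt.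
by clear; ring.
Qed.

End CoefficientEquation.

Section Continuity.
Context {R : realType} {n : nat} {h : R} (h0 : 0 < h).
Local Notation X := (history h n).
Local Notation CX := (chistory h n).

Lemma CcontX (f : R -> R[i]) m : Ccont f -> Ccont (fun t => f t ^+ m).
Proof.
move=> cf; elim: m => [|m IH].
  by rewrite (_ : (fun t => _) = fun=> 1); [exact: Ccont_cst|apply/funext => t; rewrite expr0].
by rewrite (_ : (fun t => _) = (fun t => f t * f t ^+ m)); [exact: CcontM|apply/funext => t; rewrite exprS].
Qed.

Lemma Ccont_conj (f : R -> R[i]) : Ccont f -> Ccont (fun t => conjc (f t)).
Proof.
move=> [c1 c2]; split.
  by rewrite (_ : (fun s => _) = (fun s => Re (f s)))//; apply/funext => s; case: (f s).
rewrite (_ : (fun s => _) = (fun s => - Im (f s))); first exact: contN.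
by apply/funext => s; case: (f s).
Qed.

Lemma hscale_curve_cont (z : R -> R[i]) (u : R -> CX) : Ccont z -> continuous u ->
  continuous (fun t => hscale (z t) (u t)).
Proof.
move=> [c1 c2] cu; have u1 := fst_cont cu; have u2 := snd_cont cu.
apply: pair_cont => t.
  by apply: cvgB; apply: cvgZ; [exact: c1|exact: u1|exact: c2|exact: u2].
by apply: cvgD; apply: cvgZ; [exact: c1|exact: u2|exact: c2|exact: u1].
Qed.

Lemma shift_jet_cont (E s : R -> R[i]) (Y : R -> nat -> nat -> CX) p : Ccont E -> Ccont s ->
  (forall p, p \in exps -> continuous (fun t => Y t p.1 p.2)) -> p \in exps ->
  continuous (fun t => shift_jet (E t) (s t) (Y t) p.1 p.2).
Proof.
move=> cE cs cY pe.
have c1 : continuous (fun t => hscale (mono p (E t)) (Y t p.1 p.2)).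
  apply: hscale_curve_cont; last exact: cY.
  by apply: CcontM; apply: CcontX => //; exact: Ccont_conj.
have c0 : continuous (fun t : R => 0 : CX) by move=> t; exact: cst_continuous.
have add (f g : R -> CX) : continuous f -> continuous g -> continuous (fun t => f t + g t).
  by move=> cf cg t; apply: cvgD; [exact: cf|exact: cg].
have cse : Ccont (fun t => s t * E t) by exact: CcontM.
have c10 : continuous (fun t => hscale (s t * E t) (Y t 1%N 0%N)).
  by apply: hscale_curve_cont => //; exact: (cY (1, 0)%N).
have c01 : continuous (fun t => hscale (conjc (s t * E t)) (Y t 0%N 1%N)).
  by apply: hscale_curve_cont; [exact: Ccont_conj|exact: (cY (0, 1)%N)].
case: p pe c1 => j k pe c1.
by apply: add; [exact: c1|case: j k {pe c1} => [|[|[|j]]] [|[|[|k]]]].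
Qed.

End Continuity.

(** * The critical coefficient *)

Section Assembly.
Context {R : realType}.

Lemma nat_C (m : nat) : (m%:R : R)%:C = m%:R :> R[i].
Proof. exact: rmorph_nat. Qed.

Lemma cintegral_cst (T : R) (z : R[i]) : 0 < T -> cintegral 0 T (fun=> z) = z * T%:C.
Proof.
move=> T0; rewrite (@cintegralE _ _ (fun t => z * t%:C) _ _ T0) ?rmorph0 ?mulr0 ?subr0//.
  exact: Ccont_cst.
by move=> t; rewrite -[z in Cder _ _ z]mulr1; apply: CderZ; exact: Cder_id.
Qed.

Lemma cintegral_sum (n : nat) (T : R) (z : 'I_n -> R[i]) (f : 'I_n -> R -> R[i]) : 0 < T ->
  (forall i, Ccont (f i)) ->
  cintegral 0 T (fun t => \sum_i z i * f i t) = \sum_i z i * cintegral 0 T (f i).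
Proof.
move=> T0 cf; have /choice[F DF] : forall i, exists F, forall t, Cder F t (f i t).
  by move=> i; exact: Cglobal_primitive.
rewrite (@cintegralE _ _ (fun t => \sum_i z i * F i t) _ _ T0).
- rewrite -sumrB; apply: eq_bigr => i _.
  by rewrite (cintegralE T0 (cf i) (DF i)) mulrBr.
- by apply: Ccont_sum => i; apply: CcontM => //; exact: Ccont_cst.
- by move=> t; apply: Cder_sum => i; exact: CderZ.
Qed.

Lemma bounded_linear_cont (X : normedModType R) (l : X -> R) (M : R) :
  (forall a u v, l (a *: u + v) = a * l u + l v) -> 0 <= M -> (forall u, `|l u| <= M * `|u|) ->
  continuous l.
Proof.
move=> ll M0 lM u; apply/cvgrPdist_lt => e e0.
have M1 : 0 < M + 1 by rewrite ltr_wpDl.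
have eM : 0 < e / (M + 1) by rewrite divr_gt0.
near=> v.
have -> : l u - l v = l (u - v).
  by have := ll (-1) v u; rewrite scaleN1r addrC mulN1r => ->; rewrite addrC.
apply: (le_lt_trans (lM _)); apply: (@le_lt_trans _ _ ((M + 1) * `|u - v|)).
  by rewrite ler_wpM2r// lerDl.
have uv : `|u - v| < e / (M + 1).
  by near: v; have /cvgrPdist_lt := @cvg_id _ (nbhs u); apply.
by rewrite mulrC -ltr_pdivlMr.
Unshelve. all: by end_near. Qed.

(** The solvability condition, with d = Delta'(i omega) q: the integral of p
    (N - 2 c d) over a period vanishes. *)
Lemma cintegral_coefficient (n : nat) (T : R) (p : 'rV[R[i]]_n) (N : R -> 'I_n -> R[i])
  (d : 'cV[R[i]]_n) (c : R[i]) : 0 < T -> (forall i, Ccont (fun t => N t i)) -> (p *m d) 0 0 = 1 ->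
  \sum_i p 0 i * cintegral 0 T (fun t => N t i - 2 * c * d i 0) = 0 ->
  c = (2 * T)^-1%:C * cintegral 0 T (fun t => \sum_i p 0 i * N t i).
Proof.
move=> T0 cN pd H; rewrite cintegral_sum//.
have E i : cintegral 0 T (fun t => N t i - 2 * c * d i 0) =
    cintegral 0 T (fun t => N t i) - 2 * c * T%:C * d i 0.
  have := cintegral_lin 1 (- (2 * c * d i 0)) T0 (cN i) (Ccont_cst 1).
  rewrite cintegral_cst// => e.
  rewrite -[LHS]/(cintegral 0 T (fun t => N t i - 2 * c * d i 0)).
  have -> : (fun t => N t i - 2 * c * d i 0) = (fun t => 1 * N t i + - (2 * c * d i 0) * 1).
    by apply/funext => t; rewrite mul1r mulr1.
  by rewrite e; ring.
have {H} : \sum_i p 0 i * cintegral 0 T (fun t => N t i) - 2 * c * T%:C * (p *m d) 0 0 = 0.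
  have -> : (p *m d) 0 0 = \sum_i p 0 i * d i 0 by rewrite mxE.
  rewrite -[RHS]H mulr_sumr -sumrB; apply: eq_bigr => i _.
  by rewrite E; ring.
rewrite pd mulr1 => /eqP; rewrite subr_eq0 => /eqP ->.
have T0' : T%:C != 0 :> R[i] by rewrite (inj_eq (@complexI R)) gt_eqF.
have -> : (2 * T)^-1%:C = (2 * T%:C)^-1 :> R[i] by rewrite fmorphV rmorphM /= nat_C.
by field.
Qed.

(** Otherwise m omega_T = j omega with j = 1, -1 or -3, and omega_T / omega
    would be rational. *)
Lemma resonance (omega T : R) (z : R[i]) (m : int) : 0 < omega -> 0 < T ->
  (forall r : rat, (2 * pi / T) / omega <> ratr r) -> z = 0 \/ z = 2 * (0 +i* omega) ->
  z + (0 +i* (m%:~R * (2 * pi / T))) <> 0 +i* omega /\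
  z + (0 +i* (m%:~R * (2 * pi / T))) <> - (0 +i* omega).
Proof.
move=> o0 T0 irr zE.
have key (j : int) : j != 0 -> m%:~R * (2 * pi / T) <> j%:~R * omega.
  move=> j0 E; have m0 : m != 0.
    apply/eqP => m0; move: E; rewrite m0 mul0r => /esym/eqP.
    by rewrite mulf_eq0 intr_eq0 (negbTE j0) gt_eqF.
  apply: (irr (j%:Q / m%:Q)); rewrite fmorph_div /= !ratr_int.
  have mR : m%:~R != 0 :> R by rewrite intr_eq0.
  have oR : omega != 0 by rewrite gt_eqF.
  apply: (mulIf oR); rewrite divfK//; apply: (mulfI mR); rewrite E.
  by rewrite mulrA mulrCA divff// mulr1.
have n1 : 1 != 0 :> int by [].
have K1 := @key 1 isT; have K2 := @key (- 1) isT; have K3 := @key (- 3%:Z) isT.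
by case: zE => ->; split => /(congr1 (@complex.Im R)); rewrite ?RIE /= => E;
  first [apply: K1; move: E; lra | apply: K2; move: E; lra | apply: K3; move: E; lra].
Qed.

End Assembly.

Section Family.
Context {R : realType} {n : nat} {h : R} (h0 : 0 < h).
Local Notation X := (history h n).
Local Notation CX := (chistory h n).
Variables (k : nat) (F : R * X -> 'cV[R]_n) (xb : 'cV[R]_n) (L : X -> 'cV[R]_n).
Local Notation xbar := (cst_history h xb).
Hypothesis k3 : (3 <= k)%N.
Hypothesis Fk : Ck_on k setT F.
Hypothesis Feq : is_equilibrium F xb.
Hypothesis FL : forall t, d2F F t xbar = L.

(** An equilibrium is a solution near every time, and its derivative vanishes. *)
Lemma equilibrium0 t : F (t, xbar) = 0.
Proof.
have [_ D] := Feq (t - 1) (ltr0n R 2 : 0 < 2%:R).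
have := D t; rewrite -[segment h _ t]/xbar => /(_ _) D0.
have D1 : is_derive t (1 : R) (fun=> xb : 'cV[R]_n) (F (t, xbar)) by apply: D0; apply/andP; split; lra.
have D2 : is_derive t (1 : R) (fun=> xb : 'cV[R]_n) 0 by exact: is_derive_cst.
by rewrite -(@derive_val _ _ _ _ _ _ _ D1) (@derive_val _ _ _ _ _ _ _ D2).
Qed.

(** The smoothness of F in the form used below: scalar components b and c of
    the second and third derivatives along the equilibrium, with symmetry,
    local bounds, continuity in time and a Taylor expansion uniform on compact
    intervals. *)
Lemma derivative_forms : exists (b : 'I_n -> R -> X -> X -> R) (c : 'I_n -> R -> X -> X -> X -> R),
  [/\ (forall t u v i, d2F2 F t xbar u v i 0 = b i t u v) /\
      (forall t u v w i, d2F3 F t xbar u v w i 0 = c i t u v w),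
      (forall i a u v, L (a *: u + v) i 0 = a * L u i 0 + L v i 0) /\
      (forall i, exists2 M : R, 0 <= M & forall u, `|L u i 0| <= M * `|u|),
      continuous F /\ (forall t0, exists r M : R, [/\ 0 < r, 0 < M &
        forall t (u v : X), `|t - t0| < r -> `|u - xbar| < r -> `|v - xbar| < r ->
        `|F (t, u) - F (t, v)| <= M * `|u - v|]) &
      forall i,
      [/\ [/\ forall t a u v w, b i t (a *: u + v) w = a * b i t u w + b i t v w,
            forall t u v, b i t u v = b i t v u,
            forall t a u v w x, c i t (a *: u + v) w x = a * c i t u w x + c i t v w x,
            forall t u v w, c i t u v w = c i t v u w &
            forall t u v w, c i t u v w = c i t u w v],
          forall t0, exists M r : R, [/\ 0 <= M, 0 < r & forall t, t0 <= t -> t < t0 + r ->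
            [/\ forall u, `|L u i 0| <= M * `|u|,
              forall u v, `|b i t u v| <= M * (`|u| * `|v|) &
              forall u v w, `|c i t u v w| <= M * (`|u| * (`|v| * `|w|))]],
          (forall x y : R -> X, continuous x -> continuous y ->
             continuous (fun t => b i t (x t) (y t))) /\
          (forall x y z : R -> X, continuous x -> continuous y -> continuous z ->
             continuous (fun t => c i t (x t) (y t) (z t))) &
          forall a1 b1 e : R, 0 < e -> exists2 r : R, 0 < r & forall t d,
            a1 <= t <= b1 -> `|d| < r ->
            `|F (t, xbar + d) i 0 - (L d i 0 + b i t d d / 2 + c i t d d d / 6)| <= e * `|d| ^+ 3]].
Proof.
have [D [DF CD DD]] := Ck_C3 k3 Fk.
pose Di i (x : R * X) s := D x s i 0.
have LE i t u : L u i 0 = form1 (Di i) xbar t u.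
  by rewrite -(FL t); have [-> _ _] := DD t xbar.
exists (fun i => form2 (Di i) xbar), (fun i => form3 (Di i) xbar); split.
- split; first by move=> t u v i; have [_ -> _] := DD t xbar.
  by move=> t u v w i; have [_ _ ->] := DD t xbar.
- split; first by move=> i a u v; rewrite !(LE i 0); exact: (form1_lin xbar (CD i)).
  move=> i; have [M [r [M0 r0 HM]]] := form_bounds xbar (CD i) 0.
  exists M; first exact: ltW.
  have [lM _ _] := HM 0 ltac:(by rewrite subrr normr0).
  by move=> u; rewrite (LE i 0); exact: lM.
- split; first exact: (C3_vector_cont DF CD).
  move=> t0; have [r [M [r0 M0 H]]] := C3_vector_lipschitz DF CD (t0, xbar).
  exists r, M; split => // t u v tr ur vr.
  have E : `|(t, u) - (t, v) : R * X| = `|u - v|.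
    have -> : (t, u) - (t, v) = (t - t, u - v) by [].
    by rewrite subrr norm_space.
  by rewrite -E; apply: H; exact: pair_dist.
- move=> i; split.
  + split.
    * exact: (form2_lin xbar (CD i)).
    * exact: (form2_sym xbar (CD i)).
    * exact: (form3_lin xbar (CD i)).
    * exact: (form3_sym12 xbar (CD i)).
    * exact: (form3_sym23 xbar (CD i)).
  + move=> t0; have [M [r [M0 r0 HM]]] := form_bounds xbar (CD i) t0.
    exists M, r; split => //; first exact: ltW.
    move=> t t1 t2; have tr : `|t - t0| < r by rewrite ger0_norm ?subr_ge0// ltrBlDl.
    have [h1 h2 h3] := HM t tr; by split => // u; rewrite (LE i t); exact: h1.
  + split; first by move=> x y cx cy; apply: form2_cont => //; exact: (CD i).
    by move=> x y z cx cy cz; apply: form3_cont => //; exact: (CD i).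
  + move=> a1 b1 e e0.
    have D0 t : Di i (t, xbar) [::] = 0 by rewrite /Di DF equilibrium0 mxE.
    have [r r0 Hr] := taylor_uniform (CD i) a1 b1 D0 e0; exists r => // t d tab dr.
    by rewrite (LE i t) -DF; exact: Hr.
Qed.

End Family.

Lemma entry_add3 (R : realType) (n : nat) (x y z : 'cV[R[i]]_n) i :
  (x + y + 2 *: z) i 0 = x i 0 + y i 0 + 2 * z i 0.
Proof. by rewrite !mxE. Qed.

Lemma d2F_periodic (R : realType) (X V : normedModType R) (F : R * X -> V) (T : R) :
  (forall t psi, F (t + T, psi) = F (t, psi)) ->
  forall t, d2F2 F (t + T) = d2F2 F t.
Proof.
move=> FT t.
have e1 : (fun y => F (t + T, y)) = (fun y => F (t, y)) by apply/funext => y.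
have E1 : d2F F (t + T) = d2F F t by rewrite /d2F e1.
by rewrite /d2F2 E1.
Qed.

Theorem mainTheorem4 (R : realType) (n k : nat) (h T omega : R)
    (F : R * history h n -> 'cV[R]_n) (xb : 'cV[R]_n)
    (L : history h n -> 'cV[R]_n) (zeta : R -> 'M[R]_n)
    (q : 'cV[R[i]]_n) (p : 'rV[R[i]]_n)
    (W U : set (R * history h n)) (delta : R)
    (H : R -> R[i] -> history h n) (kappa : R * history h n -> R[i])
    (Hjk : nat -> nat -> R -> chistory h n) (c : R[i]) :
  let xbar := cst_history h xb in
  let G t (psi : history h n) := F (t, xbar + psi) - F (t, xbar) - L psi in
  let B t := cext2 (d2F2 F t xbar) in
  let C t := cext3 (d2F3 F t xbar) in
  let iomega : R[i] := 0 +i* omega in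
  let phi : chistory h n := restrC (fun theta : R => cexp (iomega * theta%:C) *: q) in
  0 < h -> 0 < T -> (3 <= k)%N ->
  Ck_on k setT F ->
  is_equilibrium F xb ->
  (forall t, d2F F t xbar = L) ->
  (forall t psi, G (t + T) psi = G t psi) ->
  NBV h zeta ->
  (forall psi, L psi = dzeta_int h zeta (fun theta => psi (- theta))) ->
  0 < omega ->
  is_simple_eigenvalue L iomega ->
  is_simple_eigenvalue L (- iomega) ->
  (forall l : R[i], is_eigenvalue L l -> complex.Re l = 0 ->
    l = iomega \/ l = - iomega) ->
  (forall r : rat, (2 * pi / T) / omega <> ratr r) ->
  Delta h zeta iomega *m q = 0 ->
  p *m Delta h zeta iomega = 0 ->
  p *m Delta' h zeta iomega *m q = 1 ->
  is_local_center_manifold F k T xb L omega W ->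
  open_around xb U ->
  0 < delta ->
  is_parametrization W U delta H kappa ->
  (forall j l : nat, (2 <= j + l <= 3)%N ->
    periodic (Hjk j l) T /\ forall t, Hjk j l t = cconj (Hjk l j t)) ->
  has_expansion xb phi Hjk H ->
  has_normal_form F T omega c W U kappa ->
  exists q20 q11 : R -> 'cV[R[i]]_n,
  [/\ is_bDelta_inv h T zeta (2 * iomega) (fun t => B t phi phi) q20,
      is_bDelta_inv h T zeta 0 (fun t => B t phi (cconj phi)) q11,
      forall t theta : R, - h <= theta <= 0 ->
        ceval (Hjk 2%N 0%N t) theta
        = cexp (2 * iomega * theta%:C) *: q20 (t + theta),
      forall t theta : R, - h <= theta <= 0 ->
        ceval (Hjk 1%N 1%N t) theta = q11 (t + theta) &
      c = (2 * T)^-1%:C * cintegral 0 T (fun t =>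
            (p *m (C t phi phi (cconj phi) + B t (cconj phi) (Hjk 2%N 0%N t)
                   + 2 *: B t phi (Hjk 1%N 1%N t))) 0 0)].
Proof.
move=> xbar G B C iomega phi h0 T0 k3 Fk Feq FL Gper _ Lz o0 _ _ onlyev irr Dq pD pDq
  [_ _ WI _ _] UO delta0 HP Hjkp HE HN.
have [b [c3 [[bE cE] [Ll Lb] [cF Flip] forms]]] := derivative_forms k3 Fk Feq FL.
have F0 := equilibrium0 Feq.
have HC j l : (2 <= j + l <= 3)%N -> forall t, Hjk j l t = cconj (Hjk l j t).
  by move=> jl; have [_] := Hjkp j l jl.
have Hper j l : (2 <= j + l <= 3)%N -> periodic (Hjk j l) T by move=> jl; have [] := Hjkp j l jl.
have [_ _ P3 _ _] := HP.
have Lc i : continuous (component L i).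
  by have [M M0 HM] := Lb i; exact: (bounded_linear_cont (Ll i) M0 HM).
have FT t psi : F (t + T, psi) = F (t, psi).
  by have := Gper t (psi - xbar); rewrite /G [xbar + _]addrC subrK !F0 !subr0 => /addIr.
have BT t : B (t + T) = B t by rewrite /B (d2F_periodic FT).
have BE t u v i : B t u v i 0 = bC (b i t) u v.
  rewrite /B cext2E; congr (bC _ u v); apply/funext => a1; apply/funext => a2; exact: bE.
have CE t u v w i : C t u v w i 0 = tC (c3 i t) u v w.
  rewrite /C cext3E; congr (tC _ u v w).
  by apply/funext => a1; apply/funext => a2; apply/funext => a3; exact: cE.
pose Y := sol_jet omega Hjk c phi.
have Yfam := local_family h0 cF F0 Flip WI UO delta0 HP HC HE HN.
have ec e : e \in exps -> continuous (fun t => eta phi Hjk t e.1 e.2).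
  move=> pe t; apply: (eta_cont h0 HE HC delta0 P3).
  by move: pe; rewrite !inE; do ?[case/orP]; do 9?[move=> /eqP ->].
have coscv : Ccont (osc omega) by exact: Ccont_cexp.
have cct : Ccont (fun t => c * t%:C).
  by apply: CcontM; [exact: Ccont_cst|exact: (Cder_Ccont (fun t => Cder_id t))].
have Yc e : e \in exps -> continuous (fun t => Y t e.1 e.2).
  by move=> pe t; exact: (shift_jet_cont coscv cct ec pe).
have tr e (el : e \in low) t th i : - h <= th <= 0 ->
    cev (Y t e.1 e.2) th i = cev (Y (t + th) e.1 e.2) 0 i.
  by move=> hth; exact: (translation h0 Yfam Yc).
have ode e (el : e \in low) t i : Cder (fun t => cev (Y t e.1 e.2) 0 i) t
    (taylor_jet (component L i) (b i t) (c3 i t) (Y t) e.1 e.2).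
  have [[f1 f2 f3 f4 f5] f6 [f7 f8] f9] := forms i.
  apply: (coefficient_ode h0 Yfam Yc (Ll i) f1 f2 f3 f4 f5 f6 _ f7 f8) => //.
    move=> x cx s; apply: (@continuous_comp _ _ _ x (component L i)); [exact: cx|exact: Lc].
  by move=> a1 b1 e1 _; exact: f9.
have phiE : phi = expv iomega q by [].
have lphi i : lC (component L i) phi = iomega * q i 0.
  have := congr1 (fun M : 'cV[R[i]]_n => M i 0) Dq.
  by rewrite (Delta_mulE h0 Lz Ll) mxE phiE => /eqP; rewrite subr_eq0 => /eqP.
have oo t : osc omega t * conjc (osc omega t) = 1 by rewrite mul_conj nc_osc expr1n.
have o2 t : osc omega t ^+ 2 = cexp (2 * iomega * t%:C).
  by rewrite /osc expr2 -cexpD; congr cexp; rewrite /iomega; ring.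
have Y10 t : Y t 1%N 0%N = hscale (osc omega t) phi.
  rewrite /Y /sol_jet /shift_jet addr0; congr hscale.
  by rewrite /mono /= expr0 mulr1.
have Y01 t : Y t 0%N 1%N = hscale (conjc (osc omega t)) (cconj phi).
  rewrite /Y /sol_jet /shift_jet addr0; congr hscale.
  by rewrite /mono /= expr0 mul1r.
have Y20 t : Y t 2%N 0%N = hscale (2^-1 * cexp (2 * iomega * t%:C)) (Hjk 2%N 0%N t).
  rewrite /Y /sol_jet /shift_jet addr0 [eta _ _ _ _ _]/= (hscaleA h0) mulrC; congr hscale.
  by rewrite -o2 /mono /= expr0 mulr1.
have Y11 t : Y t 1%N 1%N = Hjk 1%N 1%N t.
  rewrite /Y /sol_jet /shift_jet addr0 [eta _ _ _ _ _]/= (hscaleA h0).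
  by rewrite /mono /= !expr1 oo mul1r invr1 (hscale1 h0).
have Y21 t : Y t 2%N 1%N = hscale (2^-1 * osc omega t) (Hjk 2%N 1%N t) + hscale (c * t%:C * osc omega t) phi.
  rewrite /Y /sol_jet /shift_jet; congr (_ + _).
  rewrite [eta _ _ _ _ _]/= (hscaleA h0) mulrC; congr (hscale (_ * _) _).
  by rewrite /mono /= expr2 expr1 -mulrA oo mulr1.
have two0 : (2^-1 : R[i]) != 0 by rewrite invr_eq0 pnatr_eq0.
have Hcont j l : (2 <= j + l <= 3)%N -> (j, l) \in exps -> continuous (Hjk j l).
  move=> jl pe; have ne : (j`! * l`!)%:R != 0 :> R[i] by rewrite pnatr_eq0 -lt0n muln_gt0 !fact_gt0.
  have E : Hjk j l = (fun t => hscale ((j`! * l`!)%:R) (eta phi Hjk t j l)).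
    apply/funext => t.
    have -> : eta phi Hjk t j l = hscale ((j`! * l`!)%:R^-1) (Hjk j l t).
      by case: j l jl {pe ne} => [|[|j]] [|[|l]].
    by rewrite (hscaleA h0) divff// (hscale1 h0).
  rewrite E; apply: hscale_curve_cont; first exact: Ccont_cst.
  by move=> t; exact: (ec _ pe).
have c20 := Hcont 2%N 0%N isT isT; have c11 := Hcont 1%N 1%N isT isT.
have c21 := Hcont 2%N 1%N isT isT.
have cphi : continuous (fun t : R => phi) by move=> t; exact: cst_continuous.
have cphib : continuous (fun t : R => cconj phi) by move=> t; exact: cst_continuous.
pose N20 t i := bC (b i t) phi phi.
pose N11 t i := bC (b i t) phi (cconj phi).
pose N21 t i := tC (c3 i t) phi phi (cconj phi) + bC (b i t) (cconj phi) (Hjk 2%N 0%N t) +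
  2 * bC (b i t) phi (Hjk 1%N 1%N t).
have cN20 i : Ccont (fun t => N20 t i).
  by have [_ _ [f7 _] _] := forms i; exact: (bC_cont f7).
have cN11 i : Ccont (fun t => N11 t i).
  by have [_ _ [f7 _] _] := forms i; exact: (bC_cont f7).
have cN21 i : Ccont (fun t => N21 t i).
  have [_ _ [f7 f8] _] := forms i; apply: CcontD; first apply: CcontD.
  - exact: (tC_cont f8).
  - exact: (bC_cont f7).
  - by apply: CcontM; [exact: Ccont_cst|exact: (bC_cont f7)].
have z0 (z : R[i]) (u : chistory h n) : hscale (0 * z) u = 0.
  by apply: (chistP h0) => th i _; rewrite cev_hscale mul0r mul0r cev0.
have Z1 : (1 : R[i]) != 0 by exact: oner_neq0.
have YE20 t : Y t 2%N 0%N = hscale (2^-1 * cexp (2 * iomega * t%:C)) (Hjk 2%N 0%N t) +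
    hscale (0 * t%:C * cexp (2 * iomega * t%:C)) (expv (2 * iomega) q).
  by rewrite Y20 mul0r z0 addr0.
have YE11 t : Y t 1%N 1%N = hscale (1 * cexp (0 * t%:C)) (Hjk 1%N 1%N t) +
    hscale (0 * t%:C * cexp (0 * t%:C)) (expv 0 q).
  by rewrite Y11 !mul0r cexp0 mulr1 (hscale1 h0) (hscale0 h0) addr0.
have YE21 t : Y t 2%N 1%N = hscale (2^-1 * cexp (iomega * t%:C)) (Hjk 2%N 1%N t) +
    hscale (c * t%:C * cexp (iomega * t%:C)) (expv iomega q).
  by rewrite Y21.
have ode20 t i : Cder (fun t => cev (Y t 2%N 0%N) 0 i) t
    (lC (component L i) (Y t 2%N 0%N) + 2^-1 * cexp (2 * iomega * t%:C) * N20 t i).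
  have [[f1 f2 f3 f4 f5] _ _ _] := forms i.
  apply: (Cder_eq (ode (2, 0)%N isT t i)) => //.
  rewrite /taylor_jet /= Y10 (bCZl (f1 t)) (bCZr (f1 t) (f2 t)) -o2 /N20; congr (_ + _).
  by ring.
have ode11 t i : Cder (fun t => cev (Y t 1%N 1%N) 0 i) t
    (lC (component L i) (Y t 1%N 1%N) + 1 * cexp (0 * t%:C) * N11 t i).
  have [[f1 f2 f3 f4 f5] _ _ _] := forms i.
  apply: (Cder_eq (ode (1, 1)%N isT t i)) => //.
  rewrite /taylor_jet /= Y10 Y01 (bCZl (f1 t)) (bCZr (f1 t) (f2 t)) mulrA oo mul0r cexp0.
  by rewrite !mul1r.
have ode21 t i : Cder (fun t => cev (Y t 2%N 1%N) 0 i) t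
    (lC (component L i) (Y t 2%N 1%N) + 2^-1 * cexp (iomega * t%:C) * N21 t i).
  have [[f1 f2 f3 f4 f5] _ _ _] := forms i.
  apply: (Cder_eq (ode (2, 1)%N isT t i)) => //.
  rewrite /taylor_jet /= Y10 Y01 Y11 Y20 !(bCZl (f1 t)) !(bCZr (f1 t) (f2 t)).
  rewrite (tCZ1 (f3 t)) (tCZ2 (f3 t) (f4 t)) (tCZ3 (f3 t) (f4 t) (f5 t)) -o2 /N21; congr (_ + _).
  rewrite -/(osc omega t).
  have := oo t; move: (osc omega t) (conjc (osc omega t)) (bC (b i t) phi (Hjk 1%N 1%N t))
    (bC (b i t) (cconj phi) (Hjk 2%N 0%N t)) (tC (c3 i t) phi phi (cconj phi)) => e e' b1 b2 t3 ee.
  have -> : e * b1 + e' * (2^-1 * e ^+ 2 * b2) + e * (e * (e' * t3)) / 2 =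
     e * b1 + 2^-1 * (e * e') * e * b2 + (e * e') * e * t3 / 2 by ring.
  by rewrite ee; field.
have [C20 E20] := coefficient_equation h0 Lz Ll Lc two0 YE20 (fun i => etrans (mul0r _) (esym (mul0r _)))
  (fun t th i => @tr (2, 0)%N isT t th i) ode20 c20 cN20 (Hper 2%N 0%N isT).
have [C11 E11] := coefficient_equation h0 Lz Ll Lc Z1 YE11 (fun i => etrans (mul0r _) (esym (mul0r _)))
  (fun t th i => @tr (1, 1)%N isT t th i) ode11 c11 cN11 (Hper 1%N 1%N isT).
have lv21 i : c * lC (component L i) (expv iomega q) = c * (iomega * q i 0) by rewrite -phiE lphi.
have [C21 E21] := coefficient_equation h0 Lz Ll Lc two0 YE21 lv21
  (fun t th i => @tr (2, 1)%N isT t th i) ode21 c21 cN21 (Hper 2%N 1%N isT).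
(* A kernel vector would make z + i m omega_T an eigenvalue on the imaginary
  axis other than the two given ones. *)
have inj z : z = 0 \/ z = 2 * iomega -> forall (m : int) (v : 'cV[R[i]]_n),
    Delta h zeta (z + (0 +i* (m%:~R * (2 * pi / T)))) *m v = 0 -> v = 0.
  move=> zE m v Dv; apply/eqP; apply: contraT => v0.
  have ev := eigenvalue_of_Delta h0 Lz Ll v0 Dv.
  have [r1 r2] := resonance m o0 T0 irr zE.
  have re : Re (z + (0 +i* (m%:~R * (2 * pi / T)))) = 0.
    by case: zE => ->; rewrite !RIE /=; ring.
  by have [] := onlyev _ ev re.
have B20 : bDelta h zeta (2 * iomega) (fun t => ceval (Hjk 2%N 0%N t) 0) = (fun t => B t phi phi).
  apply/funext => t; apply/colP => i; rewrite E20 BE /N20.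
  by rewrite mul0r mul0r subr0.
have B11 : bDelta h zeta 0 (fun t => ceval (Hjk 1%N 1%N t) 0) = (fun t => B t phi (cconj phi)).
  apply/funext => t; apply/colP => i; rewrite E11 BE /N11.
  by rewrite mul0r mul0r subr0.
exists (fun t => ceval (Hjk 2%N 0%N t) 0), (fun t => ceval (Hjk 1%N 1%N t) 0); split.
- split; [|exact: C20|exact: B20|].
    split; last by move=> t; rewrite BT.
    apply/vcontinuousP => i; rewrite (_ : (fun s => _) = (fun t => N20 t i)); first exact: cN20.
    by apply/funext => s; rewrite BE.
  move=> q' Cq' Eq'; apply: (bDelta_inj h0 Lz Ll Lc T0 (inj _ (or_intror erefl)) Cq' C20).
  exact: (etrans Eq' (esym B20)).
- split; [|exact: C11|exact: B11|].
    split; last by move=> t; rewrite BT.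
    apply/vcontinuousP => i; rewrite (_ : (fun s => _) = (fun t => N11 t i)); first exact: cN11.
    by apply/funext => s; rewrite BE.
  move=> q' Cq' Eq'; apply: (bDelta_inj h0 Lz Ll Lc T0 (inj _ (or_introl erefl)) Cq' C11).
  exact: (etrans Eq' (esym B11)).
- move=> t th hth; apply/colP => i; rewrite cevalE.
  rewrite (coefficient_translation h0 two0 YE20 (fun t th i => @tr (2, 0)%N isT t th i) t i hth).
  by rewrite !mul0r addr0 [RHS]mxE.
- move=> t th hth; apply/colP => i; rewrite cevalE.
  rewrite (coefficient_translation h0 Z1 YE11 (fun t th i => @tr (1, 1)%N isT t th i) t i hth).
  by rewrite !mul0r addr0 cexp0 mul1r.
have pd : (p *m (Delta' h zeta iomega *m q)) 0 0 = 1 by rewrite mulmxA pDq mxE.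
(* The mean value of the equation for H_21, multiplied by p. *)
have Z : \sum_i p 0 i * cintegral 0 T (fun t => N21 t i - 2 * c * (Delta' h zeta iomega *m q) i 0) = 0.
  pose m := \col_j cintegral 0 T (fun t => ceval (Hjk 2%N 1%N t) 0 j 0).
  have M i : cintegral 0 T (fun t => N21 t i - 2 * c * (Delta' h zeta iomega *m q) i 0) =
      (Delta h zeta iomega *m m) i 0.
    rewrite -(mean_bDelta h0 Lz Ll Lc T0 iomega i C21); apply: (f_equal (cintegral 0 T)).
    apply/funext => t; rewrite E21 (Delta'_mulE h0 Lz Ll Lb) invrK.
    by rewrite [c * 2]mulrC.
  have -> : \sum_i p 0 i * cintegral 0 T (fun t => N21 t i - 2 * c * (Delta' h zeta iomega *m q) i 0) =
      (p *m (Delta h zeta iomega *m m)) 0 0.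
    by rewrite mxE; apply: eq_bigr => i _; rewrite M.
  by rewrite mulmxA pD mul0mx mxE.
rewrite [LHS](cintegral_coefficient T0 cN21 pd Z); congr (_ * _); apply: (f_equal (cintegral 0 T)).
apply/funext => t; rewrite mxE; apply: eq_bigr => i _; congr (_ * _).
by rewrite [RHS]entry_add3 /N21; congr (_ + _ + 2 * _); rewrite ?CE ?BE.
Qed.
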